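(* Let $N\ge 2$, let $\lambda:\mathbb{R}\to[1,+\infty)$ be a bounded measurable function with $\lambda(t)>1$ for every $t>0$, and endow $\mathbb{R}^N$ with the density $f(x)=1+(\lambda(x_N)-1)\chi_{\{x_N>0\}}(x)$. Then for every given volume $v>0$ an isoperimetric set of volume $v$ exists, and it is a round ball contained in the half-space $\{x_N\le 0\}$.
   Context: A density on $\mathbb{R}^N$ is a positive function $f$. For measurable $E\subset\mathbb{R}^N$, the weighted volume is $|E|_f=\int_E f\,dx$ and the weighted perimeter is $P_f(E)=\liminf_{h}\int_{\partial E_h}f\,d\mathcal{H}^{N-1}$, where the $\liminf$ is taken among all smooth sets $E_h$ converging to $E$ in $L^1$ (relaxation from smooth sets). An isoperimetric set of volume $v$ is a set $E$ with $|E|_f=v$ and $P_f(E)\le P_f(F)$ for all $F$ with $|F|_f=v$. Sets are identified when they differ by a Lebesgue-null set. *)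

(* Defs.v *)
From HB Require Import structures.
From mathcomp Require Import all_boot all_order all_algebra.
From mathcomp Require Import all_classical all_reals all_analysis.

Set Implicit Arguments.
Unset Strict Implicit.
Unset Printing Implicit Defensive.

Import Order.TTheory GRing.Theory Num.Theory.
Import numFieldNormedType.Exports.

Local Open Scope classical_set_scope.
Local Open Scope ring_scope.

(* Caratheodory's construction of an outer measure from the weights [w i] of a
   family of sets [S i].  [None] stands for the empty set with weight [0], so
   that both finite and countably infinite covers are allowed. *)
Section cover_outer_measure.
Context {R : realType} {T I : Type} (S : I -> set T) (w : I -> \bar R).
Local Open Scope ereal_scope.

Definition cover_outer (A : set T) : \bar R :=
  ereal_inf [set \sum_(k <oo) oapp w 0 (F k) | F in
    [set F : (option I)^nat | A `<=` \bigcup_k oapp S set0 (F k)]].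

Hypothesis w_ge0 : forall i, 0 <= w i.

Let ow_ge0 o : 0 <= oapp w 0 o. Proof. by case: o => /=. Qed.

Lemma cover_outer0 : cover_outer set0 = 0.
Proof.
apply/eqP; rewrite eq_le; apply/andP; split.
  apply: ereal_inf_lbound; exists (fun=> None); first exact: sub0set.
  by rewrite eseries0.
by apply: le_ereal_inf_tmp => _ [F _ <-]; exact: nneseries_ge0.
Qed.

Lemma cover_outer_ge0 A : 0 <= cover_outer A.
Proof.
by apply: le_ereal_inf_tmp => _ [F _ <-]; exact: nneseries_ge0.
Qed.

Lemma le_cover_outer : {homo cover_outer : A B / A `<=` B >-> A <= B}.
Proof.
move=> A B AB; apply: ereal_inf_le_tmp => _ [F BF <-].
by exists F => //; exact: subset_trans BF.
Qed.

Lemma cover_outer_sigma_subadditive : sigma_subadditive cover_outer.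
Proof.
move=> A; have [[i ioo]|] := pselect (exists i, cover_outer (A i) = +oo).
  rewrite (eseries_pinfty _ _ ioo) ?leey// => n _.
  by rewrite -ltNye (lt_le_trans _ (cover_outer_ge0 _)).
rewrite -forallNE => Aoo.
suff add2e (e : {posnum R}) : cover_outer (\bigcup_n A n) <=
    \sum_(i <oo) cover_outer (A i) + e%:num%:E.
  by apply/lee_addgt0Pr => _/posnumP[].
rewrite (le_trans _ (epsilon_trick _ _ _))//; last first.
  by move=> n; exact: cover_outer_ge0.
pose P n (B : (option I)^nat) := A n `<=` \bigcup_k oapp S set0 (B k) /\
  \sum_(k <oo) oapp w 0 (B k) <=
    cover_outer (A n) + (e%:num / (2 ^ n.+1)%:R)%:E.
have [G PG] : {G : ((option I)^nat)^nat & forall n, P n (G n)}.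
  apply: (@choice _ _ P) => n; rewrite /P /cover_outer.
  set X := (X in ereal_inf X); move infS : (ereal_inf X) => iS.
  case: iS infS => [r Sr|Soo|Soo].
  - have en1 : (0 < e%:num / (2 ^ n.+1)%:R)%R by [].
    have /(lb_ereal_inf_adherent en1) : ereal_inf X \is a fin_num by rewrite Sr.
    move=> [x [B AnB muBx] xS].
    by exists B; split => //; rewrite muBx -Sr; exact/ltW.
  - by have := Aoo n; rewrite /cover_outer Soo.
  - suff : lbound X 0 by move/le_ereal_inf_tmp; rewrite Soo.
    by move=> /= _ [B AnB <-]; exact: nneseries_ge0.
pose g := oapp w 0.
have muG_ge0 x : 0 <= (g \o uncurry G) x by exact: ow_ge0.
apply: (@le_trans _ _ (\esum_(i in setT) (g \o uncurry G) i)).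
  rewrite /cover_outer; apply: ereal_inf_lbound => /=.
  have /card_esym/ppcard_eqP[f] := card_nat2.
  exists (uncurry G \o f).
    apply: (@subset_trans _  (\bigcup_n \bigcup_k oapp S set0 (G n k))).
      move=> t [i _] /((PG i).1) -[j _ ?]; exists i => //.
      by exists j.
    move=> t [i _ [j _ Bijt]]; exists (f^-1%FUN (i, j)) => //=.
    by rewrite invK ?inE.
  rewrite -(esum_pred_image (g \o uncurry G) _ xpredT) ?[fun=> _]set_true//.
  by rewrite image_eq.
rewrite (_ : esum _ _ = \sum_(i <oo) \sum_(j <oo ) g (G i j)); last first.
  pose J : nat -> set (nat * nat) := fun i => [set (i, j) | j in setT].
  rewrite (_ : setT = \bigcup_k J k); last first.
    by rewrite predeqE => -[a b]; split => // _; exists a => //; exists b.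
  rewrite esum_bigcupT /=; last 2 first.
    - apply/trivIsetP => i j _ _ ij.
      rewrite predeqE => -[n m] /=; split => //= -[] [_] _ [<-{n} _].
      by move=> [m' _] [] /esym/eqP; rewrite (negbTE ij).
    - by move=> /= [n m]; exact: ow_ge0.
  rewrite -(image_id [set: nat]) -fun_true esum_pred_image//; last first.
    by move=> n _; exact: esum_ge0.
  apply: eq_eseriesr => /= j _.
  rewrite -(esum_pred_image (g \o uncurry G) (pair j) predT)//=; last first.
    by move=> ? ? _ _; exact: (@can_inj _ _ _ snd).
  by congr esum; rewrite predeqE => -[a b]; split; move=> [i _ <-]; exists i.
apply: lee_lim.
- apply: is_cvg_nneseries => n *.
  by apply: nneseries_ge0 => m *; exact: (muG_ge0 (n, m)).
- by apply: is_cvg_nneseries => n *; apply: adde_ge0 => //; exact: cover_outer_ge0.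
- by near=> n; apply: lee_sum => i _; exact: (PG i).2.
Unshelve. all: by end_near. Qed.

End cover_outer_measure.

(* The measure induced by an outer measure on its Caratheodory sigma-algebra. *)
Definition cara_measure {R : realType} {T : pointedType}
    (mu : {outer_measure set T -> \bar R}) :
  {measure set (caratheodory_type mu) -> \bar R} :=
  [the {measure set (caratheodory_type mu) -> \bar R} of
   (mu : set (caratheodory_type mu) -> \bar R)].

Definition enorm {R : realType} {n} (x : 'rV[R]_n) : R :=
  Num.sqrt (\sum_(i < n) x 0 i ^+ 2).

Definition eball {R : realType} {n} (c : 'rV[R]_n) (r : R) : set 'rV[R]_n :=
  [set x | enorm (x - c) < r].

Section lebesgue_measure_rV.
Context {R : realType} {n : nat}.
Local Open Scope ereal_scope.
Implicit Types ab : 'rV[R]_n * 'rV[R]_n.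

Definition box ab : set 'rV[R]_n :=
  [set x | forall i, (ab.1 0 i < x 0 i <= ab.2 0 i)%R].

Definition box_volume ab : \bar R :=
  (\prod_(i < n) Num.max 0 (ab.2 0 i - ab.1 0 i))%:E.

Definition lebesgue_outer : set 'rV[R]_n -> \bar R :=
  cover_outer box box_volume.

Lemma box_volume_ge0 ab : 0 <= box_volume ab.
Proof. by rewrite lee_fin; apply: prodr_ge0 => i _; rewrite le_max lexx. Qed.

HB.instance Definition _ := isOuterMeasure.Build R 'rV[R]_n lebesgue_outer
  (cover_outer0 _ box_volume_ge0) (cover_outer_ge0 _ box_volume_ge0)
  (@le_cover_outer _ _ _ _ _) (cover_outer_sigma_subadditive _ box_volume_ge0).

(* The Lebesgue measure lives on the Lebesgue (= Caratheodory) sigma-algebra. *)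
Definition leb : {measure set (caratheodory_type lebesgue_outer) -> \bar R} :=
  cara_measure lebesgue_outer.

End lebesgue_measure_rV.

Section hausdorff_measure.
Context {R : realType} {n : nat} (k : nat).
Local Open Scope ereal_scope.

(* [sup set0 = 0], so the empty set has diameter [0]. *)
Definition ediam (B : set 'rV[R]_n) : R :=
  sup [set enorm (p.1 - p.2) | p in B `*` B].

Definition small_set (d : R) : Type :=
  {B : set 'rV[R]_n | forall x y, B x -> B y -> (enorm (x - y) <= d)%R}.

(* The first factor is the volume of the unit ball of R^k, so that the
   k-dimensional Hausdorff measure extends the k-dimensional area. *)
Definition hausdorff_weight (d : R) (B : small_set d) : \bar R :=
  lebesgue_outer (@eball R k 0 1) * ((ediam (sval B) / 2) ^+ k)%:E.

Definition hausdorff_delta (d : R) : set 'rV[R]_n -> \bar R :=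
  cover_outer (fun B : small_set d => sval B) (@hausdorff_weight d).

Definition hausdorff_outer (A : set 'rV[R]_n) : \bar R :=
  ereal_sup [set hausdorff_delta d A | d in [set d : R | (0 < d)%R]].

Lemma ediam_ge0 B : (0 <= ediam B)%R.
Proof.
rewrite /ediam; set X := [set _ | _ in _].
have [supX|/sup_out ->//] := pselect (has_sup X).
have [x Xx] := supX.1; apply: le_trans (ub_le_sup supX.2 Xx).
by case: Xx => p _ <-; exact: sqrtr_ge0.
Qed.

Lemma hausdorff_weight_ge0 d (B : small_set d) : 0 <= hausdorff_weight B.
Proof.
apply: mule_ge0; first exact: outer_measure_ge0.
by rewrite lee_fin exprn_ge0// divr_ge0// ediam_ge0.
Qed.

Let hausdorff_outer0 : hausdorff_outer set0 = 0.
Proof.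
apply/eqP; rewrite eq_le; apply/andP; split.
  apply: ge_ereal_sup => _ [d _ <-].
  by rewrite /hausdorff_delta cover_outer0//; exact: hausdorff_weight_ge0.
apply: ereal_sup_ubound; exists 1%R => //=.
by rewrite /hausdorff_delta cover_outer0//; exact: hausdorff_weight_ge0.
Qed.

Let hausdorff_outer_ge0 A : 0 <= hausdorff_outer A.
Proof.
apply: (@le_trans _ _ (hausdorff_delta 1 A)).
  by apply: cover_outer_ge0; exact: hausdorff_weight_ge0.
by apply: ereal_sup_ubound; exists 1%R => //=.
Qed.

Let le_hausdorff_outer : {homo hausdorff_outer : A B / A `<=` B >-> A <= B}.
Proof.
move=> A B AB; apply: ge_ereal_sup => _ [d d0 <-].
apply: (@le_trans _ _ (hausdorff_delta d B)); first exact: le_cover_outer.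
by apply: ereal_sup_ubound; exists d.
Qed.

Let hausdorff_outer_sigma_subadditive : sigma_subadditive hausdorff_outer.
Proof.
move=> F; apply: ge_ereal_sup => _ [d d0 <-].
apply: (le_trans (cover_outer_sigma_subadditive _ _ F)).
  exact: hausdorff_weight_ge0.
apply: lee_nneseries => i _ *.
  by apply: cover_outer_ge0; exact: hausdorff_weight_ge0.
by apply: ereal_sup_ubound; exists d.
Qed.

HB.instance Definition _ := isOuterMeasure.Build R 'rV[R]_n hausdorff_outer
  hausdorff_outer0 hausdorff_outer_ge0 le_hausdorff_outer
  hausdorff_outer_sigma_subadditive.

Definition hausdorff :
    {measure set (caratheodory_type hausdorff_outer) -> \bar R} :=
  cara_measure hausdorff_outer.

End hausdorff_measure.

Section smooth_sets.
Context {R : realType} {n : nat}.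
Implicit Types (U E : set 'rV[R]_n) (g : 'rV[R]_n -> R).

Definition partial (i : 'I_n) g : 'rV[R]_n -> R := 'D_(delta_mx 0 i) g.

(* [g] is of class C^k on the open set [U]. *)
Fixpoint class_C (k : nat) U g : Prop :=
  (forall x, U x -> {for x, continuous g}) /\
  (if k is k'.+1 then
     forall i, (forall x, U x -> derivable g x (delta_mx 0 i)) /\
               class_C k' U (partial i g)
   else True).

Definition boundary E : set 'rV[R]_n := closure E `\` interior E.

(* Near each boundary point, [E] is the strict sublevel set of a C^oo function
   with nonzero gradient; in particular [E] is open. *)
Definition smooth_set E : Prop :=
  forall x, boundary E x ->
  exists U g, [/\ open U, U x, forall k, class_C k U g,
    exists i, partial i g x != 0 &
    U `&` E = U `&` [set y | g y < 0]].

End smooth_sets.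

Section weighted_isoperimetry.
Context {R : realType} {n : nat} (f : 'rV[R]_n -> R).
Local Open Scope ereal_scope.
Implicit Types E F : set 'rV[R]_n.

Definition lebesgue_measurable E : Prop :=
  (@lebesgue_outer R n).-cara.-measurable E.

Definition weighted_volume E : \bar R := \int[leb]_(x in E) (f x)%:E.

Definition weighted_area E : \bar R :=
  \int[hausdorff n.-1]_(x in boundary E) (f x)%:E.

Definition cvg_L1 (Eh : (set 'rV[R]_n)^nat) E : Prop :=
  \int[leb]_x `|\1_(Eh h) x - \1_E x|%:E @[h --> \oo] --> 0.

Definition perimeter E : \bar R :=
  ereal_inf [set limn_einf (fun h => weighted_area (Eh h)) | Eh in
    [set Eh : (set 'rV[R]_n)^nat |
      (forall h, smooth_set (Eh h)) /\ cvg_L1 Eh E]].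

Definition isoperimetric (v : R) E : Prop :=
  [/\ lebesgue_measurable E, weighted_volume E = v%:E &
    forall F, lebesgue_measurable F -> weighted_volume F = v%:E ->
      perimeter E <= perimeter F].

End weighted_isoperimetry.

Definition ae_eq_set {R : realType} {n} (E F : set 'rV[R]_n) : Prop :=
  leb (E `+` F) = 0%E.

(* The last of the [n.+1] coordinates. *)
Definition last_coord {R : realType} {n} (x : 'rV[R]_n.+1) : R := x 0 ord_max.

Definition halfspace_density {R : realType} {n} (lam : R -> R) (x : 'rV[R]_n.+1) : R :=
  1 + (lam (last_coord x) - 1) * \1_[set y | 0 < last_coord y] x.

(* Measurability with respect to the Lebesgue (completed Borel) sigma-algebra
   of the real line. *)
Definition lebesgue_measurable_fun {R : realType} (lam : R -> R) : Prop :=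
  measurable_fun [set: caratheodory_type ((wlength idfun)^*)%mu] lam.

(* Main.v *)
Require Import Defs.
From HB Require Import structures.
From mathcomp Require Import all_boot all_order all_algebra.
From mathcomp Require Import all_classical all_reals all_analysis.
From mathcomp Require Import measurable_realfun perm.
From mathcomp Require Import ring lra.

(* Let [omega r^N = v] for the unit ball volume [omega].  Stretching the last
   coordinate by a primitive of the density turns the weighted volume into
   Lebesgue measure and does not increase the Euclidean perimeter beyond the
   weighted one, so the Euclidean isoperimetric inequality bounds the weighted
   perimeter below by that of a ball of radius [r] lying in [x_N <= 0], where
   the density is 1.  The inequality is proved for C^{1,1} functions with
   Gromov's transport to the ball, by induction on the dimension; its
   stability shows that an optimal set is stretched to a set having the same
   marginal along every axis as a ball, hence the same moment of inertia, hence
   to a ball.  If this ball met [x_N > 0], its top slab would be so thin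
   horizontally that lowering the density there would contradict the
   isoperimetric inequality. *)

Set Implicit Arguments.
Unset Strict Implicit.
Unset Printing Implicit Defensive.

Import Order.TTheory GRing.Theory Num.Theory.
Import numFieldNormedType.Exports.

Local Open Scope classical_set_scope.
Local Open Scope ring_scope.

(** * Euclidean geometry *)

(** The area of a smooth boundary is turned into analysis by a sweeping estimate: a set [A] pushed
    along [tau] covers a volume at most [|tau| H(A) / kap]. Applied to the points that change sides
    of a smooth set, it bounds both the gradient of the mollified indicator and its L^1 error. The
    transport is built one coordinate at a time: only the first component of Knothe's map is
    constructed, as a function of one real variable, and the inequality in one dimension less,
    applied to each slice, stands for the other components. The class C^{1,1} fits this: a
    second-order Taylor bound makes slice integrals differentiable and survives stretching by a
    Lipschitz profile. The density is only Lebesgue measurable, whereas area may charge the layers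
    over a null set of heights. It is therefore replaced by a Borel minorant equal to it almost
    everywhere, and this by a Lipschitz profile close in L^1 for area, volume and height at once.
    Finally, an optimal set is only a limit of smooth sets, so rigidity takes the form of a
    stability statement whose constants do not depend on the approximants. *)

Section euclid.
Context {R : realType}.
Implicit Types (n : nat).

Definition dotv n (x y : 'rV[R]_n) : R := \sum_i x 0 i * y 0 i.

Lemma dotvC n (x y : 'rV[R]_n) : dotv x y = dotv y x.
Proof. by apply: eq_bigr => i _; rewrite mulrC. Qed.

Lemma dotvDl n (x y z : 'rV[R]_n) : dotv (x + y) z = dotv x z + dotv y z.
Proof. by rewrite -big_split/=; apply: eq_bigr => i _; rewrite mxE mulrDl. Qed.

Lemma dotvZl n a (x z : 'rV[R]_n) : dotv (a *: x) z = a * dotv x z.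
Proof. by rewrite mulr_sumr; apply: eq_bigr => i _; rewrite mxE mulrA. Qed.

Lemma dotvNl n (x z : 'rV[R]_n) : dotv (- x) z = - dotv x z.
Proof. by rewrite -scaleN1r dotvZl mulN1r. Qed.

Lemma dotvBl n (x y z : 'rV[R]_n) : dotv (x - y) z = dotv x z - dotv y z.
Proof. by rewrite dotvDl dotvNl. Qed.

Lemma dotvDr n (x y z : 'rV[R]_n) : dotv z (x + y) = dotv z x + dotv z y.
Proof. by rewrite dotvC dotvDl !(dotvC z). Qed.

Lemma dotvZr n a (x z : 'rV[R]_n) : dotv z (a *: x) = a * dotv z x.
Proof. by rewrite dotvC dotvZl dotvC. Qed.

Lemma dotvBr n (x y z : 'rV[R]_n) : dotv z (x - y) = dotv z x - dotv z y.
Proof. by rewrite dotvC dotvBl !(dotvC z). Qed.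

Lemma dotv_ge0 n (x : 'rV[R]_n) : 0 <= dotv x x.
Proof. by apply: sumr_ge0 => i _; rewrite -expr2 sqr_ge0. Qed.

Lemma enormE n (x : 'rV[R]_n) : enorm x = Num.sqrt (dotv x x).
Proof. by congr Num.sqrt; apply: eq_bigr => i _; rewrite expr2. Qed.

Lemma enorm_ge0 n (x : 'rV[R]_n) : 0 <= enorm x.
Proof. exact: sqrtr_ge0. Qed.
Hint Resolve enorm_ge0 : core.

Lemma sqr_enorm n (x : 'rV[R]_n) : enorm x ^+ 2 = dotv x x.
Proof. by rewrite enormE sqr_sqrtr// dotv_ge0. Qed.

Lemma enorm0 n : enorm (0 : 'rV[R]_n) = 0.
Proof. by rewrite /enorm big1 ?sqrtr0// => i _; rewrite mxE expr0n. Qed.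

Lemma enormZ n a (x : 'rV[R]_n) : enorm (a *: x) = `|a| * enorm x.
Proof.
by rewrite !enormE dotvZl dotvZr mulrA -expr2 sqrtrM ?sqr_ge0// sqrtr_sqr.
Qed.

Lemma enormN n (x : 'rV[R]_n) : enorm (- x) = enorm x.
Proof. by rewrite -scaleN1r enormZ normrN1 mul1r. Qed.

Lemma enormB n (x y : 'rV[R]_n) : enorm (x - y) = enorm (y - x).
Proof. by rewrite -enormN opprB. Qed.

Lemma abs_le_enorm n (x : 'rV[R]_n) i : `|x 0 i| <= enorm x.
Proof.
rewrite -sqrtr_sqr ler_sqrt; last by apply: sumr_ge0 => j _; exact: sqr_ge0.
by rewrite (bigD1 i)//= lerDl sumr_ge0// => j _; exact: sqr_ge0.
Qed.

Lemma enorm_eq0 n (x : 'rV[R]_n) : enorm x = 0 -> x = 0.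
Proof.
move=> x0; apply/rowP => i; apply/eqP; rewrite mxE -normr_eq0 eq_le normr_ge0.
by rewrite -x0 abs_le_enorm.
Qed.

Lemma dotv_le n (x y : 'rV[R]_n) : dotv x y <= enorm x * enorm y.
Proof.
have [/enorm_eq0 ->|x0] := eqVneq (enorm x) 0.
  by rewrite enorm0 mul0r /dotv big1// => i _; rewrite mxE mul0r.
have [/enorm_eq0 ->|y0] := eqVneq (enorm y) 0.
  by rewrite enorm0 mulr0 /dotv big1// => i _; rewrite mxE mulr0.
have xp : 0 < enorm x by rewrite lt_neqAle eq_sym x0 enorm_ge0.
have yp : 0 < enorm y by rewrite lt_neqAle eq_sym y0 enorm_ge0.
(* Cauchy-Schwarz by expanding the squared norm of [|y| x - |x| y]. Zero vectors are set aside
   because the result is divided by [|x| |y|]. *)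
have := dotv_ge0 (enorm y *: x - enorm x *: y).
rewrite dotvBl !dotvBr !dotvZl !dotvZr -!sqr_enorm (dotvC y x) => h.
have : 0 <= (enorm x * enorm y) * ((enorm x * enorm y - dotv x y) *+ 2).
  by apply: le_trans h _; rewrite le_eqVlt; apply/orP; left; apply/eqP; ring.
by rewrite pmulr_rge0 ?mulr_gt0// => ?; lra.
Qed.

Lemma enormD n (x y : 'rV[R]_n) : enorm (x + y) <= enorm x + enorm y.
Proof.
rewrite -(ler_pXn2r (ltn0Sn 1)) ?nnegrE ?addr_ge0// sqrrD !sqr_enorm.
rewrite dotvDl (dotvDr x y x) (dotvDr x y y) (dotvC y x).
by have := dotv_le x y; lra.
Qed.

Lemma enorm_subD n (y x z : 'rV[R]_n) :
  enorm (x - z) <= enorm (x - y) + enorm (y - z).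
Proof. by rewrite (le_trans _ (enormD _ _))// addrA subrK. Qed.

Lemma enorm_le_sum n (x : 'rV[R]_n) : enorm x <= \sum_i `|x 0 i|.
Proof.
rewrite -(ler_pXn2r (ltn0Sn 1)) ?nnegrE ?sumr_ge0// sqr_enorm expr2 mulr_suml.
apply: ler_sum => i _; rewrite (le_trans (ler_norm _))// normrM.
by rewrite ler_wpM2l// (bigD1 i)//= lerDl sumr_ge0.
Qed.

Lemma norm_coord n (x : 'rV[R]_n) i : `|x 0 i| <= `|x|.
Proof.
rewrite [leRHS]/Num.Def.normr/= mx_normrE.
by apply: (le_trans _ (le_bigmax _ _ (0, i))).
Qed.

Lemma norm_le_coord n (x : 'rV[R]_n) (C : R) : 0 <= C ->
  (forall i, `|x 0 i| <= C) -> `|x| <= C.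
Proof.
move=> C0 xC; rewrite [leLHS]/Num.Def.normr/= mx_normrE.
by apply/bigmax_leP; split => //= -[j i] _ /=; rewrite (ord1 j).
Qed.

Lemma norm_le_enorm n (x : 'rV[R]_n) : `|x| <= enorm x.
Proof. by apply: norm_le_coord => // i; exact: abs_le_enorm. Qed.

Lemma enorm_le_norm n (x : 'rV[R]_n) : enorm x <= n%:R * `|x|.
Proof.
apply: le_trans (enorm_le_sum x) _.
rewrite -[n in n%:R]card_ord mulr_natl -sumr_const.
by apply: ler_sum => i _; exact: norm_coord.
Qed.

(* Householder reflection; for [z = 0] it is the identity since [/ 0 = 0]. *)
Definition refl n (z x : 'rV[R]_n) : 'rV[R]_n :=
  x - (2 * dotv x z / dotv z z) *: z.

Lemma reflB n (z x y : 'rV[R]_n) : refl z (x - y) = refl z x - refl z y.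
Proof.
rewrite /refl dotvBl; apply/rowP => i; rewrite !mxE; ring.
Qed.

Lemma reflD n (z x y : 'rV[R]_n) : refl z (x + y) = refl z x + refl z y.
Proof.
rewrite /refl dotvDl; apply/rowP => i; rewrite !mxE; ring.
Qed.

Lemma reflZ n (z x : 'rV[R]_n) a : refl z (a *: x) = a *: refl z x.
Proof.
rewrite /refl dotvZl; apply/rowP => i; rewrite !mxE; ring.
Qed.

Lemma dotv_refl n (z x y : 'rV[R]_n) : dotv (refl z x) (refl z y) = dotv x y.
Proof.
have [z0|z0] := eqVneq (dotv z z) 0.
  by rewrite /refl z0 invr0 !mulr0 !scale0r !subr0.
rewrite /refl dotvBl !dotvBr !dotvZl !dotvZr (dotvC z y); field.
by [].
Qed.

Lemma enorm_refl n (z x : 'rV[R]_n) : enorm (refl z x) = enorm x.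
Proof. by rewrite !enormE dotv_refl. Qed.

Lemma reflK n (z : 'rV[R]_n) : involutive (refl z).
Proof.
move=> x; have [z0|z0] := eqVneq (dotv z z) 0.
  by rewrite /refl z0 invr0 !mulr0 !scale0r !subr0.
apply/rowP => i; rewrite /refl dotvBl dotvZl !mxE; field.
by [].
Qed.

(** Equal norms give [2 a.(a - b) = |a - b|^2], so the reflection subtracts exactly [a - b]. This
    turns an arbitrary direction onto the first axis. *)
Lemma refl_swap n (a b : 'rV[R]_n) : enorm a = enorm b -> refl (a - b) a = b.
Proof.
move=> ab; have [d0|d0] := eqVneq (dotv (a - b) (a - b)) 0.
  have /enorm_eq0/eqP : enorm (a - b) = 0 by rewrite enormE d0 sqrtr0.
  by rewrite subr_eq0 => /eqP ->; rewrite subrr /refl scaler0 subr0.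
have dab : dotv a a = dotv b b by rewrite -!sqr_enorm ab.
have e : 2 * dotv a (a - b) = dotv (a - b) (a - b).
  by rewrite dotvBl !dotvBr -dab (dotvC b a); ring.
by rewrite /refl e divff// scale1r opprB addrC subrK.
Qed.

Definition upd n (x : 'rV[R]_n) (i : 'I_n) (s : R) : 'rV[R]_n :=
  \row_j if j == i then s else x 0 j.

Lemma updE n (x : 'rV[R]_n) i s j : upd x i s 0 j = if j == i then s else x 0 j.
Proof. by rewrite mxE. Qed.

Lemma upd_same n (x : 'rV[R]_n) i s : upd x i s 0 i = s.
Proof. by rewrite updE eqxx. Qed.

Lemma upd_id n (x : 'rV[R]_n) i : upd x i (x 0 i) = x.
Proof. by apply/rowP => j; rewrite updE; case: eqP => // ->. Qed.

Lemma upd_upd n (x : 'rV[R]_n) i s t : upd (upd x i s) i t = upd x i t.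
Proof. by apply/rowP => j; rewrite !updE; case: eqP. Qed.

(* The first coordinate is split off: ['rV_n.+1] is seen as [R * 'rV_n]. *)
Definition tlv n (x : 'rV[R]_n.+1) : 'rV[R]_n := \row_j x 0 (lift ord0 j).

Definition consv n (t : R) (y : 'rV[R]_n) : 'rV[R]_n.+1 :=
  \row_j if unlift ord0 j is Some k then y 0 k else t.

Lemma consv0 n t (y : 'rV[R]_n) : consv t y 0 ord0 = t.
Proof. by rewrite mxE unlift_none. Qed.

Lemma consvS n t (y : 'rV[R]_n) j : consv t y 0 (lift ord0 j) = y 0 j.
Proof. by rewrite mxE liftK. Qed.

Lemma tlvK n t (y : 'rV[R]_n) : tlv (consv t y) = y.
Proof. by apply/rowP => j; rewrite !mxE liftK. Qed.

Lemma consvK n (x : 'rV[R]_n.+1) : consv (x 0 ord0) (tlv x) = x.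
Proof.
apply/rowP => j; case: (unliftP ord0 j) => [k ->|->]; last by rewrite consv0.
by rewrite consvS mxE.
Qed.

Lemma tlvB n (x y : 'rV[R]_n.+1) : tlv (x - y) = tlv x - tlv y.
Proof. by apply/rowP => j; rewrite !mxE. Qed.

Lemma sqr_enorm_tlv n (x : 'rV[R]_n.+1) :
  enorm x ^+ 2 = x 0 ord0 ^+ 2 + enorm (tlv x) ^+ 2.
Proof.
rewrite !sqr_enorm /dotv big_ord_recl -expr2; congr (_ + _).
by apply: eq_bigr => i _; rewrite !mxE.
Qed.

Lemma enorm_tlv n (x : 'rV[R]_n.+1) : enorm (tlv x) <= enorm x.
Proof.
rewrite -(ler_pXn2r (ltn0Sn 1)) ?nnegrE// [leRHS]sqr_enorm_tlv lerDr.
exact: sqr_ge0.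
Qed.

Definition unitv n : 'rV[R]_n.+1 := delta_mx 0 ord0.

Lemma enorm_delta n (i : 'I_n) : enorm (delta_mx 0 i : 'rV[R]_n) = 1.
Proof.
rewrite enormE /dotv (bigD1 i)//= big1 ?addr0 => [|j /negbTE ji].
  by rewrite !mxE !eqxx mulr1 sqrtr1.
by rewrite !mxE ji andbF mulr0.
Qed.

End euclid.
#[export] Hint Extern 0 (is_true (0 <= enorm _)) => exact: enorm_ge0 : core.

(** * Borel sets and grids of half-open cells *)

Section borel.
Context {R : realType} (n : nat).

Definition halfspaces : set (set 'rV[R]_n) :=
  [set A | exists i t, A = [set x : 'rV[R]_n | x 0 i <= t]].

(* ['rV_n] with its Borel sigma-algebra. *)
Definition bV := g_sigma_algebraType halfspaces.

Lemma measurable_halfspace i t : measurable ([set x : 'rV[R]_n | x 0 i <= t] : set bV).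
Proof. by apply: sub_sigma_algebra; exists i, t. Qed.

Lemma measurable_coord (i : 'I_n) : measurable_fun [set: bV] (fun x : bV => (x : 'rV[R]_n) 0 i).
Proof.
apply: (measurability _ (RGenCInfty.measurableE R)) => _ [_ [r ->] <-].
rewrite setTI -[X in measurable X]setCK; apply: measurableC.
rewrite (_ : ~` _ = \bigcup_k [set x : 'rV[R]_n | x 0 i <= r - k.+1%:R^-1]); last first.
  apply/seteqP; split => [x /= |x [k _]/=].
    rewrite in_itv/= andbT => /negP; rewrite -ltNge => xr.
    have /ltr_add_invr[k hk] := xr.
    by exists k => //=; rewrite lerBrDr ltW.
  rewrite in_itv/= andbT => h; apply/negP; rewrite -ltNge (le_lt_trans h)//.
  by rewrite ltrBlDr ltrDl.
by apply: bigcupT_measurable => k; exact: measurable_halfspace.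
Qed.

Lemma measurable_box (ab : 'rV[R]_n * 'rV[R]_n) : measurable (box ab : set bV).
Proof.
rewrite (_ : box ab = \bigcap_(i in [set: 'I_n])
    ((fun x : bV => (x : 'rV[R]_n) 0 i) @^-1` `]ab.1 0 i, ab.2 0 i])).
  apply: fin_bigcap_measurable => [|i _]; first exact: finite_finset.
  by rewrite -[X in measurable X]setTI; apply: measurable_coord.
apply/seteqP; split => x /= h i; first by move=> _; rewrite /= in_itv/=; exact: h.
by have := h i I; rewrite /= in_itv.
Qed.

(* The cells of the grid of step [e], indexed by the pickling of [Z^n]. *)
Definition cellz (e : R) (z : 'rV[int]_n) : 'rV[R]_n * 'rV[R]_n :=
  (\row_i ((z 0 i)%:~R * e), \row_i ((z 0 i + 1)%:~R * e)).

Definition cell (e : R) (k : nat) : set 'rV[R]_n :=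
  oapp (fun z => box (cellz e z)) set0 (pickle_inv k).

(** Boxes are open on the left and closed on the right, whence the ceiling minus one rather than the
    floor. *)
Definition cell_idx (e : R) (x : 'rV[R]_n) : 'rV[int]_n :=
  \row_i (Num.ceil (x 0 i / e) - 1).

Lemma cellzP e z x : 0 < e -> box (cellz e z) x <-> cell_idx e x = z.
Proof.
move=> e0; split=> [zx|<- i]; last first.
  rewrite !mxE/= -ltr_pdivlMr// -ler_pdivrMr// subrK.
  by rewrite ceil_itv// num_real.
apply/rowP => i; rewrite mxE; apply/eqP; rewrite subr_eq; apply/eqP/ceil_def.
by have := zx i; rewrite !mxE/= -ltr_pdivlMr// -ler_pdivrMr// addrK.
Qed.

Lemma measurable_cell e k : measurable (cell e k : set bV).
Proof.
rewrite /cell; case: pickle_inv => [z|] /=; [exact: measurable_box|exact: measurable0].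
Qed.

Lemma trivIset_cell e : 0 < e -> trivIset setT (cell e).
Proof.
move=> e0; apply/trivIsetP => j k _ _ jk; apply/eqP/negPn/negP => /set0P[x []].
rewrite /cell; case jz : (pickle_inv j) => [z|]//= /(cellzP _ _ e0) xz.
case kz : (pickle_inv k) => [y|]//= /(cellzP _ _ e0) xy.
move: jk; have := @pickle_invK 'rV[int]_n j; rewrite jz /= => <-.
have := @pickle_invK 'rV[int]_n k; rewrite kz /= => <-.
by rewrite -xz -xy eqxx.
Qed.

Lemma bigcup_cell e : 0 < e -> \bigcup_k cell e k = setT.
Proof.
move=> e0; apply/seteqP; split => // x _; exists (pickle (cell_idx e x)) => //.
by rewrite /cell pickleK_inv /=; exact/cellzP.
Qed.

Lemma cell_norm e k (x y : 'rV[R]_n) : 0 < e -> cell e k x -> cell e k y -> `|x - y| <= e.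
Proof.
move=> e0; rewrite /cell; case: pickle_inv => [z|]//= xz yz.
apply: norm_le_coord => [|i]; first exact: ltW.
have := xz i; have := yz i; rewrite !mxE/= intrD mulrDl mul1r ler_norml.
by move=> /andP[? ?] /andP[? ?]; apply/andP; split; lra.
Qed.

Lemma open_measurableV (U : set 'rV[R]_n) : open U -> measurable (U : set bV).
Proof.
move=> oU.
have -> : U = \bigcup_m \bigcup_(k in [set k | cell m.+1%:R^-1 k `<=` U]) cell m.+1%:R^-1 k.
  apply/seteqP; split => [x Ux|x [m _ [k /= kU]]]; last exact: kU.
  have /nbhs_ballP[e/= e0 eU] := open_nbhs_nbhs (conj oU Ux).
  have [m me] : exists m, m.+1%:R^-1 < e.
    by have /ltr_add_invr[m] := e0; rewrite add0r => ?; exists m.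
  exists m => //; have : (\bigcup_k cell m.+1%:R^-1 k) x by rewrite bigcup_cell.
  move=> [k _ kx]; exists k => //= y ky; apply: eU.
  rewrite -ball_normE/=; apply: le_lt_trans me.
  by apply: cell_norm kx ky.
apply: bigcupT_measurable => m; apply: bigcup_measurable => k _.
exact: measurable_cell.
Qed.

Lemma closed_measurableV (C : set 'rV[R]_n) : closed C -> measurable (C : set bV).
Proof.
move=> cC; rewrite -(setCK C); apply: measurableC; apply: open_measurableV.
exact: closed_openC.
Qed.

(** The Caratheodory-measurable sets form a sigma-algebra, so cutting along half-spaces suffices.
    The criterion serves the Lebesgue and the Hausdorff outer measures alike. *)
Lemma halfspace_caratheodory (mu : {outer_measure set 'rV[R]_n -> \bar R}) :
  (forall i t, mu.-caratheodory [set x : 'rV[R]_n | x 0 i <= t]) ->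
  forall A, measurable (A : set bV) -> mu.-caratheodory A.
Proof.
move=> mh A mA; apply: (mA mu.-caratheodory); split.
  split; first exact: caratheodory_measurable_set0.
    by move=> B mB; rewrite setTD; exact: caratheodory_measurable_setC.
  exact: caratheodory_measurable_bigcup.
by move=> _ [i [t ->]]; exact: mh.
Qed.

(** Only the partition has to be measurable; [X] is arbitrary. Inequalities between outer measures
    can therefore be checked on the pieces of a fine grid. *)
Lemma cara_sum (mu : {outer_measure set 'rV[R]_n -> \bar R}) :
  (forall A, measurable (A : set bV) -> mu.-caratheodory A) ->
  forall (F : (set 'rV[R]_n)^nat), (forall k, measurable (F k : set bV)) ->
  trivIset setT F -> \bigcup_k F k = setT -> forall X,
  mu X = (\sum_(k <oo) mu (X `&` F k))%E.
Proof.
move=> mh F mF tF uF X; apply/eqP; rewrite eq_le; apply/andP; split.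
  by rewrite -{1}(setIT X) -uF; exact: outer_measure_bigcup_lim.
have := caratheodory_lime_le (fun k => mh _ (mF k)) tF X.
by rewrite uF setCT setI0 outer_measure0 adde0.
Qed.

End borel.

Lemma measurable_prod_ord d (T : measurableType d) (R : realType) (D : set T)
  (I : finType) (F : I -> T -> R) : (forall i, measurable_fun D (F i)) ->
  measurable_fun D (fun x => \prod_i F i x).
Proof.
move=> mF; elim: (index_enum I) => [|i s IH].
  by rewrite (_ : (fun _ => _) = cst 1)//; apply/funext => x; rewrite big_nil.
rewrite (_ : (fun _ => _) = (F i \* (fun x => \prod_(j <- s) F j x))).
  exact: measurable_funM.
by apply/funext => x; rewrite big_cons.
Qed.

(** * Lebesgue and Hausdorff measures *)

Section lebesgue_outer.
Context {R : realType}.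
Implicit Types n : nat.
Local Open Scope ereal_scope.

Lemma max0D (a b t : R) :
  (Num.max 0 (Num.min b t - a) + Num.max 0 (b - Num.max a t) = Num.max 0 (b - a))%R.
Proof.
rewrite /Num.max /Num.min.
case: (ltP b t) => ?; case: (ltP a t) => ?; (do ?[case: ltP => ?]); lra.
Qed.

(** Every box of a cover is cut at height [t] into two boxes whose volumes add up by [max0D]. *)
Lemma lebesgue_halfspace n i t :
  (@lebesgue_outer R n).-caratheodory [set x : 'rV[R]_n | x 0 i <= t]%R.
Proof.
apply: le_caratheodory_measurable => X; apply: le_ereal_inf_tmp => _ [F XF <-].
pose lo (ab : 'rV[R]_n * 'rV[R]_n) := (ab.1, upd ab.2 i (Num.min (ab.2 0 i) t)%R).
pose hi (ab : 'rV[R]_n * 'rV[R]_n) := (upd ab.1 i (Num.max (ab.1 0 i) t)%R, ab.2).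
apply: (@le_trans _ _ (\sum_(k <oo) oapp box_volume 0 (omap lo (F k)) +
                       \sum_(k <oo) oapp box_volume 0 (omap hi (F k)))).
  apply: leeD; apply: ereal_inf_lbound.
    exists (fun k => omap lo (F k)) => // x [/XF[k _ Fk] /= xt]; exists k => //.
    case: (F k) Fk => //= ab abx j; rewrite updE; case: eqP => [->|_]; last exact: abx.
    by have := abx i; rewrite le_min xt => /andP[-> ->].
  exists (fun k => omap hi (F k)) => // x [/XF[k _ Fk] /= /negP].
  rewrite -ltNge => xt; exists k => //.
  case: (F k) Fk => //= ab abx j; rewrite updE; case: eqP => [->|_]; last exact: abx.
  by have := abx i; rewrite gt_max xt => /andP[-> ->].
rewrite -nneseriesD; last 2 first.
- by move=> k _ _; case: (F k) => //= ?; exact: box_volume_ge0.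
- by move=> k _ _; case: (F k) => //= ?; exact: box_volume_ge0.
apply: lee_nneseries => [k _ _|k _].
  by apply: adde_ge0; case: (F k) => //= ?; exact: box_volume_ge0.
case: (F k) => [ab|]/=; last by rewrite adde0.
rewrite /box_volume/= -EFinD lee_fin.
rewrite (bigD1 i)//= [X in (_ + X <= _)%R](bigD1 i)//= [leRHS](bigD1 i)//= !upd_same.
rewrite -[in leRHS](max0D _ _ t) mulrDl le_eqVlt; apply/orP; left; apply/eqP; congr (_ * _ + _ * _)%R.
  by apply: eq_bigr => j /negbTE ji; rewrite updE ji.
by apply: eq_bigr => j /negbTE ji; rewrite updE ji.
Qed.

Lemma lebesgue_box_le n (ab : 'rV[R]_n * 'rV[R]_n) :
  lebesgue_outer (box ab) <= box_volume ab.
Proof.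
apply: ereal_inf_lbound.
exists (fun k => if k is 0%N then Some ab else @None ('rV[R]_n * 'rV[R]_n)).
  by move=> x abx; exists 0%N.
rewrite (nneseries_split _ 1%N)//=; last by case=> [|k] _ //=; exact: box_volume_ge0.
by rewrite big_mkord big_ord1 eseries0 ?adde0// => -[|k].
Qed.

(** Interpolates between the indicator of the box ([k = 0]) and its volume ([k = n]): the first [k]
    coordinates have been integrated out. *)
Definition part_volume n (k : nat) (ab : 'rV[R]_n * 'rV[R]_n) (x : 'rV[R]_n) : R :=
  (\prod_(i < n) if (i < k)%N then Num.max 0 (ab.2 0 i - ab.1 0 i)
                 else \1_`]ab.1 0 i, ab.2 0 i] (x 0 i))%R.

Lemma part_volume_ge0 n k ab (x : 'rV[R]_n) : (0 <= part_volume k ab x)%R.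
Proof. by apply: prodr_ge0 => i _; case: ifP => // _; rewrite le_max lexx. Qed.

Lemma part_volumeS n k (kn : (k < n)%N) ab (x : 'rV[R]_n) :
  (part_volume k.+1 ab x)%:E =
  \int[lebesgue_measure]_s (part_volume k ab (upd x (Ordinal kn) s))%:E.
Proof.
pose i := Ordinal kn.
pose C := (\prod_(j < n | j != i) if (j < k)%N then Num.max 0 (ab.2 0 j - ab.1 0 j)
                 else \1_`]ab.1 0 j, ab.2 0 j] (x 0 j))%R.
have C0 : (0 <= C)%R by apply: prodr_ge0 => j _; case: ifP => // _; rewrite le_max lexx.
transitivity (\int[lebesgue_measure]_s (C%:E * (\1_`]ab.1 0 i, ab.2 0 i] s)%:E)); last first.
  apply: eq_integral => s _; rewrite -EFinM; congr EFin.
  rewrite /part_volume (bigD1 i)//= ltnn upd_same mulrC; congr (_ * _)%R.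
  by apply: eq_bigr => j /negbTE ji; rewrite updE ji.
rewrite ge0_integralZl//; last first.
  by apply/measurable_EFinP; exact: measurable_indic.
rewrite integral_indic// setIT /= lebesgue_measure_itv/= lte_fin.
transitivity (C%:E * (Num.max 0 (ab.2 0 i - ab.1 0 i))%R%:E); last first.
  congr (_ * _); case: ltP => h; first by rewrite -EFinB max_r// subr_ge0 ltW.
  by rewrite max_l// subr_le0.
rewrite -EFinM; congr EFin; rewrite /part_volume (bigD1 i)//= ltnSn mulrC.
congr (_ * _)%R; apply: eq_bigr => j ji; rewrite ltnS leq_eqVlt.
by have /negbTE -> : (j : nat) != k by apply: contra ji => /eqP jk; apply/eqP/val_inj.
Qed.

Lemma measurable_part_volume n k i ab (x : 'rV[R]_n) :
  measurable_fun [set: R] (fun s => part_volume k ab (upd x i s)).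
Proof.
rewrite /part_volume.
apply: (@measurable_prod_ord _ _ R [set: R] 'I_n (fun (j : 'I_n) (s : R) => if (j < k)%N
  then Num.max 0 (ab.2 0 j - ab.1 0 j)
  else \1_`]ab.1 0 j, ab.2 0 j] (upd x i s 0 j))%R) => j; case: (j < k)%N => //.
rewrite (_ : (fun _ => _) = (fun s : R => if j == i then \1_`]ab.1 0 j, ab.2 0 j] s
   else \1_`]ab.1 0 j, ab.2 0 j] (x 0 j))%R); last first.
  by apply/funext => s; rewrite updE; case: eqP.
by case: (j == i) => //; exact: measurable_indic.
Qed.

(** The covering inequality between indicators is integrated one coordinate at a time, by monotone
    convergence for the countable sum; after [n] integrations it compares volumes. *)
Lemma lebesgue_box n (ab : 'rV[R]_n * 'rV[R]_n) :
  lebesgue_outer (box ab) = box_volume ab.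
Proof.
apply/eqP; rewrite eq_le lebesgue_box_le; apply: le_ereal_inf_tmp => _ [F abF <-].
suff H k : (k <= n)%N -> forall x, (part_volume k ab x)%:E <=
    \sum_(j <oo) oapp (fun b => (part_volume k b x)%:E) 0 (F j).
  have := H n (leqnn n) 0%R; rewrite /part_volume.
  under eq_bigr do rewrite ltn_ord.
  move/le_trans; apply; apply: lee_nneseries => [j _ _|j _].
    by case: (F j) => //= b; rewrite lee_fin part_volume_ge0.
  case: (F j) => //= b; rewrite /part_volume /box_volume lee_fin le_eqVlt.
  by apply/orP; left; apply/eqP; apply: eq_bigr => i _; rewrite ltn_ord.
elim: k => [_ x|k IH kn x].
  rewrite /part_volume /=.
  have [abx|nabx] := pselect (box ab x); last first.
    have [i nabi] : exists i, ~~ (ab.1 0 i < x 0 i <= ab.2 0 i)%R.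
      by apply/not_existsP => h; apply: nabx => i; exact/negPn/negP/h.
    rewrite (bigD1 i)//= indicE memNset ?mul0r; last first.
      by rewrite /= in_itv/=; exact/negP.
     apply: nneseries_ge0 => j _ _.
    by case: (F j) => //= b; rewrite lee_fin; apply: prodr_ge0.
  have [j _ Fj] := abF _ abx.
  rewrite big1 => [|i _]; last by rewrite indicE mem_set//= in_itv; exact: abx.
  apply: (@le_trans _ _ (oapp (fun b => (part_volume 0 b x)%:E) 0 (F j))).
    case: (F j) Fj => //= b bx; rewrite /part_volume big1// => i _.
    by rewrite indicE mem_set//= in_itv; exact: bx.
  rewrite (nneseries_split _ j.+1)//=; last first.
    by move=> l _; case: (F l) => //= b; rewrite lee_fin; apply: prodr_ge0.
  rewrite big_mkord big_ord_recr/= -addeA addeCA leeDl//.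
  apply: adde_ge0.
    by apply: sume_ge0 => l _; case: (F l) => //= b; rewrite lee_fin; apply: prodr_ge0.
  by apply: nneseries_ge0 => l _ _; case: (F l) => //= b; rewrite lee_fin; apply: prodr_ge0.
rewrite (part_volumeS kn).
apply: (@le_trans _ _ (\int[lebesgue_measure]_s \sum_(j <oo)
    oapp (fun b => (part_volume k b (upd x (Ordinal kn) s))%:E) 0 (F j))).
  apply: ge0_le_integral => //.
  - by move=> s _; rewrite lee_fin part_volume_ge0.
  - by apply/measurable_EFinP; exact: measurable_part_volume.
  - apply: (@ge0_emeasurable_sum _ _ _ _ _ xpredT) => j.
      by move=> s _ _; case: (F j) => //= b; rewrite lee_fin part_volume_ge0.
    by move=> _; case: (F j) => //= b; apply/measurable_EFinP; exact: measurable_part_volume.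
  - by move=> s _; apply: IH; exact: ltnW.
rewrite integral_nneseries//; last 2 first.
- by move=> j; case: (F j) => //= b; apply/measurable_EFinP; exact: measurable_part_volume.
- by move=> j s _; case: (F j) => //= b; rewrite lee_fin part_volume_ge0.
apply: lee_nneseries => [j _ _|j _].
  by apply: integral_ge0 => s _; case: (F j) => //= b; rewrite lee_fin part_volume_ge0.
case: (F j) => [b|]/=; first by rewrite -part_volumeS.
by rewrite integral0.
Qed.

(** A cover of the base yields a cover of the cylinder by product boxes, so the base may be any set.
    The empty height is separate because the proof divides by [b - a]. *)
Lemma lebesgue_cylinder_le n (D : set 'rV[R]_n) (a b : R) : (a <= b)%R ->
  lebesgue_outer [set x : 'rV[R]_n.+1 | D (tlv x) /\ (a < x 0 ord0 <= b)%R] <=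
  (b - a)%:E * lebesgue_outer D.
Proof.
rewrite le_eqVlt => /orP[/eqP <-|ab].
  rewrite subrr mul0e (_ : [set _ | _] = set0) ?outer_measure0//.
  by apply/seteqP; split => // x [_ /andP[/lt_le_trans h /h]]; rewrite ltxx.
have ba : (0 < b - a)%R by rewrite subr_gt0.
rewrite -lee_pdivrMl//; apply: le_ereal_inf_tmp => _ [F DF <-].
rewrite lee_pdivrMl// -nneseriesZl ?(ltW ba)//; last first.
  by move=> k _; case: (F k) => //= ?; exact: box_volume_ge0.
apply: ereal_inf_lbound.
exists (fun k => omap (fun c => (consv a c.1, consv b c.2)) (F k)).
  move=> x [/DF[k _ Fk] xab]; exists k => //.
  case: (F k) Fk => //= c cx i; case: (unliftP ord0 i) => [j ->|->].
    by rewrite !consvS; have := cx j; rewrite mxE.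
  by rewrite !consv0.
apply: eq_eseriesr => k _; case: (F k) => [c|]/=; last by rewrite mule0.
rewrite /box_volume big_ord_recl/= !consv0 max_r ?ltW// EFinM; congr (_ * _%:E).
by apply: eq_bigr => i _; rewrite !consvS.
Qed.

End lebesgue_outer.

(** The index jumps by two because only layers that are not adjacent lie at a positive distance; odd
    and even layers telescope separately. *)
Lemma telescope2 (R : realType) (w y : nat -> R) :
  (forall j, w j + y j.+1 <= w j.+2) -> forall m p,
  \sum_(l < p) y (m + l)%N.+1 <= w (m + p)%N.+1 + w (m + p)%N - w m - w m.+1.
Proof.
move=> wS m; elim=> [|p IH]; first by rewrite big_ord0 addn0 addrK subrr.
by rewrite big_ord_recr/= addnS; have := wS (m + p)%N; lra.
Qed.

(** * Hausdorff measure as a metric outer measure *)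

Section hausdorff_basics.
Context {R : realType}.
Implicit Types (n k : nat).
Local Open Scope ereal_scope.

Lemma ediam_le n (B : set 'rV[R]_n) d : (0 <= d)%R ->
  (forall x y, B x -> B y -> (enorm (x - y) <= d)%R) -> (ediam B <= d)%R.
Proof.
move=> d0 Bd; rewrite /ediam; set X := [set _ | _ in _].
have [[x Xx]|X0] := pselect (X !=set0); last first.
  by rewrite sup_out// => -[].
by apply: ge_sup; [exists x | move=> _ [[p q] [/= Bp Bq] <-]; exact: Bd].
Qed.

Lemma le_ediam n (B : set 'rV[R]_n) d :
  (forall x y, B x -> B y -> (enorm (x - y) <= d)%R) ->
  forall x y, B x -> B y -> (enorm (x - y) <= ediam B)%R.
Proof.
move=> Bd x y Bx By; apply: ub_le_sup; last by exists (x, y).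
by exists d => _ [[p q] [/= Bp Bq] <-]; exact: Bd.
Qed.

Lemma omega_ge0 n : 0 <= lebesgue_outer (@eball R n 0 1).
Proof. exact: outer_measure_ge0. Qed.

Lemma ow_ge0 n k d (o : option (@small_set R n d)) :
  0 <= oapp (@hausdorff_weight R n k d) 0 o.
Proof. by case: o => //= b; exact: hausdorff_weight_ge0. Qed.

Lemma hausdorff_lip a b k (f : 'rV[R]_a -> 'rV[R]_b) (A : set 'rV[R]_a) (l : R) :
  (0 < l)%R ->
  (forall x y, A x -> A y -> (enorm (f x - f y) <= l * enorm (x - y))%R) ->
  @hausdorff_outer R b k (f @` A) <= (l ^+ k)%:E * @hausdorff_outer R a k A.
Proof.
move=> l0 fl; have lk : (0 < l ^+ k)%R by rewrite exprn_gt0.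
apply: ge_ereal_sup => _ [d /= d0 <-].
apply: (@le_trans _ _ ((l ^+ k)%:E * hausdorff_delta k (d / l)%R A)); last first.
  apply: lee_wpmul2l; first by rewrite lee_fin ltW.
  apply: ereal_sup_ubound.
  by exists (d / l)%R => //=; rewrite divr_gt0.
rewrite -lee_pdivrMl//; apply: le_ereal_inf_tmp => _ [F AF <-].
rewrite lee_pdivrMl// -nneseriesZl ?(ltW lk)//; last by move=> i _; exact: ow_ge0.
have im_small (B : @small_set R a (d / l)%R) x y : (f @` (A `&` sval B)) x ->
    (f @` (A `&` sval B)) y -> (enorm (x - y) <= d)%R.
  move=> [p [Ap Bp] <-] [q [Aq Bq] <-].
  rewrite (le_trans (fl _ _ Ap Aq))// mulrC -ler_pdivlMr//; exact: (svalP B).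
pose G i := omap (fun B => exist (fun B : set 'rV[R]_b => forall x y, B x -> B y ->
  (enorm (x - y) <= d)%R) _ (im_small B)) (F i) : option (@small_set R b d).
apply: (@le_trans _ _ (\sum_(i <oo) oapp (@hausdorff_weight R b k d) 0 (G i))).
  apply: ereal_inf_lbound; exists G => // _ [x Ax <-].
  have [i _ Fi] := AF _ Ax; exists i => //; rewrite /G.
  by case: (F i) Fi => //= B Bx; exists x.
apply: lee_nneseries => [i _ _|i _]; first exact: ow_ge0.
rewrite /G; case: (F i) => [B|]/=; last by rewrite mule0.
rewrite /hausdorff_weight muleCA lee_wpmul2l ?omega_ge0// -EFinM lee_fin -exprMn.
rewrite lerXn2r ?nnegrE ?divr_ge0 ?mulr_ge0 ?ediam_ge0 ?(ltW l0)//.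
rewrite mulrA ler_wpM2r//= ediam_le ?mulr_ge0 ?ediam_ge0 ?(ltW l0)//.
move=> _ _ [p [Ap Bp] <-] [q [Aq Bq] <-]; rewrite (le_trans (fl _ _ Ap Aq))//.
by rewrite ler_wpM2l ?(ltW l0)//; exact: (le_ediam (svalP B)).
Qed.

Lemma le_hausdorff_delta n k (d e : R) (A : set 'rV[R]_n) : (d <= e)%R ->
  hausdorff_delta k e A <= hausdorff_delta k d A.
Proof.
move=> de; apply: le_ereal_inf_tmp => _ [F AF <-].
have sm (B : @small_set R n d) x y : sval B x -> sval B y -> (enorm (x - y) <= e)%R.
  by move=> Bx By; rewrite (le_trans _ de)//; exact: (svalP B).
apply: ereal_inf_lbound.
exists (fun i => omap (fun B => exist (fun B : set 'rV[R]_n => forall x y, B x -> B y ->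
  (enorm (x - y) <= e)%R) _ (sm B)) (F i) : option (@small_set R n e)).
  by move=> x /AF[i _ Fi]; exists i => //; case: (F i) Fi.
by apply: eq_eseriesr => i _; case: (F i).
Qed.

Lemma lee_supD (S : set \bar R) (T : set \bar R) (x : \bar R) :
  (forall a b, S a -> T b -> a + b <= x) -> 0 <= x ->
  (forall a, S a -> 0 <= a) -> (forall a, T a -> 0 <= a) ->
  S !=set0 -> T !=set0 ->
  ereal_sup S + ereal_sup T <= x.
Proof.
move=> STx x0 S0 T0 [s Ss] [t Tt].
have [xf|] := boolP (x \is a fin_num); last first.
  by rewrite ge0_fin_numE// -leNgt leye_eq => /eqP ->; rewrite leey.
have Sx a : S a -> a <= x.
  by move=> Sa; rewrite (le_trans _ (STx _ _ Sa Tt))// leeDl// T0.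
have Tx a : T a -> a <= x.
  by move=> Ta; rewrite (le_trans _ (STx _ _ Ss Ta))// leeDr// S0.
have fin y : 0 <= y -> y <= x -> y \is a fin_num.
  by move=> y0 yx; rewrite ge0_fin_numE// (le_lt_trans yx)// ltey_eq xf.
have supS : ereal_sup S \is a fin_num.
  apply: fin; last exact: ge_ereal_sup.
  by rewrite (le_trans (S0 _ Ss))// ereal_sup_ubound.
rewrite -leeBrDl//; apply: ge_ereal_sup => b Tb; rewrite leeBrDl// -leeBrDr ?fin ?Tx ?T0//.
by apply: ge_ereal_sup => a Sa; rewrite leeBrDr ?STx// fin ?T0 ?Tx.
Qed.

(** A covering set of diameter below [d] cannot meet both [A] and [B], so a fine cover of the union
    splits into a cover of each. *)
Lemma hausdorff_sep n k (A B : set 'rV[R]_n) (d : R) : (0 < d)%R ->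
  (forall x y, A x -> B y -> (d <= enorm (x - y))%R) ->
  hausdorff_outer k A + hausdorff_outer k B <= hausdorff_outer k (A `|` B).
Proof.
move=> d0 AB.
have d0' e X : 0 <= @hausdorff_delta R n k e X.
  by apply: cover_outer_ge0; exact: hausdorff_weight_ge0.
apply: lee_supD; rewrite ?outer_measure_ge0//; last 4 first.
- by move=> _ [e _ <-].
- by move=> _ [e _ <-].
- by exists (hausdorff_delta k 1 A); exists 1%R => //=.
- by exists (hausdorff_delta k 1 B); exists 1%R => //=.
move=> _ _ [e1 /= e10 <-] [e2 /= e20 <-].
pose e := Num.min (Num.min e1 e2) (d / 2)%R.
have e0 : (0 < e)%R by rewrite !lt_min e10 e20 divr_gt0.
have ed : (e < d)%R by rewrite gt_min [X in _ || X](_ : _ = true) ?orbT//; lra.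
apply: (@le_trans _ _ (hausdorff_delta k e A + hausdorff_delta k e B)).
  by apply: leeD; apply: le_hausdorff_delta; rewrite !ge_min lexx ?orbT.
apply: (@le_trans _ _ (hausdorff_delta k e (A `|` B))); last first.
  by apply: ereal_sup_ubound; exists e.
apply: le_ereal_inf_tmp => _ [F ABF <-].
pose res (X : set 'rV[R]_n) (o : option (@small_set R n e)) :=
  if o is Some C then if `[< X `&` sval C !=set0 >] then Some C else None else None.
pose FA i := res A (F i); pose FB i := res B (F i).
have resP (X : set 'rV[R]_n) o x : X x -> oapp sval set0 o x -> oapp sval set0 (res X o) x.
  by case: o => //= C Xx Cx; case: asboolP => //= -[]; exists x.
apply: (@le_trans _ _ (\sum_(i <oo) oapp (@hausdorff_weight R n k e) 0 (FA i) +
   \sum_(i <oo) oapp (@hausdorff_weight R n k e) 0 (FB i))).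
  apply: leeD; apply: ereal_inf_lbound.
    by exists FA => // x Ax; have [i _ Fi] := ABF x (or_introl Ax); exists i => //; exact: resP.
  by exists FB => // x Ax; have [i _ Fi] := ABF x (or_intror Ax); exists i => //; exact: resP.
rewrite -nneseriesD; try by move=> i _ _; exact: ow_ge0.
apply: lee_nneseries => [i _ _|i _]; first by rewrite adde_ge0 ?ow_ge0.
rewrite /FA /FB; case: (F i) => [C|]/=; last by rewrite adde0.
case: asboolP => [[x [Ax Cx]]|_]; case: asboolP => [[y [By Cy]]|_]; rewrite /= ?adde0 ?add0e//.
- by have := lt_le_trans ed (le_trans (AB _ _ Ax By) (svalP C _ _ Cx Cy)); rewrite ltxx.
- exact: hausdorff_weight_ge0.
Qed.

(** Caratheodory's criterion: [X] beyond the hyperplane is exhausted by the sets [W j] at positive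
    distance from it, and the layers [Y j] between them have summable measure by [telescope2], so
    nothing is lost in the limit. *)
Lemma hausdorff_halfspace n k i t :
  (@hausdorff_outer R n k).-caratheodory [set x : 'rV[R]_n | x 0 i <= t]%R.
Proof.
apply: le_caratheodory_measurable => X /=; set H := hausdorff_outer k.
set P := [set x : 'rV[R]_n | _]%R.
have [XF|] := boolP (H X \is a fin_num); last first.
  by rewrite ge0_fin_numE ?outer_measure_ge0// -leNgt leye_eq => /eqP ->; rewrite leey.
have Hfin Y : Y `<=` X -> H Y \is a fin_num.
  move=> YX; rewrite ge0_fin_numE ?outer_measure_ge0//.
  by rewrite (le_lt_trans (le_outer_measure H _ _ YX))// ltey_eq XF.
pose W (j : nat) := X `&` [set x : 'rV[R]_n | t + j.+1%:R^-1 <= x 0 i]%R.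
pose Y (j : nat) := X `&` [set x : 'rV[R]_n | t + j.+2%:R^-1 <= x 0 i < t + j.+1%:R^-1]%R.
have sep (U V : set 'rV[R]_n) (s r : R) : (s < r)%R -> (forall x, U x -> x 0 i <= s)%R ->
    (forall x, V x -> r <= x 0 i)%R -> H U + H V <= H (U `|` V).
  move=> sr Us Vr; apply: (@hausdorff_sep _ _ _ _ (r - s)%R); first by rewrite subr_gt0.
  move=> x y /Us xs /Vr yr; rewrite enormB.
  have := abs_le_enorm (y - x) i; rewrite !mxE; apply: le_trans.
  by rewrite (le_trans _ (ler_norm _))//; lra.
have invS j : (j.+2%:R^-1 < j.+1%:R^-1 :> R)%R by rewrite ltf_pV2 ?posrE// ltr_nat.
have sepW j : H (X `&` P) + H (W j) <= H X.
  apply: (@le_trans _ _ (H ((X `&` P) `|` W j))); last first.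
    by apply: le_outer_measure => x [[]|[]].
  apply: (sep _ _ t (t + j.+1%:R^-1)%R); first by rewrite ltrDl.
    by move=> x [].
  by move=> x [].
have WS j : H (W j) + H (Y j.+1) <= H (W j.+2).
  rewrite addeC; apply: (@le_trans _ _ (H (Y j.+1 `|` W j))).
    apply: (sep _ _ (t + j.+2%:R^-1)%R (t + j.+1%:R^-1)%R); first by rewrite ltrD2l.
      by move=> x [_ /= /andP[_ /ltW]].
    by move=> x [].
  apply: le_outer_measure => x [[Xx /= /andP[h _]]|[Xx /= h]]; split => //=.
  by rewrite (le_trans _ h)// lerD2l ltW// (lt_trans (invS _)).
have WX j : W j `<=` X by move=> x [].
have YX j : Y j `<=` X by move=> x [].
have [w wE] : exists w : nat -> R, forall j, H (W j) = (w j)%:E.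
  by exists (fun j => fine (H (W j))) => j; rewrite fineK// Hfin.
have [y yE] : exists y : nat -> R, forall j, H (Y j) = (y j)%:E.
  by exists (fun j => fine (H (Y j))) => j; rewrite fineK// Hfin.
have wS j : (w j + y j.+1 <= w j.+2)%R by rewrite -lee_fin EFinD -!wE -yE WS.
have wmono j : (w j <= w j.+1)%R.
  rewrite -lee_fin -!wE; apply: le_outer_measure => x [Xx /= h]; split => //=.
  by rewrite (le_trans _ h)// lerD2l ltW.
have ybound := telescope2 wS.
have wX j : (w j <= fine (H X))%R.
  by rewrite -lee_fin -wE fineK//; apply: le_outer_measure.
have [l wl] : exists l : R, w @ \oo --> l.
  apply/cvg_ex; apply: nondecreasing_is_cvgn; first by apply/nondecreasing_seqP.
  by exists (fine (H X)) => _ [j _ <-].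
have wle j : (w j <= l)%R.
  have := @nondecreasing_cvgn_le _ w _ (cvgP _ wl) j.
  by rewrite (cvg_lim _ wl)//; apply; apply/nondecreasing_seqP.
(* The part of [X] beyond the hyperplane is covered by [W m.+1] and the layers from index [m.+1] on;
   the telescoped sum of the latter is controlled by the distance of [w m] to its limit [l]. *)
have key m : (fine (H (X `&` ~` P)) <= l + 2 * (l - w m))%R.
  pose V j := if j is j'.+1 then Y (m + j').+1 else W m.+1.
  have XV : X `&` ~` P `<=` \bigcup_j V j.
    move=> x [Xx /= /negP]; rewrite -ltNge => tx.
    have [mx|mx] := leP (t + m.+2%:R^-1)%R (x 0 i)%R; first by exists 0%N.
    have ex : exists j, (t + j.+3%:R^-1 <= x 0 i)%R.
      have /ltr_add_invr[j] : (0 < x 0 i - t)%R by rewrite subr_gt0.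
      rewrite add0r => h; exists j; rewrite -lerBrDl ltW//.
      by rewrite (le_lt_trans _ h)// ltW// (lt_trans (invS _)).
    case: (ex_minnP ex) => j h jmin.
    have mj : (m <= j)%N.
      rewrite leqNgt; apply/negP => jm; move: mx; rewrite ltNge => /negP; apply.
      by rewrite (le_trans _ h)// lerD2l lef_pV2 ?posrE// ler_nat.
    exists (j - m).+1 => //=; rewrite subnKC//; split => //=; rewrite h/=.
    case: j h jmin mj => [|j] h jmin mj.
      by move: mx; rewrite (_ : m = 0%N)//; apply/eqP; rewrite -leqn0.
    rewrite ltNge; apply/negP => h'.
    by have := jmin j h'; rewrite ltnn.
  have : H (X `&` ~` P) <= (l + 2 * (l - w m))%:E.
    apply: le_trans (le_outer_measure H _ _ XV) _.
    apply: le_trans (outer_measure_sigma_subadditive H V) _.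
    apply: lime_le; first by apply: is_cvg_nneseries => j _ _; exact: outer_measure_ge0.
    apply: nearW => -[|p].
      have w0 : (0 <= w m)%R by rewrite -lee_fin -wE outer_measure_ge0.
      by rewrite big_geq// lee_fin; have := wle m; move: (w m) w0 => u u0 ul; lra.
    have V0 : H (V 0%N) = (w m.+1)%:E by exact: wE.
    have VS j : H (V j.+1) = (y (m + j).+1)%:E by exact: yE.
    rewrite big_mkord big_ord_recl [X in X + _]V0.
    rewrite (eq_bigr (fun l' : 'I_p => (y (m + l').+1)%:E)); last by move=> l' _; exact: VS.
    rewrite sumEFin -EFinD lee_fin.
    by have := ybound m p; have := wle (m + p)%N; have := wle (m + p).+1; have := wle m; lra.
  by move=> h; rewrite -lee_fin fineK// Hfin//; move=> x [].
have h1 m : (fine (H (X `&` P)) + w m <= fine (H X))%R.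
  by rewrite -lee_fin EFinD !fineK// ?Hfin// -?wE ?sepW// => x [].
suff : (fine (H (X `&` P)) + fine (H (X `&` ~` P)) <= fine (H X))%R.
  by rewrite -lee_fin EFinD !fineK// ?Hfin// => x [].
rewrite leNgt; apply/negP => hlt.
set e := (fine (H (X `&` P)) + fine (H (X `&` ~` P)) - fine (H X))%R.
have e0 : (0 < e)%R by rewrite subr_gt0.
have /cvgrPdist_lt/(_ (e / 3)%R) := wl.
rewrite divr_gt0// => /(_ isT)[m _ /(_ m (leqnn m))] /=.
rewrite ger0_norm ?subr_ge0// => lm.
by have := key m; have := h1 m; move: lm; rewrite /e; lra.
Qed.

Lemma borel_hausdorff_measurable n k (A : set 'rV[R]_n) : measurable (A : set (@bV R n)) ->
  (@hausdorff_outer R n k).-caratheodory A.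
Proof. by apply: halfspace_caratheodory => i t; exact: hausdorff_halfspace. Qed.

Lemma borel_lebesgue_measurable n (A : set 'rV[R]_n) : measurable (A : set (@bV R n)) ->
  (@lebesgue_outer R n).-caratheodory A.
Proof. by apply: halfspace_caratheodory => i t; exact: lebesgue_halfspace. Qed.

End hausdorff_basics.

(** * Proportionality of Hausdorff and Lebesgue measures *)

Section kappa.
Context {R : realType}.
Implicit Types (n k : nat).

Definition cbox n (a : 'rV[R]_n) (s : R) : set 'rV[R]_n := box (a, a + const_mx s).
Definition cube01 n : set 'rV[R]_n := cbox 0 1.

Lemma lebesgue_cbox n (a : 'rV[R]_n) s : 0 <= s -> lebesgue_outer (cbox a s) = (s ^+ n)%:E.
Proof.
move=> s0; rewrite lebesgue_box /box_volume; congr EFin.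
rewrite -[n in RHS]card_ord -prodr_const; apply: eq_bigr => i _.
by rewrite !mxE/= addrAC subrr add0r max_r.
Qed.

Lemma omega_fin n : lebesgue_outer (@eball R n 0 1) \is a fin_num.
Proof.
rewrite ge0_fin_numE ?omega_ge0//.
apply: (@le_lt_trans _ _ (lebesgue_outer (cbox (const_mx (-1) : 'rV[R]_n) 2))).
  apply: le_outer_measure => x /= + i; rewrite /eball/= subr0 => x1.
  have := le_lt_trans (abs_le_enorm x i) x1.
  by rewrite ltr_norml !mxE/= => /andP[-> ?]; lra.
by rewrite lebesgue_cbox ?ltry.
Qed.

Lemma omega_gt0 n : (0 < lebesgue_outer (@eball R n 0 1))%E.
Proof.
have n1 : 0 < n.+1%:R^-1 :> R by rewrite invr_gt0.
apply: (@lt_le_trans _ _ (lebesgue_outer (cbox (0 : 'rV[R]_n) n.+1%:R^-1))).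
  by rewrite lebesgue_cbox ?ltW// lte_fin exprn_gt0.
apply: le_outer_measure => x /= xb; rewrite /eball/= subr0.
apply: le_lt_trans (enorm_le_sum x) _.
apply: (@le_lt_trans _ _ (\sum_(i < n) n.+1%:R^-1)).
  apply: ler_sum => i _; have := xb i; rewrite !mxE/= add0r => /andP[x0 x1].
  by rewrite ger0_norm// ltW.
by rewrite sumr_const card_ord -[ltLHS]mulr_natl ltr_pdivrMr// mul1r ltr_nat.
Qed.

(** Both inequalities come from the Lipschitz bound, for the homothety and for its inverse. *)
Lemma cube_scale n k (a : 'rV[R]_n) (s : R) : 0 < s ->
  (hausdorff_outer k (cbox a s) = (s ^+ k)%:E * hausdorff_outer k (@cube01 n))%E.
Proof.
move=> s0; have sk : 0 < s ^+ k by rewrite exprn_gt0.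
have img : cbox a s = (fun x => a + s *: x) @` @cube01 n.
  apply/seteqP; split => [x xb|_ [x xb <-] i].
    exists (s^-1 *: (x - a)); last by rewrite scalerA divff ?gt_eqF// scale1r addrC subrK.
    move=> i; have := xb i; rewrite !mxE/= add0r => /andP[ax xa].
    by rewrite pmulr_rgt0 ?invr_gt0// subr_gt0 ax mulrC ler_pdivrMr// mul1r lerBlDl.
  have := xb i; rewrite !mxE/= add0r => /andP[x0 x1].
  by rewrite ltrDl pmulr_rgt0// x0 lerD2l -[leRHS]mulr1 ler_pM2l.
apply/eqP; rewrite eq_le; apply/andP; split.
  rewrite img; apply: hausdorff_lip => // x y _ _.
  by rewrite opprD addrACA subrr add0r -scalerBr enormZ gtr0_norm.
rewrite -lee_pdivlMl// -exprVn.
rewrite (_ : @cube01 n = (fun x => s^-1 *: (x - a)) @` cbox a s).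
  apply: hausdorff_lip => [|x y _ _]; first by rewrite invr_gt0.
  by rewrite -scalerBr opprB addrA subrK enormZ gtr0_norm// invr_gt0.
have sK (x : 'rV[R]_n) : s^-1 *: (a + s *: x - a) = x.
  by rewrite addrAC subrr add0r scalerA mulVf ?gt_eqF// scale1r.
rewrite img; apply/seteqP; split => [x xb|_ [_ [x xb <-] <-]]; last by rewrite sK.
by exists (a + s *: x) => //; exists x.
Qed.

Lemma nat_itv (y : R) M : 0 < y <= M%:R -> exists2 j, (j < M)%N & j%:R < y <= j.+1%:R.
Proof.
elim: M => [|M IH] /andP[y0 yM]; first by have := lt_le_trans y0 yM; rewrite ltxx.
have [yM'|yM'] := leP y M%:R; last by exists M => //; rewrite yM' yM.
have [|j jM jy] := IH; first by rewrite y0.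
by exists j => //; exact: ltnW.
Qed.

(** The cube is cut into [(m + 1)^n] cubes of side [1 / (m + 1)] and diameter at most [n / (m + 1)].
    The number of cubes compensates their weights, whatever the mesh. *)
Lemma cube01_fin n : hausdorff_outer n (@cube01 n) \is a fin_num.
Proof.
rewrite ge0_fin_numE ?outer_measure_ge0//.
pose om := lebesgue_outer (@eball R n 0 1).
apply: (@le_lt_trans _ _ (om * ((n%:R / 2) ^+ n)%:E)%E); last first.
  by rewrite lte_mul_pinfty ?omega_ge0 ?omega_fin ?ltry.
apply: ge_ereal_sup => _ [d /= d0 <-].
have [m nm] : exists m, n%:R / m.+1%:R <= d.
  have nd0 : 0 <= n%:R / d by rewrite divr_ge0// ltW.
  have /ltW nm := archi_boundP nd0; exists (Num.bound (n%:R / d)).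
  rewrite ler_pdivrMr// mulrC -ler_pdivrMr//.
  by rewrite (le_trans nm)// ler_nat.
pose s : R := m.+1%:R^-1.
have s0 : 0 < s by rewrite invr_gt0.
pose b (f : {ffun 'I_n -> 'I_m.+1}) := cbox (\row_i ((f i)%:R * s)) s.
have bs f x y : b f x -> b f y -> enorm (x - y) <= n%:R * s.
  move=> bx By; apply: le_trans (enorm_le_sum _) _.
  rewrite -[n in leRHS]card_ord mulr_natl -sumr_const; apply: ler_sum => i _.
  have := bx i; have := By i; rewrite !mxE/= => /andP[? ?] /andP[? ?].
  by rewrite ler_norml; apply/andP; split; lra.
have bd f x y : b f x -> b f y -> enorm (x - y) <= d.
  by move=> bx By; rewrite (le_trans (bs _ _ _ bx By)).
pose B f : @small_set R n d := exist _ (b f) (bd f).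
pose F (i : nat) : option (@small_set R n d) :=
  omap (fun j : 'I_#|{ffun 'I_n -> 'I_m.+1}| => B (enum_val j)) (insub i).
apply: (@le_trans _ _ (\sum_(i <oo) oapp (@hausdorff_weight R n n d) 0 (F i))%E).
  apply: ereal_inf_lbound; exists F => // x xb.
  have /choice[f fP] : forall i : 'I_n, exists j : 'I_m.+1, (j : nat)%:R < x 0 i / s <= (j : nat).+1%:R.
    move=> i; have [|j jm jx] := @nat_itv (x 0 i / s) m.+1; last by exists (Ordinal jm).
    have := xb i; rewrite !mxE/= add0r => /andP[x0 x1].
    by rewrite divr_gt0// ler_pdivrMr// /s divff// pnatr_eq0.
  exists (enum_rank [ffun i => f i]) => //; rewrite /F valK /= enum_rankK => i.
  have := fP i; rewrite !mxE/= ffunE ltr_pdivlMr// ler_pdivrMr// -natr1 mulrDl mul1r.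
  by [].
rewrite (nneseries_split _ #|{ffun 'I_n -> 'I_m.+1}|); last by move=> i _; exact: ow_ge0.
rewrite [X in (_ + X)%E]eseries0 ?adde0; last first.
  move=> i; rewrite leqNgt => /negbTE ni _ ; rewrite /F insubF//.
apply: (@le_trans _ _ (\sum_(0 <= i < 0 + #|{ffun 'I_n -> 'I_m.+1}|) (om * ((n%:R * s / 2) ^+ n)%:E))%E).
  apply: lee_sum => i _; rewrite /F; case: insub => [j|]/=; last first.
    by rewrite mule_ge0 ?omega_ge0// lee_fin exprn_ge0// divr_ge0// mulr_ge0// ltW.
  rewrite /hausdorff_weight lee_wpmul2l ?omega_ge0// lee_fin lerXn2r ?nnegrE ?divr_ge0 ?ediam_ge0 ?mulr_ge0 ?(ltW s0)//.
  rewrite ler_wpM2r// ediam_le ?mulr_ge0 ?(ltW s0)//; exact: bs.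
have [om1 omE] : exists r, om = r%:E by exists (fine om); rewrite fineK ?omega_fin.
rewrite omE -EFinM sumEFin big_mkord sumr_const card_ord card_ffun !card_ord add0n.
rewrite -EFinM lee_fin -[_ *+ (_ ^ _)]mulr_natr natrX -mulrA -exprMn.
rewrite (_ : n%:R * s / 2 * m.+1%:R = n%:R / 2)//.
have m1 : m.+1%:R != 0 :> R by rewrite pnatr_eq0.
by rewrite /s; move: (m.+1%:R : R) m1 => u u0; field.
Qed.

(* H^n is [kap n] times L^n on R^n.  [kap n = 1] is the isodiametric inequality,
   which is not needed because all estimates carry the same factor. *)
Definition kap n : R := fine (hausdorff_outer n (@cube01 n)).

Lemma kapE n : hausdorff_outer n (@cube01 n) = (kap n)%:E.
Proof. by rewrite fineK// cube01_fin. Qed.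

Lemma kap_ge0 n : 0 <= kap n.
Proof. by rewrite fine_ge0// outer_measure_ge0. Qed.

Lemma lebesgue_ediam n (d : R) (B : @small_set R n.+1 d) :
  (lebesgue_outer (sval B) <= ((4 * ediam (sval B)) ^+ n.+1)%:E)%E.
Proof.
have [[x Bx]|B0] := pselect (sval B !=set0); last first.
  rewrite (_ : sval B = set0) ?outer_measure0; last first.
    by apply/seteqP; split => // x Bx; exfalso; apply: B0; exists x.
  by rewrite lee_fin exprn_ge0// mulr_ge0// ediam_ge0.
pose c e := cbox (x - const_mx e) (2 * e).
have Bc e : ediam (sval B) < e -> sval B `<=` c e.
  move=> de y By i; rewrite !mxE/=.
  have := le_lt_trans (le_ediam (svalP B) By Bx) de.
  move=> /(le_lt_trans (abs_le_enorm _ i)); rewrite !mxE ltr_norml => /andP[? ?].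
  by apply/andP; split; lra.
have Lc e : ediam (sval B) < e -> (lebesgue_outer (sval B) <= ((2 * e) ^+ n.+1)%:E)%E.
  move=> de; rewrite -(lebesgue_cbox (x - const_mx e)) ?(le_outer_measure _ _ _ (Bc _ de))//.
  by rewrite mulr_ge0// (le_trans (ediam_ge0 _) (ltW de)).
have [d0|d0] := ltP 0 (ediam (sval B)).
  (* A half-side strictly larger than the diameter is required because boxes are half-open; doubling
     it gives the factor 4. A set of diameter 0 is handled by letting the half-side tend to 0. *)
  apply: (le_trans (Lc (2 * ediam (sval B)) _)); first by lra.
  by rewrite lee_fin mulrA (_ : 2 * 2 = 4 :> R)//; lra.
have -> : ediam (sval B) = 0 by apply/eqP; rewrite eq_le d0 ediam_ge0.
rewrite mulr0 expr0n/=; apply/lee_addgt0Pr => e e0; rewrite add0e.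
pose t := Num.min 1 e / 2.
have m0 : 0 < Num.min 1 e by rewrite lt_min ltr01.
have t0 : 0 < t by rewrite divr_gt0.
apply: (le_trans (Lc t _)); first exact: le_lt_trans t0.
have -> : 2 * t = Num.min 1 e by rewrite /t mulrC divfK.
by rewrite lee_fin exprS (@le_trans _ _ (Num.min 1 e * 1))// ?ler_wpM2l ?(ltW m0)// ?mulr1 ?ge_min ?lexx ?orbT// exprn_ile1 ?(ltW m0)// ge_min lexx.
Qed.

(** Mass distribution: each covering set has Lebesgue measure at most [(4 diam)^n], that is
    [8^n (diam / 2)^n], so the weights of a cover of the cube add up to at least [8^-n] times the
    volume of the unit ball. *)
Lemma kap_gt0 n : 0 < kap n.+1.
Proof.
rewrite -lte_fin -kapE; set om := lebesgue_outer (@eball R n.+1 0 1).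
have om0 : (0 < om)%E := omega_gt0 n.+1.
have omE : om = (fine om)%:E by rewrite fineK ?omega_fin.
have e0 : 0 < 8 ^+ n.+1 :> R by rewrite exprn_gt0.
apply: (@lt_le_trans _ _ ((8 ^+ n.+1)^-1%:E * om)%E).
  by rewrite mule_gt0// lte_fin invr_gt0.
apply: (@le_trans _ _ (hausdorff_delta n.+1 1 (@cube01 n.+1))); last first.
  by apply: ereal_sup_ubound; exists 1 => //=.
apply: le_ereal_inf_tmp => _ [F cF <-].
rewrite lee_pdivrMl// -nneseriesZl ?(ltW e0)//; last by move=> i _; exact: ow_ge0.
have -> : om = (om * lebesgue_outer (@cube01 n.+1))%E.
  by rewrite lebesgue_cbox// expr1n mule1.
apply: (@le_trans _ _ (om * \sum_(i <oo) lebesgue_outer (oapp sval set0 (F i))))%E.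
  rewrite lee_wpmul2l// ?(ltW om0)//; apply: le_trans (le_outer_measure _ _ _ cF) _.
  exact: outer_measure_sigma_subadditive.
have omr : 0 <= fine om by rewrite fine_ge0 ?omega_ge0.
rewrite omE -nneseriesZl//; last by move=> i _; exact: outer_measure_ge0.
apply: lee_nneseries => [i _ _|i _]; first by rewrite mule_ge0 ?outer_measure_ge0.
case: (F i) => [B|]/=; last by rewrite outer_measure0 !mule0.
apply: (le_trans (lee_wpmul2l _ (lebesgue_ediam B))); first by rewrite -omE ltW.
rewrite /hausdorff_weight -/om omE -!EFinM lee_fin [leRHS]mulrCA -exprMn.
by rewrite (_ : 8 * (ediam (sval B) / 2) = 4 * ediam (sval B))//; lra.
Qed.

Lemma prod_widen_lt (s : seq R) (e : R) : 0 < e ->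
  exists2 d, 0 < d & \prod_(x <- s) (x + 2 * d) <= \prod_(x <- s) x + e.
Proof.
move=> e0; pose f (l : seq R) (d : R) := \prod_(x <- l) (x + 2 * d).
have cf l : {for 0, continuous (f l)}.
  rewrite /f; elim: l => [|y l IH].
    by rewrite (_ : (fun _ => _) = cst 1); [exact: cst_continuous|apply/funext => d; rewrite big_nil].
  rewrite (_ : (fun _ => _) = (fun d => y + 2 * d) \* (fun d => \prod_(x <- l) (x + 2 * d))).
    apply: continuousM => //; apply: continuousD; first exact: cst_continuous.
    exact: mulrl_continuous.
  by apply/funext => d; rewrite big_cons.
have /cvgrPdist_lt/(_ e e0)/nbhs_ballP[d/= d0 dP] := cf s.
exists (d / 2); first by rewrite divr_gt0.
have /dP : ball 0 d (d / 2).
  by rewrite -ball_normE/= sub0r normrN ger0_norm ?divr_ge0 ?(ltW d0)//; lra.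
rewrite /f /= ltr_norml => /andP[]; rewrite (eq_bigr id) => [|x _]; last by rewrite mulr0 addr0.
by move=> h1 _; lra.
Qed.

(** On a grid cell the two measures are proportional by scaling. The box is widened by the mesh [d],
    so that every cell that meets it lies in the wider box, and [d] tends to 0. *)
Lemma hausdorff_box_le n (ab : 'rV[R]_n * 'rV[R]_n) :
  (forall i, ab.1 0 i <= ab.2 0 i) ->
  (hausdorff_outer n (box ab) <= (kap n)%:E * lebesgue_outer (box ab))%E.
Proof.
move=> leab; apply/lee_addgt0Pr => e e0.
have e'0 : 0 < e / (kap n + 1) by rewrite divr_gt0// ltr_wpDl ?kap_ge0.
have [d d0 dle] := @prod_widen_lt [seq ab.2 0 i - ab.1 0 i | i <- index_enum 'I_n] _ e'0.
pose ab' := (ab.1 - const_mx d, ab.2 + const_mx d).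
have Lab : lebesgue_outer (box ab) = (\prod_i (ab.2 0 i - ab.1 0 i))%:E.
  rewrite lebesgue_box; congr EFin; apply: eq_bigr => i _.
  by rewrite max_r// subr_ge0.
have Lab' : lebesgue_outer (box ab') = (\prod_i (ab.2 0 i - ab.1 0 i + 2 * d))%:E.
  rewrite lebesgue_box; congr EFin; apply: eq_bigr => i _; rewrite !mxE/= max_r; last first.
    by have := leab i; lra.
  lra.
apply: (@le_trans _ _ ((kap n)%:E * lebesgue_outer (box ab'))%E); last first.
  rewrite Lab Lab' -!EFinM -EFinD lee_fin; rewrite !big_map in dle.
  apply: (le_trans (ler_wpM2l (kap_ge0 _) dle)); rewrite mulrDr lerD2l mulrCA ger_pMr//.
  by rewrite ler_pdivrMr ?ltr_wpDl ?kap_ge0// mul1r lerDl.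
have cellE k : (@cell R n d k = set0) \/ exists a, @cell R n d k = cbox a d.
  rewrite /cell; case: pickle_inv => [z|]/=; [right|by left].
  exists (\row_i ((z 0 i)%:~R * d)); congr box; congr pair.
  by apply/rowP => i; rewrite !mxE/= intrD mulrDl mul1r.
rewrite (cara_sum (@borel_hausdorff_measurable R n n) (measurable_cell d) (trivIset_cell d0) (bigcup_cell _ d0)).
rewrite (cara_sum (@borel_lebesgue_measurable R n) (measurable_cell d) (trivIset_cell d0) (bigcup_cell _ d0)).
rewrite -nneseriesZl ?kap_ge0//.
apply: lee_nneseries => [i _ _|i _]; first exact: outer_measure_ge0.
have [[x [xb xc]]|n0] := pselect (box ab `&` cell d i !=set0); last first.
  rewrite (_ : _ `&` _ = set0) ?outer_measure0 ?mule_ge0 ?outer_measure_ge0 ?lee_fin ?kap_ge0//.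
  by apply/seteqP; split => // x ?; exfalso; apply: n0; exists x.
rewrite (_ : box ab' `&` _ = cell d i); last first.
  apply/seteqP; split => [y []//|y yc]; split => // j; rewrite !mxE/=.
  have := cell_norm d0 xc yc => /(le_trans (norm_coord _ j)); rewrite !mxE ler_norml.
  by have /andP[? ?] := xb j => /andP[? ?]; apply/andP; split; lra.
apply: (@le_trans _ _ (hausdorff_outer n (cell d i))).
  by apply: le_outer_measure => y [].
have [->|[a ->]] := cellE i; first by rewrite !outer_measure0 mule0.
by rewrite cube_scale// kapE /= lebesgue_cbox ?(ltW d0)// -!EFinM mulrC.
Qed.

Lemma hausdorff_le_lebesgue n (A : set 'rV[R]_n.+1) :
  (hausdorff_outer n.+1 A <= (kap n.+1)%:E * lebesgue_outer A)%E.
Proof.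
rewrite -lee_pdivrMl ?kap_gt0//; apply: le_ereal_inf_tmp => _ [F AF <-].
rewrite lee_pdivrMl ?kap_gt0//; apply: le_trans (le_outer_measure _ _ _ AF) _.
apply: le_trans (outer_measure_sigma_subadditive _ _) _.
rewrite -nneseriesZl ?kap_ge0//; last by move=> i _; case: (F i) => //= ?; exact: box_volume_ge0.
apply: lee_nneseries => [i _ _|i _]; first exact: outer_measure_ge0.
case: (F i) => [ab|]/=; last by rewrite outer_measure0 mule0.
rewrite -lebesgue_box; have [leab|] := pselect (forall i, ab.1 0 i <= ab.2 0 i).
  exact: hausdorff_box_le.
move=> /existsNP[j /negP]; rewrite -ltNge => abj.
rewrite (_ : box ab = set0) ?outer_measure0 ?mule0//.
by apply/seteqP; split => // x /(_ j)/andP[/lt_le_trans h /h]; rewrite ltNge (ltW abj).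
Qed.

(** Inside a unit cell the proportionality is exact, so the upper bound for the complement of [A]
    becomes the lower bound for [A]. Measurability of [A] is what allows the subtraction. *)
Lemma lebesgue_le_hausdorff_borel n (A : set 'rV[R]_n.+1) :
  measurable (A : set (@bV R n.+1)) ->
  ((kap n.+1)%:E * lebesgue_outer A <= hausdorff_outer n.+1 A)%E.
Proof.
move=> mA.
rewrite (cara_sum (@borel_hausdorff_measurable R _ n.+1) (measurable_cell 1) (trivIset_cell ltr01) (bigcup_cell _ ltr01)).
rewrite (cara_sum (@borel_lebesgue_measurable R _) (measurable_cell 1) (trivIset_cell ltr01) (bigcup_cell _ ltr01)).
rewrite -nneseriesZl ?kap_ge0//.
apply: lee_nneseries => [i _ _|i _].
  by rewrite mule_ge0 ?outer_measure_ge0 ?lee_fin ?kap_ge0.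
rewrite /cell; case: pickle_inv => [z|]/=; last by rewrite setI0 !outer_measure0 mule0.
set Q := box _.
have QE : Q = cbox (\row_i (z 0 i)%:~R) 1.
  by congr box; congr pair; apply/rowP => j; rewrite !mxE ?mulr1// intrD.
have LQ : lebesgue_outer Q = 1%E by rewrite QE lebesgue_cbox// expr1n.
have HQ : hausdorff_outer n.+1 Q = (kap n.+1)%:E by rewrite QE cube_scale// kapE expr1n mul1e.
have := borel_lebesgue_measurable mA Q; rewrite LQ => L1.
have := @borel_hausdorff_measurable R _ n.+1 _ mA Q; rewrite HQ => H1.
have := hausdorff_le_lebesgue (Q `&` ~` A).
have fL X : lebesgue_outer (Q `&` X) \is a fin_num.
  rewrite ge0_fin_numE ?outer_measure_ge0// (@le_lt_trans _ _ 1%E) ?ltry//.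
  by rewrite -LQ; exact: le_outer_measure.
have fH X : hausdorff_outer n.+1 (Q `&` X) \is a fin_num.
  rewrite ge0_fin_numE ?outer_measure_ge0// (@le_lt_trans _ _ (kap n.+1)%:E) ?ltry//.
  by rewrite -HQ; exact: le_outer_measure.
rewrite !(setIC A).
move: L1 H1; rewrite -(fineK (fL A)) -(fineK (fL (~` A))) -(fineK (fH A)) -(fineK (fH (~` A))).
rewrite -!EFinD -!EFinM => -[L1] [H1]; rewrite !lee_fin => h.
by rewrite -(lerD2r (fine (hausdorff_outer n.+1 (Q `&` ~` A)))) -H1 -[leRHS]mulr1 L1 mulrDr lerD2l.
Qed.

(** Replacing the sets of a cover by their closures keeps their diameters. Intersecting such closed
    covers for the meshes [1 / (j + 1)] gives a Borel set of the same measure. *)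
Lemma hausdorff_hull n k (A : set 'rV[R]_n) : exists2 G : set 'rV[R]_n,
  measurable (G : set (@bV R n)) /\ A `<=` G & hausdorff_outer k G = hausdorff_outer k A.
Proof.
have [Af|] := boolP (hausdorff_outer k A \is a fin_num); last first.
  rewrite ge0_fin_numE ?outer_measure_ge0// -leNgt leye_eq => /eqP Aoo.
  exists setT; first by split => //; exact: measurableT.
  by rewrite Aoo; apply/eqP; rewrite -leye_eq -Aoo le_outer_measure.
pose d (j : nat) : R := j.+1%:R^-1.
have d0 j : 0 < d j by rewrite invr_gt0.
have exF : forall j, exists F : (option (@small_set R n (d j)))^nat,
    A `<=` \bigcup_i oapp sval set0 (F i) /\
    (\sum_(i <oo) oapp (@hausdorff_weight R n k (d j)) 0 (F i) <= hausdorff_outer k A + (d j)%:E)%E.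
  move=> j; have dA : (hausdorff_delta k (d j) A <= hausdorff_outer k A)%E.
    by apply: ereal_sup_ubound; exists (d j) => //=.
  have df : hausdorff_delta k (d j) A \is a fin_num.
    rewrite ge0_fin_numE; last by apply: cover_outer_ge0; exact: hausdorff_weight_ge0.
    by rewrite (le_lt_trans dA)// ltey_eq Af.
  have [_ [F AF <-] Fd] := lb_ereal_inf_adherent (d0 j) df.
  by exists F; split => //; rewrite (le_trans (ltW Fd))// leeD2r.
have [F FP] : exists F : forall j, (option (@small_set R n (d j)))^nat, forall j,
    A `<=` \bigcup_i oapp sval set0 (F j i) /\
    (\sum_(i <oo) oapp (@hausdorff_weight R n k (d j)) 0 (F j i) <=
      hausdorff_outer k A + (d j)%:E)%E.
  by exists (fun j => sval (cid (exF j))) => j; exact: (svalP (cid (exF j))).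
have cls j (B : @small_set R n (d j)) x y : closure (sval B) x -> closure (sval B) y ->
    enorm (x - y) <= ediam (sval B).
  move=> cx cy; rewrite leNgt; apply/negP => xy.
  pose e := (enorm (x - y) - ediam (sval B)) / (2 * n.+1%:R).
  have e0 : 0 < e by rewrite divr_gt0 ?subr_gt0// mulr_gt0.
  have [p [Bp xp]] := cx _ (nbhsx_ballx x e e0).
  have [q [Bq yq]] := cy _ (nbhsx_ballx y e e0).
  have near (z w : 'rV[R]_n) : ball z e w -> enorm (z - w) < n.+1%:R * e.
    rewrite -ball_normE/= => zw; apply: le_lt_trans (enorm_le_norm _) _.
    apply: (@le_lt_trans _ _ (n.+1%:R * `|z - w|)); last by rewrite ltr_pM2l.
    by rewrite ler_wpM2r// ler_nat.
  have e2 : n.+1%:R * e + n.+1%:R * e = enorm (x - y) - ediam (sval B).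
    have n1 : n.+1%:R != 0 :> R by rewrite pnatr_eq0.
    by rewrite /e; move: (n.+1%:R : R) n1 => u u0; field.
  have := enorm_subD p x y; have := enorm_subD q p y.
  have := le_ediam (svalP B) Bp Bq; have := near _ _ xp; have := near _ _ yq.
  by rewrite (enormB y q) => ? ? ? ? ?; lra.
have csm j (B : @small_set R n (d j)) x y : closure (sval B) x -> closure (sval B) y ->
    enorm (x - y) <= d j.
  by move=> /cls h /h /le_trans; apply; apply: ediam_le; [exact: ltW|exact: (svalP B)].
pose C j i : option (@small_set R n (d j)) :=
  omap (fun B => exist _ (closure (sval B)) (csm j B)) (F j i).
pose G := \bigcap_j \bigcup_i oapp sval set0 (C j i).
have AG : A `<=` G.
  move=> x Ax j _; have [i _ Fx] := (FP j).1 x Ax; exists i => //; rewrite /C.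
  by case: (F j i) Fx => //= B Bx; exact: subset_closure.
exists G; first split => //.
  apply: bigcapT_measurable => j; apply: bigcupT_measurable => i; rewrite /C.
  case: (F j i) => [B|]/=; last exact: measurable0.
  by apply: closed_measurableV; exact: closed_closure.
apply/eqP; rewrite eq_le; apply/andP; split; last exact: le_outer_measure.
apply/lee_addgt0Pr => e e0; apply: ge_ereal_sup => _ [r /= r0 <-].
have [j jer] : exists j, d j < Num.min e r.
  have : 0 < Num.min e r by rewrite lt_min e0.
  by move=> /ltr_add_invr[j]; rewrite add0r => ?; exists j.
apply: (@le_trans _ _ (hausdorff_delta k (d j) G)).
  by apply: le_hausdorff_delta; rewrite ltW// (lt_le_trans jer)// ge_min lexx orbT.
apply: (@le_trans _ _ (\sum_(i <oo) oapp (@hausdorff_weight R n k (d j)) 0 (C j i))%E).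
  by apply: ereal_inf_lbound; exists (C j) => // x /(_ j I).
apply: (@le_trans _ _ (hausdorff_outer k A + (d j)%:E)%E); last first.
  by rewrite leeD2l// lee_fin ltW// (lt_le_trans jer)// ge_min lexx.
apply: le_trans (FP j).2; apply: lee_nneseries => [i _ _|i _]; first exact: ow_ge0.
rewrite /C; case: (F j i) => [B|]//=; rewrite /hausdorff_weight lee_wpmul2l ?omega_ge0// lee_fin.
rewrite lerXn2r ?nnegrE ?divr_ge0 ?ediam_ge0// ler_wpM2r//=.
by apply: ediam_le; [exact: ediam_ge0|exact: cls].
Qed.

Theorem hausdorff_lebesgue n (A : set 'rV[R]_n.+1) :
  (hausdorff_outer n.+1 A = (kap n.+1)%:E * lebesgue_outer A)%E.
Proof.
apply/eqP; rewrite eq_le hausdorff_le_lebesgue/=.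
have [G [mG AG] <-] := hausdorff_hull n.+1 A.
apply: le_trans (lebesgue_le_hausdorff_borel mG).
by rewrite lee_wpmul2l ?lee_fin ?kap_ge0//; exact: le_outer_measure.
Qed.

(** Lebesgue measure inherits the Lipschitz bound of Hausdorff measure, the factor [kap] cancelling.
    Invariance under reflections and translations and the scaling of balls follow. *)
Lemma lebesgue_lip n (f : 'rV[R]_n.+1 -> 'rV[R]_n.+1) (A : set 'rV[R]_n.+1) (l : R) :
  0 < l -> (forall x y, A x -> A y -> enorm (f x - f y) <= l * enorm (x - y)) ->
  (lebesgue_outer (f @` A) <= (l ^+ n.+1)%:E * lebesgue_outer A)%E.
Proof.
move=> l0 fl; have := hausdorff_lip n.+1 l0 fl; rewrite !hausdorff_lebesgue.
by rewrite muleCA lee_pmul2l// lte_fin kap_gt0.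
Qed.

Lemma lebesgue_isom n (f g : 'rV[R]_n.+1 -> 'rV[R]_n.+1) (A : set 'rV[R]_n.+1) :
  cancel f g -> (forall x y, enorm (f x - f y) = enorm (x - y)) ->
  lebesgue_outer (f @` A) = lebesgue_outer A.
Proof.
move=> fg fi; apply/eqP; rewrite eq_le; apply/andP; split.
  have := @lebesgue_lip n f A 1 ltr01; rewrite expr1n mul1e; apply => x y _ _.
  by rewrite fi mul1r.
have gfA : g @` (f @` A) = A.
  apply/seteqP; split => [_ [_ [x Ax <-] <-]|x Ax]; first by rewrite fg.
  by exists (f x); [exists x|rewrite fg].
have := @lebesgue_lip n g (f @` A) 1 ltr01; rewrite expr1n mul1e gfA.
by apply => _ _ [x Ax <-] [y Ay <-]; rewrite !fg fi mul1r.
Qed.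
End kappa.

Lemma outer_setY {R : realType} T (m : {outer_measure set T -> \bar R}) (A B C : set T) :
  (m (A `+` C) <= m (A `+` B) + m (B `+` C))%E.
Proof.
apply: le_trans (outer_measureU2 _ _ _); apply: le_outer_measure => x h.
have [Bx|Bx] := pselect (B x); case: h => -[h1 h2].
- by right; left.
- by left; right.
- by left; left.
- by right; right.
Qed.

Lemma outer_leD {R : realType} T (m : {outer_measure set T -> \bar R}) (A B : set T) : (m A <= m B + m (A `\` B))%E.
Proof.
apply: le_trans (outer_measureU2 _ _ _); apply: le_outer_measure => x Ax.
by have [Bx|Bx] := pselect (B x); [left|right].
Qed.

(** * Volume swept by a translated set *)

Section sweep.
Context {R : realType}.
Implicit Types (n : nat).

Definition sweep n (A : set 'rV[R]_n) (tau : 'rV[R]_n) : set 'rV[R]_n :=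
  [set x | exists a s, [/\ A a, 0 <= s <= 1 & x = a + s *: tau]].

(** A piece of [A] of height at most [e] sweeps a subset of a cylinder of height [s + e] over its
    projection, and the projection is 1-Lipschitz. Finiteness of the area makes the error [e H(A)]
    vanish. *)
Lemma kap_sweep0 n (A : set 'rV[R]_n.+2) (s : R) : 0 <= s ->
  (hausdorff_outer n.+1 A < +oo)%E ->
  ((kap n.+1)%:E * lebesgue_outer (sweep A (s *: unitv n.+1)) <=
   s%:E * hausdorff_outer n.+1 A)%E.
Proof.
move=> s0 Afin; have Af : hausdorff_outer n.+1 A \is a fin_num.
  by rewrite ge0_fin_numE ?outer_measure_ge0.
suff key e : 0 < e -> ((kap n.+1)%:E * lebesgue_outer (sweep A (s *: unitv n.+1)) <=
    (s + e)%:E * hausdorff_outer n.+1 A)%E.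
  apply/lee_addgt0Pr => e e0; pose h := fine (hausdorff_outer n.+1 A).
  have h0 : 0 <= h by rewrite fine_ge0 ?outer_measure_ge0.
  have h1 : 0 < h + 1 by rewrite ltr_wpDl.
  apply: (le_trans (key (e / (h + 1)) _)); first by rewrite divr_gt0.
  rewrite -(fineK Af) -/h -!EFinM -EFinD lee_fin mulrDl lerD2l mulrAC ler_pdivrMr//.
  by rewrite ler_pM2l// lerDl.
move=> e0.
have sub : sweep A (s *: unitv n.+1) `<=`
    \bigcup_k sweep (A `&` cell e k) (s *: unitv n.+1).
  move=> _ [a [t [Aa t01 ->]]].
  have [k _ ak] : (\bigcup_k cell e k) a by rewrite bigcup_cell.
  by exists k => //; exists a, t.
apply: (@le_trans _ _ ((kap n.+1)%:E *
    \sum_(k <oo) lebesgue_outer (sweep (A `&` cell e k) (s *: unitv n.+1)))%E).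
  rewrite lee_wpmul2l ?lee_fin ?kap_ge0//; apply: le_trans (le_outer_measure _ _ _ sub) _.
  exact: outer_measure_sigma_subadditive.
rewrite (cara_sum (@borel_hausdorff_measurable R _ n.+1) (measurable_cell e) (trivIset_cell e0) (bigcup_cell _ e0)).
rewrite -!nneseriesZl ?kap_ge0 ?addr_ge0 ?(ltW e0)//; last by move=> i _; exact: outer_measure_ge0.
apply: lee_nneseries => [k _ _|k _].
  by rewrite mule_ge0 ?outer_measure_ge0 ?lee_fin ?kap_ge0.
have [c cP] : exists c, forall x : 'rV[R]_n.+2, cell e k x -> c < x 0 ord0 <= c + e.
  rewrite /cell; case: pickle_inv => [z|]/=; last by exists 0.
  exists ((z 0 ord0)%:~R * e) => x /(_ ord0); rewrite !mxE/= intrD mulrDl mul1r.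
  by [].
pose D := @tlv R n.+1 @` (A `&` cell e k).
have sub2 : sweep (A `&` cell e k) (s *: unitv n.+1) `<=`
    [set x : 'rV[R]_n.+2 | D (tlv x) /\ c < x 0 ord0 <= c + (s + e)].
  move=> _ [a [t [[Aa ac] /andP[t0 t1] ->]]]; split.
    exists a => //; apply/rowP => j; rewrite !mxE/=.
    by rewrite !mulr0 addr0.
  have := cP _ ac; rewrite !mxE !eqxx/= mulr1 => /andP[ca cae].
  have ts0 : 0 <= t * s by rewrite mulr_ge0.
  have ts1 : t * s <= s by rewrite ler_piMl.
  by apply/andP; split; lra.
have se0 : 0 <= s + e by rewrite addr_ge0// ltW.
apply: (@le_trans _ _ ((kap n.+1)%:E * ((s + e)%:E * lebesgue_outer D))%E).
  rewrite lee_wpmul2l ?lee_fin ?kap_ge0//; apply: le_trans (le_outer_measure _ _ _ sub2) _.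
  have := @lebesgue_cylinder_le R n.+1 D c (c + (s + e)).
  by rewrite addrAC subrr add0r; apply; rewrite lerDl.
rewrite muleCA -hausdorff_lebesgue lee_wpmul2l ?lee_fin//.
have := @hausdorff_lip R n.+2 n.+1 n.+1 (@tlv R n.+1) (A `&` cell e k) 1 ltr01.
rewrite expr1n mul1e; apply => x y _ _.
by rewrite -tlvB mul1r enorm_tlv.
Qed.

Lemma lebesgue_refl n (z : 'rV[R]_n.+1) (A : set 'rV[R]_n.+1) :
  lebesgue_outer (refl z @` A) = lebesgue_outer A.
Proof.
by apply: (lebesgue_isom _ (reflK z)) => x y; rewrite -reflB enorm_refl.
Qed.

Lemma hausdorff_refl n k (z : 'rV[R]_n) (A : set 'rV[R]_n) :
  (hausdorff_outer k (refl z @` A) <= hausdorff_outer k A)%E.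
Proof.
have := @hausdorff_lip R n n k (refl z) A 1 ltr01.
by rewrite expr1n mul1e; apply => x y _ _; rewrite -reflB enorm_refl mul1r.
Qed.

(* Reflecting [tau] onto the first axis and cutting [A] into small cells, each
   piece sweeps a set which is almost a cylinder over its projection. *)
Lemma kap_sweep n (A : set 'rV[R]_n.+2) (tau : 'rV[R]_n.+2) :
  (hausdorff_outer n.+1 A < +oo)%E ->
  ((kap n.+1)%:E * lebesgue_outer (sweep A tau) <=
   (enorm tau)%:E * hausdorff_outer n.+1 A)%E.
Proof.
move=> Afin; pose z := tau - enorm tau *: unitv n.+1.
have ztau : refl z tau = enorm tau *: unitv n.+1.
  by apply: refl_swap; rewrite enormZ ger0_norm// enorm_delta mulr1.
rewrite -(lebesgue_refl z).
have sub : refl z @` sweep A tau `<=` sweep (refl z @` A) (enorm tau *: unitv n.+1).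
  move=> _ [_ [a [t [Aa t01 ->]]] <-]; exists (refl z a), t; split => //.
  by rewrite reflD reflZ ztau.
apply: (@le_trans _ _ ((kap n.+1)%:E *
    lebesgue_outer (sweep (refl z @` A) (enorm tau *: unitv n.+1)))%E).
  by rewrite lee_wpmul2l ?lee_fin ?kap_ge0//; exact: le_outer_measure.
apply: (le_trans (kap_sweep0 _ _)) => //.
  exact: le_lt_trans (hausdorff_refl _ _ _) Afin.
by rewrite lee_wpmul2l ?lee_fin//; exact: hausdorff_refl.
Qed.

Lemma lebesgue_translate n (A : set 'rV[R]_n.+1) (a : 'rV[R]_n.+1) :
  lebesgue_outer ((fun x => x + a) @` A) = lebesgue_outer A.
Proof.
apply: (@lebesgue_isom _ _ (fun x => x + a) (fun x => x - a)) => [x|x y].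
  by rewrite addrK.
by rewrite opprD addrACA subrr addr0.
Qed.

End sweep.

(** * Restriction of the measures to Borel sets *)

Section borel_measures.
Context {R : realType} (n : nat).
Local Open Scope ereal_scope.

(** The same outer measure on a smaller sigma-algebra, where product measures and uniqueness from
    boxes are available. *)
Definition lebB (A : set (@bV R n)) : \bar R := lebesgue_outer A.

Let lebB0 : lebB set0 = 0. Proof. exact: outer_measure0. Qed.
Let lebB_ge0 A : 0 <= lebB A. Proof. exact: outer_measure_ge0. Qed.
Let lebB_additive : semi_sigma_additive lebB.
Proof.
move=> F mF tF mU; apply: (caratheodory_measure_sigma_additive (mu := @lebesgue_outer R n)) => //.
  by move=> i; exact: (borel_lebesgue_measurable (mF i)).
exact: (borel_lebesgue_measurable mU).
Qed.

HB.instance Definition _ := isMeasure.Build _ _ _ lebB lebB0 lebB_ge0 lebB_additive.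

Let lebB_sigma_finite : sigma_finite setT lebB.
Proof.
exists (cell 1); first by rewrite bigcup_cell.
move=> k; split; first exact: measurable_cell.
rewrite /lebB /cell; case: pickle_inv => [z|]/=; last by rewrite outer_measure0 ltry.
by rewrite lebesgue_box ltry.
Qed.

HB.instance Definition _ := Measure_isSigmaFinite.Build _ _ _ lebB lebB_sigma_finite.

Definition hausB (k : nat) (A : set (@bV R n)) : \bar R := hausdorff_outer k A.

Let hausB0 k : hausB k set0 = 0. Proof. exact: outer_measure0. Qed.
Let hausB_ge0 k A : 0 <= hausB k A. Proof. exact: outer_measure_ge0. Qed.
Let hausB_additive k : semi_sigma_additive (hausB k).
Proof.
move=> F mF tF mU; apply: (caratheodory_measure_sigma_additive (mu := @hausdorff_outer R n k)) => //.
  by move=> i; exact: (@borel_hausdorff_measurable R n k _ (mF i)).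
exact: (@borel_hausdorff_measurable R n k _ mU).
Qed.

HB.instance Definition _ k :=
  isMeasure.Build _ _ _ (hausB k) (hausB0 k) (hausB_ge0 k) (@hausB_additive k).

End borel_measures.

Section borel_functions.
Context {R : realType}.
Implicit Types (n : nat).

Lemma measurable_sum_ord d (T : measurableType d) (D : set T) (I : finType)
  (F : I -> T -> R) : (forall i, measurable_fun D (F i)) ->
  measurable_fun D (fun x => \sum_i F i x).
Proof.
move=> mF; elim: (index_enum I) => [|i s IH].
  by rewrite (_ : (fun _ => _) = cst 0)//; apply/funext => x; rewrite big_nil.
rewrite (_ : (fun _ => _) = (F i \+ (fun x => \sum_(j <- s) F j x))).
  exact: measurable_funD.
by apply/funext => x; rewrite big_cons.
Qed.

Lemma measurable_to_bV d (T : measurableType d) n (f : T -> 'rV[R]_n) :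
  (forall i, measurable_fun setT (fun x => f x 0 i)) ->
  measurable_fun setT (f : T -> @bV R n).
Proof.
move=> mf; apply: (@measurability _ _ T (@bV R n) setT f (@halfspaces R n)) => // _ [_ [i [t ->]] <-].
rewrite (_ : _ @^-1` _ = (fun x => f x 0 i) @^-1` [set` `]-oo, t]%R]).
  by apply: mf => //.
by apply/seteqP; split => x /=; rewrite in_itv.
Qed.

Lemma continuous_measurableV n (f : 'rV[R]_n -> R) : continuous f ->
  measurable_fun [set: @bV R n] (f : @bV R n -> R).
Proof.
move=> cf; apply: (measurability _ (RGenOpens.measurableE R)) => _ [_ [a [b ->]] <-].
rewrite setTI; apply: open_measurableV.
by apply: open_comp => //; exact: interval_open.
Qed.

Lemma lip_continuous n (f : 'rV[R]_n -> R) (L : R) :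
  (forall x y, `|f x - f y| <= L * `|x - y|) -> continuous f.
Proof.
move=> fL x; apply/(@cvgrPdist_lt _ R _ (nbhs x)) => e e0; apply/nbhs_ballP.
have L1 : 0 < `|L| + 1 by rewrite ltr_wpDl.
exists (e / (`|L| + 1)) => /=; first by rewrite divr_gt0.
move=> y; rewrite -ball_normE/= => xy; apply: le_lt_trans (fL _ _) _.
rewrite ltr_pdivlMr// mulrC in xy; apply: le_lt_trans xy.
by rewrite ler_wpM2r// (le_trans (ler_norm _))// lerDl.
Qed.

Lemma enorm_lip n (x y : 'rV[R]_n) : `|enorm x - enorm y| <= n%:R * `|x - y|.
Proof.
apply: le_trans (enorm_le_norm (x - y)); rewrite ler_norml; apply/andP; split.
  by have := enorm_subD x y 0; rewrite !subr0 (enormB y); lra.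
by have := enorm_subD y x 0; rewrite !subr0; lra.
Qed.

Lemma enorm_continuous n : continuous (@enorm R n).
Proof. exact: (lip_continuous (@enorm_lip n)). Qed.

Lemma measurable_enorm n : measurable_fun [set: @bV R n] (@enorm R n : @bV R n -> R).
Proof. by apply: continuous_measurableV; exact: enorm_continuous. Qed.

Lemma open_eball n (c : 'rV[R]_n) r : open (eball c r).
Proof.
apply: (@open_comp 'rV[R]_n R (fun x => enorm (x - c)) [set t | t < r]); last exact: open_lt.
move=> x _; apply: (@lip_continuous _ _ n%:R) => y z.
by rewrite (le_trans (enorm_lip _ _))// opprB addrA subrK.
Qed.

Lemma measurable_eball n (c : 'rV[R]_n) r : measurable (eball c r : set (@bV R n)).
Proof. by apply: open_measurableV; exact: open_eball. Qed.

Definition omega n : R := fine (lebesgue_outer (@eball R n 0 1)).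

Lemma omegaE n : lebesgue_outer (@eball R n 0 1) = (omega n)%:E.
Proof. by rewrite fineK// omega_fin. Qed.

Lemma omega_pos n : 0 < omega n.
Proof. by rewrite -lte_fin -omegaE omega_gt0. Qed.

Lemma lebesgue_eball n (c : 'rV[R]_n.+1) r : 0 <= r ->
  lebesgue_outer (eball c r) = (omega n.+1 * r ^+ n.+1)%:E.
Proof.
rewrite le_eqVlt => /orP[/eqP <-|r0].
  rewrite expr0n/= mulr0 (_ : eball c 0 = set0) ?outer_measure0//.
  by apply/seteqP; split => // x; rewrite /eball/= ltNge enorm_ge0.
rewrite -(lebesgue_translate _ (- c)).
have -> : (fun x => x - c) @` eball c r = eball 0 r.
  apply/seteqP; split => [_ [x xc <-]|x]; rewrite /eball/= subr0// => xr.
  by exists (x + c); rewrite /eball/= addrK.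
have img : eball 0 r = (fun x => r *: x) @` @eball R n.+1 0 1.
  apply/seteqP; split => [x|_ [x + <-]]; rewrite /eball/= !subr0.
    move=> xr; exists (r^-1 *: x); last by rewrite scalerA divff ?gt_eqF// scale1r.
    by rewrite subr0 enormZ gtr0_norm ?invr_gt0// mulrC ltr_pdivrMr// mul1r.
  by move=> x1; rewrite enormZ gtr0_norm// -[ltRHS]mulr1 ltr_pM2l.
have img' : @eball R n.+1 0 1 = (fun x => r^-1 *: x) @` eball 0 r.
  rewrite img; apply/seteqP; split => [x x1|_ [_ [x x1 <-] <-]].
    by exists (r *: x); [exists x|rewrite scalerA mulVf ?gt_eqF// scale1r].
  by rewrite scalerA mulVf ?gt_eqF// scale1r.
apply/eqP; rewrite eq_le; apply/andP; split.
  rewrite img mulrC EFinM -omegaE; apply: lebesgue_lip => // x y _ _.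
  by rewrite -scalerBr enormZ gtr0_norm.
rewrite mulrC EFinM -lee_pdivlMl ?exprn_gt0// -omegaE img' -exprVn.
apply: lebesgue_lip => [|x y _ _]; first by rewrite invr_gt0.
by rewrite -scalerBr enormZ gtr0_norm ?invr_gt0.
Qed.

(** Over the cube the volume of the cylinder is exact, and over [D] and its complement in the cube
    it is bounded above; hence both bounds are equalities. *)
Lemma lebesgue_cylinder n (D : set 'rV[R]_n) (c : 'rV[R]_n) (r a b : R) : 0 <= r -> a <= b ->
  measurable (D : set (@bV R n)) -> D `<=` cbox c r ->
  lebesgue_outer [set x : 'rV[R]_n.+1 | D (tlv x) /\ a < x 0 ord0 <= b] =
  ((b - a)%:E * lebesgue_outer D)%E.
Proof.
move=> r0 ab mD Dc; apply/eqP; rewrite eq_le lebesgue_cylinder_le//=.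
set cyl := fun E : set 'rV[R]_n => [set x : 'rV[R]_n.+1 | E (tlv x) /\ a < x 0 ord0 <= b].
have ba0 : 0 <= b - a by rewrite subr_ge0.
have QE : cyl (cbox c r) = box (consv a c, consv b (c + const_mx r)).
  apply/seteqP; split => [x [xc xab] i|x xb].
    case: (unliftP ord0 i) => [j ->|->]; last by rewrite /= !consv0.
    by rewrite /= !consvS; have := xc j; rewrite mxE.
  split; last by have := xb ord0; rewrite /= !consv0.
  by move=> j; have := xb (lift ord0 j); rewrite /= !consvS [tlv x 0 j]mxE.
have LQ : lebesgue_outer (cyl (cbox c r)) = ((b - a)%:E * lebesgue_outer (cbox c r))%E.
  rewrite QE !lebesgue_box /box_volume big_ord_recl/= !consv0 max_r// -EFinM.
  congr (_ * _)%:E; by apply: eq_bigr => j _; rewrite !consvS.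
have sD : lebesgue_outer (cbox c r) = (lebesgue_outer D + lebesgue_outer (cbox c r `\` D))%E.
  rewrite (borel_lebesgue_measurable mD (cbox c r)) setDE; congr (lebesgue_outer _ + _)%E.
  by rewrite setIC; apply/setIidPl.
have cb : cyl (cbox c r) `<=` cyl D `|` cyl (cbox c r `\` D).
  by move=> x [xc xab]; have [Dx|Dx] := pselect (D (tlv x)); [left|right].
have fin X : X `<=` cbox c r -> lebesgue_outer X \is a fin_num.
  move=> Xc; rewrite ge0_fin_numE ?outer_measure_ge0//.
  by rewrite (le_lt_trans (le_outer_measure _ _ _ Xc))//= lebesgue_cbox ?ltry.
have := le_trans (le_outer_measure (@lebesgue_outer R n.+1) _ _ cb) (outer_measureU2 _ _ _).
rewrite [X in (X <= _)%E]LQ sD.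
have := @lebesgue_cylinder_le R n (cbox c r `\` D) a b ab.
have := @lebesgue_cylinder_le R n D a b ab; rewrite -/(cyl D) -/(cyl _).
have fD := fin _ Dc; have fcD : lebesgue_outer (cbox c r `\` D) \is a fin_num.
  by apply: fin => x [].
rewrite -(fineK fD) -(fineK fcD) -!EFinD -!EFinM => h1 h2.
have f1 : lebesgue_outer (cyl D) \is a fin_num.
  by rewrite ge0_fin_numE ?outer_measure_ge0// (le_lt_trans h1)// ltry.
have f2 : lebesgue_outer (cyl (cbox c r `\` D)) \is a fin_num.
  by rewrite ge0_fin_numE ?outer_measure_ge0// (le_lt_trans h2)// ltry.
move: h1 h2; rewrite /= -(fineK f1) -(fineK f2) -!EFinD !lee_fin mulrDr.
by move=> h1 h2 h3; lra.
Qed.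

End borel_functions.

(** * Transport to the ball *)

Section calculus.
Context {R : realType}.

Lemma deriv_eps (f : R -> R) (s d : R) :
  (forall e, 0 < e -> exists2 r, 0 < r & forall t, `|t - s| < r ->
     `|f t - f s - d * (t - s)| <= e * `|t - s|) -> is_derive s 1 f d.
Proof.
move=> fs; have c : h^-1 *: (f (h *: 1 + s) - f s) @[h --> 0^'] --> d.
  apply/cvgrPdist_le => e e0; have [r r0 rP] := fs e e0.
  near=> h; have h0 : h != 0 by near: h; exact: nbhs_dnbhs_neq.
  have hr : `|h| < r.
    near: h; apply: dnbhs0_lt => //.
  have -> : h *: (1 : R) = h by rewrite /GRing.scale/= mulr1.
  have := rP (h + s); rewrite addrK => /(_ hr).
  rewrite /GRing.scale/= => H.
  have -> : d - h^-1 * (f (h + s) - f s) = - (h^-1 * (f (h + s) - f s - d * h)) by field.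
  by rewrite normrN normrM normfV mulrC ler_pdivrMr ?normr_gt0.
by apply: DeriveDef; [apply/cvg_ex; exists d|exact: cvg_lim].
Unshelve. all: by end_near. Qed.

Lemma deriv_continuous (f : R -> R) (s d : R) : is_derive s 1 f d -> {for s, continuous f}.
Proof. by move=> [fd _]; apply: differentiable_continuous; exact/derivable1_diffP. Qed.

Lemma deriv_le (f df : R -> R) (a b : R) : a <= b ->
  (forall x, a < x < b -> is_derive x 1 f (df x)) ->
  (forall x, a < x < b -> 0 <= df x) ->
  (forall x, a <= x <= b -> {for x, continuous f}) -> f a <= f b.
Proof.
move=> ab fd d0 fc.
have cf : {within `[a, b], continuous f}.
  apply: continuous_in_subspaceT => x; rewrite inE/= in_itv/= => xab; exact: fc.
move: ab; rewrite le_eqVlt => /orP[/eqP -> //|ab].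
have fd' x : x \in `]a, b[ -> is_derive x 1 f (df x) by rewrite in_itv/=; exact: fd.
have [c] := @MVT _ f df a b ab fd' cf.
rewrite in_itv/= => /d0 c0 e; rewrite -subr_ge0 e mulr_ge0//.
by rewrite subr_ge0 ltW.
Qed.

Definition prim (a : R) (f : R -> R) (x : R) : R := \int[lebesgue_measure]_(t in `[a, x]) f t.

Lemma continuous_itv_integrable (f : R -> R) a b : continuous f ->
  lebesgue_measure.-integrable `[a, b] (EFin \o f).
Proof.
move=> cf; apply: continuous_compact_integrable; first exact: segment_compact.
exact: continuous_subspaceT.
Qed.

Lemma prim_deriv (a : R) (f : R -> R) (x : R) : continuous f -> a < x -> is_derive x 1 (prim a f) (f x).
Proof.
move=> cf ax; have x1 : x < x + 1 by rewrite ltrDl.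
have H := @continuous_FTC1_closed R f a x (x+1) x1 (continuous_itv_integrable a (x + 1) cf) ax (cf x).
case: H => d e; rewrite derive1E in e.
by apply: DeriveDef; [exact: d|exact: e].
Qed.

Lemma prim_le a (f g : R -> R) b : continuous f -> continuous g ->
  (forall x, a <= x <= b -> f x <= g x) -> prim a f b <= prim a g b.
Proof.
move=> cf cg fg; apply: le_Rintegral => //; try exact: continuous_itv_integrable.
Qed.

Lemma prim_ge0 a (f : R -> R) b : (forall x, a <= x <= b -> 0 <= f x) -> 0 <= prim a f b.
Proof.
by move=> f0; apply: Rintegral_ge0 => x; rewrite /= in_itv/=; exact: f0.
Qed.

Lemma primD a (f g : R -> R) b : continuous f -> continuous g ->
  prim a (fun x => f x + g x) b = prim a f b + prim a g b.
Proof.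
by move=> cf cg; apply: RintegralD => //; exact: continuous_itv_integrable.
Qed.

Lemma primZ a (c : R) (f : R -> R) b : continuous f ->
  prim a (fun x => c * f x) b = c * prim a f b.
Proof. by move=> cf; apply: RintegralZl => //; exact: continuous_itv_integrable. Qed.

Lemma prim_eq a (f g : R -> R) b : (forall x, a <= x <= b -> f x = g x) -> prim a f b = prim a g b.
Proof. by move=> fg; apply: eq_Rintegral => x; rewrite inE/= in_itv/=; exact: fg. Qed.

Lemma prim_nondec a (f : R -> R) : continuous f -> (forall x, 0 <= f x) ->
  forall x y, a < x -> x <= y -> prim a f x <= prim a f y.
Proof.
move=> cf f0 x y ax xy; apply: (@deriv_le _ f) => //.
- by move=> z /andP[xz _]; apply: prim_deriv => //; exact: lt_trans xz.
- move=> z /andP[xz _]; apply: deriv_continuous; apply: prim_deriv => //.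
  exact: lt_le_trans xz.
Qed.

Lemma prim_cont a (f : R -> R) : continuous f -> forall x, a < x -> {for x, continuous (prim a f)}.
Proof. by move=> cf x ax; apply: deriv_continuous; exact: prim_deriv. Qed.

Definition nroot (m : nat) (x : R) : R := x `^ (m%:R^-1).

Lemma nroot_ge0 m x : 0 <= nroot m x. Proof. exact: powR_ge0. Qed.

Lemma nrootK m x : 0 <= x -> nroot m.+1 x ^+ m.+1 = x.
Proof.
by move=> x0; rewrite -powR_mulrn ?nroot_ge0// /nroot -powRrM mulVf ?pnatr_eq0// powRr1.
Qed.

Lemma nroot_le1 m x : 0 <= x <= 1 -> nroot m.+1 x <= 1.
Proof.
move=> /andP[x0 x1]; rewrite leNgt; apply/negP => h.
by have : 1 < nroot m.+1 x ^+ m.+1 by [rewrite exprn_egt1]; rewrite nrootK// ltNge x1.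
Qed.

Lemma nroot_ge m x : 0 <= x <= 1 -> x <= nroot m.+1 x.
Proof.
move=> /andP[x0 x1]; have r1 : nroot m.+1 x <= 1 by rewrite nroot_le1 ?x0.
rewrite -{1}(nrootK m x0) exprS ler_piMr ?nroot_ge0//.
by rewrite exprn_ile1 ?nroot_ge0.
Qed.

Lemma ge0_expn_le m (x y : R) : 0 <= x -> 0 <= y -> x ^+ m.+1 <= y ^+ m.+1 -> x <= y.
Proof. by move=> x0 y0; rewrite ler_pXn2r. Qed.

Lemma bernoulli m (x : R) : 0 <= x -> 1 + m.+1%:R * (x - 1) <= x ^+ m.+1.
Proof.
move=> x0; elim: m => [|m IH]; first by rewrite mul1r expr1; lra.
rewrite exprS; apply: le_trans (ler_wpM2l x0 IH).
have : 0 <= m.+1%:R * (x - 1) ^+ 2 by rewrite mulr_ge0// sqr_ge0.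
rewrite -[m.+2%:R]natr1; move: (m.+1%:R) => c h.
by rewrite -subr_ge0; apply: le_trans h _; rewrite le_eqVlt; apply/orP; left; apply/eqP; ring.
Qed.

(** The numbers [l, p, ..., p] have geometric mean [y]. Bernoulli's inequality at [y / p] gives the
    arithmetic bound. *)
Lemma agm m (l p y : R) : 0 <= l -> 0 <= p -> 0 <= y -> y ^+ m.+2 = l * p ^+ m.+1 ->
  m.+2%:R * y <= l + m.+1%:R * p.
Proof.
move=> l0 p0 y0 e; have [p1|p1] := eqVneq p 0.
  have /eqP : y ^+ m.+2 = 0 by rewrite e p1 expr0n mulr0.
  by rewrite expf_eq0 => /andP[_ /eqP ->]; rewrite p1 !mulr0 addr0.
have pp : 0 < p by rewrite lt_neqAle eq_sym p1.
have le : l = p * (y / p) ^+ m.+2.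
  have /(congr1 (fun z => z / p ^+ m.+1)) := e.
  rewrite mulfK ?expf_neq0// => <-.
  by rewrite expr_div_n [p ^+ m.+2]exprS; field; rewrite p1 expf_neq0.
have h := @bernoulli m.+1 (y / p) (divr_ge0 y0 p0).
have /(ler_wpM2l p0) := h; rewrite -le.
have yp : y = p * (y / p) by rewrite mulrC divfK.
move: yp h; move: (y / p) => z -> _; rewrite -[m.+2%:R]natr1.
by move: (m.+1%:R : R) => c; lra.
Qed.

(** The quantitative form behind stability: for [l q^(m+1) = 1], multiplied by [l], it bounds the
    defect [l + (m+1) q - (m+2)] of the arithmetic-geometric inequality below by [l (1 - q)^2]. *)
Lemma agm_sharp m (q : R) : 0 <= q ->
  (1 - q) ^+ 2 <= 1 + m.+1%:R * q ^+ m.+2 - m.+2%:R * q ^+ m.+1.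
Proof.
move=> q0; elim: m => [|m IH]; first by rewrite expr1 mul1r le_eqVlt; apply/orP; left; apply/eqP; ring.
apply: le_trans IH _; rewrite -subr_ge0.
have : 0 <= m.+2%:R * (q ^+ m.+1 * (q - 1) ^+ 2).
  by apply: mulr_ge0 => //; apply: mulr_ge0; [exact: exprn_ge0|exact: sqr_ge0].
rewrite -[m.+3%:R]natr1 -[m.+2%:R]natr1 (exprS q m.+2) (exprS q m.+1).
move: (m.+1%:R : R) (q ^+ m.+1) => c x h; apply: le_trans h _.
by rewrite le_eqVlt; apply/orP; left; apply/eqP; ring.
Qed.

End calculus.

(** * Volume of a truncated ball and its inverse *)

Section ball_function.
Context {R : realType} (k : nat).

(** Radius of the slice of the unit ball at height [u]. Beyond the ball it vanishes, since the
    square root of a negative number is 0. *)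
Definition rho (u : R) : R := Num.sqrt (1 - u ^+ 2).

Lemma rho_ge0 u : 0 <= rho u. Proof. exact: sqrtr_ge0. Qed.

Lemma rho_continuous : continuous rho.
Proof.
move=> u; apply: continuous_comp; last exact: sqrt_continuous.
apply: continuousB; first exact: cst_continuous.
exact: exprn_continuous.
Qed.

Definition ball_slab (s t : R) : set 'rV[R]_k.+2 :=
  [set x | eball 0 1 x /\ s < x 0 ord0 <= t].

Definition Bf (s : R) : R :=
  fine (lebesgue_outer ([set x | eball 0 1 x /\ x 0 ord0 <= s] : set 'rV[R]_k.+2)).

Let fin_ball (X : set 'rV[R]_k.+2) : X `<=` eball 0 1 -> lebesgue_outer X \is a fin_num.
Proof.
move=> Xb; rewrite ge0_fin_numE ?outer_measure_ge0//.
by rewrite (le_lt_trans (le_outer_measure _ _ _ Xb))//= omegaE ltry.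
Qed.

Lemma BfB s t : s <= t -> (Bf t - Bf s)%:E = lebesgue_outer (ball_slab s t).
Proof.
move=> st; rewrite /Bf.
set X := [set x | _ /\ _ <= t]; set Y := [set x | _ /\ _ <= s].
have Xb : X `<=` eball 0 1 by move=> x [].
have Yb : Y `<=` eball 0 1 by move=> x [].
have := @lebesgue_halfspace R k.+2 ord0 s X.
have -> : X `&` [set x | x 0 ord0 <= s] = Y.
  apply/seteqP; split => [x [[xb _] xs]//|x [xb xs]].
  by split => //; split => //; exact: le_trans st.
have -> : X `&` ~` [set x | x 0 ord0 <= s] = ball_slab s t.
  apply/seteqP; split => [x [[xb xt] /negP]|x [xb /andP[xs xt]]].
    by rewrite -ltNge => xs; split => //; rewrite xs.
  by split => //; apply/negP; rewrite -ltNge.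
have Zf : lebesgue_outer (ball_slab s t) \is a fin_num by apply: fin_ball => x [].
rewrite -(fineK (fin_ball Xb)) -(fineK (fin_ball Yb)) -(fineK Zf) -EFinD => -[->].
by congr EFin; rewrite addrAC subrr add0r.
Qed.

(** The slab of the ball lies between the cylinders over the balls of radii [m] and [M]. *)
Lemma BfB_bounds (s t m M : R) : s <= t -> 0 <= m -> 0 <= M ->
  (forall u, s <= u <= t -> m <= rho u <= M) ->
  (t - s) * (omega k.+1 * m ^+ k.+1) <= Bf t - Bf s <= (t - s) * (omega k.+1 * M ^+ k.+1).
Proof.
move=> st m0 M0 muM; rewrite -!lee_fin (BfB st); apply/andP; split.
  rewrite EFinM -(lebesgue_eball 0 m0) -(@lebesgue_cylinder _ _ _ (const_mx (- (m + 1))) (2 * (m + 1)))//; last 3 first.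
  - by rewrite mulr_ge0// addr_ge0.
  - exact: measurable_eball.
  - move=> x; rewrite /eball/= subr0 => xm i; rewrite !mxE/=.
    by have := le_lt_trans (abs_le_enorm x i) xm; rewrite ltr_norml => /andP[? ?]; lra.
  apply: le_outer_measure => x [xm /andP[sx xt]]; split; last by rewrite sx.
  have [|mr _] := andP (muM (x 0 ord0) _); first by rewrite (ltW sx).
  move: xm; rewrite /eball/= !subr0 => xm.
  have m1 : 0 < m by rewrite (le_lt_trans _ xm).
  (* A point of the inner cylinder forces [m > 0], hence [rho > 0]. This rules out the default value
     of the square root and makes the height lie inside the ball. *)
  have r1 : 0 < 1 - x 0 ord0 ^+ 2 by rewrite -sqrtr_gt0 (lt_le_trans m1).
  have : rho (x 0 ord0) ^+ 2 = 1 - x 0 ord0 ^+ 2 by rewrite sqr_sqrtr// ltW.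
  move=> r2; rewrite -(ltr_pXn2r (ltn0Sn 1)) ?nnegrE// expr1n sqr_enorm_tlv.
  have : enorm (tlv x) ^+ 2 < m ^+ 2 by rewrite ltr_pXn2r ?nnegrE.
  have : m ^+ 2 <= rho (x 0 ord0) ^+ 2 by rewrite ler_pXn2r ?nnegrE ?rho_ge0.
  by rewrite r2; lra.
rewrite EFinM -(lebesgue_eball 0 M0); apply: le_trans (lebesgue_cylinder_le _ st).
apply: le_outer_measure => x [xb /andP[sx xt]]; split; last by rewrite sx.
have [|_ rM] := andP (muM (x 0 ord0) _); first by rewrite (ltW sx).
move: xb; rewrite /eball/= !subr0 => xb.
have : enorm x ^+ 2 < 1 by rewrite -(expr1n _ 2) ltr_pXn2r ?nnegrE.
rewrite sqr_enorm_tlv => h.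
rewrite -(ltr_pXn2r (ltn0Sn 1)) ?nnegrE//; apply: (@lt_le_trans _ _ (rho (x 0 ord0) ^+ 2)).
  have h' := sqr_ge0 (enorm (tlv x)).
  have -> : rho (x 0 ord0) ^+ 2 = 1 - x 0 ord0 ^+ 2.
    by rewrite sqr_sqrtr// subr_ge0; apply: le_trans (ltW h); rewrite lerDl.
  by rewrite ltrBrDl.
by rewrite ler_pXn2r ?nnegrE ?rho_ge0.
Qed.

Lemma Bf_deriv (s : R) : is_derive s 1 Bf (omega k.+1 * rho s ^+ k.+1).
Proof.
apply: deriv_eps => e e0.
pose g (y : R) := omega k.+1 * Num.max 0 y ^+ k.+1.
have cm : continuous (fun y : R => Num.max 0 y).
  by move=> y; apply: continuous_max; [exact: cst_continuous|].
have c2 : continuous (fun y : R => omega k.+1 * y ^+ k.+1 : R).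
  by move=> y; apply: cvgM; [exact: cvg_cst|exact: exprn_continuous].
have cg : continuous g by move=> y; exact: continuous_comp (cm y) (c2 _).
have rs : Num.max 0 (rho s) = rho s by rewrite max_r// rho_ge0.
have [d d0 dP] : exists2 d, 0 < d & forall y, `|rho s - y| < d -> `|g (rho s) - g y| < e.
  have /cvgrPdist_lt/(_ e e0)/nbhs_ballP[d/= d0 dP] := cg (rho s).
  by exists d => // y h; apply: dP; rewrite -ball_normE.
have d20 : 0 < d / 2 by rewrite divr_gt0.
have [r r0 rP] : exists2 r, 0 < r & forall u, `|s - u| < r -> `|rho s - rho u| < d / 2.
  have /cvgrPdist_lt/(_ _ d20)/nbhs_ballP[r/= r0 rP] := @rho_continuous s.
  by exists r => // y h; apply: rP; rewrite -ball_normE.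
exists r => // t tr.
(* Truncation at 0 keeps the lower bound a radius; the maximum in [g] matches it. *)
pose m := Num.max 0 (rho s - d / 2); pose M := rho s + d / 2.
have m0 : 0 <= m by rewrite le_max lexx.
have M0 : 0 <= M by rewrite addr_ge0 ?rho_ge0 ?ltW.
have mM u : `|s - u| < r -> m <= rho u <= M.
  move=> /rP; rewrite ltr_norml => /andP[h1 h2]; rewrite /m /M ge_max rho_ge0/=.
  by apply/andP; split; lra.
have gm : `|g (rho s) - omega k.+1 * m ^+ k.+1| < e.
  by have := dP (rho s - d / 2); rewrite /g opprB addrC subrK ger0_norm ?(ltW d20)//; apply; lra.
have gM : `|g (rho s) - omega k.+1 * M ^+ k.+1| < e.
  have := dP M; rewrite /g /M opprD addrA subrr add0r normrN ger0_norm ?(ltW d20)//.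
  by rewrite [Num.max 0 (rho s + _)]max_r//; apply; lra.
move: gm gM; rewrite /g rs; set G := omega k.+1 * rho s ^+ k.+1.
set gm := omega k.+1 * m ^+ _; set gM := omega k.+1 * M ^+ _.
rewrite !ltr_norml => /andP[gm1 gm2] /andP[gM1 gM2].
have [st|/ltW ts] := leP s t.
  have ts0 : 0 <= t - s by rewrite subr_ge0.
  have /andP[h1 h2] := @BfB_bounds s t m M st m0 M0 (fun u su => mM u ltac:(
    move: su tr; rewrite !ltr_norml => /andP[? ?] /andP[? ?]; apply/andP; split; lra)).
  rewrite (ger0_norm ts0) ler_norml; apply/andP; split.
    have := ler_wpM2r ts0 (ltW gm2); move: h1; rewrite -/gm; lra.
  by have := ler_wpM2r ts0 (ltW gM1); move: h2; rewrite -/gM; lra.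
have ts0 : 0 <= s - t by rewrite subr_ge0.
have /andP[h1 h2] := @BfB_bounds t s m M ts m0 M0 (fun u su => mM u ltac:(
    move: su tr; rewrite !ltr_norml => /andP[? ?] /andP[? ?]; apply/andP; split; lra)).
rewrite [`|t - s|]distrC (ger0_norm ts0) ler_norml; apply/andP; split.
  by have := ler_wpM2r ts0 (ltW gM1); move: h2; rewrite -/gM; lra.
by have := ler_wpM2r ts0 (ltW gm2); move: h1; rewrite -/gm; lra.
Qed.

Lemma Bf_le0 (s : R) : s <= -1 -> Bf s = 0.
Proof.
move=> s1; rewrite /Bf (_ : [set x | _] = set0) ?outer_measure0//.
rewrite -subset0 => x [xb xs]; move: xb; rewrite /eball/= subr0 ltNge => /negP; apply.
by apply: le_trans (abs_le_enorm x ord0); rewrite ler_normr; apply/orP; right; lra.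
Qed.

Lemma Bf_ge1 (s : R) : 1 <= s -> Bf s = omega k.+2.
Proof.
move=> s1; rewrite /Bf (_ : [set x | _] = eball 0 1).
  by rewrite lebesgue_eball// expr1n mulr1.
apply/seteqP; split => [x []//|x xb]; split => //.
move: xb; rewrite /eball/= subr0 => xb; apply: le_trans s1.
by apply: le_trans (ltW xb); apply: le_trans (abs_le_enorm x ord0); exact: ler_norm.
Qed.

Lemma rho_gt0 (s : R) : -1 < s < 1 -> 0 < rho s.
Proof.
move=> /andP[s1 s2]; rewrite /rho sqrtr_gt0.
have : 0 < (1 - s) * (1 + s) by rewrite mulr_gt0//; lra.
by rewrite (_ : (1 - s) * _ = 1 - s ^+ 2)//; ring.
Qed.

Lemma Bf_nondec (s t : R) : s <= t -> Bf s <= Bf t.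
Proof.
move=> st; apply: (@deriv_le _ _ (fun s => omega k.+1 * rho s ^+ k.+1)) => //.
- by move=> x _; exact: Bf_deriv.
- by move=> x _; rewrite mulr_ge0 ?exprn_ge0 ?rho_ge0// ltW// omega_pos.
- by move=> x _; apply: deriv_continuous; exact: Bf_deriv.
Qed.

Lemma Bf_lt (s t : R) : -1 <= s -> s < t -> t <= 1 -> Bf s < Bf t.
Proof.
move=> s1 st t1; have [] := @MVT _ Bf (fun s => omega k.+1 * rho s ^+ k.+1) s t st.
- by move=> x _; exact: Bf_deriv.
- by apply: continuous_subspaceT => x; apply: deriv_continuous; exact: Bf_deriv.
move=> c; rewrite in_itv/= => /andP[sc ct] e; rewrite -subr_gt0 e mulr_gt0 ?subr_gt0//.
by rewrite mulr_gt0 ?omega_pos// exprn_gt0// rho_gt0// (le_lt_trans s1 sc) (lt_le_trans ct).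
Qed.

(** The bound by 1 is required for every [v], also outside the range of volumes, so that the
    transport stays in the ball unconditionally. *)
Lemma beta_exists : exists beta : R -> R, forall v,
  -1 <= beta v <= 1 /\ (0 <= v <= omega k.+2 -> Bf (beta v) = v).
Proof.
suff H v : exists b : R, -1 <= b <= 1 /\ (0 <= v <= omega k.+2 -> Bf b = v).
  by have [b bP] := choice H; exists b.
case: (boolP (0 <= v <= omega k.+2)) => [vo|_]; last by exists 0; split => //; lra.
have [] := @IVT _ Bf (-1) 1 v _ _ _; first lra.
- by apply: continuous_subspaceT => x; apply: deriv_continuous; exact: Bf_deriv.
- by rewrite Bf_le0// Bf_ge1// min_l ?max_r// ltW// omega_pos.
by move=> b; rewrite in_itv/= => bb e; exists b.
Qed.

Definition beta : R -> R := sval (cid beta_exists).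

Lemma beta_itv (v : R) : -1 <= beta v <= 1.
Proof. by rewrite /beta; case: cid => b /= /(_ v)[]. Qed.

Lemma betaK (v : R) : 0 <= v <= omega k.+2 -> Bf (beta v) = v.
Proof. by rewrite /beta; case: cid => b /= /(_ v)[]. Qed.

Lemma BfK (s : R) : -1 <= s <= 1 -> beta (Bf s) = s.
Proof.
move=> /andP[s1 s2]; have B : 0 <= Bf s <= omega k.+2.
  by rewrite -(Bf_le0 (lexx (-1))) -(Bf_ge1 (lexx 1)) !Bf_nondec.
have /andP[b1 b2] := beta_itv (Bf s); have := betaK B.
case: (ltgtP (beta (Bf s)) s) => // h e.
  by have := Bf_lt b1 h s2; rewrite e ltxx.
by have := Bf_lt s1 h b2; rewrite e ltxx.
Qed.

Lemma beta_nondec (v w : R) : 0 <= v -> v <= w -> w <= omega k.+2 -> beta v <= beta w.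
Proof.
move=> v0 vw wo; rewrite leNgt; apply/negP => h.
have /andP[b1 b2] := beta_itv v; have /andP[b3 b4] := beta_itv w.
have := Bf_lt b3 h b2; rewrite !betaK ?v0 ?wo ?(le_trans v0 vw) ?(le_trans vw wo)//.
by rewrite ltNge vw.
Qed.

Lemma beta_in (v : R) : 0 < v < omega k.+2 -> -1 < beta v < 1.
Proof.
move=> /andP[v0 vo]; have /andP[b1 b2] := beta_itv v.
have e := @betaK v ltac:(by rewrite !ltW).
rewrite !lt_neqAle b1 b2 !andbT; apply/andP; split; apply/eqP => h.
  by move: e v0; rewrite -h Bf_le0// => <-; rewrite ltxx.
by move: e vo; rewrite h Bf_ge1// => <-; rewrite ltxx.
Qed.

Lemma beta_continuous (v : R) : 0 < v < omega k.+2 -> {for v, continuous beta}.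
Proof.
move=> vo; have /andP[v0 v1] := vo; have /andP[b1 b2] := beta_in vo.
have e1 : v = Bf (beta v) by rewrite betaK ?(ltW v0) ?(ltW v1).
apply/cvgrPdist_lt => e e0.
(* The bracket is truncated to [[-1, 1]], where [Bf] is strictly increasing. *)
pose l := Num.max (-1) (beta v - e / 2); pose r := Num.min 1 (beta v + e / 2).
have lb : Bf l < v.
  rewrite [ltRHS]e1; apply: Bf_lt; rewrite ?(ltW b2)//; first by rewrite le_max lexx.
  by rewrite gt_max b1/=; lra.
have rb : v < Bf r.
  rewrite [ltLHS]e1; apply: Bf_lt; rewrite ?(ltW b1)//; last by rewrite ge_min lexx.
  by rewrite lt_min b2/=; lra.
near=> w; have /andP[w0 w1] : 0 < w < omega k.+2.
  near: w; apply: (@near_in_itvoo _ 0 (omega k.+2) v); by rewrite in_itv/= v0.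
have lw : Bf l < w by near: w; exact: lt_nbhsr.
have rw : w < Bf r by near: w; exact: lt_nbhsl.
have le1 : l <= beta w.
  rewrite leNgt; apply/negP => h; have := @Bf_nondec _ _ (ltW h).
  by rewrite betaK ?(ltW w0) ?(ltW w1)// leNgt lw.
have re1 : beta w <= r.
  rewrite leNgt; apply/negP => h; have := @Bf_nondec _ _ (ltW h).
  by rewrite betaK ?(ltW w0) ?(ltW w1)// leNgt rw.
move: le1 re1; rewrite ge_max le_min => /andP[_ h1] /andP[_ h2].
rewrite ltr_norml; apply/andP; split; lra.
Unshelve. all: by end_near. Qed.

Lemma beta_deriv (v : R) : 0 < v < omega k.+2 ->
  is_derive v 1 beta (omega k.+1 * rho (beta v) ^+ k.+1)^-1.
Proof.
move=> vo; have /andP[v0 v1] := vo; have /andP[b1 b2] := beta_in vo.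
have e : v = Bf (beta v) by rewrite betaK ?ltW.
have /near_in_itvoo bI : beta v \in `]-1, 1[ by rewrite in_itv/= b1.
rewrite e BfK; last by rewrite !ltW.
apply: (@is_derive_inverse R Bf).
- near=> z; apply: BfK; have : z \in `]-1, 1[ by near: z.
  by rewrite in_itv/= => /andP[? ?]; rewrite !ltW.
- by near=> z; apply: deriv_continuous; exact: Bf_deriv.
- exact: Bf_deriv.
- by rewrite mulf_neq0// ?expf_neq0// gt_eqF ?omega_pos// rho_gt0// b1.
Unshelve. all: by end_near. Qed.
End ball_function.

Lemma continuous_gt0 {R : realType} (f : R -> R) (s : R) : {for s, continuous f} -> 0 < f s ->
  exists2 d, 0 < d & forall x, `|s - x| < d -> 0 < f x.
Proof.
move=> /cvgrPdist_lt cf /cf/nbhs_ballP[d/= d0 dP]; exists d => // x sx.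
have := dP x; rewrite -ball_normE/= => /(_ sx).
by rewrite ltr_norml => /andP[_]; lra.
Qed.

Lemma knothe_gap_arith {R : realFieldType} (c x x1 x2 lam q Q w y : R) : 0 <= c -> 0 <= x -> x1 <= x -> x2 <= x ->
  q <= Q -> w <= lam + c * q - (c + 1) -> lam * x + c * (q * x1) - (c + 1) * x2 <= y ->
  x * w <= y + c * Q * (x - x1).
Proof.
move=> c0 x0 x1x x2x qQ wl yl.
have h1 := ler_wpM2l x0 wl.
have h2 : (c + 1) * x2 <= (c + 1) * x by rewrite ler_wpM2l// addr_ge0.
have h3 : c * q * (x - x1) <= c * Q * (x - x1) by rewrite ler_wpM2r ?subr_ge0// ler_wpM2l.
lra.
Qed.

(* Bounds on the slices at height [s] of a function [u] on R^(k+2):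
   [al], [P], [S], [A1] and [A2] stand for the integrals over the slice of [u],
   of the horizontal and of the full gradient norm, and of [u^(1+1/(k+1))] and
   [u^(1+1/(k+2))]; [de] is the derivative of [al]. *)
Record slices {R : realType} (k : nat) (a b : R) (al de P S A1 A2 : R -> R) : Prop := Slices {
  sl_deriv : forall s : R, is_derive s 1 al (de s);
  sl_contS : continuous S;
  sl_cont1 : continuous A1;
  sl_cont2 : continuous A2;
  sl_ge0 : forall s, 0 <= al s;
  sl_left : forall s, s <= a + 1 -> al s = 0;
  sl_right : forall s, b - 1 <= s -> al s = 0;
  sl_P0 : forall s, 0 <= P s;
  sl_S : forall s r t, `|t| <= r -> - t * de s + Num.sqrt (r ^+ 2 - t ^+ 2) * P s <= r * S s;
  sl_A1 : forall s, 0 <= A1 s <= al s;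
  sl_A2 : forall s, 0 <= A2 s <= al s;
  sl_iso : forall s th, 0 <= th -> omega k.+1 * th ^+ k.+1 = al s -> k.+1%:R * A1 s <= th * P s;
  sl_agm : forall s l q, 0 <= l -> 0 <= q -> l * q ^+ k.+1 = 1 ->
    k.+2%:R * A2 s <= l * al s + k.+1%:R * (q * A1 s)
}.

(** * Transport of the first coordinate *)

Section slices_theory.
Context {R : realType} (k : nat) (a b : R) (al de P S A1 A2 : R -> R).
Hypothesis sl : slices k a b al de P S A1 A2.
Hypothesis ab : a + 1 <= b.

Let V := prim a al.

Lemma slices_cont : continuous al.
Proof. by move=> s; apply: deriv_continuous; exact: (sl_deriv sl). Qed.
Let ca := slices_cont.

Lemma slices_S_ge0 s : 0 <= S s.
Proof.
have := @sl_S _ _ _ _ _ _ _ _ _ _ sl s 1 0; rewrite normr0 ler01 => /(_ isT).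
rewrite oppr0 mul0r add0r expr1n expr0n subr0 sqrtr1 !mul1r.
by apply: le_trans; exact: (sl_P0 sl).
Qed.

Lemma slices_deriv_vol (s : R) : a < s -> is_derive s 1 V (al s).
Proof. by move=> sa; apply: prim_deriv. Qed.

Lemma slices_vol_ge0 s : 0 <= V s.
Proof. by apply: prim_ge0 => x _; exact: (sl_ge0 sl). Qed.

Lemma slices_vol_nondec s t : a < s -> s <= t -> V s <= V t.
Proof. by apply: prim_nondec => //; exact: (sl_ge0 sl). Qed.

(** A positive value of the continuous function [al] at [s] would persist to the left of [s] and
    make the volume positive. *)
Lemma slices_vol0 s : a < s -> V s = 0 -> al s = 0.
Proof.
move=> sa V0; have := sl_ge0 sl s; rewrite le_eqVlt => /orP[/eqP //|h].
exfalso; pose c := (a + s) / 2.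
have [ac cs] : a < c /\ c < s by rewrite /c; split; lra.
have [d d0 dP] := @continuous_gt0 _ al s (@ca s) h.
pose x := Num.max c (s - d / 2).
have xs : x < s by rewrite /x gt_max cs/=; lra.
have ax : a < x by rewrite /x lt_max ac.
have [] := @MVT _ V al x s xs.
- by move=> z; rewrite in_itv/= => /andP[xz _]; apply: slices_deriv_vol; exact: lt_trans xz.
- apply: continuous_in_subspaceT => z; rewrite inE/= in_itv/= => /andP[xz _].
  by apply: deriv_continuous; apply: slices_deriv_vol; exact: lt_le_trans xz.
move=> z; rewrite in_itv/= => /andP[xz zs].
have -> : V s - V x = 0.
  apply/eqP; rewrite V0 sub0r oppr_eq0 eq_le slices_vol_ge0 andbT -V0.
  by apply: slices_vol_nondec => //; exact: ltW.
move=> /esym/eqP; rewrite mulf_eq0 subr_eq0 (gt_eqF xs) orbF => /eqP z0.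
have := dP z; rewrite z0 ltxx; move=> H; suff : false by []; apply: H; rewrite gtr0_norm ?subr_gt0//.
by move: xz; rewrite /x gt_max => /andP[_]; lra.
Qed.

Section radius.
Variable r : R.
Hypothesis r0 : 0 < r.
Let vr := omega k.+2 * r ^+ k.+2.

(** First component of Knothe's map: the ball of radius [r] has volume [V s] below the height
    [tau s]. *)
Definition tau s : R := r * beta k (V s / r ^+ k.+2).
(** Area of the slice of that ball at height [tau s]; conservation of volume gives
    [tau' = al / bur]. *)
Definition bur s : R := omega k.+1 * (r * rho (beta k (V s / r ^+ k.+2))) ^+ k.+1.
(* Nondecreasing in [s]: this is the isoperimetric inequality one dimension up. *)
Definition knothe s : R := prim a (fun s => r * S s - k.+2%:R * A2 s) s + tau s * al s.

Let rk : 0 < r ^+ k.+2. Proof. exact: exprn_gt0. Qed.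

Lemma tau_le s : `|tau s| <= r.
Proof.
rewrite normrM (gtr0_norm r0) ler_piMr ?(ltW r0)//.
by rewrite ler_norml beta_itv.
Qed.

Let cI : continuous (fun s => r * S s - k.+2%:R * A2 s).
Proof.
move=> s; apply: cvgB; apply: cvgM; try exact: cvg_cst; [exact: (sl_contS sl)|exact: (sl_cont2 sl)].
Qed.

Let V01 s : 0 < V s < vr -> 0 < V s / r ^+ k.+2 < omega k.+2.
Proof. by move=> /andP[? ?]; rewrite divr_gt0//= ltr_pdivrMr. Qed.

Lemma bur_gt0 s : 0 < V s < vr -> 0 < bur s.
Proof.
move=> /V01 h; rewrite mulr_gt0 ?omega_pos// exprn_gt0// mulr_gt0// rho_gt0//.
exact: beta_in.
Qed.

Lemma tau_deriv (s : R) : a < s -> 0 < V s < vr -> is_derive s 1 tau (al s / bur s).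
Proof.
move=> sa h; have hb := bur_gt0 h.
have d1 := slices_deriv_vol sa.
have d2 : is_derive s 1 (fun s => V s / r ^+ k.+2) (al s / r ^+ k.+2).
  have := @is_deriveZ _ _ _ V (r ^+ k.+2)^-1 s 1 (al s) d1.
  rewrite (_ : _ \*: _ = fun s => V s / r ^+ k.+2); last by apply/funext => x; rewrite /= mulrC.
  by rewrite /GRing.scale/= mulrC.
have d3 := beta_deriv (V01 h).
have d4 := @is_derive1_comp _ (beta k) (fun s => V s / r ^+ k.+2) s _ _ d3 d2.
have H := @is_deriveZ _ _ _ (beta k \o (fun s => V s / r ^+ k.+2)) r s 1 _ d4.
apply: (is_derive_eq H); rewrite /GRing.scale/= /bur exprMn.
have : rho (beta k (V s / r ^+ k.+2)) ^+ k.+1 != 0 by rewrite expf_neq0// gt_eqF// rho_gt0// beta_in// V01.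
have : omega k.+1 != 0 :> R by rewrite gt_eqF// omega_pos.
have : r ^+ k.+1 != 0 by rewrite expf_neq0// gt_eqF.
move: (rho (beta k (V s / r ^+ k.+2)) ^+ k.+1) (omega k.+1) => x y.
rewrite [r ^+ k.+2]exprS; move: (r ^+ k.+1) => z z0 y0 x0.
by field; rewrite z0 y0 x0 gt_eqF.
Qed.

Definition knothe' s := r * S s - k.+2%:R * A2 s + (tau s * de s + al s / bur s * al s).

Lemma knothe_deriv (s : R) : a < s -> 0 < V s < vr -> is_derive s 1 knothe (knothe' s).
Proof.
move=> sa h; have d1 := tau_deriv sa h.
have d2 := prim_deriv cI sa; have d3 := sl_deriv sl s.
have d4 := is_deriveM d1 d3; have H := is_deriveD d2 d4.
by apply: (is_derive_eq H); rewrite /knothe' /GRing.scale/= [al s * (_ / _)]mulrC.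
Qed.

(** The slice has the area of a ball of radius [th] and is sent to one of radius [hh], so
    [q = hh / th] is the horizontal stretch and [al / bur] the vertical one; their determinant is 1.
    The slice inequality [sl_iso] at radius [th] stands for the divergence of the horizontal
    transport. *)
Lemma knothe_gap s : a < s -> 0 < V s < vr -> 0 < al s -> exists2 q, 0 < q &
  al s / bur s * q ^+ k.+1 = 1 /\
  al s / bur s * al s + k.+1%:R * (q * A1 s) - k.+2%:R * A2 s <= knothe' s.
Proof.
move=> sa h a0; have b0 := bur_gt0 h.
pose th := nroot k.+1 (al s / omega k.+1); pose hh := r * rho (beta k (V s / r ^+ k.+2)).
have oe : 0 < omega k.+1 :> R by exact: omega_pos.
have the : omega k.+1 * th ^+ k.+1 = al s.
  by rewrite nrootK ?divr_ge0 ?ltW// mulrC divfK// gt_eqF.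
have th0 : 0 < th.
  rewrite lt_neqAle nroot_ge0 andbT eq_sym; apply/eqP => t0.
  by move: the a0; rewrite t0 expr0n mulr0 => <-; rewrite ltxx.
have h0 : 0 < hh by rewrite mulr_gt0// rho_gt0// beta_in// V01.
exists (hh / th); first exact: divr_gt0.
split.
  rewrite expr_div_n -{1}the /bur -/hh.
  have : th ^+ k.+1 != 0 by rewrite expf_neq0// gt_eqF.
  have : hh ^+ k.+1 != 0 by rewrite expf_neq0// gt_eqF.
  move: (th ^+ k.+1) (hh ^+ k.+1) => x y x0 y0.
  by field; rewrite x0 y0 gt_eqF.
have i2 := @sl_iso _ _ _ _ _ _ _ _ _ _ sl s th (ltW th0) the.
have i3 : k.+1%:R * (hh / th * A1 s) <= hh * P s.
  have := ler_wpM2l (ltW (divr_gt0 h0 th0)) i2.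
  by rewrite [X in _ <= X -> _](_ : _ = hh * P s) 1?[leLHS]mulrCA//; field; rewrite gt_eqF.
have i1 := @sl_S _ _ _ _ _ _ _ _ _ _ sl s r (tau s) (tau_le s).
have e : Num.sqrt (r ^+ 2 - tau s ^+ 2) = hh.
  rewrite /tau exprMn -{1}[r ^+ 2]mulr1 -mulrBr sqrtrM ?sqr_ge0// sqrtr_sqr gtr0_norm//.
by rewrite /knothe'; move: i1 i3; rewrite e; lra.
Qed.

Lemma knothe'_ge0 s : a < s -> 0 < V s < vr -> 0 <= knothe' s.
Proof.
move=> sa h; have := sl_ge0 sl s; rewrite le_eqVlt => /orP[/eqP a0|a0].
  have /andP[h1 h2] := sl_A2 sl s; have A20 : A2 s = 0 by apply/eqP; rewrite eq_le h1 andbT a0.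
  rewrite /knothe' A20 -a0 !mulr0 subr0 addr0.
  have := @sl_S _ _ _ _ _ _ _ _ _ _ sl s r (tau s) (tau_le s).
  have := mulr_ge0 (sqrtr_ge0 (r ^+ 2 - tau s ^+ 2)) (sl_P0 sl s); lra.
have [q q0 [qe h1]] := knothe_gap sa h a0.
apply: le_trans h1; rewrite subr_ge0; apply: (sl_agm sl) => //; last exact: ltW.
by rewrite divr_ge0 ?(ltW a0)// ltW// bur_gt0.
Qed.

(** Where no volume has been met [tau] need not be differentiable, because the slice of the ball
    degenerates; but [tau] is bounded and [al] tends to 0, so the product is continuous. *)
Lemma knothe_cont0 s : a < s -> V s = 0 -> {for s, continuous knothe}.
Proof.
move=> sa V0; have a0 := slices_vol0 sa V0.
apply: cvgD; first exact: prim_cont.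
have rc : r * al t @[t --> s] --> 0.
  by rewrite -(mulr0 r) -a0; apply: cvgM; [exact: cvg_cst|exact: ca].
rewrite a0 mulr0; apply: (@squeeze_cvgr _ _ _ _ (fun s => - (r * al s)) (fun s => r * al s)).
- near=> t; rewrite -ler_norml normrM [`|al t|]ger0_norm ?(sl_ge0 sl)//.
  by rewrite ler_wpM2r ?(sl_ge0 sl)// tau_le.
- by have := cvgN rc; rewrite oppr0; apply.
- by [].
Unshelve. all: by end_near. Qed.

(** The interval is split at the last point where the volume vanishes: before it [al = 0] and only
    the integral of [r S] grows, after it the derivative [knothe'] is nonnegative. *)
Lemma knothe_nondec s t : a < s -> s <= t -> V t < vr -> knothe s <= knothe t.
Proof.
move=> sa st tv.
have Vst x : s <= x <= t -> V x < vr.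
  move=> /andP[sx xt]; apply: le_lt_trans tv; apply: slices_vol_nondec => //.
  exact: lt_le_trans sx.
have main x : s <= x <= t -> V x = 0 \/ 0 < V x.
  by move=> _; have := slices_vol_ge0 x; rewrite le_eqVlt => /orP[/eqP|]; [left|right].
have zero x : s <= x -> x <= t -> V x = 0 -> knothe s <= knothe x.
  move=> sx xt Vx; have V0 y : s <= y <= x -> V y = 0.
    move=> /andP[sy yx]; apply/eqP; rewrite eq_le slices_vol_ge0 -Vx slices_vol_nondec//.
    exact: lt_le_trans sy.
  have a0 y : s <= y <= x -> al y = 0.
    by move=> h; apply: slices_vol0; [case/andP: h => h _; exact: lt_le_trans h|exact: V0].
  rewrite /knothe !a0 ?lexx ?sx// !mulr0 !addr0.
  apply: (@deriv_le _ _ (fun s => r * S s - k.+2%:R * A2 s)) => //.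
  - by move=> y /andP[sy _]; apply: prim_deriv => //; exact: lt_trans sy.
  - move=> y /andP[sy yx]; have y0 := a0 y ltac:(by rewrite !ltW).
    have /andP[h1 h2] := sl_A2 sl y; have -> : A2 y = 0 by apply/eqP; rewrite eq_le h1 andbT -y0.
    by rewrite mulr0 subr0 mulr_ge0 ?(ltW r0)// slices_S_ge0.
  - by move=> y /andP[sy _]; apply: prim_cont => //; exact: lt_le_trans sy.
have pos x : s <= x -> x <= t -> (forall y, x < y <= t -> 0 < V y) -> knothe x <= knothe t.
  move=> sx xt V0; apply: (@deriv_le _ _ knothe') => //.
  - move=> y /andP[xy yt]; apply: knothe_deriv; first exact: lt_trans (lt_le_trans sa sx) xy.
    by rewrite V0 ?xy ?(ltW yt)//= Vst// (ltW yt) (le_trans sx (ltW xy)).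
  - move=> y /andP[xy yt]; apply: knothe'_ge0; first exact: lt_trans (lt_le_trans sa sx) xy.
    by rewrite V0 ?xy ?(ltW yt)//= Vst// (ltW yt) (le_trans sx (ltW xy)).
  - move=> y /andP[xy yt]; have ay : a < y by apply: lt_le_trans xy; exact: lt_le_trans sx.
    have syt : s <= y <= t by rewrite yt (le_trans sx).
    have [y0|y0] := main y syt; first exact: knothe_cont0.
    by apply: deriv_continuous; apply: knothe_deriv => //; rewrite y0 Vst.
have [Vs|Vs] := main s ltac:(by rewrite lexx); last first.
  apply: pos => // y /andP[sy yt]; apply: lt_le_trans Vs _.
  by apply: slices_vol_nondec => //; exact: ltW.
pose Z := [set x | s <= x <= t /\ V x = 0].
have Zs : Z s by split=> //; rewrite lexx.
have supZ : has_sup Z by split; [exists s|exists t => x [/andP[]]].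
have sz : s <= sup Z by apply: ub_le_sup => //; exact: supZ.2.
have zt : sup Z <= t by apply: ge_sup; [exists s|move=> x [/andP[]]].
have Vz : V (sup Z) = 0.
  have [//|Vp] := main (sup Z) ltac:(by rewrite sz).
  have [d d0 dP] : exists2 d, 0 < d & forall x, `|sup Z - x| < d -> 0 < V x.
    by apply: continuous_gt0 => //; apply: prim_cont => //; exact: lt_le_trans sz.
  have [x Zx xd] := sup_adherent d0 supZ; have := dP x; rewrite Zx.2 ltxx.
  move=> H; suff : false by []; apply: H.
  rewrite ger0_norm; first by lra.
  by rewrite subr_ge0 ub_le_sup//; exact: supZ.2.
apply: le_trans (zero _ sz zt Vz) _; apply: pos => // y /andP[zy yt].
have syt : s <= y <= t by rewrite yt (le_trans sz (ltW zy)).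
have [y0|//] := main y syt.
by move: zy; rewrite ltNge ub_le_sup//; exact: supZ.2.
Qed.

Lemma knothe_left_ge0 : 0 <= knothe (a + 1).
Proof.
rewrite /knothe (sl_left sl) ?lexx// mulr0 addr0; apply: prim_ge0 => x /andP[_ xa].
have /andP[h1 h2] := sl_A2 sl x; have -> : A2 x = 0.
  by apply/eqP; rewrite eq_le h1 andbT -(sl_left sl xa).
by rewrite mulr0 subr0 mulr_ge0 ?(ltW r0)// slices_S_ge0.
Qed.

Lemma knothe_right : knothe b = r * prim a S b - k.+2%:R * prim a A2 b.
Proof.
have cS := sl_contS sl; have c2 := sl_cont2 sl.
rewrite /knothe (sl_right sl) ?mulr0 ?addr0; last lra.
rewrite -mulNr -!primZ// -primD//.
- by apply: prim_eq => x _; rewrite mulNr.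
- by move=> x; apply: cvgM; [exact: cvg_cst|exact: cS].
- by move=> x; apply: cvgM; [exact: cvg_cst|exact: c2].
Qed.

Lemma knothe_itv s : a + 1 <= s <= b -> V b < vr ->
  0 <= knothe s <= r * prim a S b - k.+2%:R * prim a A2 b.
Proof.
move=> /andP[sa sb] h; rewrite -knothe_right; apply/andP; split.
  apply: le_trans knothe_left_ge0 _; apply: knothe_nondec => //; first by rewrite ltrDl.
  by apply: le_lt_trans h; apply: slices_vol_nondec => //; lra.
by apply: knothe_nondec => //; lra.
Qed.

End radius.

Lemma slices_knotheE r s : prim a (fun s => r * S s - k.+2%:R * A2 s) s =
  r * prim a S s - k.+2%:R * prim a A2 s.
Proof.
have cS := sl_contS sl; have c2 := sl_cont2 sl.
rewrite -mulNr -!primZ// -primD//.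
- by apply: prim_eq => x _; rewrite mulNr.
- by move=> x; apply: cvgM; [exact: cvg_cst|exact: cS].
- by move=> x; apply: cvgM; [exact: cvg_cst|exact: c2].
Qed.

Lemma slices_iso r : 0 <= r -> V b <= omega k.+2 * r ^+ k.+2 ->
  k.+2%:R * prim a A2 b <= r * prim a S b.
Proof.
move=> r0 vr; have IS : 0 <= prim a S b by apply: prim_ge0 => x _; exact: slices_S_ge0.
(* The transport is differentiated only while the volume is strictly below that of the ball, so the
   radius is enlarged by [d], at a cost of at most [e]. *)
apply/ler_addgt0Pr => e e0; pose d := e / (prim a S b + 1).
have I1 : 0 < prim a S b + 1 by rewrite ltr_wpDl.
have d0 : 0 < d by rewrite divr_gt0.
have rd : 0 < r + d by rewrite ltr_wpDl.
have vb : V b < omega k.+2 * (r + d) ^+ k.+2.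
  by apply: (le_lt_trans vr); rewrite ltr_pM2l ?omega_pos// ltr_pXn2r ?nnegrE ?(ltW rd)// ltrDl.
have /(_ b) := @knothe_itv (r + d) rd; rewrite ab lexx => /(_ isT vb)/andP[h1 h2].
have := le_trans h1 h2; rewrite subr_ge0 => /le_trans; apply.
rewrite mulrDl lerD2l /d mulrAC ler_pdivrMr// ler_pM2l// lerDl//.
Qed.

(** The part below [s] fits into the ball of the smaller radius [r0] and satisfies the stricter
    inequality with it, up to the boundary term [r0 al s]. Against the small deficit [e1] for the
    radius [r], the difference must be paid by the slice, so [al s] is bounded below. *)
Lemma slices_low r r0 e1 e2 s : 0 < r0 -> r0 <= r -> a + 1 <= s <= b ->
  V b < omega k.+2 * r ^+ k.+2 -> V s < omega k.+2 * r0 ^+ k.+2 ->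
  r * prim a S b - k.+2%:R * prim a A2 b <= e1 ->
  prim a (fun s => al s - A2 s) b <= e2 ->
  k.+2%:R * ((V s - e2) * (1 - r0 / r)) - e1 <= 2 * (r * al s).
Proof.
move=> r00 r0r sab vb vs he1 he2; have rp := lt_le_trans r00 r0r.
have [sa sb] := andP sab; have a0 := sl_ge0 sl s.
have /andP[kn1 kn2] := knothe_itv rp sab vb.
have e10 : 0 <= e1 by apply: le_trans he1; apply: le_trans kn1 _.
have h1 : 0 <= r0 * prim a S s - k.+2%:R * prim a A2 s + r0 * al s.
  apply: (@le_trans _ _ (knothe r0 s)).
    apply: le_trans (knothe_left_ge0 r00) _; apply: knothe_nondec => //.
    by rewrite ltrDl.
  rewrite /knothe slices_knotheE lerD2l ler_wpM2r//.
  by have := tau_le r00 s; rewrite ler_norml => /andP[].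
have h2 : r * prim a S s - k.+2%:R * prim a A2 s - r * al s <= e1.
  apply: le_trans he1; apply: le_trans kn2; rewrite /knothe slices_knotheE lerD2l -mulNr.
  by rewrite ler_wpM2r//; have := tau_le rp s; rewrite ler_norml => /andP[].
have h3 : V s - e2 <= prim a A2 s.
  have c2 := sl_cont2 sl.
  have cd : continuous (fun s => al s - A2 s) by move=> x; apply: cvgB; [exact: ca|exact: c2].
  have : prim a (fun s => al s - A2 s) s <= e2.
    apply: le_trans he2; apply: prim_nondec => //; last lra.
    by move=> x; rewrite subr_ge0; have /andP[] := sl_A2 sl x.
  have : V s = prim a A2 s + prim a (fun s => al s - A2 s) s.
    by rewrite -primD//; apply: prim_eq => x _; rewrite addrC subrK.
  by move=> ->; lra.
have p1 : r0 / r <= 1 by rewrite ler_pdivrMr// mul1r.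
have p0 : 0 <= r0 / r by rewrite ltW// divr_gt0.
have q1 : 0 <= 1 - r0 / r by rewrite subr_ge0.
have h1' : 0 <= r0 / r * (r * prim a S s) - k.+2%:R * prim a A2 s + r0 / r * (r * al s).
  by rewrite !mulrA divfK// gt_eqF.
move: p1 p0 q1 h1'; move: (r0 / r) => p p1 p0 q1 h1'.
have k0 : 0 <= k.+2%:R :> R by [].
have g1 := ler_wpM2l k0 (ler_wpM2r q1 h3).
have g2 := ler_wpM2l p0 h2.
have g3 : p * e1 <= e1 by rewrite ler_piMl.
have g4 : p * (r * al s) <= r * al s by rewrite ler_piMl// mulr_ge0// ltW.
apply: (@le_trans _ _ (k.+2%:R * (prim a A2 s * (1 - p)) - e1)); first by rewrite lerD2r.
move: g2 g3 g4 h1'; rewrite [k.+2%:R * (prim a A2 s * _)]mulrA; move: (k.+2%:R * _) (r * prim a S s) (r * al s) => Y X Z; lra.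
Qed.

Lemma norm_expB n (q Q : R) : 0 <= q -> q <= Q -> 1 <= Q ->
  `|1 - q ^+ n.+1| <= n.+1%:R * Q ^+ n.+1 * `|1 - q|.
Proof.
move=> q0 qQ Q1; have Q0 : 0 <= Q by rewrite (le_trans _ Q1).
elim: n => [|n IH]; first by rewrite !expr1 mul1r ler_peMl.
have -> : 1 - q ^+ n.+2 = (1 - q) + q * (1 - q ^+ n.+1) by rewrite exprS; ring.
apply: (le_trans (ler_normD _ _)); rewrite normrM (ger0_norm q0).
have h1 := ler_pM q0 (normr_ge0 _) qQ IH.
apply: (le_trans (lerD (lexx _) h1)); rewrite -[n.+2%:R]natr1 mulrDl mulrDl addrC.
apply: lerD; first by rewrite [Q ^+ n.+2]exprS le_eqVlt; apply/orP; left; apply/eqP; ring.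
by rewrite mul1r ler_peMl// exprn_ege1.
Qed.

(** A small deficit forces the vertical stretch [tau' = al / bur] close to 1 on average: by
    [agm_sharp] the derivative of [knothe] dominates a multiple of [(tau' - 1)^2], and the total
    growth of [knothe] is at most [e1]. *)
Lemma slices_rigid r c cB Q eta e1 e2 t1 t2 : 0 < r -> 0 < c -> 0 < cB -> 1 <= Q -> 0 < eta ->
  V b < omega k.+2 * r ^+ k.+2 -> a + 1 <= t1 -> t1 <= t2 -> t2 <= b ->
  (forall s, t1 <= s <= t2 -> [/\ 0 < V s, c <= al s & cB <= bur r s]) ->
  omega k.+1 * r ^+ k.+1 <= c * Q ->
  r * prim a S b - k.+2%:R * prim a A2 b <= e1 ->
  prim a (fun s => al s - A1 s) b <= e2 ->
  `|tau r t2 - tau r t1 - (t2 - t1)| <= k.+1%:R * Q ^+ k.+1 *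
     (eta * (t2 - t1) + (e1 + k.+1%:R * Q * e2) / (eta * cB)).
Proof.
move=> r0 c0 cB0 Q1 eta0 vb at1 t12 t2b inn cQ he1 he2.
have Q0 : 0 < Q by rewrite (lt_le_trans _ Q1).
pose C := k.+1%:R * Q ^+ k.+1.
have C0 : 0 < C by rewrite mulr_gt0// exprn_gt0.
have Vlt s : t1 <= s <= t2 -> V s < omega k.+2 * r ^+ k.+2.
  by move=> /andP[s1 s2]; apply: le_lt_trans vb; apply: slices_vol_nondec; lra.
have c1 := sl_cont1 sl.
have cd : continuous (fun s => al s - A1 s) by move=> x; apply: cvgB; [exact: ca|exact: c1].
have pt s : t1 <= s <= t2 -> `|al s / bur r s - 1| <=
    C * (eta + (knothe' r s + k.+1%:R * Q * (al s - A1 s)) / (eta * cB)).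
  move=> st; have [Vs cs Bs] := inn s st; have a0 := lt_le_trans c0 cs.
  have B0 := lt_le_trans cB0 Bs; have as' : a < s by case/andP: st => ? _; lra.
  have V2 : 0 < V s < omega k.+2 * r ^+ k.+2 by rewrite Vs Vlt.
  have [q q0 [qe gap]] := knothe_gap r0 as' V2 a0.
  have rb : bur r s <= omega k.+1 * r ^+ k.+1.
    rewrite /bur ler_pM2l ?omega_pos// lerXn2r ?nnegrE ?mulr_ge0 ?rho_ge0 ?(ltW r0)//.
    rewrite ler_piMr ?(ltW r0)// -(sqrtr1 R) ler_wsqrtr// lerBlDr lerDl sqr_ge0//.
  have qQ : q <= Q.
    apply: (@ge0_expn_le _ k); rewrite ?(ltW q0) ?(ltW Q0)//.
    apply: (@le_trans _ _ Q); last by rewrite exprS ler_peMr ?(ltW Q0)// exprn_ege1.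
    have -> : q ^+ k.+1 = bur r s / al s.
      apply: (mulfI (x := al s / bur r s)); first by rewrite mulf_neq0 ?invr_eq0 ?gt_eqF.
      by rewrite qe; field; rewrite !gt_eqF.
    rewrite ler_pdivrMr// (le_trans rb)// (le_trans cQ)// mulrC ler_pM2l//.
  have lam0 : 0 < al s / bur r s by rewrite divr_gt0.
  have al_e : al s = al s / bur r s * bur r s by rewrite divfK// gt_eqF.
  move: qe gap lam0 al_e; set lam := al s / bur r s => qe gap lam0 al_e.
  have sharp : lam * (1 - q) ^+ 2 <= lam + k.+1%:R * q - k.+2%:R.
    have := ler_wpM2l (ltW lam0) (agm_sharp k (ltW q0)).
    move=> /le_trans; apply; rewrite exprS !mulrBr !mulrDr mulr1.
    rewrite ![lam * (_ * _)]mulrCA qe ![q * _]mulrC mulrA.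
    by rewrite !mulr1.
  have e0 : lam - 1 = lam * (1 - q ^+ k.+1) by rewrite mulrBr qe mulr1.
  have n1 : `|lam - 1| <= C * (lam * `|1 - q|).
    rewrite e0 normrM (gtr0_norm lam0) mulrCA ler_pM2l//.
    exact: norm_expB (ltW q0) qQ Q1.
  apply: le_trans n1 _; rewrite ler_pM2l//.
  have a1 : 0 <= al s - A1 s by rewrite subr_ge0; have /andP[] := sl_A1 sl s.
  have sq : lam ^+ 2 * (1 - q) ^+ 2 * cB <= knothe' r s + k.+1%:R * Q * (al s - A1 s).
    apply: (@le_trans _ _ (al s * (lam * (1 - q) ^+ 2))).
      have -> : al s * (lam * (1 - q) ^+ 2) = lam ^+ 2 * (1 - q) ^+ 2 * bur r s by rewrite {1}al_e; ring.
      by rewrite ler_wpM2l// mulr_ge0 ?sqr_ge0.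
    have /andP[_ A2l] := sl_A2 sl s.
    apply: (@knothe_gap_arith _ _ _ _ (A2 s) lam q) => //; rewrite ?natr1//; first exact: ltW.
    by rewrite -subr_ge0.
  have x0 : 0 <= lam * `|1 - q| by rewrite mulr_ge0// ltW.
  (* With [x = lam |1 - q|], the pointwise inequality [x <= eta + x^2 / eta] plays the part of
     Cauchy-Schwarz under the integral. *)
  have [le|/ltW ge] := leP (lam * `|1 - q|) eta.
    apply: le_trans le _; rewrite lerDl divr_ge0 ?mulr_ge0 ?(ltW eta0) ?(ltW cB0)//.
    by apply: le_trans sq; rewrite mulr_ge0 ?(ltW cB0)// mulr_ge0 ?sqr_ge0.
  apply: (@le_trans _ _ ((lam ^+ 2 * (1 - q) ^+ 2 * cB) / (eta * cB))); last first.
    by apply: ler_wpDl; rewrite ?(ltW eta0)// ler_pM2r// invr_gt0 mulr_gt0.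
  rewrite ler_pdivlMr ?mulr_gt0// mulrA ler_pM2r//.
  rewrite -exprMn -real_normK ?num_real// normrM (gtr0_norm lam0) expr2.
  by rewrite ler_wpM2l.
(* An antiderivative of the pointwise bound plus [u (tau' - 1)]: it is increasing for both signs
   [u = 1] and [u = -1], which yields the two sides of the estimate without integrating an absolute
   value. *)
have [F FE] : exists F, F = fun u s =>
    C * (eta * s + (knothe r s + k.+1%:R * Q * prim a (fun s => al s - A1 s) s) / (eta * cB))
   + u * (tau r s - s) by eexists.
have [F' F'E] : exists F', F' = fun u s =>
   C * (eta + (knothe' r s + k.+1%:R * Q * (al s - A1 s)) / (eta * cB))
   + u * (al s / bur r s - 1) by eexists.
have Fd u (s : R) : t1 <= s <= t2 -> is_derive s 1 (F u) (F' u s).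
  move=> st; have as' : a < s by case/andP: st => ? _; lra.
  have V2 : 0 < V s < omega k.+2 * r ^+ k.+2 by rewrite Vlt// andbT; have [] := inn s st.
  have d1 := knothe_deriv r0 as' V2; have d2 := prim_deriv cd as'.
  have d3 := tau_deriv r0 as' V2.
  have d4 := is_deriveD d1 (is_deriveZ (k.+1%:R * Q) d2).
  have d5 := is_deriveD (is_deriveZ eta (is_derive_id s 1)) (is_deriveZ (eta * cB)^-1 d4).
  have d6 := is_deriveD (is_deriveZ C d5) (is_deriveZ u (is_deriveB d3 (is_derive_id s 1))).
  rewrite FE F'E (_ : (fun s => _) = C \*: (eta \*: id +
   (eta * cB)^-1 \*: (knothe r + (k.+1%:R * Q) \*: prim a (fun s0 => al s0 - A1 s0))) +
   u \*: (tau r - id)).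
    apply: (is_derive_eq d6).
    by rewrite /GRing.scale/= mulr1 [(_ + _) / (eta * cB)]mulrC.
  by apply/funext => x; rewrite /= [(_ + _) / (eta * cB)]mulrC.
have Finc u : `|u| = 1 -> F u t1 <= F u t2.
  move=> u1; apply: (@deriv_le _ _ (F' u)); first exact: t12.
  - by move=> x /andP[x1 x2]; apply: Fd; rewrite !ltW.
  - move=> x /andP[x1 x2]; have /pt : t1 <= x <= t2 by rewrite !ltW.
    rewrite F'E => h; rewrite -lerBlDr sub0r; apply: le_trans h.
    by apply: le_trans (ler_norm _) _; rewrite normrN normrM u1 mul1r.
  - by move=> x x12; apply: deriv_continuous; exact: Fd.
have kb : knothe r t2 - knothe r t1 <= e1.
  have /andP[h1 _] := @knothe_itv r r0 t1 ltac:(apply/andP; split; lra) vb.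
  have /andP[_ h2] := @knothe_itv r r0 t2 ltac:(apply/andP; split; lra) vb.
  by move: h1 h2 he1; lra.
have pb : prim a (fun s => al s - A1 s) t2 - prim a (fun s => al s - A1 s) t1 <= e2.
  have a1 x : 0 <= al x - A1 x by rewrite subr_ge0; have /andP[] := sl_A1 sl x.
  have : prim a (fun s => al s - A1 s) t2 <= e2 by apply: le_trans he2; apply: prim_nondec => //; lra.
  have : 0 <= prim a (fun s => al s - A1 s) t1 by apply: prim_ge0.
  lra.
have tot : C * (eta * t2 + (knothe r t2 + k.+1%:R * Q * prim a (fun s => al s - A1 s) t2) / (eta * cB)) -
  C * (eta * t1 + (knothe r t1 + k.+1%:R * Q * prim a (fun s => al s - A1 s) t1) / (eta * cB)) <=
   C * (eta * (t2 - t1) + (e1 + k.+1%:R * Q * e2) / (eta * cB)).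
  rewrite -mulrBr ler_pM2l// opprD addrACA -mulrBr lerD2l -mulrBl ler_pM2r ?invr_gt0 ?mulr_gt0//.
  rewrite opprD addrACA -mulrBr; apply: lerD => //.
  by rewrite ler_pM2l// mulr_gt0.
have := Finc 1 (normr1 _); have := Finc (-1) ltac:(by rewrite normrN normr1).
rewrite FE -/C => f1 f2; rewrite ler_norml; apply/andP; split; move: f1 f2 tot; rewrite !mul1r !mulN1r; lra.
Qed.

End slices_theory.

(** The threshold [d] is chosen before the slices, so that it applies uniformly along a sequence of
    approximating functions. *)
Lemma slices_rigidity {R : realType} (k : nat) (r v1 v2 t1 t2 e : R) :
  0 < r -> 0 < v1 -> v1 <= v2 -> v2 < omega k.+2 * r ^+ k.+2 -> t1 <= t2 -> 0 < e ->
  exists2 d, 0 < d & forall (a b : R) (al de P S A1 A2 : R -> R),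
    slices k a b al de P S A1 A2 -> a + 1 <= t1 -> t2 <= b ->
    prim a al b < omega k.+2 * r ^+ k.+2 -> v1 <= prim a al t1 -> prim a al t2 <= v2 ->
    r * prim a S b - k.+2%:R * prim a A2 b <= d ->
    prim a (fun s => al s - A1 s) b <= d -> prim a (fun s => al s - A2 s) b <= d ->
    `|tau k a al r t2 - tau k a al r t1 - (t2 - t1)| <= e.
Proof.
move=> r0 v10 v12 v2r t12 e0.
have oe : 0 < omega k.+2 :> R by exact: omega_pos.
have rk : 0 < r ^+ k.+2 by exact: exprn_gt0.
have v20 := lt_le_trans v10 v12.
(* The ball of radius [r0'] has a volume halfway between [v2] and that of the ball of radius [r]; it
   is the comparison ball for [slices_low]. *)
pose r0' := nroot k.+2 ((v2 / omega k.+2 + r ^+ k.+2) / 2).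
have v2' : v2 / omega k.+2 < r ^+ k.+2 by rewrite ltr_pdivrMr// mulrC.
have v2p : 0 < v2 / omega k.+2 by rewrite divr_gt0.
have rE : r0' ^+ k.+2 = (v2 / omega k.+2 + r ^+ k.+2) / 2 by rewrite nrootK//; lra.
have r0p : 0 < r0'.
  rewrite lt_neqAle nroot_ge0 andbT; apply/eqP => h.
  by move: rE; rewrite -h expr0n/=; lra.
have r0r : r0' < r by rewrite -(@ltr_pXn2r _ k.+2) ?nnegrE ?(ltW r0p) ?(ltW r0)// rE; lra.
have v2r0 : v2 < omega k.+2 * r0' ^+ k.+2.
  by rewrite mulrC -ltr_pdivrMr// rE; lra.
have p1 : r0' / r < 1 by rewrite ltr_pdivrMr// mul1r.
pose w := k.+2%:R * (v1 * (1 - r0' / r)).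
have w0 : 0 < w by rewrite !mulr_gt0// subr_gt0.
(* With errors at most [v1 / 2] and [w / 4], [slices_low] reads [w / 2 - w / 4 <= 2 r al], which is
   this lower bound for [al]. *)
pose c := w / 8 / r.
have c0 : 0 < c by rewrite !divr_gt0.
have V01 v : v1 <= v <= v2 -> 0 < v / r ^+ k.+2 < omega k.+2.
  move=> /andP[h1 h2]; apply/andP; split; first by apply: divr_gt0 => //; exact: lt_le_trans h1.
  by rewrite ltr_pdivrMr//; exact: le_lt_trans v2r.
have /andP[b11 b12] := beta_in (V01 v1 ltac:(by rewrite lexx)).
have /andP[b21 b22] := beta_in (V01 v2 ltac:(by rewrite lexx andbT)).
(* A lower bound for [1 - x^2 = (1 - x)(1 + x)] when [x] runs between the two values of [beta], so
   the slices of the ball do not degenerate. *)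
pose c2 := (1 - beta k (v2 / r ^+ k.+2)) * (1 + beta k (v1 / r ^+ k.+2)).
have c20 : 0 < c2 by rewrite mulr_gt0//; lra.
pose cB := omega k.+1 * (r * Num.sqrt c2) ^+ k.+1.
have cB0 : 0 < cB by rewrite mulr_gt0 ?omega_pos// exprn_gt0// mulr_gt0// sqrtr_gt0.
(* Bounds the horizontal stretch [q], since [q^(k+1) = bur / al] and [Q >= 1]. *)
pose Q := 1 + omega k.+1 * r ^+ k.+1 / c.
have q0 : 0 < omega k.+1 * r ^+ k.+1 / c by rewrite divr_gt0// mulr_gt0 ?omega_pos// exprn_gt0.
have Q1 : 1 <= Q by rewrite lerDl ltW.
have Q0 : 0 < Q by rewrite (lt_le_trans _ Q1).
pose C := k.+1%:R * Q ^+ k.+1.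
have C0 : 0 < C by rewrite mulr_gt0// exprn_gt0.
pose T := t2 - t1 + 1; have T0 : 0 < T by rewrite ltr_wpDl// subr_ge0.
pose eta := e / (2 * C * T).
have eta0 : 0 < eta by rewrite divr_gt0// mulr_gt0// mulr_gt0.
pose g := e * (eta * cB) / (2 * C * (1 + k.+1%:R * Q)).
have kq : 0 < 1 + k.+1%:R * Q by rewrite addr_gt0// mulr_gt0.
have g0 : 0 < g by rewrite divr_gt0// mulr_gt0// mulr_gt0.
pose d := Num.min (v1 / 2) (Num.min (w / 4) g).
have d0 : 0 < d by rewrite !lt_min g0 andbT; apply/andP; split; exact: divr_gt0.
exists d => // a b al de P S A1 A2 sl at1 t2b vb V1 V2 he1 he2 he3.
have ab : a + 1 <= b by clear -at1 t12 t2b; lra.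
have nd := slices_vol_nondec sl.
have inn s : t1 <= s <= t2 -> v1 <= prim a al s <= v2.
  by move=> /andP[h1 h2]; rewrite (le_trans V1) ?(le_trans _ V2)//=; apply: nd; clear -h1 h2 at1; lra.
have d1 : d <= v1 / 2 by rewrite ge_min lexx.
have d2 : d <= w / 4 by rewrite !ge_min lexx orbT.
have d3 : d <= g by rewrite !ge_min lexx !orbT.
have := @slices_rigid R k a b al de P S A1 A2 sl r c cB Q eta d d t1 t2 r0 c0 cB0 Q1 eta0 vb at1 t12 t2b.
move=> H; apply: le_trans (H _ _ he1 he2) _.
- move=> s st; have /andP[s1 s2] := inn s st; split.
  + exact: lt_le_trans s1.
  + have sab : a + 1 <= s <= b by case/andP: st => s3 s4; apply/andP; split; clear -s3 s4 at1 t2b; lra.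
    have := @slices_low R k a b al de P S A1 A2 sl r r0' d d s r0p (ltW r0r) sab vb (le_lt_trans s2 v2r0) he1 he3.
    rewrite /c ler_pdivrMr// [al s * r]mulrC => h.
    have : w / 2 <= k.+2%:R * ((prim a al s - d) * (1 - r0' / r)).
      have -> : w / 2 = k.+2%:R * (v1 / 2 * (1 - r0' / r)) by rewrite /w; field; rewrite gt_eqF.
      by rewrite ler_pM2l// ler_pM2r ?subr_gt0//; clear -s1 d1; lra.
    by move=> h'; clear -h h' d2; lra.
  + rewrite /cB /bur ler_pM2l ?omega_pos// lerXn2r ?nnegrE ?mulr_ge0 ?rho_ge0 ?sqrtr_ge0 ?(ltW r0)//.
    rewrite ler_pM2l// /rho ler_wsqrtr//.
    have m1 : beta k (v1 / r ^+ k.+2) <= beta k (prim a al s / r ^+ k.+2).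
      apply: beta_nondec; first by rewrite divr_ge0 ?ltW.
        by rewrite ler_pM2r// invr_gt0.
      by apply: ltW; have /andP[] := V01 _ (inn s st).
    have m2 : beta k (prim a al s / r ^+ k.+2) <= beta k (v2 / r ^+ k.+2).
      apply: beta_nondec; first by apply: ltW; have /andP[] := V01 _ (inn s st).
        by rewrite ler_pM2r// invr_gt0.
      by apply: ltW; have /andP[] := V01 v2 ltac:(by rewrite lexx andbT).
    move: m1 m2; rewrite /c2; move: (beta k (prim a al s / _)) => x m1 m2.
    have -> : 1 - x ^+ 2 = (1 - x) * (1 + x) by ring.
    by apply: ler_pM; clear -m1 m2 b11 b22; lra.
- by rewrite /Q mulrDr mulr1 [c * (_ / c)]mulrC divfK ?gt_eqF// lerDr ltW.
rewrite -/C.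
have -> : (d + k.+1%:R * Q * d) = (1 + k.+1%:R * Q) * d by rewrite mulrDl mul1r.
have h1 : C * (eta * (t2 - t1)) <= e / 2.
  apply: (@le_trans _ _ (C * (eta * T))); first by rewrite !ler_pM2l// lerDl.
  by rewrite /eta le_eqVlt; apply/orP; left; apply/eqP; field; rewrite !gt_eqF.
have h2 : C * ((1 + k.+1%:R * Q) * d / (eta * cB)) <= e / 2.
  apply: (@le_trans _ _ (C * ((1 + k.+1%:R * Q) * g / (eta * cB)))).
    apply: ler_wpM2l; first exact: ltW.
    apply: ler_wpM2r; first by rewrite invr_ge0 ltW// mulr_gt0.
    by apply: ler_wpM2l => //; exact: ltW.
  rewrite /g; move: kq; move: (1 + k.+1%:R * Q) => z z0.
  by rewrite le_eqVlt; apply/orP; left; apply/eqP; field; rewrite !gt_eqF.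
by rewrite mulrDr; clear -h1 h2; lra.
Qed.

(** * Fubini's theorem in coordinates *)

Section boxes.
Context {R : realType}.
Local Open Scope ereal_scope.

Definition boxes n : set (set 'rV[R]_n) := range box.

Lemma boxI n (ab cd : 'rV[R]_n * 'rV[R]_n) : exists ef, box ab `&` box cd = box ef.
Proof.
exists (\row_i Num.max (ab.1 ord0 i) (cd.1 ord0 i), \row_i Num.min (ab.2 ord0 i) (cd.2 ord0 i))%R.
apply/seteqP; split => x /=.
  move=> [h1 h2] i; rewrite !mxE gt_max le_min.
  by have /andP[-> ->] := h1 i; have /andP[-> ->] := h2 i.
by move=> h; split => i; have := h i; rewrite !mxE gt_max le_min => /andP[/andP[? ?] /andP[? ?]]; apply/andP.
Qed.

Definition bigbox n (k : nat) : 'rV[R]_n * 'rV[R]_n := (const_mx (- k%:R), const_mx k%:R)%R.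

Lemma bigbox_in n (x : 'rV[R]_n) : exists k0, forall k, (k0 <= k)%N -> box (bigbox n k) x.
Proof.
have [k0 hk] : exists k0 : nat, (`|x| < k0%:R)%R.
  by exists (Num.truncn `|x|).+1; rewrite truncnS_gt.
exists k0 => k k0k i; rewrite /= !mxE.
have h : (`|x ord0 i| < k%:R)%R.
  by rewrite (le_lt_trans (norm_coord x i))// (lt_le_trans hk)// ler_nat.
by move: h; rewrite ltr_norml => /andP[-> /ltW ->].
Qed.

Lemma bigcup_bigbox n : \bigcup_k box (bigbox n k) = setT.
Proof.
apply/seteqP; split => // x _; have [k hk] := bigbox_in x.
by exists k => //; exact: hk.
Qed.

Lemma halfspaces_boxes n : <<s @halfspaces R n >> = <<s @boxes n >>.
Proof.
apply/seteqP; split; apply: smallest_sub; try exact: smallest_sigma_algebra; last first.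
  by move=> _ [ab _ <-]; exact: measurable_box.
move=> _ [i [t ->]].
rewrite (_ : [set x | _] = \bigcup_k box (const_mx (- k%:R), \row_j if j == i then t else k%:R)%R).
  apply: (@bigcupT_measurable _ (g_sigma_algebraType (@boxes n))) => k.
  by apply: sub_sigma_algebra; eexists.
apply/seteqP; split => [x /= xt|x [k _ /= h]].
  have [k hk] := bigbox_in x; exists k => // j; have := hk k (leqnn k) j; rewrite /= !mxE.
  by case: eqP => // ->; rewrite xt => /andP[->].
by have := h i; rewrite !mxE eqxx => /andP[].
Qed.

Lemma bV_unique n (m1 m2 : {measure set (@bV R n) -> \bar R}) :
  (forall ab, m1 (box ab) = m2 (box ab)) -> (forall k, m1 (box (bigbox n k)) < +oo) ->
  forall A, measurable A -> m1 A = m2 A.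
Proof.
move=> m12 fin A mA; apply: (@measure_unique _ R (@bV R n) (@boxes n) (fun k => box (bigbox n k)) _ _ _ _ m1 m2) => //.
- exact: halfspaces_boxes.
- by move=> _ _ [ab _ <-] [cd _ <-]; have [ef ->] := boxI ab cd; eexists.
- by move=> k; eexists.
- exact: bigcup_bigbox.
- by move=> _ [ab _ <-]; exact: m12.
Qed.

Definition consp n (p : R * @bV R n) : @bV R n.+1 := consv p.1 (p.2 : 'rV[R]_n).

Lemma measurable_consp n : measurable_fun setT (@consp n).
Proof.
apply: measurable_to_bV => i; case: (unliftP ord0 i) => [j ->|->].
  under eq_fun do rewrite consvS.
  by apply: (measurableT_comp (measurable_coord j)); exact: measurable_snd.
by under eq_fun do rewrite consv0; exact: measurable_fst.
Qed.

Definition prodB n : {measure set (@bV R n.+1) -> \bar R} :=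
  @measure_function_pushforward__canonical__measure_function_Measure _ _ _ _ _
    (lebesgue_measure \x @lebB R n) (@consp n) (@measurable_consp n).

Lemma prodB_box n (ab : 'rV[R]_n.+1 * 'rV[R]_n.+1) : prodB n (box ab) = lebB (box ab).
Proof.
rewrite /lebB lebesgue_box /= /pushforward.
have -> : @consp n @^-1` box ab =
   `]ab.1 ord0 ord0, ab.2 ord0 ord0]%classic `*` box (tlv ab.1, tlv ab.2).
  apply/seteqP; split => -[s y] /=.
    move=> h; split.
      by have := h ord0; rewrite /consp/= consv0 in_itv.
    by move=> i; have := h (lift ord0 i); rewrite /consp/= consvS !mxE.
  move=> [/= hs hy] i; case: (unliftP ord0 i) => [j ->|->].
    by rewrite /consp/= consvS; have := hy j; rewrite !mxE.
  by rewrite /consp/= consv0; move: hs; rewrite in_itv.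
rewrite product_measure1E//; last exact: measurable_box.
rewrite /box_volume big_ord_recl EFinM.
congr (_ * _).
  apply: (eq_trans (lebesgue_measure_itv _)); rewrite /= lte_fin; case: ltP => h.
    by rewrite max_r// subr_ge0 ltW.
  by rewrite max_l// subr_le0.
by apply: (eq_trans (lebesgue_box _)); congr EFin; apply: eq_bigr => i _; rewrite !mxE.
Qed.

Lemma prodBE n (A : set (@bV R n.+1)) : measurable A -> prodB n A = lebB A.
Proof.
move=> mA; apply: bV_unique => //; first exact: prodB_box.
by move=> k; rewrite prodB_box /lebB lebesgue_box ltry.
Qed.

(** By uniqueness on boxes, [lebB] is the image of the product of Lebesgue measure on the line and
    [lebB] in one dimension less. *)
Lemma fubiniV n (h : @bV R n.+1 -> \bar R) : measurable_fun setT h -> (forall x, 0 <= h x) ->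
  \int[@lebB R n.+1]_x h x = \int[lebesgue_measure]_s \int[@lebB R n]_y h (consv s y).
Proof.
move=> mh h0; transitivity (\int[prodB n]_x h x).
  by apply: eq_measure_integral => A mA _; rewrite prodBE.
rewrite ge0_integral_pushforward//; last exact: measurable_consp.
rewrite preimage_setT fubini_tonelli1//.
  by apply: measurableT_comp => //; exact: measurable_consp.
by move=> x; exact: h0.
Qed.

End boxes.

(** * Integrals of compactly supported Lipschitz functions *)

Section lipschitz_functions.
Context {R : realType}.

(** One constant bounds both the values and the slopes. The support is measured in the maximum norm
    [|x|], for which fixing a coordinate costs nothing. *)
Record lipc n (L K : R) (h : 'rV[R]_n -> R) : Prop := Lipc {
  lipc_bd : forall x, `|h x| <= L;
  lipc_lip : forall x y, `|h x - h y| <= L * `|x - y|;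
  lipc_supp : forall x, K <= `|x| -> h x = 0 }.

Definition cub n (K : R) : set (@bV R n) := box (const_mx (- K), const_mx K).

Definition cvol n (K : R) : R := fine (lebB (@cub n K)).

Lemma lebB_cub n K : lebB (@cub n K) = (cvol n K)%:E.
Proof. by rewrite fineK// /lebB /cub lebesgue_box. Qed.

Lemma cvol_ge0 n K : 0 <= cvol n K.
Proof. by rewrite fine_ge0. Qed.

Lemma cub_norm n K (x : 'rV[R]_n) : ~ cub K x -> K <= `|x|.
Proof.
move=> nx; rewrite leNgt; apply/negP => xK; apply: nx => i; rewrite /= !mxE.
have : `|x ord0 i| < K by rewrite (le_lt_trans (norm_coord x i)).
by rewrite ltr_norml => /andP[-> /ltW ->].
Qed.

Lemma measurable_lipc n L K (h : 'rV[R]_n -> R) : lipc L K h -> measurable_fun [set: @bV R n] h.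
Proof. by move=> hl; apply: continuous_measurableV; apply: lip_continuous (lipc_lip hl). Qed.

Lemma lipc_ge0 n L K (h : 'rV[R]_n -> R) : lipc L K h -> 0 <= L.
Proof. by move=> hl; apply: le_trans (lipc_bd hl 0). Qed.

Lemma integral_cub n K (c : R) : 0 <= c -> (\int[@lebB R n]_x (c * \1_(cub K) x)%:E = (c * cvol n K)%:E)%E.
Proof.
move=> c0; under eq_integral do rewrite EFinM.
rewrite ge0_integralZl//; last first.
  by apply/measurable_EFinP; exact: measurable_indic (measurable_box _).
rewrite integral_indic//; last exact: measurable_box.
by rewrite setIT EFinM; congr (_ * _)%E; exact: lebB_cub.
Qed.

Lemma dominated_integrable n K c (h : 'rV[R]_n -> R) : measurable_fun [set: @bV R n] h ->
  (forall x, `|h x| <= c) -> (forall x, K <= `|x| -> h x = 0) ->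
  (@lebB R n).-integrable setT (EFin \o h).
Proof.
move=> mh hc hK; have c0 : 0 <= c by apply: le_trans (hc 0).
apply/integrableP; split; first exact/measurable_EFinP.
apply: (@le_lt_trans _ _ (\int[@lebB R n]_x (c * \1_(cub K) x)%:E)%E); last by rewrite integral_cub// ltry.
apply: ge0_le_integral => //.
- by apply: measurableT_comp => //; exact/measurable_EFinP.
- apply/measurable_EFinP; apply: measurable_funM => //; exact: measurable_indic (measurable_box _).
move=> x _; rewrite /= lee_fin indicE; case: (boolP (x \in _)) => [_|]; first by rewrite mulr1.
by move/negP; rewrite inE => /cub_norm/hK ->; rewrite mulr0 normr0.
Qed.

Definition J n (h : 'rV[R]_n -> R) : R := \int[@lebB R n]_x h x.

Lemma lipc_integrable n L K (h : 'rV[R]_n -> R) : lipc L K h ->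
  (@lebB R n).-integrable setT (EFin \o h).
Proof. move=> hl; apply: dominated_integrable (measurable_lipc hl) (lipc_bd hl) (lipc_supp hl). Qed.

Lemma J_le n L K L' K' (g h : 'rV[R]_n -> R) : lipc L K g -> lipc L' K' h ->
  (forall x, g x <= h x) -> J g <= J h.
Proof. by move=> lg lh gh; apply: le_Rintegral => //; [exact: lipc_integrable lg|exact: lipc_integrable lh]. Qed.

Lemma J_ge0 n (h : 'rV[R]_n -> R) : (forall x, 0 <= h x) -> 0 <= J h.
Proof. by move=> h0; apply: Rintegral_ge0. Qed.

Lemma JD n L K L' K' (g h : 'rV[R]_n -> R) : lipc L K g -> lipc L' K' h ->
  J (fun x => g x + h x) = J g + J h.
Proof. by move=> lg lh; apply: RintegralD => //; [exact: lipc_integrable lg|exact: lipc_integrable lh]. Qed.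

Lemma JB n L K L' K' (g h : 'rV[R]_n -> R) : lipc L K g -> lipc L' K' h ->
  J (fun x => g x - h x) = J g - J h.
Proof. by move=> lg lh; apply: RintegralB => //; [exact: lipc_integrable lg|exact: lipc_integrable lh]. Qed.

Lemma JZ n L K c (h : 'rV[R]_n -> R) : lipc L K h -> J (fun x => c * h x) = c * J h.
Proof. by move=> lh; apply: RintegralZl => //; exact: lipc_integrable lh. Qed.

Lemma J_bound n K c (h : 'rV[R]_n -> R) : measurable_fun [set: @bV R n] h ->
  (forall x, `|h x| <= c) -> (forall x, K <= `|x| -> h x = 0) -> `|J h| <= c * cvol n K.
Proof.
move=> mh hc hK; have c0 : 0 <= c by apply: le_trans (hc 0).
have hi := dominated_integrable mh hc hK.
rewrite -lee_fin EFin_normr_Rintegral//.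
apply: (le_trans (le_abse_integral _ _ _)) => //; first exact/measurable_EFinP.
rewrite -(integral_cub _ _ c0); apply: ge0_le_integral => //.
- by apply: measurableT_comp => //; exact/measurable_EFinP.
- apply/measurable_EFinP; apply: measurable_funM => //; exact: measurable_indic (measurable_box _).
move=> x _; rewrite /= lee_fin indicE; case: (boolP (x \in _)) => [_|]; first by rewrite mulr1.
by move/negP; rewrite inE => /cub_norm/hK ->; rewrite mulr0 normr0.
Qed.

Lemma lipc_add n L K L' K' (g h : 'rV[R]_n -> R) : lipc L K g -> lipc L' K' h ->
  lipc (L + L') (Num.max K K') (fun x => g x + h x).
Proof.
move=> lg lh; split => [x|x y|x].
- by apply: le_trans (ler_normD _ _) _; apply: lerD; [exact: (lipc_bd lg)|exact: (lipc_bd lh)].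
- rewrite opprD addrACA; apply: le_trans (ler_normD _ _) _; rewrite mulrDl.
  by apply: lerD; [exact: (lipc_lip lg)|exact: (lipc_lip lh)].
- by rewrite ge_max => /andP[h1 h2]; rewrite (lipc_supp lg)// (lipc_supp lh)// addr0.
Qed.

Lemma lipc_scale n L K c (h : 'rV[R]_n -> R) : lipc L K h -> lipc (`|c| * L) K (fun x => c * h x).
Proof.
move=> lh; split => [x|x y|x Kx].
- by rewrite normrM ler_wpM2l//; exact: (lipc_bd lh).
- by rewrite -mulrBr normrM -mulrA ler_wpM2l//; exact: (lipc_lip lh).
- by rewrite (lipc_supp lh)// mulr0.
Qed.

Lemma norm_consv n (s : R) (y : 'rV[R]_n) : `|y| <= `|consv s y|.
Proof.
by apply: norm_le_coord => // i; rewrite -(consvS s y); exact: norm_coord.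
Qed.

Lemma norm_consv0 n (s : R) (y : 'rV[R]_n) : `|s| <= `|consv s y|.
Proof. by rewrite -{1}(consv0 s y); exact: norm_coord. Qed.

Lemma consvB n s t (y z : 'rV[R]_n) : consv s y - consv t z = consv (s - t) (y - z).
Proof.
apply/rowP => i; case: (unliftP ord0 i) => [j ->|->].
  by rewrite !mxE !liftK !mxE.
by rewrite !mxE !unlift_none.
Qed.

Lemma norm_consv_le n (s : R) (y : 'rV[R]_n) M : 0 <= M -> `|s| <= M -> `|y| <= M -> `|consv s y| <= M.
Proof.
move=> M0 sM yM; apply: norm_le_coord => // i; case: (unliftP ord0 i) => [j ->|->].
  by rewrite consvS (le_trans (norm_coord _ _)).
by rewrite consv0.
Qed.

Lemma lipc_slice n L K (h : 'rV[R]_n.+1 -> R) s : lipc L K h -> lipc L K (fun y => h (consv s y)).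
Proof.
move=> lh; split => [x|x y|x Kx].
- exact: (lipc_bd lh).
- apply: (le_trans (lipc_lip lh _ _)); rewrite ler_wpM2l ?(lipc_ge0 lh)//.
  by rewrite consvB subrr norm_consv_le// normr0.
- by apply: (lipc_supp lh); exact: le_trans Kx (norm_consv _ _).
Qed.

Lemma J_slice_lip n L K (h : 'rV[R]_n.+1 -> R) s t : lipc L K h ->
  `|J (fun y => h (consv s y)) - J (fun y => h (consv t y))| <= L * `|s - t| * cvol n K.
Proof.
move=> lh; have ls := lipc_slice s lh; have lt := lipc_slice t lh.
rewrite -(JB ls lt); apply: J_bound.
- by apply: measurable_funB; [exact: measurable_lipc ls|exact: measurable_lipc lt].
- move=> y; apply: (le_trans (lipc_lip lh _ _)); rewrite ler_wpM2l ?(lipc_ge0 lh)//.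
  by rewrite consvB subrr norm_consv_le// normr0.
- by move=> y Ky; rewrite (lipc_supp ls)// (lipc_supp lt)// subrr.
Qed.

Lemma J_slice_continuous n L K (h : 'rV[R]_n.+1 -> R) : lipc L K h ->
  continuous (fun s => J (fun y => h (consv s y))).
Proof.
move=> lh s; apply/cvgrPdist_lt => e e0.
have c0 : 0 < L * cvol n K + 1 by rewrite ltr_wpDl// mulr_ge0 ?cvol_ge0// (lipc_ge0 lh).
apply/nbhs_ballP; exists (e / (L * cvol n K + 1)) => /=; first exact: divr_gt0.
move=> t st'; have st : `|s - t| < e / (L * cvol n K + 1) := st'.
apply: (le_lt_trans (J_slice_lip s t lh)).
rewrite mulrAC; apply: (@le_lt_trans _ _ ((L * cvol n K + 1) * `|s - t|)).
  by rewrite ler_wpM2r// lerDl.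
by rewrite mulrC -ltr_pdivlMr.
Qed.

Lemma JE n L K (h : 'rV[R]_n -> R) : lipc L K h -> (J h)%:E = (\int[@lebB R n]_x (h x)%:E)%E.
Proof. by move=> lh; rewrite /J/= fineK//; apply: integrable_fin_num => //; exact: lipc_integrable lh. Qed.

Lemma J_fubini n L K a b (h : 'rV[R]_n.+1 -> R) : lipc L K h -> (forall x, 0 <= h x) ->
  a <= - K -> K <= b -> J h = prim a (fun s => J (fun y => h (consv s y))) b.
Proof.
move=> lh h0 aK Kb; rewrite /J [in LHS]/Rintegral fubiniV; last 2 first.
- by apply/measurable_EFinP; exact: measurable_lipc lh.
- by move=> x; rewrite lee_fin.
rewrite /prim Rintegral_mkcond /Rintegral; congr fine.
apply: eq_integral => s _; rewrite -(JE (lipc_slice s lh)) patchE.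
case: ifPn => // /negP sab; congr EFin.
have Ks : K <= `|s|.
  rewrite leNgt; apply/negP; rewrite ltr_norml => /andP[s1 s2]; apply: sab.
  by rewrite inE/= in_itv/=; apply/andP; split; lra.
rewrite /J; under eq_Rintegral do rewrite (lipc_supp lh) ?(le_trans Ks (norm_consv0 _ _))//.
by rewrite Rintegral_cst// mul0r.
Qed.

(** The slices of a function on the line are functions on a point, whose measure is the empty
    product 1. *)
Lemma JE0 (h : 'rV[R]_0 -> R) : J h = h 0.
Proof.
rewrite /J (_ : h = cst (h 0)); last by apply/funext => x; congr h; apply/rowP => -[].
rewrite Rintegral_cst// (_ : fine _ = 1) ?mulr1//.
have -> : [set: @bV R 0] = box (0, 0) by apply/seteqP; split => // x _ [].
by rewrite [X in fine X]lebesgue_box /box_volume big_ord0.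
Qed.

End lipschitz_functions.

(** * The isoperimetric inequality for functions *)

Section c11_class.
Context {R : realType}.

(** C^{1,1} expressed by a Taylor bound with an explicit gradient [G]: in this form it passes to
    slices, products, convolutions and stretchings with computable constants. *)
Record c11 n (L K : R) (u : 'rV[R]_n -> R) (G : 'rV[R]_n -> 'rV[R]_n) : Prop := C11 {
  c11_01 : forall x, 0 <= u x <= 1;
  c11_lip : lipc L K u;
  c11_grad : forall i, lipc L K (fun x => G x 0 i);
  c11_taylor : forall x z, `|u (x + z) - u x - dotv (G x) z| <= L * `|z| ^+ 2 }.

Lemma lipc_enorm n L K (G : 'rV[R]_n -> 'rV[R]_n) : 0 <= L -> (forall i, lipc L K (fun x => G x 0 i)) ->
  lipc (n%:R * L) K (fun x => enorm (G x)).
Proof.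
move=> L0 lG; split => [x|x y|x Kx].
- rewrite ger0_norm//; apply: (le_trans (enorm_le_norm _)); rewrite ler_wpM2l//.
  by apply: norm_le_coord => // i; exact: (lipc_bd (lG i)).
- apply: (le_trans (enorm_lip _ _)); rewrite -mulrA ler_wpM2l//.
  apply: norm_le_coord => [|i]; first by rewrite mulr_ge0.
  by rewrite !mxE; exact: (lipc_lip (lG i)).
- rewrite (_ : G x = 0) ?enorm0//; apply/rowP => i; rewrite mxE; exact: (lipc_supp (lG i)).
Qed.

(** The power [u^(1 + 1/m)]: the divergence of the transport of [u] in dimension [m] is at least
    [m u^(1/m)], and it is integrated against [u]. *)
Definition upow n m (u : 'rV[R]_n -> R) (x : 'rV[R]_n) : R := u x * nroot m (u x).

Lemma upow_lip1 m (a b : R) : 0 <= b -> b <= a -> a <= 1 ->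
  a * nroot m.+1 a - b * nroot m.+1 b <= 2 * (a - b).
Proof.
move=> b0 ba a1; have a0 := le_trans b0 ba.
pose x := nroot m.+1 a; pose y := nroot m.+1 b.
have x0 : 0 <= x by exact: nroot_ge0. have y0 : 0 <= y by exact: nroot_ge0.
have x1 : x <= 1 by rewrite nroot_le1// a0.
have y1 : y <= 1 by rewrite nroot_le1// b0 (le_trans ba).
have xa : x ^+ m.+1 = a by rewrite nrootK.
have yb : y ^+ m.+1 = b by rewrite nrootK.
have yx : y <= x by apply: (@ge0_expn_le _ m) => //; rewrite xa yb.
have h1 : y ^+ m * (x - y) <= a - b.
  rewrite -xa -yb !exprS mulrBr [y ^+ m * y]mulrC lerD2r [_ * x]mulrC ler_wpM2l//.
  by rewrite lerXn2r ?nnegrE.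
have h2 : b * (x - y) <= y ^+ m * (x - y).
  rewrite ler_wpM2r ?subr_ge0// -yb exprS ler_piMl ?exprn_ge0//.
rewrite -/x -/y; have -> : a * x - b * y = x * (a - b) + b * (x - y) by ring.
have h3 : x * (a - b) <= a - b by rewrite ler_piMl ?subr_ge0.
lra.
Qed.

Lemma lipc_upow n m L K (u : 'rV[R]_n -> R) : (forall x, 0 <= u x <= 1) -> lipc L K u ->
  lipc (2 * L) K (upow m.+1 u).
Proof.
move=> u01 lu; have L0 := lipc_ge0 lu; split => [x|x y|x Kx].
- have /andP[ux0 ux1] := u01 x.
  rewrite /upow ger0_norm ?mulr_ge0 ?nroot_ge0//; apply: (@le_trans _ _ (u x)).
    by rewrite ler_piMr// nroot_le1// ux0.
  have := lipc_bd lu x; rewrite ger0_norm// => h; lra.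
- wlog yx : x y / u y <= u x => [W|].
    have [|/ltW] := leP (u y) (u x); first exact: W.
    by move=> /W; rewrite distrC [`|y - x|]distrC.
  have /andP[ux0 ux1] := u01 x; have /andP[uy0 uy1] := u01 y.
  have h := upow_lip1 m uy0 yx ux1.
  have h1 : u y * nroot m.+1 (u y) <= u x * nroot m.+1 (u x).
    apply: ler_pM => //; first exact: nroot_ge0.
    by rewrite ge0_ler_powR ?nnegrE// invr_ge0.
  rewrite /upow ger0_norm ?subr_ge0//; apply: le_trans h _; rewrite -mulrA ler_pM2l//.
  by apply: le_trans (lipc_lip lu x y); exact: ler_norm.
- by rewrite /upow (lipc_supp lu)// mul0r.
Qed.

Lemma upow01 n m (u : 'rV[R]_n -> R) x : 0 <= u x <= 1 -> 0 <= upow m.+1 u x <= u x.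
Proof.
move=> /andP[u0 u1]; rewrite mulr_ge0 ?nroot_ge0//= ler_piMr// nroot_le1// u0//.
Qed.

Lemma consvD0 n s (y z : 'rV[R]_n) : consv s (y + z) = consv s y + consv 0 z.
Proof.
apply/rowP => i; case: (unliftP ord0 i) => [j ->|->].
  by rewrite consvS !mxE !liftK.
by rewrite !mxE !unlift_none addr0.
Qed.

Lemma dotv_consv n s (x : 'rV[R]_n.+1) (z : 'rV[R]_n) : dotv x (consv s z) = x 0 ord0 * s + dotv (tlv x) z.
Proof.
rewrite /dotv big_ord_recl consv0; congr (_ + _).
by apply: eq_bigr => i _; rewrite consvS mxE.
Qed.

Lemma dotv0r n (x : 'rV[R]_n) : dotv x 0 = 0.
Proof. by apply: big1 => i _; rewrite mxE mulr0. Qed.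

Lemma c11_slice n L K (u : 'rV[R]_n.+1 -> R) G s : c11 L K u G ->
  c11 L K (fun y => u (consv s y)) (fun y => tlv (G (consv s y))).
Proof.
move=> cu; have L0 := lipc_ge0 (c11_lip cu); split => [x||i|x z].
- exact: (c11_01 cu).
- exact: lipc_slice (c11_lip cu).
- have := lipc_slice s (c11_grad cu (lift ord0 i)); congr lipc.
  by apply/funext => y; rewrite mxE.
- have := c11_taylor cu (consv s x) (consv 0 z); rewrite -consvD0 dotv_consv mulr0 add0r.
  move=> /le_trans; apply; rewrite ler_wpM2l// lerXn2r ?nnegrE//.
  by rewrite norm_consv_le// normr0.
Qed.

(** Cauchy-Schwarz against the vector [(-t, sqrt(r^2 - t^2))] of length [r]: a point of the ball at
    height [t] has a horizontal part no longer than the second entry. *)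
Lemma cauchy2 (x y r t : R) : 0 <= y -> `|t| <= r ->
  - t * x + Num.sqrt (r ^+ 2 - t ^+ 2) * y <= r * Num.sqrt (x ^+ 2 + y ^+ 2).
Proof.
move=> y0 tr; have r0 : 0 <= r by apply: le_trans tr.
have t2 : 0 <= r ^+ 2 - t ^+ 2.
  by rewrite subr_ge0 -(real_normK (num_real t)) lerXn2r ?nnegrE.
pose w := Num.sqrt (r ^+ 2 - t ^+ 2); have w0 : 0 <= w by exact: sqrtr_ge0.
have w2 : w ^+ 2 = r ^+ 2 - t ^+ 2 by rewrite sqr_sqrtr.
have s0 : 0 <= x ^+ 2 + y ^+ 2 by rewrite addr_ge0 ?sqr_ge0.
rewrite -/w; have [le|/ltW ge] := leP (- t * x + w * y) 0.
  by apply: le_trans le _; rewrite mulr_ge0// sqrtr_ge0.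
rewrite -(@ler_pXn2r _ 2) ?nnegrE ?mulr_ge0 ?sqrtr_ge0//.
rewrite exprMn sqr_sqrtr//.
have := sqr_ge0 (t * y + w * x).
have -> : r ^+ 2 = w ^+ 2 + t ^+ 2 by rewrite w2 subrK.
move=> h; rewrite -subr_ge0.
by rewrite (_ : _ - (- t * x + w * y) ^+ 2 = (t * y + w * x) ^+ 2)//; ring.
Qed.

Definition gradJ n (G : 'rV[R]_n -> 'rV[R]_n) := J (fun x => enorm (G x)).

(* The Sobolev-type form of the isoperimetric inequality in dimension [k.+1]. *)
Definition gromov_ineq k := forall L K (u : 'rV[R]_k.+1 -> R) G th, c11 L K u G -> 0 <= th ->
  J u <= omega k.+1 * th ^+ k.+1 -> k.+1%:R * J (upow k.+1 u) <= th * gradJ G.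

(** The Taylor bound allows differentiation under the integral, [cauchy2] gives [sl_S], the
    inequality in dimension [k + 1] applied to a slice is [sl_iso], and the arithmetic-geometric
    inequality integrated over a slice is [sl_agm]. *)
Lemma c11_slices k L K (u : 'rV[R]_k.+2 -> R) G a b : c11 L K u G -> gromov_ineq k ->
  a + 1 <= - K -> K <= b - 1 ->
  slices k a b (fun s => J (fun y => u (consv s y)))
    (fun s => J (fun y => G (consv s y) 0 ord0))
    (fun s => gradJ (fun y => tlv (G (consv s y))))
    (fun s => J (fun y => enorm (G (consv s y))))
    (fun s => J (upow k.+1 (fun y => u (consv s y))))
    (fun s => J (upow k.+2 (fun y => u (consv s y)))).
Proof.
move=> cu IH aK Kb; have lu := c11_lip cu; have lG := c11_grad cu.
have L0 := lipc_ge0 lu.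
have u01 := c11_01 cu.
have lE := lipc_enorm L0 lG.
have lp m := lipc_upow m u01 lu.
have lps s m := lipc_upow m (fun y => u01 (consv s y)) (lipc_slice s lu).
have lT s := lipc_enorm L0 (c11_grad (c11_slice s cu)).
have out s : K <= `|s| -> J (fun y => u (consv s y)) = 0.
  move=> Ks; rewrite (_ : (fun y => _) = cst 0) /J ?Rintegral_cst ?mul0r//.
  by apply/funext => y; apply: (lipc_supp lu); exact: le_trans Ks (norm_consv0 _ _).
split.
- move=> s; apply: deriv_eps => e e0.
  have c0 : 0 < L * cvol k.+1 (K + 1) + 1 by rewrite ltr_wpDl// mulr_ge0 ?cvol_ge0.
  exists (Num.min 1 (e / (L * cvol k.+1 (K + 1) + 1))); first by rewrite lt_min ltr01 divr_gt0.
  move=> t; rewrite lt_min => /andP[t1 te].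
  have g1 := lipc_slice t lu; have g2 := lipc_slice s lu; have g3 := lipc_slice s (lG ord0).
  rewrite mulrC -(JZ _ g3) -(JB g1 g2).
  have g4 := lipc_add g1 (lipc_scale (-1) g2); have g5 := lipc_scale (t - s) g3.
  rewrite (_ : (fun x => u (consv t x) - u (consv s x)) =
    (fun x => u (consv t x) + (-1) * u (consv s x))); last by apply/funext => x; rewrite mulN1r.
  rewrite -(JB g4 g5).
  apply: (@le_trans _ _ (L * `|t - s| ^+ 2 * cvol k.+1 (K + 1))).
    apply: J_bound.
    + by apply: measurable_funB; [exact: measurable_lipc g4|exact: measurable_lipc g5].
    + move=> y; have := c11_taylor cu (consv s y) (consv (t - s) 0).
      rewrite dotv_consv (_ : consv s y + consv (t - s) 0 = consv t y); last first.
        by rewrite -[X in X + _]subr0 -(subr0 (consv (t - s) 0)); apply/rowP => i;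
          case: (unliftP ord0 i) => [j ->|->]; rewrite !mxE ?liftK ?unlift_none ?mxE; ring.
      rewrite dotv0r addr0 mulN1r [_ * (t - s)]mulrC => /le_trans; apply.
      rewrite ler_wpM2l// lerXn2r ?nnegrE// norm_consv_le// normr0//.
    + move=> y Ky; have Ky' : K <= `|y| by apply: le_trans Ky; rewrite lerDl.
      by rewrite (lipc_supp g4) ?(lipc_supp g5) ?subrr// maxxx.
  rewrite (_ : L * `|t - s| ^+ 2 * cvol k.+1 (K + 1) = L * cvol k.+1 (K + 1) * `|t - s| * `|t - s|); last by ring.
  rewrite ler_wpM2r//.
  apply: (@le_trans _ _ ((L * cvol k.+1 (K + 1) + 1) * `|t - s|)).
    by rewrite ler_wpM2r// lerDl.
  by rewrite mulrC -ler_pdivlMr// ltW.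
- exact: J_slice_continuous lE.
- exact: J_slice_continuous (lp k).
- exact: J_slice_continuous (lp k.+1).
- by move=> s; apply: J_ge0 => y; have /andP[] := u01 (consv s y).
- by move=> s sa; apply: out; rewrite ler_normr; apply/orP; right; clear -sa aK; lra.
- by move=> s sa; apply: out; rewrite ler_normr; apply/orP; left; clear -sa Kb; lra.
- by move=> s; apply: J_ge0.
- move=> s r t tr; have g1 := lipc_slice s (lG ord0); have g3 := lipc_slice s lE.
  have g4 := lipc_scale (- t) g1; have g5 := lipc_scale (Num.sqrt (r ^+ 2 - t ^+ 2)) (lT s).
  rewrite -(JZ _ g1) /gradJ -(JZ _ (lT s)) -(JD g4 g5) -(JZ r g3).
  apply: (J_le (lipc_add g4 g5) (lipc_scale r g3)) => y.
  have := cauchy2 (G (consv s y) 0 ord0) (enorm_ge0 (tlv (G (consv s y)))) tr.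
  by rewrite -sqr_enorm_tlv sqrtr_sqr ger0_norm.
- move=> s; apply/andP; split.
    by apply: J_ge0 => y; have /andP[] := upow01 k (u01 (consv s y)).
  apply: (J_le (lps s k) (lipc_slice s lu)) => y.
  by have /andP[] := @upow01 _ k (fun y => u (consv s y)) y (u01 (consv s y)).
- move=> s; apply/andP; split.
    by apply: J_ge0 => y; have /andP[] := upow01 k.+1 (u01 (consv s y)).
  apply: (J_le (lps s k.+1) (lipc_slice s lu)) => y.
  by have /andP[] := @upow01 _ k.+1 (fun y => u (consv s y)) y (u01 (consv s y)).
- move=> s th th0 h; apply: (IH _ _ _ _ _ (c11_slice s cu)) => //.
  by rewrite h.
- move=> s l q l0 q0 lq.
  have g1 := lipc_slice s lu; have g2 := lps s k; have g3 := lps s k.+1.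
  rewrite -(JZ _ g1) -(JZ q g2) -(JZ _ (lipc_scale q g2)) -(JZ _ g3).
  rewrite -(JD (lipc_scale l g1) (lipc_scale _ (lipc_scale q g2))).
  apply: (J_le (lipc_scale _ g3) (lipc_add (lipc_scale l g1) (lipc_scale _ (lipc_scale q g2)))) => y.
  rewrite /upow; have := u01 (consv s y); move: (u (consv s y)) => v /andP[v0 v1].
  (* With [l q^(k+1) = 1], the numbers [l] and [k + 1] copies of [q v^(1/(k+1))] have the geometric
     mean [v^(1/(k+2))]. *)
  have := @agm _ k l (q * nroot k.+1 v) (nroot k.+2 v) l0 (mulr_ge0 q0 (nroot_ge0 _ _)) (nroot_ge0 _ _).
  have e : nroot k.+2 v ^+ k.+2 = l * (q * nroot k.+1 v) ^+ k.+1.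
    by rewrite nrootK// exprMn (nrootK k v0) mulrA lq mul1r.
  move=> /(_ e)/(ler_wpM2l v0).
  by rewrite mulrDr [v * (_ * nroot k.+2 v)]mulrCA [v * l]mulrC [v * (k.+1%:R * _)]mulrCA [v * (q * _)]mulrCA.
Qed.

Lemma c11_J_fubini k L K (u : 'rV[R]_k.+1 -> R) G a b m : c11 L K u G -> a <= - K -> K <= b ->
  [/\ J u = prim a (fun s => J (fun y => u (consv s y))) b,
    gradJ G = prim a (fun s => J (fun y => enorm (G (consv s y)))) b &
    J (upow m.+1 u) = prim a (fun s => J (upow m.+1 (fun y => u (consv s y)))) b].
Proof.
move=> cu aK Kb; have u01 := c11_01 cu; split.
- by apply: J_fubini (c11_lip cu) _ aK Kb => x; have /andP[] := u01 x.
- exact: J_fubini (lipc_enorm (lipc_ge0 (c11_lip cu)) (c11_grad cu)) _ aK Kb.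
- apply: J_fubini (lipc_upow m u01 (c11_lip cu)) _ aK Kb => x.
  by have /andP[] := upow01 m (u01 x).
Qed.

Lemma gromov_step k : gromov_ineq k -> gromov_ineq k.+1.
Proof.
move=> IH L K u G th cu th0 h.
have [a aE] : exists a, a = - (`|K| + 1) by eexists.
have [b bE] : exists b, b = `|K| + 2 by eexists.
have aK : a + 1 <= - K by rewrite aE; have := ler_norm K; clear; lra.
have Kb : K <= b - 1 by rewrite bE; have := ler_norm K; clear; lra.
have aK' : a <= - K by clear -aK; lra.
have Kb' : K <= b by clear -Kb; lra.
have [e1 e2 e3] := @c11_J_fubini _ _ _ _ _ a b k.+1 cu aK' Kb'.
have sl := c11_slices cu IH aK Kb.
rewrite e2 e3; apply: (slices_iso sl) => //.
  by rewrite aE bE; have := normr_ge0 K; clear; lra.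
by rewrite -e1.
Qed.

Lemma omega1_le2 : omega 1 <= 2 :> R.
Proof.
rewrite -lee_fin -omegaE; apply: (@le_trans _ _ (lebesgue_outer (@cub R 1 1))).
  apply: le_outer_measure => x; rewrite /eball/= subr0 => x1 i; rewrite !mxE.
  by have := le_lt_trans (abs_le_enorm x i) x1; rewrite ltr_norml => /andP[-> /ltW ->].
rewrite /cub lebesgue_box /box_volume big_ord_recl big_ord0 !mxE/= mulr1 lee_fin max_r; lra.
Qed.

(** On the line a compactly supported function rises and falls, so twice its maximum is at most its
    total variation. Integrating against [u] itself gives the claim because [upow 1 u = u^2] and
    [omega 1 <= 2]. *)
Lemma gromov_base : gromov_ineq 0.
Proof.
move=> L K u G th cu th0 h; have lu := c11_lip cu; have L0 := lipc_ge0 lu.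
have [a aE] : exists a, a = - (`|K| + 1) by eexists.
have [b bE] : exists b, b = `|K| + 2 by eexists.
have aK : a + 1 <= - K by rewrite aE; have := ler_norm K; clear; lra.
have Kb : K <= b - 1 by rewrite bE; have := ler_norm K; clear; lra.
have aK' : a <= - K by clear -aK; lra.
have Kb' : K <= b by clear -Kb; lra.
have ab : a < b by rewrite aE bE; have := normr_ge0 K; clear; lra.
have [e1 e2 e3] := @c11_J_fubini _ _ _ _ _ a b 0 cu aK' Kb'.
pose v s := u (consv s 0); pose w s := G (consv s 0) 0 ord0.
have [e1' e2' e3'] : [/\ J u = prim a v b, gradJ G = prim a (fun s => `|w s|) b &
    J (upow 1 u) = prim a (fun s => v s * v s) b].
  rewrite e1 e2 e3; split; apply: prim_eq => s _; rewrite JE0//.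
    apply/eqP; rewrite -(@eqrXn2 _ 2)//; apply/eqP; rewrite real_normK ?num_real// sqr_enorm_tlv (_ : tlv _ = 0) ?enorm0 ?expr0n ?addr0//.
    by apply/rowP => -[].
  by rewrite /upow /nroot invr1 powRr1//; have /andP[] := c11_01 cu (consv s 0).
have cv : continuous v.
  have -> : v = (fun s => J (fun y => u (consv s y))) by apply/funext => s; rewrite JE0.
  exact: J_slice_continuous lu.
have cw : continuous w.
  have -> : w = (fun s => J (fun y => G (consv s y) 0 ord0)) by apply/funext => s; rewrite JE0.
  exact: J_slice_continuous (c11_grad cu ord0).
have cnw : continuous (fun s => `|w s|) by move=> s; apply: cvg_norm; exact: cw.
have v0 s : 0 <= v s by have /andP[] := c11_01 cu (consv s 0).
have vd (s : R) : is_derive s 1 v (w s).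
  apply: deriv_eps => e e0.
  exists (e / (L + 1)); first by rewrite divr_gt0// ltr_wpDl.
  move=> t te; have := c11_taylor cu (consv s 0) (consv (t - s) 0).
  rewrite dotv_consv (_ : consv s 0 + consv (t - s) 0 = consv t 0); last first.
    by apply/rowP => i; case: (unliftP ord0 i) => [j ->|->]; rewrite !mxE ?liftK ?unlift_none ?mxE; ring.
  rewrite dotv0r addr0 -/(v t) -/(v s) -/(w s) => /le_trans; apply.
  apply: (@le_trans _ _ (L * `|t - s| ^+ 2)).
    by rewrite ler_wpM2l// lerXn2r ?nnegrE// norm_consv_le// normr0.
  rewrite expr2 mulrA ler_wpM2r//; apply: (@le_trans _ _ ((L + 1) * `|t - s|)).
    by rewrite ler_wpM2r// lerDl.
  by rewrite mulrC -ler_pdivlMr ?ltW// ltr_wpDl.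
have W0 : 0 <= prim a (fun s => `|w s|) b by apply: prim_ge0.
have out s : K <= `|s| -> v s = 0.
  by move=> Ks; apply: (lipc_supp lu); exact: le_trans Ks (norm_consv0 _ _).
(* The primitive from [a] is differentiated only to the right of [a], so the comparison starts at
   [a + 1/2], still outside the support. *)
have va : v (a + 1/2) = 0 by apply: out; rewrite ler_normr; apply/orP; right; clear -aK; lra.
have vb : v b = 0 by apply: out; rewrite ler_normr Kb'.
pose W := prim a (fun s => `|w s|).
have dW s : a < s -> is_derive s 1 W `|w s| by exact: prim_deriv.
have key s : a + 1/2 <= s <= b -> 2 * v s <= W b.
  move=> /andP[sa sb].
  have h1 : W (a + 1/2) - v (a + 1/2) <= W s - v s.
    apply: (@deriv_le _ (fun s => W s - v s) (fun s => `|w s| - w s)) => //.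
    - move=> x /andP[x1 x2]; have ax : a < x by clear -x1; lra.
      exact: (is_deriveB (dW x ax) (vd x)).
    - by move=> x _; rewrite subr_ge0 ler_norm.
    - move=> x /andP[x1 x2]; have ax : a < x by clear -x1; lra.
      apply: cvgB; [exact: prim_cont|exact: cv].
  have h2 : W s + v s <= W b + v b.
    apply: (@deriv_le _ (fun s => W s + v s) (fun s => `|w s| + w s)) => //.
    - move=> x /andP[x1 x2]; have ax : a < x by clear -x1 sa; lra.
      exact: (is_deriveD (dW x ax) (vd x)).
    - by move=> x _; have := ler_norm (- w x); rewrite normrN; clear; lra.
    - move=> x /andP[x1 x2]; have ax : a < x by clear -x1 sa; lra.
      apply: cvgD; [exact: prim_cont|exact: cv].
  have h3 : 0 <= W (a + 1/2) by apply: prim_ge0.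
  by move: h1 h2 h3; rewrite va vb; clear; lra.
have cvv : continuous (fun s => v s * v s) by move=> s; apply: cvgM; exact: cv.
have : 2 * prim a (fun s => v s * v s) b <= W b * prim a v b.
  rewrite -!primZ//; apply: prim_le.
  - by move=> s; apply: cvgM; [exact: cvg_cst|exact: cvv].
  - by move=> s; apply: cvgM; [exact: cvg_cst|exact: cv].
  move=> s /andP[sa sb]; rewrite mulrA; have [s1|s1] := leP (a + 1/2) s.
    by rewrite ler_wpM2r// key// s1.
  by rewrite out ?mulr0// ler_normr; apply/orP; right; clear -s1 aK; lra.
rewrite -e1' -/W => h1; rewrite mul1r e3' e2' -/W.
have h2 : W b * J u <= W b * (2 * th).
  rewrite ler_wpM2l//; apply: le_trans h _; rewrite expr1 ler_wpM2r//; exact: omega1_le2.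
by move: h1 h2; clear; lra.
Qed.

Lemma gromov k : gromov_ineq k.
Proof. by elim: k => [|k]; [exact: gromov_base|exact: gromov_step]. Qed.

End c11_class.

(** * Perimeter by smooth approximation *)

Section bv_perimeter.
Context {R : realType}.

Lemma ge0_integral_leD d (T : measurableType d) (mu : {measure set T -> \bar R}) (D : set T) (f g h : T -> R) :
  measurable D -> measurable_fun setT f -> measurable_fun setT g -> measurable_fun setT h ->
  (forall x, 0 <= f x) -> (forall x, 0 <= g x) -> (forall x, 0 <= h x) ->
  (forall x, f x <= g x + h x) ->
  (\int[mu]_(x in D) (f x)%:E <= \int[mu]_(x in D) (g x)%:E + \int[mu]_(x in D) (h x)%:E)%E.
Proof.
move=> mD mf mg mh f0 g0 h0 fgh.
have mE (q : T -> R) : measurable_fun setT q -> measurable_fun D (EFin \o q).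
  by move=> mq; apply/measurable_EFinP; exact: measurable_funS mq.
rewrite -ge0_integralD//; try exact: mE; try by move=> x _; rewrite lee_fin.
apply: ge0_le_integral => //; try exact: mE; try by move=> x _; rewrite lee_fin ?addr_ge0.
by have := mE _ (measurable_funD mg mh).
Qed.

(* The relaxed Euclidean perimeter of [A] is at most [P]. *)
Definition bvper n (A : set (@bV R n)) (P : R) : Prop := forall e, 0 < e ->
  exists L K u G, [/\ @c11 R n L K u G,
    (\int[@lebB R n]_x (`|u x - \1_A x|)%:E <= e%:E)%E & gradJ G <= P + e].

Section approximation.
Context n (L K : R) (u : 'rV[R]_n -> R) (G : 'rV[R]_n -> 'rV[R]_n) (A : set (@bV R n)) (e : R).
Hypothesis cu : c11 L K u G.
Hypothesis mA : measurable A.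
Hypothesis ue : (\int[@lebB R n]_x (`|u x - \1_A x|)%:E <= e%:E)%E.

Let mu : measurable_fun [set: @bV R n] u. Proof. exact: measurable_lipc (c11_lip cu). Qed.
Let mi : measurable_fun [set: @bV R n] (\1_A : @bV R n -> R). Proof. exact: measurable_indic. Qed.
Let md : measurable_fun [set: @bV R n] (fun x => `|u x - \1_A x|).
Proof. by apply: measurableT_comp => //; exact: measurable_funB. Qed.

Let ueD (D : set (@bV R n)) : measurable D -> (\int[@lebB R n]_(x in D) (`|u x - \1_A x|)%:E <= e%:E)%E.
Proof.
move=> mD; apply: le_trans ue; apply: ge0_subset_integral => //; exact/measurable_EFinP.
Qed.

Lemma approx_le (D : set (@bV R n)) : measurable D ->
  (\int[@lebB R n]_(x in D) (u x)%:E <= lebB (A `&` D) + e%:E)%E.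
Proof.
move=> mD; have := @ge0_integral_leD _ _ (@lebB R n) D u \1_A (fun x => `|u x - \1_A x|) mD mu mi md.
rewrite integral_indic//; move=> H; apply: (le_trans (H _ _ _ _)) => //.
- by move=> x; have /andP[] := c11_01 cu x.
- by move=> x; have := ler_norm (u x - \1_A x); lra.
- by apply: leeD => //; exact: ueD.
Qed.

Lemma approx_ge (D : set (@bV R n)) : measurable D ->
  (lebB (A `&` D) <= \int[@lebB R n]_(x in D) (u x)%:E + e%:E)%E.
Proof.
move=> mD; have := @ge0_integral_leD _ _ (@lebB R n) D \1_A u (fun x => `|u x - \1_A x|) mD mi mu md.
rewrite integral_indic//; move=> H; apply: (le_trans (H _ _ _ _)) => //.
- by move=> x; have /andP[] := c11_01 cu x.
- by move=> x; rewrite -{1}[`|_|]normrN; have := ler_norm (- (u x - \1_A x)); lra.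
- by apply: leeD => //; exact: ueD.
Qed.

(** Pointwise [u - u^(1+1/m) <= |u - 1_A|]: off [A] trivially, and on [A] because
    [u (1 - u^(1/m)) <= 1 - u^(1/m) <= 1 - u]. *)
Lemma approx_upow m : J u <= J (upow m.+1 u) + e.
Proof.
have lu := c11_lip cu; have u01 := c11_01 cu; have lp := lipc_upow m u01 lu.
have mp := measurable_lipc lp.
have := @ge0_integral_leD _ _ (@lebB R n) setT u (upow m.+1 u) (fun x => `|u x - \1_A x|) measurableT mu mp md.
rewrite -(JE lu) -(JE lp) => H; rewrite -lee_fin EFinD; apply: (le_trans (H _ _ _ _)) => //.
- by move=> x; have /andP[] := u01 x.
- by move=> x; have /andP[] := upow01 m (u01 x).
- move=> x; rewrite /upow indicE; have /andP[u0 u1] := u01 x.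
  have r0 := nroot_ge0 m.+1 (u x); have r1 := @nroot_ge _ m _ (u01 x).
  case: (x \in A) => /=; last by rewrite subr0 (ger0_norm u0) lerDr mulr_ge0.
  rewrite ler0_norm ?subr_le0// opprB.
  have : u x * (1 - nroot m.+1 (u x)) <= 1 * (1 - nroot m.+1 (u x)).
    by rewrite ler_wpM2r// subr_ge0 nroot_le1.
  rewrite mulrBr mulr1 mul1r; lra.
- by apply: leeD => //; exact: ueD.
Qed.

End approximation.

(** Shrinking [u] by a factor brings its integral strictly below the volume of the ball, as the
    transport requires. *)
Lemma c11_scale n L K (u : 'rV[R]_n -> R) G c : 0 <= c <= 1 -> c11 L K u G ->
  c11 L K (fun x => c * u x) (fun x => c *: G x).
Proof.
move=> /andP[c0 c1] cu.
have sc (h : 'rV[R]_n -> R) : lipc L K h -> lipc L K (fun x => c * h x).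
  move=> lh; have := lipc_scale c lh; rewrite (ger0_norm c0) => lc; split.
  - move=> x; rewrite normrM (ger0_norm c0); apply: le_trans (lipc_bd lh x).
    by rewrite ler_piMl.
  - move=> x y; rewrite -mulrBr normrM (ger0_norm c0); apply: le_trans (lipc_lip lh x y).
    by rewrite ler_piMl.
  - exact: (lipc_supp lc).
split => [x||i|x z].
- by have /andP[u0 u1] := c11_01 cu x; rewrite mulr_ge0//= mulr_ile1.
- exact: sc (c11_lip cu).
- have := sc _ (c11_grad cu i); congr lipc; apply/funext => x; by rewrite mxE.
- rewrite dotvZl -!mulrBr normrM (ger0_norm c0); apply: le_trans (c11_taylor cu x z).
  by rewrite ler_piMl.
Qed.

Lemma gradJ_scale n L K (u : 'rV[R]_n -> R) G c : 0 <= c <= 1 -> c11 L K u G ->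
  gradJ (fun x => c *: G x) <= gradJ G.
Proof.
move=> c01 cu; have L0 := lipc_ge0 (c11_lip cu); have /andP[c0 c1] := c01.
apply: J_le (lipc_enorm L0 (c11_grad (c11_scale c01 cu))) (lipc_enorm L0 (c11_grad cu)) _ => x.
by rewrite enormZ (ger0_norm c0) ler_piMl.
Qed.

Lemma bvper_ge0 n (A : set (@bV R n)) P : bvper A P -> 0 <= P.
Proof.
move=> h; apply/ler_addgt0Pr => e /h [L [K [u [G [_ _ le]]]]].
by apply: le_trans le; apply: J_ge0.
Qed.

Lemma bvper_iso k (A : set (@bV R k.+1)) P v r : measurable A -> lebB A = v%:E -> bvper A P ->
  0 <= r -> v <= omega k.+1 * r ^+ k.+1 -> k.+1%:R * v <= r * P.
Proof.
move=> mA Av bA r0 vr; have P0 := bvper_ge0 bA.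
have o0 : 0 < omega k.+1 :> R by exact: omega_pos.
(* The larger radius leaves room for the L^1 error that the approximating function makes in the
   volume. *)
have step r' : r < r' -> k.+1%:R * v <= r' * P.
  move=> rr'; have r'0 := le_lt_trans r0 rr'.
  have gap : v < omega k.+1 * r' ^+ k.+1.
    by apply: (le_lt_trans vr); rewrite ltr_pM2l// ltr_pXn2r ?nnegrE// ltW.
  apply/ler_addgt0Pr => e e0.
  have c0 : 0 < r' + k.+1%:R * 2 by rewrite addr_gt0.
  pose d := Num.min (omega k.+1 * r' ^+ k.+1 - v) (e / (r' + k.+1%:R * 2)).
  have d0 : 0 < d by rewrite lt_min subr_gt0 gap divr_gt0.
  have d1 : d <= omega k.+1 * r' ^+ k.+1 - v by rewrite ge_min lexx.
  have d2 : d * (r' + k.+1%:R * 2) <= e by rewrite -ler_pdivlMr// ge_min lexx orbT.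
  have [L [K [u [G [cu ue gP]]]]] := bA d d0.
  have lu := c11_lip cu.
  have h1 : J u <= v + d.
    by have := approx_le cu mA ue measurableT; rewrite -(JE lu) setIT Av -EFinD lee_fin.
  have h2 : v <= J u + d.
    by have := approx_ge cu mA ue measurableT; rewrite -(JE lu) setIT Av -EFinD lee_fin.
  have h3 := approx_upow cu mA ue k.
  have h4 := @gromov R k L K u G r' cu (ltW r'0) ltac:(clear -h1 d1; lra).
  have h5 : r' * gradJ G <= r' * (P + d) by rewrite ler_pM2l.
  have h6 : k.+1%:R * v <= k.+1%:R * (J (upow k.+1 u) + 2 * d).
    rewrite ler_pM2l//; clear -h2 h3; lra.
  move: h6 h5 h4 d2; rewrite !mulrDr; clear; lra.
apply/ler_addgt0Pr => e e0.
have := step (r + e / (P + 1)) ltac:(by rewrite ltrDl divr_gt0// ltr_wpDl).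
move=> /le_trans; apply; rewrite mulrDl lerD2l mulrAC ler_pdivrMr ?ltr_wpDl//.
by rewrite ler_pM2l// lerDl.
Qed.

Definition hsp n (i : 'I_n) (t : R) : set (@bV R n) := [set x : 'rV[R]_n | x 0 i <= t].

Lemma J_half n L K a t (h : 'rV[R]_n.+1 -> R) : lipc L K h -> (forall x, 0 <= h x) -> a <= - K ->
  (\int[@lebB R n.+1]_(x in hsp ord0 t) (h x)%:E)%E =
  (prim a (fun s => J (fun y => h (consv s y))) t)%:E.
Proof.
move=> lh h0 aK; have mh := measurable_lipc lh.
rewrite integral_mkcond fubiniV; last 2 first.
- apply/(measurable_restrictT _ (measurable_halfspace _ _)).
  by apply/measurable_EFinP; exact: measurable_funS mh.
- by move=> x; rewrite patchE; case: ifP => // _; rewrite lee_fin.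
have cJ := J_slice_continuous lh.
have := continuous_itv_integrable a t cJ => /(integrable_fin_num _) H.
rewrite /prim /Rintegral fineK; last by apply: H.
rewrite [RHS]integral_mkcond; apply: eq_integral => s _.
under eq_integral do rewrite patchE.
rewrite patchE; have lhs := lipc_slice s lh.
have inE' y : (consv s y \in hsp ord0 t) = (s <= t).
  by apply/idP/idP; rewrite inE /hsp/= consv0.
have [st|st] := leP s t; last first.
  rewrite ifF; last by apply/negP; rewrite inE/= in_itv/= => /andP[_]; rewrite leNgt st.
  by apply: integral0_eq => y _; rewrite inE' leNgt st.
under eq_integral do rewrite inE' st.
rewrite -(JE lhs); case: ifPn => // /negP; rewrite inE/= in_itv/= st andbT => /negP.
rewrite -ltNge => sa; congr EFin.
have Ks : K <= `|s| by rewrite ler_normr; apply/orP; right; clear -sa aK; lra.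
rewrite /J; under eq_Rintegral do rewrite (lipc_supp lh) ?(le_trans Ks (norm_consv0 _ _))//.
by rewrite Rintegral_cst// mul0r.
Qed.

Lemma scaled_approx n L K (u : 'rV[R]_n -> R) G (A : set (@bV R n)) e c : 0 <= c <= 1 -> c11 L K u G ->
  measurable A -> (\int[@lebB R n]_x (`|u x - \1_A x|)%:E <= e%:E)%E ->
  (\int[@lebB R n]_x (`|c * u x - \1_A x|)%:E <= (e + (1 - c) * J u)%:E)%E.
Proof.
move=> /andP[c0 c1] cu mA ue; have lu := c11_lip cu; have mu := measurable_lipc lu.
have mi : measurable_fun [set: @bV R n] (\1_A : @bV R n -> R) by exact: measurable_indic.
have c1' : 0 <= 1 - c by rewrite subr_ge0.
have mcu a : measurable_fun [set: @bV R n] (fun x => a * u x) by apply: measurable_funM.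
have u0 x : 0 <= u x by have /andP[] := c11_01 cu x.
rewrite EFinD -(JZ _ lu) (JE (lipc_scale _ lu)).
apply: le_trans (leeD ue (lexx _)).
apply: ge0_integral_leD => //.
- by apply: measurableT_comp => //; exact: measurable_funB.
- by apply: measurableT_comp => //; exact: measurable_funB.
- by move=> x; rewrite mulr_ge0.
- move=> x; have -> : c * u x - \1_A x = (u x - \1_A x) - (1 - c) * u x by ring.
  by apply: (le_trans (ler_normB _ _)); rewrite [X in _ + X <= _]ger0_norm ?mulr_ge0.
Qed.

Lemma primB (a : R) (f g : R -> R) b : continuous f -> continuous g ->
  prim a (fun x => f x - g x) b = prim a f b - prim a g b.
Proof. by move=> cf cg; apply: RintegralB => //; exact: continuous_itv_integrable. Qed.

Lemma beta_near k (r M e : R) : 0 < r -> 0 < M < omega k.+2 * r ^+ k.+2 -> 0 < e ->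
  exists2 d, 0 < d & forall x, `|x - M| < d ->
    `|r * beta k (x / r ^+ k.+2) - r * beta k (M / r ^+ k.+2)| <= e.
Proof.
move=> r0 /andP[M0 M1] e0; have rk : 0 < r ^+ k.+2 by rewrite exprn_gt0.
have cb : {for M / r ^+ k.+2, continuous (beta k)}.
  by apply: beta_continuous; rewrite divr_gt0//= ltr_pdivrMr.
have er : 0 < e / r by rewrite divr_gt0.
move: cb => /cvgrPdist_lt/(_ _ er)/nbhs_ballP[d/= d0 dP].
exists (d * r ^+ k.+2); first by rewrite mulr_gt0.
move=> x xM; have := dP (x / r ^+ k.+2); rewrite -ball_normE/= => H.
rewrite -mulrBr normrM (gtr0_norm r0) mulrC -ler_pdivlMr// distrC ltW//; apply: H.
rewrite -mulrBl normrM [`|_^-1|]gtr0_norm ?invr_gt0// ltr_pdivrMr//.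
by rewrite distrC.
Qed.

(** [r beta (M / r^(k+2))] is the height at which the ball of radius [r] has volume [M] below it.
    The sets are only approximate in volume, marginals and perimeter, but the conclusion is exact
    since the errors are arbitrarily small. *)
Lemma bvper_rigid k r t1 t2 M1 M2 : 0 < r -> 0 < M1 -> M1 <= M2 ->
  M2 < omega k.+2 * r ^+ k.+2 -> t1 <= t2 ->
  (forall e, 0 < e -> exists A P a1 a2 v,
    [/\ [/\ measurable A, @bvper k.+2 A P, lebB A = v%:E,
        lebB (A `&` hsp ord0 t1) = a1%:E & lebB (A `&` hsp ord0 t2) = a2%:E],
      `|v - omega k.+2 * r ^+ k.+2| <= e, `|a1 - M1| <= e, `|a2 - M2| <= e &
      r * P <= k.+2%:R * (omega k.+2 * r ^+ k.+2) + e]) ->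
  r * beta k (M2 / r ^+ k.+2) - r * beta k (M1 / r ^+ k.+2) = t2 - t1.
Proof.
move=> r0 M10 M12; have rk : 0 < r ^+ k.+2 by rewrite exprn_gt0.
have : 0 < omega k.+2 * r ^+ k.+2 by rewrite mulr_gt0 ?omega_pos.
have [V0 V0E] : exists V0, V0 = omega k.+2 * r ^+ k.+2 by eexists.
rewrite -V0E => V0p M2V t12 hyp; have M20 := lt_le_trans M10 M12.
apply/eqP; rewrite -subr_eq0 -normr_le0; apply/ler_addgt0Pr => e e0; rewrite add0r.
have e3 : 0 < e / 3 by rewrite divr_gt0.
have v10 : 0 < M1 / 2 by rewrite divr_gt0.
have v12 : M1 / 2 <= (M2 + V0) / 2 by clear -M10 M12 M2V; lra.
have v2V : (M2 + V0) / 2 < omega k.+2 * r ^+ k.+2 by rewrite -V0E; clear -M2V; lra.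
have [d d0 dP] := slices_rigidity r0 v10 v12 v2V t12 e3.
have [d1 d10 d1P] := @beta_near k r M1 (e / 3) r0 ltac:(by rewrite M10 -V0E (le_lt_trans M12)) e3.
have [d2 d20 d2P] := @beta_near k r M2 (e / 3) r0 ltac:(by rewrite M20 -V0E) e3.
have [q [q0 [q1 q2 q3 q4]]] : exists q, 0 < q /\
    [/\ q <= d, q <= Num.min (M1 / 2) ((V0 - M2) / 2), q <= V0 & q < Num.min d1 d2].
  exists (Num.min (Num.min d (Num.min (M1 / 2) ((V0 - M2) / 2))) (Num.min V0 (Num.min d1 d2 / 2))).
  have g1 : 0 < (V0 - M2) / 2 by rewrite divr_gt0// subr_gt0.
  have g2 : 0 < Num.min d1 d2 by rewrite lt_min d10.
  split; first by rewrite !lt_min d0 v10 g1 V0p divr_gt0.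
  split.
  - by rewrite !ge_min lexx.
  - by rewrite ge_min; apply/orP; left; rewrite ge_min lexx orbT.
  - by rewrite ge_min; apply/orP; right; rewrite ge_min lexx.
  - apply: (@le_lt_trans _ _ (Num.min d1 d2 / 2)); last by rewrite ltr_pdivrMr// ltr_pMr// ltr1n.
    by rewrite ge_min; apply/orP; right; rewrite ge_min lexx orbT.
have m0 : 0 <= k.+2%:R :> R by [].
have [m mE] : exists m : R, m = k.+2%:R by eexists.
rewrite -mE in m0.
have C0 : 0 < 20 + r + 9 * m by rewrite ltr_wpDr ?mulr_ge0// addr_gt0.
(* All errors are multiples of [h]. The deficit is at most [(1 + r + 9 m) h], where 9 collects 5
   from the volume and 4 from [approx_upow]; volumes and marginals stay within [20 h]. *)
have [h hE] : exists h, h = q / (20 + r + 9 * m) by eexists.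
have h0 : 0 < h by rewrite hE divr_gt0.
have hq : h * (20 + r + 9 * m) = q by rewrite hE divfK// gt_eqF.
have hr : 0 <= h * r by rewrite mulr_ge0// ltW.
have hm : 0 <= h * m by rewrite mulr_ge0// ltW.
move: hq; rewrite !mulrDr => hq.
have hq20 : 20 * h <= q by clear -hq hr hm; lra.
have hqd : h * (1 + r + 9 * m) <= d by rewrite !mulrDr; clear -hq h0 q1; lra.
have [A [P [a1 [a2 [v [[mA bA Av A1 A2] vV a1M a2M rP]]]]]] := hyp h h0.
have [L [K [u [G [cu ue gP]]]]] := bA h h0.
have lu := c11_lip cu.
have Ju0 : 0 <= J u by apply: J_ge0 => x; have /andP[] := c11_01 cu x.
have Ju : J u <= V0 + 2 * h.
  have := approx_le cu mA ue measurableT; rewrite -(JE lu) setIT Av -EFinD lee_fin.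
  by move: vV; rewrite ler_norml => /andP[_]; clear; lra.
(* Since [J u <= V0 + 2 h], this factor gives [c J u <= V0 - 4 h^2 / V0 < V0] at an L^1 cost of at
   most [3 h]. *)
have [c cE] : exists c, c = 1 - 2 * h / V0 by eexists.
have hV : 2 * h / V0 <= 1 by rewrite ler_pdivrMr// mul1r; clear -hq20 q3 h0; lra.
have hV0 : 0 <= 2 * h / V0 by rewrite divr_ge0// ?mulr_ge0// ltW.
have c01 : 0 <= c <= 1 by rewrite cE; apply/andP; split; clear -hV hV0; lra.
have hh : 0 < 4 * (h * h / V0) by rewrite mulr_gt0// divr_gt0// mulr_gt0.
have hh2 : 4 * (h * h / V0) <= h.
  rewrite -mulrA mulrCA ler_piMr ?(ltW h0)// mulrA ler_pdivrMr// mul1r.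
  by clear -hq20 q3 h0; lra.
have JcV : c * J u < V0.
  have : c * J u <= c * (V0 + 2 * h) by rewrite ler_wpM2l//; case/andP: c01.
  move=> /le_lt_trans; apply; rewrite cE.
  have -> : (1 - 2 * h / V0) * (V0 + 2 * h) = V0 - 4 * (h * h / V0).
    by field; rewrite gt_eqF.
  by rewrite ltrBlDr ltrDl.
have c1J : (1 - c) * J u <= 3 * h.
  have : (1 - c) * J u <= (1 - c) * (V0 + 2 * h) by rewrite ler_wpM2l// subr_ge0; case/andP: c01.
  move=> /le_trans; apply; rewrite cE.
  have -> : (1 - (1 - 2 * h / V0)) * (V0 + 2 * h) = 2 * h + 4 * (h * h / V0).
    by field; rewrite gt_eqF.
  by clear -hh2; lra.
have cu' := c11_scale c01 cu; have lu' := c11_lip cu'.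
have ue' : (\int[@lebB R k.+2]_x (`|c * u x - \1_A x|)%:E <= (4 * h)%:E)%E.
  apply: le_trans (scaled_approx c01 cu mA ue) _; rewrite lee_fin; clear -c1J; lra.
have u0' x : 0 <= c * u x by have /andP[] := c11_01 cu' x.
have [a aE] : exists a, a = - (`|K| + `|t1| + 2) by eexists.
have [b bE] : exists b, b = `|K| + `|t1| + `|t2| + 2 by eexists.
have nK := normr_ge0 K; have n1 := normr_ge0 t1; have n2 := normr_ge0 t2.
have K1 := ler_norm K; have T2 := ler_norm t2.
have T1 : - t1 <= `|t1| by have := ler_norm (- t1); rewrite normrN.
have aK : a + 1 <= - K by rewrite aE; clear -K1 n1; lra.
have Kb : K <= b - 1 by rewrite bE; clear -K1 n1 n2; lra.
have at1 : a + 1 <= t1 by rewrite aE; clear -T1 nK; lra.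
have t2b : t2 <= b by rewrite bE; clear -T2 n1 nK; lra.
have aK' : a <= - K by clear -aK; lra.
have Kb' : K <= b by clear -Kb; lra.
have sl := c11_slices cu' (@gromov R k) aK Kb.
have [f1 f2 f3] := c11_J_fubini k cu' aK' Kb'.
have [_ _ f4] := c11_J_fubini k.+1 cu' aK' Kb'.
have J' : J (fun x => c * u x) = c * J u by rewrite (JZ _ lu).
have ca := slices_cont sl.
have h1 t : (\int[@lebB R k.+2]_(x in hsp ord0 t) (c * u x)%:E)%E =
  (prim a (fun s => J (fun y => c * u (consv s y))) t)%:E := J_half t lu' u0' aK'.
have p1 : M1 - 5 * h <= prim a (fun s => J (fun y => c * u (consv s y))) t1.
  have := approx_ge cu' mA ue' (measurable_halfspace ord0 t1).
  rewrite A1 h1 -EFinD lee_fin; move: a1M; rewrite ler_norml => /andP[+ _]; clear; lra.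
have p1' : prim a (fun s => J (fun y => c * u (consv s y))) t1 <= M1 + 5 * h.
  have := approx_le cu' mA ue' (measurable_halfspace ord0 t1).
  rewrite A1 h1 -EFinD lee_fin; move: a1M; rewrite ler_norml => /andP[_ +]; clear; lra.
have p2 : M2 - 5 * h <= prim a (fun s => J (fun y => c * u (consv s y))) t2.
  have := approx_ge cu' mA ue' (measurable_halfspace ord0 t2).
  rewrite A2 h1 -EFinD lee_fin; move: a2M; rewrite ler_norml => /andP[+ _]; clear; lra.
have p2' : prim a (fun s => J (fun y => c * u (consv s y))) t2 <= M2 + 5 * h.
  have := approx_le cu' mA ue' (measurable_halfspace ord0 t2).
  rewrite A2 h1 -EFinD lee_fin; move: a2M; rewrite ler_norml => /andP[_ +]; clear; lra.
have up1 := approx_upow cu' mA ue' k; have up2 := approx_upow cu' mA ue' k.+1.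
have Jv : V0 - 5 * h <= J (fun x => c * u x).
  have := approx_ge cu' mA ue' measurableT; rewrite -(JE lu') setIT Av -EFinD lee_fin.
  by move: vV; rewrite ler_norml => /andP[+ _]; clear; lra.
move: q2 q4; rewrite le_min lt_min => /andP[q21 q22] /andP[q41 q42].
have := dP a b _ _ _ _ _ _ sl at1 t2b.
rewrite -V0E -f1 -f2 -f4 => H.
have {H} : `|tau k a (fun s => J (fun y => c * u (consv s y))) r t2 -
    tau k a (fun s => J (fun y => c * u (consv s y))) r t1 - (t2 - t1)| <= e / 3.
  apply: H.
  - by rewrite J'.
  - by apply: le_trans p1; clear -q21 hq20 h0; lra.
  - by apply: le_trans p2' _; clear -q22 hq20 h0; lra.
  - apply: le_trans hqd; have g1 := gradJ_scale c01 cu.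
    have g2 : r * gradJ (fun x => c *: G x) <= r * (P + h).
      by rewrite ler_pM2l//; apply: le_trans g1 _.
    have g3 : m * (V0 - 9 * h) <= m * J (upow k.+2 (fun x => c * u x)).
      by rewrite ler_wpM2l//; clear -up2 Jv; lra.
    rewrite -mE; move: g2 g3 rP; rewrite -mE; clear; lra.
  - rewrite primB//; last exact: (sl_cont1 sl).
    by rewrite -f1 -f3; clear -up1 q1 hq20 h0; lra.
  - rewrite primB//; last exact: (sl_cont2 sl).
    by rewrite -f1 -f4; clear -up2 q1 hq20 h0; lra.
have := d1P (prim a (fun s => J (fun y => c * u (consv s y))) t1).
have := d2P (prim a (fun s => J (fun y => c * u (consv s y))) t2).
rewrite /tau; move: p1 p1' p2 p2'; move: (prim a _ t1) (prim a _ t2) => x1 x2 p1 p1' p2 p2' H2 H1.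
have {}H1 : `|r * beta k (x1 / r ^+ k.+2) - r * beta k (M1 / r ^+ k.+2)| <= e / 3.
  by apply: H1; rewrite ltr_norml; apply/andP; split; clear -p1 p1' q41 hq20 h0; lra.
have {}H2 : `|r * beta k (x2 / r ^+ k.+2) - r * beta k (M2 / r ^+ k.+2)| <= e / 3.
  by apply: H2; rewrite ltr_norml; apply/andP; split; clear -p2 p2' q42 hq20 h0; lra.
move: H1 H2; rewrite !ler_norml => /andP[i1 i2] /andP[i3 i4] /andP[i5 i6].
by apply/andP; split; move: i1 i2 i3 i4 i5 i6; clear; lra.
Qed.

End bv_perimeter.

(** * Exchanging the first axis with another *)

Section swap.
Context {R : realType} (n : nat).
Implicit Types (x y : 'rV[R]_n.+1) (i : 'I_n.+1).

Definition sw i x : 'rV[R]_n.+1 := \row_j x 0 (tperm ord0 i j).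

Lemma swK i : involutive (sw i).
Proof. by move=> x; apply/rowP => j; rewrite !mxE tpermK. Qed.

Lemma swE0 i x : sw i x 0 ord0 = x 0 i. Proof. by rewrite mxE tpermL. Qed.

Lemma swEi i x : sw i x 0 i = x 0 ord0. Proof. by rewrite mxE tpermR. Qed.

Lemma swD i x y : sw i (x + y) = sw i x + sw i y.
Proof. by apply/rowP => j; rewrite !mxE. Qed.

Lemma swB i x y : sw i (x - y) = sw i x - sw i y.
Proof. by apply/rowP => j; rewrite !mxE. Qed.

Lemma dotv_sw i x y : dotv (sw i x) (sw i y) = dotv x y.
Proof.
rewrite /dotv [RHS](reindex_inj (@perm_inj _ (tperm ord0 i))).
by apply: eq_bigr => j _; rewrite !mxE.
Qed.

Lemma enorm_sw i x : enorm (sw i x) = enorm x.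
Proof. by rewrite !enormE dotv_sw. Qed.

Lemma norm_sw i x : `|sw i x| = `|x|.
Proof.
have H y : `|sw i y| <= `|y| by apply: norm_le_coord => // j; rewrite mxE norm_coord.
by apply/eqP; rewrite eq_le H -{1}(swK i x) H.
Qed.

Lemma measurable_sw i : measurable_fun [set: @bV R n.+1] (sw i : @bV R n.+1 -> @bV R n.+1).
Proof. by apply: measurable_to_bV => j; under eq_fun do rewrite mxE; exact: measurable_coord. Qed.

Lemma measurable_preimage_sw i (A : set (@bV R n.+1)) : measurable A -> measurable (sw i @^-1` A : set (@bV R n.+1)).
Proof. by move=> mA; rewrite -[X in measurable X]setTI; exact: measurable_sw. Qed.

Lemma lebB_sw i (A : set (@bV R n.+1)) : lebB (sw i @^-1` A : set (@bV R n.+1)) = lebB A.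
Proof.
rewrite /lebB -(@lebesgue_isom R n (sw i) (sw i) A) => [|x|x y]; last 2 first.
- exact: swK.
- by rewrite -swB enorm_sw.
congr lebesgue_outer; apply/seteqP; split => [x /= Ax|_ [x Ax <-]/=]; last by rewrite swK.
by exists (sw i x); rewrite ?swK.
Qed.

Definition swB_measure i : {measure set (@bV R n.+1) -> \bar R} :=
  @measure_function_pushforward__canonical__measure_function_Measure _ _ _ _ _
    (@lebB R n.+1) (sw i : @bV R n.+1 -> @bV R n.+1) (@measurable_sw i).

Lemma integral_sw i (D : set (@bV R n.+1)) (h : @bV R n.+1 -> \bar R) : measurable D ->
  measurable_fun D h -> (forall x, 0 <= h x)%E ->
  (\int[@lebB R n.+1]_(x in D) h x = \int[@lebB R n.+1]_(x in sw i @^-1` D) h (sw i x))%E.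
Proof.
move=> mD mh h0; transitivity (\int[swB_measure i]_(x in D) h x)%E.
  by apply: eq_measure_integral => A mA _; rewrite /= /pushforward lebB_sw.
by rewrite ge0_integral_pushforward//; exact: measurable_sw.
Qed.

End swap.

Section bvper_swap.
Context {R : realType}.

Lemma lipc_sw n L K i (h : 'rV[R]_n.+1 -> R) : lipc L K h -> lipc L K (fun x => h (sw i x)).
Proof.
move=> lh; split => [x|x y|x Kx].
- exact: (lipc_bd lh).
- by apply: (le_trans (lipc_lip lh _ _)); rewrite -swB norm_sw.
- by apply: (lipc_supp lh); rewrite norm_sw.
Qed.

Lemma J_sw n L K i (h : 'rV[R]_n.+1 -> R) : lipc L K h -> (forall x, 0 <= h x) ->
  J (fun x => h (sw i x)) = J h.
Proof.
move=> lh h0; rewrite /J /Rintegral [in RHS](@integral_sw R n i)//.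
by apply/measurable_EFinP; exact: measurable_lipc lh.
Qed.

Lemma bvper_sw n i (A : set (@bV R n.+1)) P : measurable A -> bvper A P ->
  bvper (sw i @^-1` A : set (@bV R n.+1)) P.
Proof.
move=> mA bA e /bA[L [K [u [G [cu ue gP]]]]].
exists L, K, (fun x => u (sw i x)), (fun x => sw i (G (sw i x))).
have L0 := lipc_ge0 (c11_lip cu).
split.
- split => [x||j|x z].
  + exact: (c11_01 cu).
  + exact: lipc_sw (c11_lip cu).
  + have := lipc_sw i (c11_grad cu (tperm ord0 i j)); congr lipc.
    by apply/funext => x; rewrite mxE.
  + have := c11_taylor cu (sw i x) (sw i z); rewrite -swD norm_sw.
    by rewrite -(dotv_sw i (sw i (G _))) swK.
- apply: le_trans ue; rewrite [leRHS](@integral_sw R n i)//.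
  apply/measurable_EFinP; apply: measurableT_comp => //.
  by apply: measurable_funB; [exact: measurable_lipc (c11_lip cu)|exact: measurable_indic].
- apply: le_trans gP; rewrite /gradJ.
  have lE := lipc_enorm L0 (c11_grad cu).
  rewrite -(J_sw i lE)//.
  by under [in X in X <= _]eq_fun do rewrite enorm_sw.
Qed.

End bvper_swap.

(** * Stretching one coordinate by a density *)

Lemma leb_oc {R : realType} (a b : R) :
  (lebesgue_measure (`]a, b]%classic : set R) = (Num.max 0 (b - a))%:E :> \bar R)%E.
Proof.
rewrite lebesgue_measure_itv/= lte_fin; case: ltP => h.
  by rewrite max_r// subr_ge0 ltW.
by rewrite max_l// subr_le0.
Qed.

Section profile.
Context {R : realType} (g : R -> R) (M : R).
Hypothesis mg : measurable_fun setT g.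
Hypothesis g1 : forall t, 1 <= g t.
Hypothesis gM : forall t, g t <= M.

Definition Ig (a b : R) : R := \int[lebesgue_measure]_(x in `]a, b]) g x.

(** The oriented integral of [g] from 0 to [t]; one of the two intervals is always empty. *)
Definition Lam (t : R) : R := Ig 0 t - Ig t 0.

Let g0 t : 0 <= g t. Proof. by apply: le_trans (g1 t). Qed.

Lemma Ig_integrable a b : lebesgue_measure.-integrable `]a, b] (EFin \o g).
Proof.
apply: measurable_bounded_integrable => //.
- by apply: (@le_lt_trans _ _ (Num.max 0 (b - a))%:E); rewrite ?ltry// le_eqVlt; apply/orP; left; apply/eqP; exact: leb_oc.
- exact: measurable_funS mg.
- exists M; split; first exact: num_real.
  move=> m Mm x _; rewrite /= ger0_norm//; exact: le_trans (gM x) (ltW Mm).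
Qed.

Lemma Ig_out a b : b <= a -> Ig a b = 0.
Proof. by move=> ba; rewrite /Ig set_itv_ge ?Rintegral_set0// bnd_simp -leNgt. Qed.

Lemma Ig_add a b c : a <= b -> b <= c -> Ig a c = Ig a b + Ig b c.
Proof.
move=> ab bc; rewrite /Ig -Rintegral_setU//.
- congr (Rintegral _ _ _); apply/seteqP; split => x /=; rewrite !in_itv/=.
    by move=> /andP[ax xc]; have [xb|xb] := leP x b; [left; rewrite ax|right; rewrite xc].
  by case=> /andP[h1 h2]; [rewrite h1 (le_trans h2)|rewrite h2 (le_lt_trans ab h1)].
- have := Ig_integrable a c; congr (_.-integrable _ _).
  apply/seteqP; split => x /=; rewrite !in_itv/=.
    by move=> /andP[ax xc]; have [xb|xb] := leP x b; [left; rewrite ax|right; rewrite xc].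
  by case=> /andP[h1 h2]; [rewrite h1 (le_trans h2)|rewrite h2 (le_lt_trans ab h1)].
- apply/disj_setPS => x /=; rewrite !in_itv/= => -[/andP[_ h1] /andP[h2 _]].
  by move: h2; rewrite ltNge h1.
Qed.

Lemma LamB s t : s <= t -> Lam t - Lam s = Ig s t.
Proof.
move=> st; rewrite /Lam; have [s0|/ltW s0] := leP 0 s.
  rewrite [Ig s 0]Ig_out// [Ig t 0]Ig_out ?(le_trans s0)// (Ig_add s0 st); ring.
rewrite [Ig 0 s]Ig_out//; have [t0|/ltW t0] := leP 0 t.
  rewrite [Ig t 0]Ig_out// (Ig_add s0 t0); ring.
rewrite [Ig 0 t]Ig_out// (Ig_add st t0); ring.
Qed.

Lemma Ig_cst a b (c : R) : a <= b -> \int[lebesgue_measure]_(x in `]a, b]) c = c * (b - a).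
Proof.
move=> ab; rewrite Rintegral_cst//; congr (_ * _).
by apply: (eq_trans (congr1 fine (leb_oc a b))); rewrite /= max_r// subr_ge0.
Qed.

Lemma cst_integrable a b (c : R) : lebesgue_measure.-integrable `]a, b] (EFin \o cst c).
Proof.
apply: measurable_bounded_integrable => //.
- by apply: (@le_lt_trans _ _ (Num.max 0 (b - a))%:E); rewrite ?ltry// le_eqVlt; apply/orP; left; apply/eqP; exact: leb_oc.
- exists `|c|; split; first exact: num_real.
  by move=> m Mm x _; exact: ltW.
Qed.

Lemma Lam_bounds s t m m' : s <= t -> (forall u, s < u <= t -> m <= g u <= m') ->
  m * (t - s) <= Lam t - Lam s <= m' * (t - s).
Proof.
move=> st gm; rewrite LamB// -!(Ig_cst _ st) /Ig; apply/andP; split.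
  apply: le_Rintegral => //; [exact: cst_integrable|exact: Ig_integrable|].
  by move=> x /=; rewrite in_itv/= => /gm/andP[].
apply: le_Rintegral => //; [exact: Ig_integrable|exact: cst_integrable|].
by move=> x /=; rewrite in_itv/= => /gm/andP[].
Qed.

Lemma Lam_lip s t : s <= t -> t - s <= Lam t - Lam s <= M * (t - s).
Proof.
move=> st; have := @Lam_bounds s t 1 M st; rewrite mul1r; apply.
by move=> u _; rewrite g1 gM.
Qed.

Lemma Lam0 : Lam 0 = 0. Proof. by rewrite /Lam subrr. Qed.

Lemma Lam_lt s t : (Lam s < Lam t) = (s < t).
Proof.
have H a b : a < b -> Lam a < Lam b.
  move=> ab; have /andP[h _] := Lam_lip (ltW ab); rewrite -subr_gt0.
  by apply: lt_le_trans h; rewrite subr_gt0.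
apply/idP/idP; last exact: H.
by rewrite !ltNge; apply: contra; rewrite le_eqVlt => /orP[/eqP ->//|/H/ltW].
Qed.

Lemma Lam_le s t : (Lam s <= Lam t) = (s <= t).
Proof. by rewrite !leNgt Lam_lt. Qed.

Lemma Lam_norm s t : `|s - t| <= `|Lam s - Lam t| <= M * `|s - t|.
Proof.
wlog st : s t / s <= t => [W|].
  have [|/ltW] := leP s t; first exact: W.
  by rewrite distrC [`|Lam s - _|]distrC; exact: W.
rewrite distrC [`|Lam s - _|]distrC !ger0_norm ?subr_ge0 ?Lam_le//; exact: Lam_lip.
Qed.

Lemma Lam_continuous : continuous Lam.
Proof.
move=> s; apply/cvgrPdist_lt => e e0; apply/nbhs_ballP.
have M0 : 0 < M by apply: lt_le_trans (le_trans (g1 0) (gM 0)).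
exists (e / M) => /=; first exact: divr_gt0.
move=> t st'; have st : `|s - t| < e / M := st'.
have /andP[_ h] := Lam_norm s t; apply: (le_lt_trans h).
by rewrite mulrC -ltr_pdivlMr.
Qed.

Lemma Lam_surj y : exists s, Lam s = y.
Proof.
have h1 : Lam (- `|y|) <= y.
  have /andP[h _] := @Lam_lip (- `|y|) 0 ltac:(by rewrite oppr_le0).
  move: h; rewrite Lam0 !sub0r opprK lerNr => /le_trans; apply.
  by have := ler_norm (- y); rewrite normrN; lra.
have h2 : y <= Lam `|y|.
  have /andP[h _] := @Lam_lip 0 `|y| ltac:(by []).
  by move: h; rewrite Lam0 !subr0; apply: le_trans; exact: ler_norm.
have ab : - `|y| <= `|y| by have := normr_ge0 y; lra.
have [] := @IVT _ Lam (- `|y|) `|y| y ab.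
- exact: continuous_subspaceT Lam_continuous.
- by rewrite ge_min h1 le_max h2 orbT.
by move=> s _ <-; exists s.
Qed.

Definition LamV (y : R) : R := xget 0 [set s | Lam s = y].

Lemma LamVK y : Lam (LamV y) = y. Proof. exact: (xgetPex 0 (Lam_surj y)). Qed.

Lemma LamK s : LamV (Lam s) = s.
Proof.
have := LamVK (Lam s); case: (ltgtP (LamV (Lam s)) s) => //.
  by rewrite -Lam_lt => h e; rewrite e ltxx in h.
by rewrite -Lam_lt => h e; rewrite e ltxx in h.
Qed.

Lemma LamV_lip y z : `|LamV y - LamV z| <= `|y - z|.
Proof. by have /andP[] := Lam_norm (LamV y) (LamV z); rewrite !LamVK. Qed.

Lemma measurable_LamV : measurable_fun setT LamV.
Proof.
apply: continuous_measurable_fun => y; apply/cvgrPdist_lt => e e0; apply/nbhs_ballP.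
exists e => // z yz'; have yz : `|y - z| < e := yz'.
exact: le_lt_trans (LamV_lip _ _) yz.
Qed.

Variables (n : nat) (i : 'I_n.+1).

Definition stretchV (y : 'rV[R]_n.+1) : 'rV[R]_n.+1 := upd y i (LamV (y 0 i)).

Definition stretch (x : 'rV[R]_n.+1) : 'rV[R]_n.+1 := upd x i (Lam (x 0 i)).

Lemma stretchVK x : stretch (stretchV x) = x.
Proof. by rewrite /stretchV /stretch upd_upd upd_same LamVK upd_id. Qed.

Lemma measurable_stretchV : measurable_fun [set: @bV R n.+1] (stretchV : @bV R n.+1 -> @bV R n.+1).
Proof.
apply: measurable_to_bV => j; under eq_fun do rewrite updE.
case: (j == i); last exact: measurable_coord.
by apply: (measurableT_comp measurable_LamV); exact: measurable_coord.
Qed.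

Lemma measurable_stretch : measurable_fun [set: @bV R n.+1] (stretch : @bV R n.+1 -> @bV R n.+1).
Proof.
apply: measurable_to_bV => j; under eq_fun do rewrite updE.
case: (j == i); last exact: measurable_coord.
apply: (@measurableT_comp _ _ _ _ _ _ Lam); last exact: measurable_coord.
exact: continuous_measurable_fun Lam_continuous.
Qed.

Lemma measurable_profile : measurable_fun [set: @bV R n.+1] (fun x : @bV R n.+1 => g ((x : 'rV[R]_n.+1) 0 i)).
Proof. by apply: (measurableT_comp mg); exact: measurable_coord. Qed.

Definition dens (A : set (@bV R n.+1)) : \bar R := (\int[@lebB R n.+1]_(x in A) (g ((x : 'rV[R]_n.+1) 0 i))%:E)%E.

Let dens0 : dens set0 = 0%E. Proof. exact: integral_set0. Qed.
Let dens_ge0 A : (0 <= dens A)%E. Proof. by apply: integral_ge0 => x _; rewrite lee_fin. Qed.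
Let dens_additive : semi_sigma_additive dens.
Proof.
move=> F mF tF mU; rewrite /dens ge0_integral_bigcup//.
- apply: is_cvg_ereal_nneg_natsum_cond => k _ _.
  by apply: integral_ge0 => x _; rewrite lee_fin.
- by apply/measurable_EFinP; apply: measurable_funS measurable_profile.
- by move=> x _; rewrite lee_fin.
Qed.

HB.instance Definition _ := isMeasure.Build _ _ _ dens dens0 dens_ge0 dens_additive.

Definition stretched : {measure set (@bV R n.+1) -> \bar R} :=
  @measure_function_pushforward__canonical__measure_function_Measure _ _ _ _ _
    (@lebB R n.+1) (stretchV : @bV R n.+1 -> @bV R n.+1) measurable_stretchV.

Lemma dens_box0 (h : R -> R) (ab : 'rV[R]_n.+1 * 'rV[R]_n.+1) : measurable_fun setT h -> (forall t, 0 <= h t) ->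
  (\int[@lebB R n.+1]_(x in box ab) (h ((x : 'rV[R]_n.+1) 0 ord0))%:E =
   box_volume (tlv ab.1, tlv ab.2) *
   \int[lebesgue_measure]_(s in `]ab.1 ord0 ord0, ab.2 ord0 ord0]) (h s)%:E)%E.
Proof.
move=> mh h0; rewrite integral_mkcond fubiniV; last 2 first.
- apply/(measurable_restrictT _ (measurable_box _)).
  apply/measurable_EFinP; apply: (@measurable_funS _ _ _ _ setT) => //.
  by apply: (measurableT_comp mh); exact: measurable_coord.
- by move=> x; rewrite patchE; case: ifP => // _; rewrite lee_fin.
rewrite -ge0_integralZl//=; last 3 first.
- by apply/measurable_EFinP; exact: measurable_funS mh.
- by move=> s _; rewrite lee_fin.
- exact: box_volume_ge0.
rewrite [RHS]integral_mkcond; apply: eq_integral => s _.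
rewrite patchE; under eq_integral do rewrite patchE.
have inE' y : (consv s y \in box ab) = (s \in `]ab.1 0 ord0, ab.2 0 ord0]%classic) && (y \in box (tlv ab.1, tlv ab.2)).
  apply/idP/idP.
    move=> /set_mem hy; apply/andP; split; apply/mem_set.
      by have := hy ord0; rewrite consv0 /= in_itv.
    by move=> j; have := hy (lift ord0 j); rewrite consvS !mxE.
  move=> /andP[/set_mem hs /set_mem hy]; apply/mem_set => j.
  case: (unliftP ord0 j) => [l ->|->]; first by rewrite consvS; have := hy l; rewrite !mxE.
  by rewrite consv0; move: hs; rewrite /= in_itv.
case: ifPn => [sI|/negbTE sI]; last first.
  by apply: integral0_eq => y _; rewrite inE' sI.
under eq_integral do rewrite inE' sI consv0.
rewrite -[LHS]/(\int[@lebB R n]_y (if y \in box (tlv ab.1, tlv ab.2) then (h s)%:E else 0))%E.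
transitivity (\int[@lebB R n]_(y in box (tlv ab.1, tlv ab.2)) (h s)%:E)%E.
  by rewrite [RHS]integral_mkcond; apply: eq_integral => y _; rewrite patchE.
rewrite integral_cst//; last exact: measurable_box.
rewrite muleC; congr (_ * _)%E; exact: lebesgue_box.
Qed.

Lemma dens_box (ab : 'rV[R]_n.+1 * 'rV[R]_n.+1) : dens (box ab) = stretched (box ab).
Proof.
have -> : stretched (box ab) = lebB (box (stretch ab.1, stretch ab.2)).
  rewrite /= /pushforward; congr lebB; apply/seteqP; split => y /= h j.
    have := h j; rewrite !updE; case: (eqVneq j i) => [->|//].
    by rewrite -(Lam_lt _ (LamV (y 0 i))) -(Lam_le (LamV (y 0 i))) LamVK.
  have := h j; rewrite !updE; case: (eqVneq j i) => [->|//].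
  by rewrite -(Lam_lt _ (LamV (y 0 i))) -(Lam_le (LamV (y 0 i))) LamVK.
rewrite /dens (@integral_sw R n i); last 3 first.
- exact: measurable_box.
- by apply/measurable_EFinP; apply: measurable_funS measurable_profile.
- by move=> x; rewrite lee_fin.
have -> : sw i @^-1` box ab = box (sw i ab.1, sw i ab.2).
  apply/seteqP; split => x /= h j.
    by have := h (tperm ord0 i j); rewrite !mxE tpermK.
  by have := h (tperm ord0 i j); rewrite !mxE tpermK.
under eq_integral do rewrite swEi.
rewrite dens_box0// /= !swE0 /lebB lebesgue_box /box_volume.
rewrite [in RHS](reindex_inj (@perm_inj _ (tperm ord0 i))) big_ord_recl/= tpermL !upd_same.
have -> : (\int[lebesgue_measure]_(s in `]ab.1 ord0 i, ab.2 ord0 i]) (g s)%:E)%E =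
    (Num.max 0 (Lam (ab.2 0 i) - Lam (ab.1 0 i)))%:E.
  have [h|h] := leP (ab.1 0 i) (ab.2 0 i).
    rewrite max_r ?subr_ge0 ?Lam_le// LamB// /Ig /Rintegral fineK//.
    by apply: integrable_fin_num => //; exact: Ig_integrable.
  rewrite max_l; last by rewrite subr_le0 Lam_le ltW.
  by rewrite set_itv_ge ?integral_set0// bnd_simp -leNgt ltW.
rewrite -EFinM mulrC; congr (_ * _)%:E.
apply: eq_bigr => j _; rewrite !updE !mxE.
have /negbTE -> : tperm ord0 i (lift ord0 j) != i.
  apply/eqP => h; have := neq_lift ord0 j; rewrite -(inj_eq (@perm_inj _ (tperm ord0 i))) tpermL h.
  by rewrite eqxx.
by [].
Qed.

Lemma stretched_le (b : R) (A : set (@bV R n.+1)) : measurable A -> 0 <= b ->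
  (forall x : 'rV[R]_n.+1, A x -> g (x 0 i) <= b) -> (dens A <= b%:E * lebB A)%E.
Proof.
move=> mA b0 gb; rewrite /dens -integral_cst//.
apply: ge0_le_integral => //.
- by move=> x _; rewrite lee_fin.
- by apply/measurable_EFinP; apply: measurable_funS measurable_profile.
Qed.

(** Both sides are measures that agree on boxes, where the stretched side has length
    [Lam b - Lam a], the integral of [g] over []a, b]]. *)
Lemma stretchedE (A : set (@bV R n.+1)) : measurable A ->
  lebB (stretchV @^-1` A : set (@bV R n.+1)) = dens A.
Proof.
move=> mA; apply/esym; apply: (@bV_unique R n.+1 (dens : {measure set _ -> \bar R}) stretched) => //.
  exact: dens_box.
move=> k; apply: (le_lt_trans (@stretched_le M _ (measurable_box _) _ _)) => //.
- by apply: le_trans (gM 0); apply: le_trans (g1 0).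
- by rewrite /lebB lebesgue_box -EFinM ltry.
Qed.

(** The image of Lebesgue measure under [stretchV] has density [g], which is at most [b] wherever
    [h] does not vanish. A local bound of [g] can thus be used when [h] has small support. *)
Lemma stretched_integral_le (b : R) (h : @bV R n.+1 -> R) : 0 <= b -> measurable_fun setT h ->
  (forall x, 0 <= h x) -> (forall x : 'rV[R]_n.+1, h x != 0 -> g (x 0 i) <= b) ->
  (\int[@lebB R n.+1]_y (h (stretchV y))%:E <= b%:E * \int[@lebB R n.+1]_x (h x)%:E)%E.
Proof.
move=> b0 mh h0 hb; pose D : set (@bV R n.+1) := [set x | h x != 0].
have mD : measurable D.
  rewrite (_ : D = h @^-1` [set~ 0]); last by apply/seteqP; split => x /= /eqP.
  by rewrite -[X in measurable X]setTI; apply: mh => //; exact: measurableC.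
have mhE : measurable_fun setT (EFin \o h) by exact/measurable_EFinP.
have offD (mu : {measure set (@bV R n.+1) -> \bar R}) :
    (\int[mu]_x (h x)%:E = \int[mu]_(x in D) (h x)%:E)%E.
  rewrite [RHS]integral_mkcond; apply: eq_integral => x _; rewrite patchE.
  by case: ifPn => // /negP; rewrite inE/= => /negP; rewrite negbK => /eqP ->.
have -> : (\int[@lebB R n.+1]_y (h (stretchV y))%:E = \int[stretched]_x (h x)%:E)%E.
  rewrite ge0_integral_pushforward ?preimage_setT//; first exact: measurable_stretchV.
  by move=> x _; rewrite lee_fin.
rewrite -(@ge0_integral_mscale _ _ R (@lebB R n.+1) setT measurableT (NngNum b0))//; last first.
  by move=> x _; rewrite lee_fin.
rewrite (offD stretched) (offD (mscale (NngNum b0) (@lebB R n.+1))).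
have -> : (\int[stretched]_(x in D) (h x)%:E = \int[mrestr stretched mD]_(x in D) (h x)%:E)%E.
  by apply: eq_measure_integral => A mA AD; change (stretched A = stretched (A `&` D)); rewrite (setIidl AD).
apply: ge0_le_measure_integral => // A mA.
change (lebB (stretchV @^-1` (A `&` D) : set (@bV R n.+1)) <= b%:E * lebB A)%E.
rewrite stretchedE; last exact: measurableI.
apply: (le_trans (@stretched_le b _ (measurableI _ _ mA mD) b0 _)).
  by move=> x [_ /hb].
by rewrite lee_wpmul2l ?lee_fin//; apply: le_outer_measure => x [].
Qed.

Section taylor.
Variable l : R.
Hypothesis gl : forall s t, `|g s - g t| <= l * `|s - t|.

Let l0 : 0 <= l.
Proof. by have := gl 1 0; rewrite subr0 normr1 mulr1; apply: le_trans. Qed.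

Lemma Lam_taylor s t : `|Lam t - Lam s - g s * (t - s)| <= l * (t - s) ^+ 2.
Proof.
have key a b u : a <= b -> a <= u <= b ->
    (g u - l * (b - a)) * (b - a) <= Lam b - Lam a <= (g u + l * (b - a)) * (b - a).
  move=> ab /andP[au ub]; apply: Lam_bounds => // v /andP[av vb].
  have h : l * `|v - u| <= l * (b - a).
    by rewrite ler_wpM2l// ler_norml; apply/andP; split; lra.
  have := le_trans (gl v u) h; rewrite ler_norml => /andP[h1 h2].
  by apply/andP; split; lra.
have [st|/ltW ts] := leP s t.
  have /andP[h1 h2] := key s t s st ltac:(by rewrite lexx).
  by rewrite ler_norml; apply/andP; split; lra.
have /andP[h1 h2] := key t s s ts ltac:(by rewrite lexx ts).
by rewrite ler_norml; apply/andP; split; lra.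
Qed.

(** Since [g >= 1], neither the division by [g] nor the passage to the 1-Lipschitz inverse worsens
    the constant of [Lam_taylor]. *)
Lemma LamV_taylor y z : `|LamV z - LamV y - (g (LamV y))^-1 * (z - y)| <= l * (z - y) ^+ 2.
Proof.
have gp : 0 < g (LamV y) by apply: lt_le_trans (g1 _).
have := Lam_taylor (LamV y) (LamV z); rewrite !LamVK => h.
have -> : LamV z - LamV y - (g (LamV y))^-1 * (z - y) =
   - ((g (LamV y))^-1 * (z - y - g (LamV y) * (LamV z - LamV y))).
  by field; rewrite gt_eqF.
rewrite normrN normrM normfV (gtr0_norm gp) -[X in _ <= X]mul1r.
apply: ler_pM => //; first by rewrite invr_ge0 ltW.
  by rewrite invf_le1.
apply: (le_trans h); rewrite ler_wpM2l//.
rewrite -(real_normK (num_real (LamV z - LamV y))) -(real_normK (num_real (z - y))).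
by rewrite lerXn2r ?nnegrE// LamV_lip.
Qed.

End taylor.

End profile.

(** * Products and stretchings of C^{1,1} functions *)

Section c11b.
Context {R : realType}.

(** [c11] without the range and the support: the factors of a product do not have these properties
    separately. *)
Record c11b n (L : R) (u : 'rV[R]_n -> R) (G : 'rV[R]_n -> 'rV[R]_n) : Prop := C11b {
  cb_bd : forall x, `|u x| <= L;
  cb_lip : forall x y, `|u x - u y| <= L * `|x - y|;
  cb_gbd : forall x i, `|G x 0 i| <= L;
  cb_glip : forall x y i, `|G x 0 i - G y 0 i| <= L * `|x - y|;
  cb_taylor : forall x z, `|u (x + z) - u x - dotv (G x) z| <= L * `|z| ^+ 2 }.

Lemma c11b_ge0 n L (u : 'rV[R]_n -> R) G : c11b L u G -> 0 <= L.
Proof. by move=> cu; apply: le_trans (cb_bd cu 0). Qed.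

Lemma normM_le (a b c d : R) : `|a| <= c -> `|b| <= d -> `|a * b| <= c * d.
Proof. by move=> h1 h2; rewrite normrM ler_pM. Qed.

Lemma c11b_mul n L L' (u v : 'rV[R]_n -> R) G H : c11b L u G -> c11b L' v H ->
  c11b (4 * (L * L')) (fun x => u x * v x) (fun x => u x *: H x + v x *: G x).
Proof.
move=> cu cv; have L0 := c11b_ge0 cu; have L'0 := c11b_ge0 cv.
have LL : 0 <= L * L' by rewrite mulr_ge0.
have lip2 (a b : 'rV[R]_n -> R) A B x y : 0 <= A -> 0 <= B -> `|a x| <= A -> `|b y| <= B ->
    `|a x - a y| <= A * `|x - y| -> `|b x - b y| <= B * `|x - y| ->
    `|a x * b x - a y * b y| <= 2 * (A * B) * `|x - y|.
  move=> A0 B0 h1 h2 h3 h4.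
  have -> : a x * b x - a y * b y = a x * (b x - b y) + (a x - a y) * b y by ring.
  apply: (le_trans (ler_normD _ _)).
  have := normM_le h1 h4; have := normM_le h3 h2.
  rewrite (_ : A * `|x - y| * B = A * B * `|x - y|); last by ring.
  clear; lra.
split => [x|x y|x i|x y i|x z].
- by have := normM_le (cb_bd cu x) (cb_bd cv x); lra.
- apply: (le_trans (lip2 u v L L' x y L0 L'0 (cb_bd cu x) (cb_bd cv y) (cb_lip cu x y) (cb_lip cv x y))).
  by rewrite ler_wpM2r//; lra.
- rewrite !mxE; apply: (le_trans (ler_normD _ _)).
  have := normM_le (cb_bd cu x) (cb_gbd cv x i); have := normM_le (cb_bd cv x) (cb_gbd cu x i).
  by rewrite [L' * L]mulrC; lra.
- rewrite !mxE opprD addrACA; apply: (le_trans (ler_normD _ _)).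
  have := lip2 u (fun x => H x 0 i) L L' x y L0 L'0 (cb_bd cu x) (cb_gbd cv y i) (cb_lip cu x y) (cb_glip cv x y i).
  have := lip2 v (fun x => G x 0 i) L' L x y L'0 L0 (cb_bd cv x) (cb_gbd cu y i) (cb_lip cv x y) (cb_glip cu x y i).
  clear; lra.
- rewrite dotvDl !dotvZl.
  have -> : u (x + z) * v (x + z) - u x * v x - (u x * dotv (H x) z + v x * dotv (G x) z) =
    (u (x + z) - u x) * (v (x + z) - v x) + u x * (v (x + z) - v x - dotv (H x) z) +
     v x * (u (x + z) - u x - dotv (G x) z) by ring.
  have h1 := cb_lip cu (x + z) x; have h2 := cb_lip cv (x + z) x.
  rewrite addrAC subrr add0r in h1 h2.
  apply: (le_trans (ler_normD _ _)); apply: (le_trans (lerD (ler_normD _ _) (lexx _))).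
  have := normM_le h1 h2; have := normM_le (cb_bd cu x) (cb_taylor cv x z).
  have := normM_le (cb_bd cv x) (cb_taylor cu x z).
  rewrite (_ : L * `|z| * (L' * `|z|) = L * L' * `|z| ^+ 2); last by ring.
  rewrite !mulrA [L' * L]mulrC -[4 * L * L']mulrA -[4 * (L * L') * _]mulrA.
  have : 0 <= L * L' * `|z| ^+ 2 by rewrite mulr_ge0.
  by clear; lra.
Qed.

Lemma c11b_scale n L (u : 'rV[R]_n -> R) G c : c11b L u G ->
  c11b (`|c| * L) (fun x => c * u x) (fun x => c *: G x).
Proof.
move=> cu; split => [x|x y|x i|x y i|x z].
- by rewrite normrM ler_wpM2l// (cb_bd cu).
- by rewrite -mulrBr normrM -mulrA ler_wpM2l// (cb_lip cu).
- by rewrite mxE normrM ler_wpM2l// (cb_gbd cu).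
- by rewrite !mxE -mulrBr normrM -mulrA ler_wpM2l// (cb_glip cu).
- by rewrite dotvZl -!mulrBr normrM -mulrA ler_wpM2l// (cb_taylor cu).
Qed.

Lemma c11b_c11 n L K (u : 'rV[R]_n -> R) G : c11b L u G -> (forall x, 0 <= u x <= 1) ->
  (forall x, K <= `|x| -> u x = 0) -> (forall x, K <= `|x| -> G x = 0) -> c11 L K u G.
Proof.
move=> cu u01 uK GK; split => //.
- by split=> [x|x y|]//; [exact: (cb_bd cu)|exact: (cb_lip cu)].
- move=> i; split=> [x|x y|x Kx]; [exact: (cb_gbd cu)|exact: (cb_glip cu)|].
  by rewrite GK// mxE.
- exact: (cb_taylor cu).
Qed.

Lemma upd_norm_le n (x : 'rV[R]_n) i s : `|s| <= `|x 0 i| -> `|upd x i s| <= `|x|.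
Proof.
move=> h; apply: norm_le_coord => // j; rewrite updE; case: eqP => [_|_]; last exact: norm_coord.
exact: le_trans h (norm_coord _ _).
Qed.

Section compose.
Variables (g : R -> R) (M l : R) (n : nat) (i : 'I_n.+1).
Hypothesis mg : measurable_fun setT g.
Hypothesis g1 : forall t, 1 <= g t.
Hypothesis gM : forall t, g t <= M.
Hypothesis gl : forall s t, `|g s - g t| <= l * `|s - t|.

(** The chain rule: the partial derivative along the stretched axis is multiplied by the slope
    [1 / g] of [LamV]. *)
Definition stretch_grad (G : 'rV[R]_n.+1 -> 'rV[R]_n.+1) (y : 'rV[R]_n.+1) :=
  let x := stretchV g i y in upd (G x) i ((g (x 0 i))^-1 * G x 0 i).

Lemma stretch_gradE G y j : stretch_grad G y 0 j =
  if j == i then (g (stretchV g i y 0 i))^-1 * G (stretchV g i y) 0 i else G (stretchV g i y) 0 j.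
Proof. by rewrite /stretch_grad updE. Qed.

Lemma stretchV_lip (y z : 'rV[R]_n.+1) : `|stretchV g i y - stretchV g i z| <= `|y - z|.
Proof.
apply: norm_le_coord => // j; rewrite !mxE; case: (eqVneq j i) => [_|_].
  by apply: (le_trans (LamV_lip mg g1 gM _ _)); have := norm_coord (y - z) i; rewrite !mxE.
by have := norm_coord (y - z) j; rewrite !mxE.
Qed.

Let gV0 t : 0 <= (g t)^-1 <= 1.
Proof.
have gp : 0 < g t by apply: lt_le_trans (g1 t).
by rewrite invr_ge0 (ltW gp)/= invf_le1.
Qed.

Let gV_lip s t : `|(g s)^-1 - (g t)^-1| <= l * `|s - t|.
Proof.
have gs : 0 < g s by apply: lt_le_trans (g1 s).
have gt : 0 < g t by apply: lt_le_trans (g1 t).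
have -> : (g s)^-1 - (g t)^-1 = - ((g s)^-1 * (g t)^-1 * (g s - g t)).
  by field; rewrite !gt_eqF.
rewrite normrN normrM; apply: le_trans (gl s t).
rewrite ler_piMl// normrM; have /andP[a0 a1] := gV0 s; have /andP[b0 b1] := gV0 t.
by rewrite !ger0_norm// mulr_ile1.
Qed.

Lemma c11b_stretch L u G : c11b L u G ->
  c11b (L * (1 + l)) (fun y => u (stretchV g i y)) (stretch_grad G).
Proof.
move=> cu; have L0 := c11b_ge0 cu.
have l0 : 0 <= l by have := gl 1 0; rewrite subr0 normr1 mulr1; apply: le_trans.
have LL : L <= L * (1 + l) by rewrite ler_peMr// lerDl.
have sl := stretchV_lip.
split => [x|x y|x j|x y j|y z].
- exact: le_trans (cb_bd cu _) LL.
- apply: (le_trans (cb_lip cu _ _)); apply: ler_pM => //.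
- apply: le_trans LL; rewrite stretch_gradE; case: (eqVneq j i) => [_|_]; last exact: (cb_gbd cu).
  rewrite normrM; apply: le_trans (cb_gbd cu (stretchV g i x) i).
  by rewrite ler_piMl// ger0_norm; have /andP[] := gV0 (stretchV g i x 0 i).
- rewrite !stretch_gradE; case: (eqVneq j i) => [_|_]; last first.
    by apply: (le_trans (cb_glip cu _ _ _)); apply: ler_pM.
  set a := stretchV g i x; set b := stretchV g i y.
  have -> : (g (a 0 i))^-1 * G a 0 i - (g (b 0 i))^-1 * G b 0 i =
    (g (a 0 i))^-1 * (G a 0 i - G b 0 i) + ((g (a 0 i))^-1 - (g (b 0 i))^-1) * G b 0 i by ring.
  apply: (le_trans (ler_normD _ _)).
  have h1 : `|(g (a 0 i))^-1 * (G a 0 i - G b 0 i)| <= L * `|x - y|.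
    rewrite normrM; apply: (@le_trans _ _ (`|G a 0 i - G b 0 i|)).
      by rewrite ler_piMl// ger0_norm; have /andP[] := gV0 (a 0 i).
    by apply: (le_trans (cb_glip cu _ _ _)); apply: ler_wpM2l => //; exact: sl.
  have h2 : `|((g (a 0 i))^-1 - (g (b 0 i))^-1) * G b 0 i| <= l * `|x - y| * L.
    apply: normM_le; last exact: (cb_gbd cu).
    apply: (le_trans (gV_lip _ _)); rewrite ler_wpM2l//.
    by apply: le_trans (sl x y); have := norm_coord (a - b) i; rewrite !mxE.
  by apply: (le_trans (lerD h1 h2)); rewrite -subr_ge0 (_ : _ - _ = 0)//; ring.
- set x := stretchV g i y.
  pose h := LamV g (y 0 i + z 0 i) - LamV g (y 0 i).
  have e : stretchV g i (y + z) = x + upd z i h.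
    apply/rowP => j; rewrite !mxE; case: (j == i) => //.
    by rewrite /h [RHS]addrC subrK.
  have hz : `|h| <= `|z 0 i|.
    apply: (le_trans (LamV_lip mg g1 gM _ _)); by rewrite addrAC subrr add0r.
  have xi : x 0 i = LamV g (y 0 i) by rewrite upd_same.
  have d : dotv (G x) (upd z i h) - dotv (stretch_grad G y) z =
      G x 0 i * (h - (g (x 0 i))^-1 * z 0 i).
    rewrite /dotv (bigD1 i)//= [X in _ - X](bigD1 i)//= stretch_gradE upd_same eqxx.
    rewrite (eq_bigr (fun j => stretch_grad G y 0 j * z 0 j)); last first.
      by move=> j ji; rewrite stretch_gradE updE (negbTE ji).
    by rewrite -/x; ring.
  (* The remainder splits into the Taylor error of [u] for the actual displacement and the Taylor
     error of [LamV] multiplied by a partial derivative. *)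
  rewrite e (_ : _ - _ - _ = (u (x + upd z i h) - u x - dotv (G x) (upd z i h)) +
     (dotv (G x) (upd z i h) - dotv (stretch_grad G y) z)); last by ring.
  apply: (le_trans (ler_normD _ _)); rewrite mulrDr mulr1 mulrDl; apply: lerD.
    apply: (le_trans (cb_taylor cu _ _)); rewrite ler_wpM2l// lerXn2r ?nnegrE//.
    exact: upd_norm_le.
  rewrite d -mulrA; apply: normM_le; first exact: (cb_gbd cu).
  have := LamV_taylor mg g1 gM gl (y 0 i) (y 0 i + z 0 i).
  have -> : y 0 i + z 0 i - y 0 i = z 0 i by rewrite addrAC subrr add0r.
  rewrite -/h -xi => /le_trans; apply; rewrite ler_wpM2l//.
  rewrite -(real_normK (num_real (z 0 i))) lerXn2r ?nnegrE//; exact: norm_coord.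
Qed.

(** Shrinking one component shortens the gradient, while the change of variables contributes the
    factor [g]; so the Euclidean total variation of the stretched function is at most the weighted
    one. *)
Lemma stretch_grad_le G y : enorm (stretch_grad G y) <= enorm (G (stretchV g i y)).
Proof.
rewrite -(ler_pXn2r (ltn0Sn 1)) ?nnegrE// !sqr_enorm /dotv; apply: ler_sum => j _.
rewrite !stretch_gradE; case: (eqVneq j i) => [->|//].
rewrite -!expr2 exprMn ler_piMl ?sqr_ge0//; have /andP[a b] := gV0 (stretchV g i y 0 i).
by rewrite exprn_ile1.
Qed.

End compose.
End c11b.

(** * Mollification of smooth sets *)

Section mollifier.
Context {R : realType} {n : nat} (e : R).
Hypothesis e0 : 0 < e.
Implicit Types (z w : 'rV[R]_n).

(** The mollifier [eta] is the square of this truncated paraboloid: explicit, supported in the ball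
    of radius [e], and of class C^{1,1}. It is not normalised; its integral is divided out at the
    end. *)
Definition etam z : R := Num.max 0 (e ^+ 2 - dotv z z).
Definition eta z : R := etam z ^+ 2.
Definition deta z : 'rV[R]_n := (- 4 * etam z) *: z.

Lemma etam_itv z : 0 <= etam z <= e ^+ 2.
Proof. by rewrite le_max lexx/= ge_max sqr_ge0 lerBlDr lerDl dotv_ge0. Qed.

Lemma etam_out z : e <= enorm z -> etam z = 0.
Proof.
move=> ez; rewrite /etam max_l// subr_le0 -sqr_enorm lerXn2r ?nnegrE//; exact: ltW.
Qed.

Lemma max0_lip (a b : R) : `|Num.max 0 a - Num.max 0 b| <= `|a - b|.
Proof.
rewrite ler_norml; have h1 := ler_norm (a - b); have h2 := ler_norm (b - a).
rewrite distrC in h2; apply/andP; split; case: (leP 0 a) => ha; case: (leP 0 b) => hb; lra.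
Qed.

Lemma dotv_cauchy z w : `|dotv z w| <= enorm z * enorm w.
Proof.
rewrite ler_norml dotv_le andbT lerNl -dotvNl -(enormN z); exact: dotv_le.
Qed.

Lemma dotvD_sq z w : dotv (z + w) (z + w) = dotv z z + 2 * dotv z w + dotv w w.
Proof. by rewrite dotvDl !dotvDr (dotvC w z); ring. Qed.

(** If [|w| >= e] the total oscillation is small enough, and if [|z| >= 2 e >= 2 |w|] both values
    vanish; in between [2 |z| + |w| <= 5 e]. *)
Lemma etam_lip z w : `|etam (z + w) - etam z| <= 5 * e * enorm w.
Proof.
have w0 := enorm_ge0 w; have ew0 : 0 <= e * enorm w by rewrite mulr_ge0// ltW.
have /andP[m0 m1] := etam_itv z; have /andP[m0' m1'] := etam_itv (z + w).
have [we|/ltW we] := leP e (enorm w).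
  have : e ^+ 2 <= e * enorm w by rewrite expr2 ler_pM2l.
  by rewrite -mulrA; move=> h; rewrite ler_norml; apply/andP; split; lra.
have [ze|/ltW ze] := leP (2 * e) (enorm z).
  have h : enorm z <= enorm (z + w) + enorm w.
    by have := enorm_subD 0 (z + w) w; rewrite subr0 addrK sub0r enormN; lra.
  rewrite !etam_out ?subrr ?normr0 -?mulrA ?mulr_ge0//; lra.
apply: (le_trans (max0_lip _ _)); rewrite dotvD_sq.
have -> : e ^+ 2 - (dotv z z + 2 * dotv z w + dotv w w) - (e ^+ 2 - dotv z z) =
  - (2 * dotv z w + dotv w w) by ring.
rewrite normrN; apply: (le_trans (ler_normD _ _)); rewrite normrM ger0_norm//.
rewrite (ger0_norm (dotv_ge0 _)) -sqr_enorm.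
have h1 := dotv_cauchy z w.
have h2 : enorm z * enorm w <= 2 * e * enorm w by rewrite ler_wpM2r.
have h3 : enorm w ^+ 2 <= e * enorm w by rewrite expr2 ler_wpM2r.
by rewrite -!mulrA in h2 *; lra.
Qed.

Lemma max0_taylor (t s : R) :
  `|Num.max 0 (t + s) ^+ 2 - Num.max 0 t ^+ 2 - 2 * Num.max 0 t * s| <= s ^+ 2.
Proof.
case: (leP 0 t) => ht; case: (leP 0 (t + s)) => hs; rewrite ler_norml; apply/andP; split; nra.
Qed.

Lemma eta_itv z : 0 <= eta z <= e ^+ 4.
Proof.
have /andP[m0 m1] := etam_itv z; rewrite exprn_ge0//=.
by rewrite -[4%N]/(2 * 2)%N exprM lerXn2r ?nnegrE ?sqr_ge0.
Qed.

Lemma eta_lip z w : `|eta (z + w) - eta z| <= 10 * e ^+ 3 * enorm w.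
Proof.
have /andP[m0 m1] := etam_itv z; have /andP[m0' m1'] := etam_itv (z + w).
rewrite /eta subr_sqr; have h1 := etam_lip z w.
have h2 : `|etam (z + w) + etam z| <= 2 * e ^+ 2 by rewrite ger0_norm ?addr_ge0//; lra.
apply: (le_trans (normM_le h1 h2)); rewrite le_eqVlt; apply/orP; left; apply/eqP; ring.
Qed.

Lemma etamZ_lip z w i : `|etam (z + w) * (z + w) 0 i - etam z * z 0 i| <= 6 * e ^+ 2 * enorm w.
Proof.
have w0 := enorm_ge0 w; have ew0 : 0 <= e * enorm w by rewrite mulr_ge0// ltW.
have e2 : 0 <= e ^+ 2 * enorm w by rewrite mulr_ge0// exprn_ge0// ltW.
have /andP[m0 m1] := etam_itv z.
have h1 := etam_lip z w.
have [ze|/ltW ze] := leP e (enorm (z + w)); last first.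
  have -> : etam (z + w) * (z + w) 0 i - etam z * z 0 i =
     (etam (z + w) - etam z) * (z + w) 0 i + etam z * w 0 i by rewrite !mxE; ring.
  apply: (le_trans (ler_normD _ _)).
  have h2 := normM_le h1 (le_trans (abs_le_enorm (z + w) i) ze).
  have h3 : `|etam z * w 0 i| <= e ^+ 2 * enorm w.
    by apply: normM_le; [rewrite ger0_norm|exact: abs_le_enorm].
  rewrite (_ : 6 * e ^+ 2 * enorm w = 5 * e * enorm w * e + e ^+ 2 * enorm w); last by ring.
  exact: lerD.
rewrite [etam (z + w)]etam_out// mul0r sub0r normrN.
have [ze'|/ltW ze'] := leP e (enorm z); first by rewrite etam_out// mul0r normr0 -mulrA mulr_ge0.
rewrite [etam (z + w)]etam_out// sub0r normrN in h1.
apply: (le_trans (normM_le h1 (le_trans (abs_le_enorm z i) ze'))).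
by rewrite -subr_ge0 (_ : _ - _ = e ^+ 2 * enorm w)//; ring.
Qed.

(** The constant is 25 + 2: the square of the variation [5 e |w|] of the squared norm, and the term
    [2 etam |w|^2] that the gradient omits. *)
Lemma eta_taylor z w : `|eta (z + w) - eta z - dotv (deta z) w| <= 27 * e ^+ 2 * enorm w ^+ 2.
Proof.
have w0 := enorm_ge0 w; have /andP[m0 m1] := etam_itv z.
have e2w : 0 <= e ^+ 2 * enorm w ^+ 2 by rewrite mulr_ge0// exprn_ge0// ltW.
have [we|/ltW we] := leP e (enorm w).
  have /andP[p0 p1] := eta_itv z; have /andP[p0' p1'] := eta_itv (z + w).
  have h1 : `|dotv (deta z) w| <= 4 * (e ^+ 2 * e) * enorm w.
    rewrite dotvZl !mulNr normrN -mulrA normrM (ger0_norm (ler0n _ 4)) -mulrA ler_pM2l//.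
    have [ze|/ltW ze] := leP e (enorm z).
      by rewrite etam_out// mul0r normr0 !mulr_ge0 ?exprn_ge0// ltW.
    rewrite -mulrA; apply: normM_le; first by rewrite ger0_norm.
    by apply: (le_trans (dotv_cauchy _ _)); rewrite ler_wpM2r.
  apply: (le_trans (ler_normB _ _)).
  have h2 : `|eta (z + w) - eta z| <= e ^+ 4 by rewrite ler_norml; apply/andP; split; lra.
  have ee : e ^+ 2 <= enorm w ^+ 2 by rewrite lerXn2r ?nnegrE// ltW.
  have h3 : e ^+ 4 <= e ^+ 2 * enorm w ^+ 2.
    by rewrite -[4%N]/(2 + 2)%N exprD ler_wpM2l// exprn_ge0// ltW.
  have h4 : e ^+ 2 * e * enorm w <= e ^+ 2 * enorm w ^+ 2.
    by rewrite -mulrA ler_wpM2l ?exprn_ge0 ?(ltW e0)// expr2 ler_wpM2r.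
  move: h1; rewrite -!mulrA; move: h4; rewrite -!mulrA => h4 h1; lra.
have [ze|/ltW ze] := leP (2 * e) (enorm z).
  have h : enorm z <= enorm (z + w) + enorm w.
    by have := enorm_subD 0 (z + w) w; rewrite subr0 addrK sub0r enormN; lra.
  rewrite /deta /eta !etam_out; try lra.
  rewrite mulr0 scale0r (_ : dotv 0 w = 0); last by rewrite dotvC dotv0r.
  by rewrite expr0n/= !subr0 normr0 -mulrA mulr_ge0.
pose t := e ^+ 2 - dotv z z; pose s := - (2 * dotv z w + dotv w w).
have em : etam z = Num.max 0 t by [].
have em' : etam (z + w) = Num.max 0 (t + s).
  by rewrite /etam dotvD_sq; congr Num.max; rewrite /t /s; ring.
have -> : eta (z + w) - eta z - dotv (deta z) w =
  (Num.max 0 (t + s) ^+ 2 - Num.max 0 t ^+ 2 - 2 * Num.max 0 t * s) - 2 * etam z * dotv w w.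
  by rewrite /eta em' em /deta dotvZl em /s; ring.
apply: (le_trans (ler_normB _ _)).
have h1 := max0_taylor t s.
have h2 : `|2 * etam z * dotv w w| <= 2 * (e ^+ 2 * enorm w ^+ 2).
  rewrite -mulrA normrM ger0_norm// ler_pM2l// -sqr_enorm.
  by rewrite normrM !ger0_norm ?exprn_ge0// ler_wpM2r ?exprn_ge0.
have h3 : s ^+ 2 <= 25 * (e ^+ 2 * enorm w ^+ 2).
  have h : `|s| <= 5 * e * enorm w.
    rewrite /s normrN; apply: (le_trans (ler_normD _ _)); rewrite normrM ger0_norm//.
    rewrite (ger0_norm (dotv_ge0 _)) -sqr_enorm.
    have h1' := dotv_cauchy z w.
    have h2' : enorm z * enorm w <= 2 * e * enorm w by rewrite ler_wpM2r.
    have h3' : enorm w ^+ 2 <= e * enorm w by rewrite expr2 ler_wpM2r.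
    by rewrite -!mulrA in h2' *; lra.
  rewrite -(real_normK (num_real s)) (_ : 25 * _ = (5 * e * enorm w) ^+ 2); last by ring.
  by rewrite lerXn2r ?nnegrE// !mulr_ge0// ltW.
lra.
Qed.

Lemma eta_c11b : exists L, c11b L eta deta.
Proof.
pose C := e ^+ 4 + 10 * e ^+ 3 + 27 * e ^+ 2 + 4 * e ^+ 3.
have p1 : 0 <= e ^+ 4 by rewrite exprn_ge0// ltW.
have p2 : 0 <= e ^+ 3 by rewrite exprn_ge0// ltW.
have p3 : 0 <= e ^+ 2 by rewrite exprn_ge0// ltW.
(* The mollifier is radial for the Euclidean norm while the class is stated with the maximum norm;
   [N] converts between them. *)
have [N [N1 NE]] : exists N : R, 1 <= N /\ forall w, enorm w <= N * `|w|.
  exists (1 + n%:R); split; first by rewrite lerDl.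
  by move=> w; apply: (le_trans (enorm_le_norm w)); rewrite ler_wpM2r// lerDr.
have N0 : 0 <= N by apply: le_trans N1.
have NN : 1 <= N ^+ 2 by rewrite exprn_ege1.
have N2 : N <= N ^+ 2 by rewrite expr2 ler_peMl.
have C0 : 0 <= C by rewrite /C; lra.
have up c d k : 0 <= d -> 0 <= c -> c <= C -> k <= N ^+ 2 -> 0 <= k -> c * (k * d) <= C * N ^+ 2 * d.
  by move=> d0 c0 cC kN k0; rewrite -mulrA; apply: ler_pM => //; rewrite ?mulr_ge0// ler_wpM2r.
exists (C * N ^+ 2); split => [x|x y|x i|x y i|x z].
- have /andP[h0 h1] := eta_itv x; rewrite ger0_norm//; apply: (le_trans h1).
  by apply: (@le_trans _ _ C); [rewrite /C; lra|rewrite ler_peMr].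
- have := eta_lip y (x - y); rewrite (addrC y) subrK => /le_trans; apply.
  apply: (@le_trans _ _ (10 * e ^+ 3 * (N * `|x - y|))); first by rewrite ler_wpM2l// mulr_ge0.
  by apply: up => //; [rewrite mulr_ge0|rewrite /C; lra].
- have /andP[m0 m1] := etam_itv x; rewrite mxE mulNr mulNr normrN -mulrA normrM (ger0_norm (ler0n _ 4)).
  apply: (@le_trans _ _ C); last by rewrite ler_peMr.
  apply: (@le_trans _ _ (4 * (e ^+ 2 * e))); last by rewrite -exprSr /C; lra.
  rewrite ler_pM2l//; have [xe|/ltW xe] := leP e (enorm x).
    by rewrite etam_out// mul0r normr0 mulr_ge0// ltW.
  by apply: normM_le; [rewrite ger0_norm|exact: le_trans (abs_le_enorm x i) xe].
- rewrite !mxE (_ : - 4 * etam x * x 0 i - - 4 * etam y * y 0 i =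
    - (4 * (etam x * x 0 i - etam y * y 0 i))); last by ring.
  rewrite normrN normrM (ger0_norm (ler0n _ 4)).
  have := etamZ_lip y (x - y) i; rewrite (addrC y) subrK => h.
  apply: (@le_trans _ _ (4 * (6 * e ^+ 2 * enorm (x - y)))); first by rewrite ler_pM2l.
  apply: (@le_trans _ _ (24 * e ^+ 2 * (N * `|x - y|))).
    rewrite (_ : 4 * _ = 24 * e ^+ 2 * enorm (x - y)); last by ring.
    by rewrite ler_wpM2l// mulr_ge0.
  by apply: up => //; [rewrite mulr_ge0|rewrite /C; lra].
- apply: (le_trans (eta_taylor x z)).
  apply: (@le_trans _ _ (27 * e ^+ 2 * (N ^+ 2 * `|z| ^+ 2))).
    apply: ler_wpM2l; first by rewrite mulr_ge0.
    by rewrite -exprMn lerXn2r ?nnegrE ?mulr_ge0//.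
  have h1 : 0 <= 27 * e ^+ 2 by rewrite mulr_ge0.
  have h2 : 27 * e ^+ 2 <= C by rewrite /C; lra.
  exact: (up _ _ _ (exprn_ge0 2 (normr_ge0 z)) h1 h2 (lexx _) (exprn_ge0 2 N0)).
Qed.

(** Moving the centre by at most [e'] is absorbed by enlarging the radius by [e']. This permits
    sampling the kernel at one point of each boundary piece. *)
Lemma eta_shift e' z w : enorm w <= e' -> eta (z + w) <= (Num.max 0 ((e + e') ^+ 2 - dotv z z)) ^+ 2.
Proof.
move=> we; have e'0 : 0 <= e' by apply: le_trans we.
rewrite lerXn2r ?nnegrE ?le_max ?lexx//.
have [ze|/ltW ze] := leP e (enorm (z + w)); first by rewrite etam_out// lexx.
apply/orP; right.
have h : enorm z <= enorm (z + w) + e'.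
  by have := enorm_subD 0 (z + w) w; rewrite subr0 addrK sub0r enormN; lra.
have : enorm z ^+ 2 <= (enorm (z + w) + e') ^+ 2 by rewrite lerXn2r ?nnegrE ?addr_ge0.
have : enorm (z + w) * e' <= e * e' by rewrite ler_wpM2r.
have := sqr_ge0 (enorm (z + w)); have := ltW (exprn_gt0 2 e0).
rewrite /etam ge_max -!sqr_enorm !sqrrD.
have ze2 : enorm (z + w) ^+ 2 <= e ^+ 2 by rewrite lerXn2r ?nnegrE// ltW.
by move=> ????; apply/andP; split; lra.
Qed.

End mollifier.

(** * Convolution of a kernel with a set *)

Section convolution.
Context {R : realType} (n : nat) (S : set (@bV R n)) (s : R).
Hypothesis mS : measurable S.
Hypothesis Ss : lebB S = s%:E.

Definition convS (h : 'rV[R]_n -> R) (x : 'rV[R]_n) : R := \int[@lebB R n]_(y in S) h (x - y).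

Let s0 : 0 <= s. Proof. by rewrite -lee_fin -Ss. Qed.

Lemma bounded_integrableS (c : R) (h : @bV R n -> R) : measurable_fun setT h -> (forall x, `|h x| <= c) ->
  (@lebB R n).-integrable S (EFin \o h).
Proof.
move=> mh hc; apply: measurable_bounded_integrable => //.
- by change (lebB S < +oo)%E; rewrite Ss ltry.
- exact: measurable_funS mh.
- exists c; split; first exact: num_real.
  by move=> M cM x _; apply: le_trans (hc x) (ltW cM).
Qed.

Lemma bounded_intS (c : R) (h : @bV R n -> R) : measurable_fun setT h -> (forall x, `|h x| <= c) ->
  `|\int[@lebB R n]_(y in S) h y| <= c * s.
Proof.
move=> mh hc; apply: (le_trans (le_normr_Rintegral _ (bounded_integrableS mh hc))) => //.
have -> : c * s = \int[@lebB R n]_(y in S) (cst c) y.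
  rewrite Rintegral_cst//; congr (_ * _); symmetry; exact: (congr1 fine Ss).
apply: le_Rintegral => //.
- apply: (@bounded_integrableS c (fun x => `|h x|)) => [|x]; first exact: measurableT_comp.
  by rewrite normr_id.
- by apply: (@bounded_integrableS `|c| (cst c)).
Qed.

Lemma measurable_shift (h : 'rV[R]_n -> R) (x : 'rV[R]_n) : measurable_fun [set: @bV R n] (h : @bV R n -> R) ->
  measurable_fun [set: @bV R n] (fun y : @bV R n => h (x - y)).
Proof.
move=> mh; apply: (measurableT_comp mh); apply: measurable_to_bV => i.
under eq_fun do rewrite !mxE.
by apply: measurable_funB => //; exact: measurable_coord.
Qed.

Lemma intS_sum (I : finType) (c : R) (h : I -> @bV R n -> R) : (forall i, measurable_fun setT (h i)) ->
  (forall i x, `|h i x| <= c) ->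
  \int[@lebB R n]_(y in S) (\sum_i h i y) = \sum_i \int[@lebB R n]_(y in S) h i y.
Proof.
move=> mh hc.
have H (r : seq I) : (@lebB R n).-integrable S (EFin \o (fun y => \sum_(i <- r) h i y)) /\
   \int[@lebB R n]_(y in S) (\sum_(i <- r) h i y) = \sum_(i <- r) \int[@lebB R n]_(y in S) h i y.
  elim: r => [|i r [IH1 IH2]].
    split; first by under eq_fun do rewrite big_nil; apply: (@bounded_integrableS 0 (cst 0)) => // x; rewrite normr0.
    by rewrite big_nil; under eq_Rintegral do rewrite big_nil; rewrite Rintegral_cst// mul0r.
  have hi := bounded_integrableS (mh i) (hc i).
  split.
    rewrite (_ : _ \o _ = ((EFin \o h i) \+ (EFin \o (fun y => (\sum_(j <- r) h j y)%R)))%E).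
      exact: integrableD.
    by apply/funext => y; rewrite /= big_cons EFinD.
  rewrite big_cons; under eq_Rintegral do rewrite big_cons.
  by rewrite RintegralD// IH2.
exact: (H _).2.
Qed.

Lemma c11b_conv L (h : 'rV[R]_n -> R) dh : c11b L h dh ->
  c11b (L * s) (convS h) (fun x => \row_i convS (fun z => dh z 0 i) x).
Proof.
move=> ch.
have mh : measurable_fun [set: @bV R n] (h : @bV R n -> R).
  exact: continuous_measurableV (lip_continuous (cb_lip ch)).
have mdh i : measurable_fun [set: @bV R n] ((fun z => dh z 0 i) : @bV R n -> R).
  by apply: continuous_measurableV; apply: (@lip_continuous _ _ _ L) => x y; exact: (cb_glip ch).
have I1 x := bounded_integrableS (measurable_shift x mh) (fun y => cb_bd ch (x - y)).
have I2 x i := bounded_integrableS (measurable_shift x (mdh i)) (fun y => cb_gbd ch (x - y) i).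
split => [x|x y|x i|x y i|x z].
- by apply: bounded_intS; [exact: measurable_shift|move=> y; exact: (cb_bd ch)].
- rewrite /convS -RintegralB// mulrAC; apply: bounded_intS.
    by apply: measurable_funB; exact: measurable_shift.
  by move=> w; apply: (le_trans (cb_lip ch _ _)); rewrite opprB addrA subrK.
- rewrite mxE; apply: bounded_intS; first exact: measurable_shift (mdh i).
  by move=> y; exact: (cb_gbd ch).
- rewrite !mxE /convS -RintegralB// mulrAC; apply: bounded_intS.
    by apply: measurable_funB; [exact: (measurable_shift x (mdh i))|exact: (measurable_shift y (mdh i))].
  by move=> w; apply: (le_trans (cb_glip ch _ _ _)); rewrite opprB addrA subrK.
- have -> : dotv (\row_i convS (fun z0 => dh z0 0 i) x) z =
      \int[@lebB R n]_(y in S) dotv (dh (x - y)) z.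
    rewrite /dotv (@intS_sum _ (L * `|z|) (fun i y => dh (x - y) 0 i * z 0 i)).
    + apply: eq_bigr => i _; rewrite mxE /convS -RintegralZr//.
    + by move=> i; apply: measurable_funM => //; exact: (measurable_shift x (mdh i)).
    + by move=> i y; apply: normM_le; [exact: (cb_gbd ch)|exact: norm_coord].
  have md : measurable_fun [set: @bV R n] (fun y : @bV R n => dotv (dh (x - y)) z).
    by apply: measurable_sum_ord => i; apply: measurable_funM => //; exact: (measurable_shift x (mdh i)).
  have id : (@lebB R n).-integrable S (EFin \o (fun y => dotv (dh (x - y)) z)).
    apply: (@bounded_integrableS (\sum_(i < n) L * `|z|)) => // y.
    apply: (le_trans (ler_norm_sum _ _ _)); apply: ler_sum => i _.
    by apply: normM_le; [exact: (cb_gbd ch)|exact: norm_coord].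
  have mz : measurable_fun [set: @bV R n] (fun y : @bV R n => h (x + z - y) - h (x - y)).
    by apply: measurable_funB; exact: measurable_shift.
  have iz : (@lebB R n).-integrable S (EFin \o (fun y => h (x + z - y) - h (x - y))).
    apply: (@bounded_integrableS (L + L)) => // y; apply: (le_trans (ler_normB _ _)).
    by apply: lerD; exact: (cb_bd ch).
  rewrite /convS -RintegralB// -RintegralB// mulrAC; apply: bounded_intS.
    exact: measurable_funB.
  by move=> y; have := cb_taylor ch (x - y) z; rewrite (_ : x - y + z = x + z - y) // addrAC.
Qed.

End convolution.

(** * Points that cross a boundary under translation *)

Section crossing.
Context {R : realType}.

Lemma closed_boundary n (S : set 'rV[R]_n) : closed (boundary S).
Proof. by rewrite /boundary setDE; apply: closedI; [exact: closed_closure|exact/open_closedC/open_interior]. Qed.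

Lemma measurable_boundary n (S : set 'rV[R]_n) : measurable (boundary S : set (@bV R n)).
Proof. by apply: closed_measurableV; exact: closed_boundary. Qed.

(** The supremum of the parameters that stay in [S] is a limit of points of [S]; were it interior,
    the segment would stay in [S] longer. *)
Lemma segment_boundary n (S : set 'rV[R]_n) x y : S x -> ~ S y ->
  exists2 s, 0 <= s <= 1 & boundary S (x + s *: (y - x)).
Proof.
move=> Sx Sy; pose z s := x + s *: (y - x).
pose I := [set s | 0 <= s <= 1 /\ S (z s)].
have I0 : I 0 by split; [rewrite lexx ler01|rewrite /z scale0r addr0].
have ubI : ubound I 1 by move=> s [/andP[]].
have supI : has_sup I by split; [exists 0|exists 1].
set s := sup I; have s0 : 0 <= s by apply: ub_le_sup => //; exists 1.
have s1 : s <= 1 by apply: ge_sup => //; exists 0.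
have zB t u : `|z t - z u| = `|t - u| * `|y - x|.
  by rewrite /z opprD addrACA subrr add0r -scalerBl normrZ.
have zball e t : 0 < e -> `|s - t| < e / (1 + `|y - x|) -> ball (z s) e (z t).
  move=> e0; have p : 0 < 1 + `|y - x| by rewrite ltr_pwDl.
  rewrite ltr_pdivlMr// -ball_normE /= zB => h; apply: le_lt_trans h.
  by rewrite mulrDr mulr1 lerDr.
exists s; rewrite ?s0//; split.
  move=> B /nbhs_ballP[e /= e0 eB].
  have e1 : 0 < e / (1 + `|y - x|) by rewrite divr_gt0// ltr_pwDl.
  have [t It st] := sup_adherent e1 supI.
  exists (z t); split; first exact: It.2.
  apply: eB; apply: zball => //; rewrite ger0_norm ?subr_ge0; first by rewrite -/s in st; lra.
  by apply: ub_le_sup => //; exists 1.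
move=> /nbhs_ballP[e /= e0 eB].
have e1 : 0 < e / (1 + `|y - x|) by rewrite divr_gt0// ltr_pwDl.
have [s1'|s1'] := eqVneq s 1.
  apply: Sy; rewrite (_ : y = z s); first by apply: eB; exact: ballxx.
  by rewrite /z s1' scale1r addrC subrK.
have s1l : s < 1 by rewrite lt_neqAle s1' s1.
pose t := Num.min 1 (s + e / (1 + `|y - x|) / 2).
have st : s < t by rewrite lt_min s1l /=; lra.
suff It : I t by have := ub_le_sup (ex_intro _ 1 ubI) It; rewrite leNgt st.
have tu : t <= s + e / (1 + `|y - x|) / 2 by rewrite ge_min lexx orbT.
split; first by rewrite (le_trans s0 (ltW st)) ge_min lexx.
by apply: eB; apply: zball => //; rewrite ltr0_norm ?subr_lt0//; lra.
Qed.

Definition crossing n (S : set 'rV[R]_n) (tau : 'rV[R]_n) : set (@bV R n) :=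
  ((fun y => y + tau) @^-1` S) `+` S.

(** If exactly one of [y] and [y + tau] is in [S], the segment between them meets the boundary, and
    [y] is reached from that point backwards, whence [- tau]. *)
Lemma crossing_sweep n (S : set 'rV[R]_n) tau : crossing S tau `<=` sweep (boundary S) (- tau).
Proof.
move=> y [[/= Sy nS]|[Sy /= nS]].
  have [s /andP[s0 s1] bs] := segment_boundary Sy nS.
  exists (y + tau + s *: (y - (y + tau))), (1 - s); split => //; first by apply/andP; split; lra.
  by apply/rowP => j; rewrite !mxE; ring.
have [s s01 bs] := segment_boundary Sy nS.
exists (y + s *: (y + tau - y)), s; split => //.
by apply/rowP => j; rewrite !mxE; ring.
Qed.

Lemma kap_crossing n (S : set 'rV[R]_n.+2) tau : (hausdorff_outer n.+1 (boundary S) < +oo)%E ->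
  ((kap n.+1)%:E * lebB (crossing S tau) <= (enorm tau)%:E * hausB n.+1 (boundary S : set (@bV R _)))%E.
Proof.
move=> Sf; apply: le_trans (_ : (_ <= (kap n.+1)%:E * lebesgue_outer (sweep (boundary S) (- tau)))%E) _.
  rewrite lee_pmul2l//; last by rewrite lte_fin kap_gt0.
  by apply: le_outer_measure; exact: crossing_sweep.
by rewrite -[enorm tau]enormN; exact: kap_sweep.
Qed.

Lemma lebesgue_hull n (A : set 'rV[R]_n.+1) : exists Y : set (@bV R n.+1),
  [/\ measurable Y, A `<=` Y & lebB Y = lebesgue_outer A].
Proof.
have [Y [mY AY] YA] := @hausdorff_hull R _ n.+1 A; exists Y; split => //.
have k0 := @kap_gt0 R n.
move: YA; rewrite !hausdorff_lebesgue => /(congr1 (fun x => (kap n.+1)^-1%:E * x)%E).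
by rewrite !muleA -EFinM mulVf ?gt_eqF// !mul1e.
Qed.

End crossing.

Section translation.
Context {R : realType} (n : nat) (a : 'rV[R]_n.+1).

Definition tr (x : 'rV[R]_n.+1) := x + a.

Lemma measurable_tr : measurable_fun [set: @bV R n.+1] (tr : @bV R n.+1 -> @bV R n.+1).
Proof.
apply: measurable_to_bV => i; under eq_fun do rewrite !mxE.
by apply: measurable_funD => //; exact: measurable_coord.
Qed.

Lemma lebB_tr (A : set (@bV R n.+1)) : lebB (tr @^-1` A : set (@bV R n.+1)) = lebB A.
Proof.
rewrite /lebB -(@lebesgue_translate R n (tr @^-1` A) a).
congr lebesgue_outer; apply/seteqP; split => [_ [x Ax <-]//|x Ax].
by exists (x - a); rewrite /tr /= ?subrK.
Qed.

Lemma integral_tr (D : set (@bV R n.+1)) (h : @bV R n.+1 -> \bar R) : measurable D ->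
  measurable_fun D h -> (forall x, 0 <= h x)%E ->
  (\int[@lebB R n.+1]_(x in tr @^-1` D) h (tr x) = \int[@lebB R n.+1]_(x in D) h x)%E.
Proof.
move=> mD mh h0; symmetry.
pose m : {measure set (@bV R n.+1) -> \bar R} :=
  @measure_function_pushforward__canonical__measure_function_Measure _ _ _ _ _
    (@lebB R n.+1) (tr : @bV R n.+1 -> @bV R n.+1) measurable_tr.
transitivity (\int[m]_(x in D) h x)%E.
  by apply: eq_measure_integral => A mA _; rewrite /= /pushforward lebB_tr.
by rewrite ge0_integral_pushforward//; exact: measurable_tr.
Qed.

End translation.

(** * Gradient and L^1 estimates for the mollified set *)

Section mollification.
Context {R : realType} (n : nat).
Local Notation bV' := (@bV R n.+2).
Local Notation leb' := (@lebB R n.+2).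
Local Notation haus' := (@hausB R n.+2 n.+1).
Variables (S : set bV') (s P e : R).
Hypothesis mS : measurable S.
Hypothesis Ss : lebB S = s%:E.
Hypothesis SP : hausB n.+1 (boundary S : set bV') = P%:E.
Hypothesis e0 : 0 < e.

Lemma eta_ge0 (r : R) (x : 'rV[R]_n.+2) : 0 <= eta r x.
Proof. exact: sqr_ge0. Qed.

Lemma measurable_eta (r : R) : 0 < r -> measurable_fun [set: bV'] (eta r : bV' -> R).
Proof.
move=> r0; have [L cL] := @eta_c11b R n.+2 r r0.
exact: continuous_measurableV (lip_continuous (cb_lip cL)).
Qed.

Lemma convSE (x : 'rV[R]_n.+2) : (convS S (eta e) x)%:E = (\int[leb']_(y in S) (eta e (x - y))%:E)%E.
Proof.
rewrite /convS /Rintegral fineK//; apply: integrable_fin_num => //.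
apply: (@bounded_integrableS _ _ _ _ mS Ss (e ^+ 4)); first exact: measurable_shift (measurable_eta e0).
by move=> y; have /andP[h0 h1] := eta_itv e (x - y); rewrite ger0_norm.
Qed.

(** Moving [x] by [tau] amounts to integrating over the translated set, which exceeds [S] only
    within the crossing set. *)
Lemma convS_diff (x tau : 'rV[R]_n.+2) : ((convS S (eta e) (x + tau))%:E <=
  (convS S (eta e) x)%:E + \int[leb']_(y in crossing S tau) (eta e (x - y))%:E)%E.
Proof.
pose S' : set bV' := tr tau @^-1` S.
have mS' : measurable S' by rewrite -[S']setTI; exact: measurable_tr.
have mh (z : 'rV[R]_n.+2) : measurable_fun [set: bV'] (fun y : bV' => (eta e (z - y))%:E).
  by apply/measurable_EFinP; exact: measurable_shift (measurable_eta e0).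
have h0 (z y : 'rV[R]_n.+2) : (0 <= (eta e (z - y))%:E)%E by rewrite lee_fin eta_ge0.
have -> : (convS S (eta e) (x + tau))%:E = (\int[leb']_(y in S') (eta e (x - y))%:E)%E.
  rewrite convSE -[LHS](@integral_tr R n.+1 tau)//; last exact: measurable_funS (mh _).
  by apply: eq_integral => y _; congr (eta e _)%:E; apply/rowP => j; rewrite !mxE; ring.
rewrite convSE -(setUIDK S' S) ge0_integral_setU//; last 4 first.
- exact: measurableI.
- exact: measurableD.
- exact: measurable_funS (mh _).
- by apply/disj_setPS => y [[_ ?] []].
rewrite leeD//.
  by apply: ge0_subset_integral => //; [exact: measurableI|exact: measurable_funS (mh _)].
apply: ge0_subset_integral => //; first exact: measurableD.
- by apply: measurableU; apply: measurableD.
- exact: measurable_funS (mh _).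
- by move=> y [? ?]; left.
Qed.

Lemma ge0_integral_bigcup_le d (T : measurableType d) (mu : {measure set T -> \bar R}) (F : (set T)^nat)
    (f : T -> \bar R) : (forall k, measurable (F k)) -> measurable_fun setT f -> (forall x, 0 <= f x)%E ->
  (\int[mu]_(x in \bigcup_k F k) f x <= \sum_(k <oo) \int[mu]_(x in F k) f x)%E.
Proof.
move=> mF mf f0; rewrite seqDU_bigcup_eq ge0_integral_bigcup//; first last.
- exact: measurable_funS mf.
- exact: seqDU_measurable.
apply: lee_nneseries => [*|k _]; first exact: integral_ge0.
apply: ge0_subset_integral => //; [exact: seqDU_measurable|exact: measurable_funS mf|].
exact: subset_seqDU.
Qed.

Let bd : set bV' := boundary S.

Let mbd : measurable bd. Proof. exact: measurable_boundary. Qed.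

Definition piece (d : R) (j : nat) : set bV' := bd `&` cell d j.

(** The default value is harmless: an empty piece has weight 0 in [majorant]. *)
Definition piece_pt (d : R) (j : nat) : 'rV[R]_n.+2 := xget 0 (piece d j).

(* Discretises [a |-> eta r (x - a)] integrated over the boundary against the
   Hausdorff measure, so that no product measure is needed. *)
Definition majorant (d r : R) (x : 'rV[R]_n.+2) : \bar R :=
  (\sum_(j <oo) (eta r (x - piece_pt d j))%:E * hausB n.+1 (piece d j))%E.

Lemma measurable_piece d j : measurable (piece d j).
Proof. by apply: measurableI => //; exact: measurable_cell. Qed.

(** Each crossing point lies on the sweep of some piece, within [N d + |tau|] of its sample point,
    so the kernel there is at most the wider kernel at the sample; [kap_sweep] bounds the volume
    swept by the piece. *)
Lemma crossing_majorant d r x tau : 0 < d -> e + n.+2%:R * d + enorm tau <= r ->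
  ((kap n.+1)%:E * \int[leb']_(y in crossing S tau) (eta e (x - y))%:E <=
   (enorm tau)%:E * majorant d r x)%E.
Proof.
move=> d0 der.
have k0 : (0 <= (kap n.+1)%:E :> \bar R)%E by rewrite lee_fin ltW ?kap_gt0.
have h0 (y : 'rV[R]_n.+2) : (0 <= (eta e (x - y))%:E)%E by rewrite lee_fin eta_ge0.
have mh : measurable_fun [set: bV'] (fun y : bV' => (eta e (x - y))%:E).
  by apply/measurable_EFinP; exact: measurable_shift (measurable_eta e0).
pose b j := eta r (x - piece_pt d j).
have /choice[Y HY] j := lebesgue_hull (sweep (piece d j) (- tau)).
(* The Borel hull of a sweep may contain points where the kernel is larger, so it is cut back to
   where the bound holds. *)
pose Z j : set bV' := Y j `&` [set y | eta e (x - y) <= b j].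
have mZ j : measurable (Z j).
  apply: measurableI; first by have [] := HY j.
  rewrite (_ : [set _ | _] = (fun y : bV' => eta e (x - y)) @^-1` `]-oo, b j]%classic).
    by rewrite -[X in measurable X]setTI; apply: (measurable_shift x (measurable_eta e0)).
  by apply/seteqP; split => y /=; rewrite in_itv.
have cZ : crossing S tau `<=` \bigcup_j Z j.
  move=> y /crossing_sweep[a [t [ba /andP[t0 t1] ya]]].
  have [j _ aj] : (\bigcup_j cell d j) a by rewrite bigcup_cell.
  have pa : piece d j a by [].
  exists j => //; split; first by have [_ + _] := HY j; apply; exists a, t; split; rewrite ?t0.
  rewrite /= (_ : x - y = x - piece_pt d j + (piece_pt d j - a + t *: tau)); last first.
    by rewrite ya; apply/rowP => i; rewrite !mxE; ring.
  have pj : piece d j (piece_pt d j) by exact: xgetI pa.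
  have w : enorm (piece_pt d j - a + t *: tau) <= r - e.
    apply: (le_trans (enormD _ _)).
    have h1 : enorm (piece_pt d j - a) <= n.+2%:R * d.
      by apply: (le_trans (enorm_le_norm _)); rewrite ler_wpM2l//; exact: cell_norm pj.2 aj.
    have h2 : enorm (t *: tau) <= enorm tau by rewrite enormZ ger0_norm// ler_piMl// enorm_ge0.
    lra.
  by apply: (le_trans (eta_shift e0 _ w)); rewrite /b /eta /etam (addrC e) subrK.
have mU : measurable (\bigcup_j Z j) by exact: bigcup_measurable.
apply: (@le_trans _ _ ((kap n.+1)%:E * \sum_(j <oo) \int[leb']_(y in Z j) (eta e (x - y))%:E)%E).
  apply: lee_wpmul2l => //; apply: (@le_trans _ _ (\int[leb']_(y in \bigcup_j Z j) (eta e (x - y))%:E)%E).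
    apply: ge0_subset_integral => //; last exact: measurable_funS mh.
    apply: measurableU; apply: measurableD => //; rewrite -[X in measurable X]setTI; exact: (measurable_tr tau).
  exact: ge0_integral_bigcup_le.
rewrite -nneseriesZl; last by move=> j _; exact: integral_ge0.
rewrite /majorant -nneseriesZl; last by move=> j _; rewrite mule_ge0// lee_fin eta_ge0.
apply: lee_nneseries => j _; first by rewrite mule_ge0//; exact: integral_ge0.
have [mY AY YA] := HY j.
apply: (@le_trans _ _ ((kap n.+1)%:E * ((b j)%:E * lebB (Y j)))%E).
  apply: lee_wpmul2l => //; apply: (@le_trans _ _ (\int[leb']_(y in Z j) (b j)%:E)%E).
    by apply: ge0_le_integral => //; [exact: measurable_funS mh|move=> y []].
  rewrite integral_cst//; apply: lee_wpmul2l; first by rewrite lee_fin eta_ge0.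
  by apply: le_outer_measure => y [].
rewrite YA muleCA [leRHS]muleCA; apply: lee_wpmul2l; first by rewrite lee_fin eta_ge0.
rewrite -[enorm tau]enormN; apply: kap_sweep.
apply: le_lt_trans (ltry P); rewrite -SP; apply: le_outer_measure => y []//.
Qed.

Definition conv_grad (x : 'rV[R]_n.+2) : 'rV[R]_n.+2 := \row_i convS S (fun z => deta e z 0 i) x.

Lemma conv_c11b : exists L, c11b L (convS S (eta e)) conv_grad.
Proof. by have [L cL] := @eta_c11b R n.+2 e e0; exists (L * s); exact: c11b_conv. Qed.

(** The convolution is tested in the direction of its own gradient [g]: a step [h g] raises it by
    about [h |g|^2], while the crossing set allows at most [h |g|] times the majorant over [kap].
    Then [h] tends to 0. *)
Lemma conv_grad_majorant d r x : 0 < d -> e + n.+2%:R * d < r ->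
  ((kap n.+1 * enorm (conv_grad x))%:E <= majorant d r x)%E.
Proof.
move=> d0 der; have [L cL] := conv_c11b; have L0 := c11b_ge0 cL.
have k0 := @kap_gt0 R n.
have := @crossing_majorant d r x _ d0.
have : (0 <= majorant d r x)%E.
  by apply: nneseries_ge0 => j _ _; rewrite mule_ge0// lee_fin eta_ge0.
case: (majorant d r x) => [p|_ _|//]; last by rewrite leey.
rewrite !lee_fin => p0 H; set g := conv_grad x.
have [g0|g0] := eqVneq (enorm g) 0; first by rewrite g0 mulr0.
have gp : 0 < enorm g by rewrite lt_neqAle eq_sym g0 enorm_ge0.
rewrite -(ler_pM2l gp) mulrCA -expr2 sqr_enorm.
(* The largest step for which [e + N d + |h g| <= r]. *)
pose h0 := (r - e - n.+2%:R * d) / enorm g.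
have h00 : 0 < h0 by rewrite divr_gt0//; lra.
have key h : 0 < h -> h <= h0 -> kap n.+1 * dotv g g <= enorm g * p + h * (kap n.+1 * L * `|g| ^+ 2).
  move=> hp; rewrite ler_pdivlMr// => hh.
  have hE : enorm (h *: g) = h * enorm g by rewrite enormZ gtr0_norm.
  have := H (h *: g); rewrite hE => /(_ _)/wrap[|H1]; first by lra.
  have := convS_diff x (h *: g).
  have : ((kap n.+1)%:E * \int[leb']_(y in crossing S (h *: g)) (eta e (x - y))%:E <=
     (h * enorm g)%:E * p%:E)%E by exact: H1.
  have : (0 <= \int[leb']_(y in crossing S (h *: g)) (eta e (x - y))%:E)%E.
    by apply: integral_ge0 => y _; rewrite lee_fin eta_ge0.
  case: (\int[_]_(y in _) _)%E => [q||]//; last by rewrite gt0_muley ?lte_fin.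
  rewrite !lee_fin => q0 q1 q2.
  have := cb_taylor cL x (h *: g); rewrite ler_norml => /andP[t1 _].
  rewrite -/g dotvZr normrZ gtr0_norm// exprMn in t1.
  have kq : kap n.+1 * (h * dotv g g) <= kap n.+1 * (q + L * (h ^+ 2 * `|g| ^+ 2)).
    by apply: ler_wpM2l; [exact: ltW|clear -t1 q2; lra].
  rewrite -(ler_pM2l hp); clear -kq q1; nra.
apply/ler_addgt0Pr => z z0.
pose C := kap n.+1 * L * `|g| ^+ 2.
have C0 : 0 <= C by rewrite !mulr_ge0// ltW.
have C1 : 0 < C + 1 by lra.
pose h := Num.min h0 (z / (C + 1)).
have hp : 0 < h by rewrite lt_min h00 divr_gt0.
have hz : h * (C + 1) <= z by rewrite -ler_pdivlMr// ge_min lexx orbT.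
have := key h hp; rewrite ge_min lexx -/C => /(_ isT) => h1.
by apply: (le_trans h1); rewrite lerD2l; clear -hz hp C0; nra.
Qed.

Lemma sum_piece d (h : bV' -> \bar R) : 0 < d -> measurable_fun setT h -> (forall x, 0 <= h x)%E ->
  (\int[haus']_(x in bd) h x = \sum_(j <oo) \int[haus']_(x in piece d j) h x)%E.
Proof.
move=> d0 mh h0; have -> : bd = \bigcup_j piece d j by rewrite -setI_bigcupr bigcup_cell// setIT.
rewrite ge0_integral_bigcup//; first by move=> j; exact: measurable_piece.
- exact: measurable_funS mh.
- by apply: trivIset_setIl; exact: trivIset_cell.
Qed.

Lemma eta_int (r : R) : 0 < r -> exists2 c, 0 < c & (\int[leb']_x (eta r x)%:E)%E = c%:E.
Proof.
move=> r0; set I := (\int[_]_x _)%E.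
have mE : measurable_fun [set: bV'] (fun x : bV' => (eta r x)%:E).
  by apply/measurable_EFinP; exact: measurable_eta.
have E t : 0 <= t -> leb' (eball 0 t) = (omega n.+2 * t ^+ n.+2)%:E.
  by move=> t0; rewrite /lebB lebesgue_eball.
have mb t : measurable (eball 0 t : set bV') by exact: measurable_eball.
have I1 : (I <= (r ^+ 4 * (omega n.+2 * r ^+ n.+2))%:E)%E.
  have -> : I = (\int[leb']_(x in eball 0%R r) (eta r x)%:E)%E.
    rewrite [RHS]integral_mkcond; apply: eq_integral => x _; rewrite patchE; case: ifPn => //.
    move=> /negP; rewrite inE /eball/= subr0 => /negP; rewrite -leNgt => h.
    by rewrite /eta etam_out// expr0n.
  rewrite EFinM -E ?(ltW r0)// -[leRHS](integral_cst leb' (mb r)).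
  apply: ge0_le_integral => //; first by move=> x _; rewrite lee_fin eta_ge0.
    exact: measurable_funS mE.
  by move=> x _; rewrite lee_fin; have /andP[] := eta_itv r x.
have I2 : (((3 / 4 * r ^+ 2) ^+ 2 * (omega n.+2 * (r / 2) ^+ n.+2))%:E <= I)%E.
  have r2 : 0 <= r / 2 by rewrite divr_ge0// ltW.
  rewrite EFinM -E// -[leLHS](integral_cst leb' (mb (r / 2))).
  apply: (@le_trans _ _ (\int[leb']_(x in eball 0%R (r / 2)) (eta r x)%:E)%E); last first.
    by apply: ge0_subset_integral => // x _; rewrite lee_fin eta_ge0.
  apply: ge0_le_integral => //; [by move=> x _; rewrite lee_fin sqr_ge0|exact: measurable_funS mE|].
  move=> x; rewrite /eball/= subr0 => xr; rewrite lee_fin /eta.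
  have q0 : 0 <= 3 / 4 * r ^+ 2 by rewrite mulr_ge0 ?exprn_ge0 ?(ltW r0).
  have : enorm x ^+ 2 <= (r / 2) ^+ 2 by rewrite lerXn2r ?nnegrE ?enorm_ge0// ltW.
  rewrite sqr_enorm expr_div_n => h; rewrite lerXn2r// ?nnegrE//; first by rewrite /etam le_max lexx.
  by rewrite /etam le_max; apply/orP; right; lra.
have If : I \is a fin_num.
  by rewrite ge0_fin_numE; [exact: le_lt_trans I1 (ltry _)|apply: integral_ge0 => x _; rewrite lee_fin eta_ge0].
exists (fine I); last by rewrite fineK.
rewrite -lte_fin fineK//; apply: lt_le_trans I2; rewrite lte_fin.
apply: mulr_gt0; first by rewrite exprn_gt0// mulr_gt0// exprn_gt0.
by apply: mulr_gt0; [exact: omega_pos|rewrite exprn_gt0// divr_gt0].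
Qed.

(** The mass of the kernel is Lipschitz in its radius near [e], so the enlargement of the radius in
    the majorant can be undone in the limit. *)
Lemma eta_int_le : exists2 C, 0 <= C & forall r, e <= r -> r <= 2 * e ->
  (\int[leb']_x (eta r x)%:E <= \int[leb']_x (eta e x)%:E + (C * (r - e))%:E)%E.
Proof.
pose D : set bV' := eball 0 (2 * e).
have mD : measurable D by exact: measurable_eball.
exists (24 * e ^+ 3 * (omega n.+2 * (2 * e) ^+ n.+2)).
  have e2 : 0 <= 2 * e by rewrite mulr_ge0// ltW.
  apply: mulr_ge0; first by rewrite mulr_ge0// exprn_ge0// ltW.
  by apply: mulr_ge0; [exact/ltW/omega_pos|rewrite exprn_ge0].
move=> r er r2; have r0 : 0 < r by apply: lt_le_trans er.
have pw (x : 'rV[R]_n.+2) : eta r x <= eta e x + 24 * e ^+ 3 * (r - e) * \1_D x.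
  have c0 : 0 <= 24 * e ^+ 3 * (r - e) by rewrite mulr_ge0 ?mulr_ge0 ?exprn_ge0 ?(ltW e0)// subr_ge0.
  have [xr|xr] := leP r (enorm x).
    by rewrite {1}/eta etam_out// expr0n /= addr_ge0 ?eta_ge0// mulr_ge0.
  have -> : \1_D x = 1 :> R by rewrite indicE mem_set// /D /eball /= subr0; lra.
  rewrite mulr1 addrC -lerBlDr /eta subr_sqr.
  have h1 : etam r x - etam e x <= 3 * e * (r - e).
    have := max0_lip (r ^+ 2 - dotv x x) (e ^+ 2 - dotv x x); rewrite ler_norml => /andP[_ h].
    apply: (le_trans h); rewrite (_ : _ - _ - _ = (r + e) * (r - e)); last by ring.
    rewrite ger0_norm ?mulr_ge0 ?subr_ge0 ?addr_ge0 ?(ltW e0) ?(ltW r0)//.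
    by apply: ler_wpM2r; rewrite ?subr_ge0//; lra.
  have h1' : 0 <= etam r x - etam e x.
    rewrite subr_ge0 /etam ge_max !le_max lexx/=; apply/orP; right.
    by rewrite lerD2r lerXn2r// nnegrE ltW.
  have /andP[a0 a1] := etam_itv r x; have /andP[b0 b1] := etam_itv e x.
  have r2' : r ^+ 2 <= (2 * e) ^+ 2 by rewrite lerXn2r ?nnegrE ?mulr_ge0// ltW.
  have e2' : e ^+ 2 <= (2 * e) ^+ 2 by rewrite lerXn2r ?nnegrE ?mulr_ge0 ?(ltW e0)//; lra.
  rewrite (_ : 24 * e ^+ 3 * (r - e) = 3 * e * (r - e) * (2 * (2 * e) ^+ 2)); last by ring.
  by apply: ler_pM => //; [rewrite addr_ge0|lra].
have mI : measurable_fun [set: bV'] (\1_D : bV' -> R) by exact: measurable_indic.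
have c0 : 0 <= 24 * e ^+ 3 * (r - e) by rewrite !mulr_ge0 ?exprn_ge0 ?(ltW e0)// subr_ge0.
apply: (@le_trans _ _ (\int[leb']_x ((eta e x)%:E + (24 * e ^+ 3 * (r - e))%:E * (\1_D x)%:E))%E).
  apply: ge0_le_integral => //.
  - by move=> x _; rewrite lee_fin eta_ge0.
  - by apply/measurable_EFinP; exact: measurable_eta.
  - apply: emeasurable_funD; first by apply/measurable_EFinP; exact: measurable_eta.
    by apply: measurable_funeM; exact/measurable_EFinP.
  - by move=> x _; rewrite -EFinM -EFinD lee_fin.
rewrite ge0_integralD//; last 4 first.
- by move=> x _; rewrite lee_fin eta_ge0.
- by apply/measurable_EFinP; exact: measurable_eta.
- by move=> x _; rewrite mule_ge0// lee_fin.
- by apply: measurable_funeM; exact/measurable_EFinP.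
rewrite leeD2l// ge0_integralZl//.
  rewrite integral_indic// setIT; apply: (@le_trans _ _ ((24 * e ^+ 3 * (r - e))%:E * lebB D)%E) => //.
  by rewrite /lebB lebesgue_eball ?mulr_ge0 ?(ltW e0)// -EFinM lee_fin mulrAC.
exact/measurable_EFinP.
Qed.

Section weighted.
Variables (g : R -> R) (M l : R) (i : 'I_n.+2) (W : R).
Hypothesis mg : measurable_fun setT g.
Hypothesis g1 : forall t, 1 <= g t.
Hypothesis gM : forall t, g t <= M.
Hypothesis gl : forall s t, `|g s - g t| <= l * `|s - t|.
Hypothesis gW : (\int[haus']_(x in bd) (g (x ord0 i))%:E = W%:E)%E.

(** On the support of a kernel centred at a sample point [a], the density is at most [g(a) + l r],
    so stretching multiplies its mass by no more than that. Passing from [a] to the other points of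
    its piece costs another [l d <= l r]; summing gives the weighted area [W]. *)
Lemma majorant_int d r : 0 < d -> d <= r ->
  (\int[leb']_y majorant d r (stretchV g i y) <=
   \int[leb']_x (eta r x)%:E * (W + 2 * l * r * P)%:E)%E.
Proof.
move=> d0 dr; have r0 : 0 < r by apply: lt_le_trans dr.
have l0 : 0 <= l by have := gl 1 0; rewrite subr0 normr1 mulr1; apply: le_trans.
have mT : measurable_fun [set: bV'] (stretchV g i : bV' -> bV').
  exact: measurable_stretchV.
pose c := (\int[leb']_x (eta r x)%:E)%E.
have c0 : (0 <= c)%E by apply: integral_ge0 => x _; rewrite lee_fin eta_ge0.
have ms (a : 'rV[R]_n.+2) : measurable_fun [set: bV'] (fun x : bV' => eta r (x - a)).
  exact: (measurableT_comp (measurable_eta r0) (measurable_tr (- a))).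
have [c' _ cE] := eta_int r0.
have mse (a : 'rV[R]_n.+2) :
    measurable_fun [set: bV'] (fun y : bV' => (eta r (stretchV g i y - a))%:E).
  by apply/measurable_EFinP; exact: (measurableT_comp (ms a) mT).
pose b j := g (piece_pt d j ord0 i) + l * r.
have b0 j : 0 <= b j by rewrite addr_ge0 ?mulr_ge0 ?(ltW r0)// (le_trans ler01).
have H0 j : (0 <= hausB n.+1 (piece d j))%E by [].
rewrite /majorant integral_nneseries//; last 2 first.
- by move=> j; apply: emeasurable_funM => //.
- by move=> j x _; rewrite mule_ge0// lee_fin eta_ge0.
apply: (@le_trans _ _ (\sum_(j <oo) c * ((b j)%:E * hausB n.+1 (piece d j)))%E).
  apply: lee_nneseries => [j _ _|j _].
    by apply: integral_ge0 => x _; rewrite mule_ge0// lee_fin eta_ge0.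
  rewrite ge0_integralZr//; last by move=> x _; rewrite lee_fin eta_ge0.
  rewrite muleA (muleC c); apply: lee_wpmul2r => //.
  apply: (@le_trans _ _ ((b j)%:E * \int[leb']_x (eta r (x - piece_pt d j))%:E)%E).
    apply: (@stretched_integral_le R g M mg g1 gM _ i (b j) (fun x => eta r (x - piece_pt d j))) => //.
      by move=> x; exact: eta_ge0.
    move=> x; have [h|h _] := leP r (enorm (x - piece_pt d j)).
      by rewrite /eta etam_out// expr0n eqxx.
    rewrite /b -lerBlDl; apply: (le_trans (ler_norm _)); apply: (le_trans (gl _ _)).
    apply: ler_wpM2l => //; apply: le_trans (ltW h).
    by have := abs_le_enorm (x - piece_pt d j) i; rewrite !mxE.
  apply: lee_wpmul2l; first by rewrite lee_fin.
  rewrite /c -[leRHS](@integral_tr R n.+1 (- piece_pt d j) setT)//.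
  - by apply/measurable_EFinP; exact: measurable_eta.
  - by move=> x; rewrite lee_fin eta_ge0.
rewrite -/c /c cE in c0 *; rewrite nneseriesZl; last by move=> j _; rewrite mule_ge0// lee_fin.
apply: lee_wpmul2l => //.
have mgi : measurable_fun [set: bV'] (fun x : bV' => g (x ord0 i)).
  by apply: measurableT_comp => //; exact: measurable_coord.
have mgE : measurable_fun [set: bV'] (fun x : bV' => (g (x ord0 i))%:E + (2 * l * r)%:E)%E.
  by apply: emeasurable_funD => //; exact/measurable_EFinP.
have lr0 : 0 <= 2 * l * r by rewrite !mulr_ge0// ltW.
have g0 t : 0 <= g t by apply: le_trans (g1 t).
have -> : ((W + 2 * l * r * P)%:E = \int[haus']_(x in bd) ((g (x ord0 i))%:E + (2 * l * r)%:E))%E.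
  rewrite ge0_integralD//; last 2 first.
  - by move=> x _; rewrite lee_fin.
  - by apply/measurable_EFinP; exact: measurable_funS mgi.
  rewrite gW EFinD; congr (_ + _)%E; rewrite integral_cst// EFinM; congr (_ * _)%E; exact: esym SP.
rewrite (sum_piece d0 mgE); last by move=> x; rewrite -EFinD lee_fin addr_ge0.
apply: lee_nneseries => [j _ _|j _]; first by rewrite mule_ge0// lee_fin.
have mp := measurable_piece d j.
rewrite -[leLHS](integral_cst haus' mp (b j)%:E).
apply: ge0_le_integral => //; first by move=> x _; rewrite lee_fin.
  exact: measurable_funS mgE.
move=> x px; rewrite -EFinD lee_fin /b.
have pj : piece d j (piece_pt d j) by exact: xgetI px.
have h := cell_norm d0 pj.2 px.2.
have : g (piece_pt d j ord0 i) - g (x ord0 i) <= l * d.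
  apply: (le_trans (ler_norm _)); apply: (le_trans (gl _ _)); apply: ler_wpM2l => //.
  by apply: le_trans h; have := norm_coord (piece_pt d j - x) i; rewrite !mxE.
have : l * d <= l * r by apply: ler_wpM2l.
by lra.
Qed.

Lemma conv_grad_int c : (\int[leb']_x (eta e x)%:E)%E = c%:E ->
  (\int[leb']_y (kap n.+1 * enorm (conv_grad (stretchV g i y)))%:E <=
   (c * (W + 4 * l * e * P))%:E)%E.
Proof.
move=> cE; have [C C0 HC] := eta_int_le.
have l0 : 0 <= l by have := gl 1 0; rewrite subr0 normr1 mulr1; apply: le_trans.
have W0 : 0 <= W.
  by rewrite -lee_fin -gW; apply: integral_ge0 => x _; rewrite lee_fin (le_trans ler01).
have P0 : 0 <= P by rewrite -lee_fin -SP.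
have c0 : 0 <= c.
  by rewrite -lee_fin -cE; apply: integral_ge0 => x _; rewrite lee_fin eta_ge0.
set Y := W + _; have Y0 : 0 <= Y by rewrite addr_ge0 ?mulr_ge0// ltW.
apply/lee_addgt0Pr => z z0; rewrite -EFinD.
pose t := Num.min e (z / (C * Y + 1)).
have CY : 0 < C * Y + 1 by rewrite ltr_wpDl// mulr_ge0.
have t0 : 0 < t by rewrite lt_min e0 divr_gt0.
have te : t <= e by rewrite ge_min lexx.
have tz : t * (C * Y) <= z.
  have : t * (C * Y + 1) <= z by rewrite -ler_pdivlMr// ge_min lexx orbT.
  by rewrite mulrDr mulr1; lra.
(* Then [N d = t / 2], strictly below the enlargement [t] of the radius, as [conv_grad_majorant]
   demands. *)
pose d := t / (2 * n.+2%:R).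
have d0 : 0 < d by rewrite divr_gt0.
have n0 : n.+2%:R != 0 :> R by rewrite pnatr_eq0.
have nd : n.+2%:R * d = t / 2 by rewrite /d; move: (n.+2%:R : R) n0 => N N0; field.
have dt : d <= t by rewrite ler_pdivrMr// ler_peMr ?(ltW t0)// -natrM ler1n.
apply: (@le_trans _ _ (\int[leb']_y majorant d (e + t) (stretchV g i y))%E).
  have [L cL] := conv_c11b.
  apply: ge0_le_integral => //.
  - by move=> x _; rewrite lee_fin mulr_ge0 ?enorm_ge0// ltW// kap_gt0.
  - apply/measurable_EFinP; apply: measurable_funM; first exact: measurable_cst.
    apply: (@measurableT_comp _ _ _ _ _ _ (fun x : bV' => enorm (conv_grad x))); last exact: measurable_stretchV.
    have mG : measurable_fun [set: bV'] (conv_grad : bV' -> bV').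
      apply: measurable_to_bV => j; apply: continuous_measurableV.
      by apply: (@lip_continuous _ _ _ L) => x y; exact: (cb_glip cL).
    exact: (measurableT_comp (@measurable_enorm R n.+2) mG).
  - apply: (@measurableT_comp _ _ _ _ _ _ (majorant d (e + t) : bV' -> \bar R)); last exact: measurable_stretchV.
    apply: ge0_emeasurable_sum => [j x _ _|j _]; first by rewrite mule_ge0// lee_fin eta_ge0.
    apply: emeasurable_funM => //; apply/measurable_EFinP.
    by apply: (measurableT_comp _ (measurable_tr (- piece_pt d j))); apply: measurable_eta; lra.
  - by move=> x _; apply: conv_grad_majorant; rewrite ?nd//; lra.
apply: (@le_trans _ _ _ _ _ (@majorant_int d (e + t) d0 _)); first by lra.
have : (\int[leb']_x (eta (e + t) x)%:E <= (c + C * t)%:E)%E.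
  have := HC (e + t); rewrite cE -EFinD (_ : e + t - e = t); last by ring.
  by apply; lra.
have : (0 <= \int[leb']_x (eta (e + t) x)%:E)%E by apply: integral_ge0 => x _; rewrite lee_fin eta_ge0.
case: (\int[_]_x _)%E => [q||]//; rewrite !lee_fin => q0 qc.
apply: (@le_trans _ _ (q * Y)).
  apply: ler_wpM2l => //; rewrite /Y lerD2l; apply: ler_wpM2r => //.
  have : l * t <= l * e by apply: ler_wpM2l.
  lra.
apply: (@le_trans _ _ ((c + C * t) * Y)); first by apply: ler_wpM2r.
by lra.
Qed.

End weighted.

Lemma conv_trE (x : bV') : (convS S (eta e) x)%:E =
  (\int[leb']_z (eta e z * \1_S (z + x))%:E)%E.
Proof.
have mS1 : measurable_fun [set: bV'] (\1_S : bV' -> R) by exact: measurable_indic.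
have me2 : measurable_fun [set: bV'] (fun z : bV' => (eta e z * \1_S (z + x))%:E).
  apply/measurable_EFinP; apply: measurable_funM; first exact: measurable_eta.
  exact: (measurableT_comp mS1 (measurable_tr x)).
rewrite convSE -[RHS](@integral_tr R n.+1 (- x) setT)//; last first.
  by move=> z; rewrite lee_fin mulr_ge0 ?eta_ge0.
rewrite preimage_setT [LHS]integral_mkcond; apply: eq_integral => y _; rewrite patchE /tr subrK.
have -> : eta e (y - x) = eta e (x - y).
  by rewrite -[x - y]opprB /eta /etam dotvNl [dotv _ (- _)]dotvC dotvNl opprK.
by rewrite indicE; case: (y \in S); rewrite ?mulr1 ?mulr0.
Qed.

Lemma conv_itv c x : (\int[leb']_x (eta e x)%:E)%E = c%:E -> 0 <= convS S (eta e) x <= c.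
Proof.
move=> cE; have mS1 : measurable_fun [set: bV'] (\1_S : bV' -> R) by exact: measurable_indic.
have h0 (z : bV') : (0 <= (eta e z * \1_S (z + x))%:E)%E by rewrite lee_fin mulr_ge0 ?eta_ge0.
rewrite -!lee_fin conv_trE -cE integral_ge0//=; apply: ge0_le_integral => //.
- apply/measurable_EFinP; apply: measurable_funM; first exact: measurable_eta.
  exact: (measurableT_comp mS1 (measurable_tr x)).
- by apply/measurable_EFinP; exact: measurable_eta.
- by move=> z _; rewrite lee_fin ler_piMr ?eta_ge0// indicE; case: (_ \in _).
Qed.

(** The error is at most the integral of [eta(z) |1_S(x + z) - 1_S(x)|]. Integrating in [x] first
    yields the volume of the crossing set of [z], at most [|z| P / kap], and [|z| <= e] on the
    support of the kernel. *)
Lemma conv_L1 c : (\int[leb']_x (eta e x)%:E)%E = c%:E ->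
  (\int[leb']_x (`|convS S (eta e) x - c * \1_S x|)%:E <= (c * (e * P / kap n.+1))%:E)%E.
Proof.
move=> cE; have k0 := @kap_gt0 R n.
have P0 : 0 <= P by rewrite -lee_fin -SP.
have c0 : 0 <= c.
  by rewrite -lee_fin -cE; apply: integral_ge0 => x _; rewrite lee_fin eta_ge0.
pose F (p : bV' * bV') := (eta e p.2 * `|\1_S (p.2 + p.1) - \1_S p.1|)%:E : \bar R.
have mS1 : measurable_fun [set: bV'] (\1_S : bV' -> R) by exact: measurable_indic.
have madd : measurable_fun [set: bV' * bV'] (fun p : bV' * bV' => (p.2 + p.1 : bV')).
  apply: measurable_to_bV => j; under eq_fun do rewrite !mxE.
  by apply: measurable_funD; apply: measurableT_comp (measurable_coord j) _.
have mF : measurable_fun setT F.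
  apply/measurable_EFinP; apply: measurable_funM.
    by apply: measurableT_comp => //; exact: measurable_eta.
  apply: measurableT_comp => //; apply: measurable_funB; first exact: measurableT_comp mS1 madd.
  exact: measurableT_comp mS1 _.
have F0 p : (0 <= F p)%E by rewrite lee_fin mulr_ge0// eta_ge0.
have mFx (x : bV') : measurable_fun [set: bV'] (fun z => F (x, z)).
  by apply: measurableT_comp => //; exact: pair1_measurable.
have mQ : measurable_fun [set: bV'] (convS S (eta e) : bV' -> R).
  by have [L cL] := conv_c11b; exact: continuous_measurableV (lip_continuous (cb_lip cL)).
have me : measurable_fun [set: bV'] (fun z : bV' => (eta e z)%:E).
  by apply/measurable_EFinP; exact: measurable_eta.
have me2 (x : bV') : measurable_fun [set: bV'] (fun z : bV' => (eta e z * \1_S (z + x))%:E).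
  apply/measurable_EFinP; apply: measurable_funM; first exact: measurable_eta.
  exact: (measurableT_comp mS1 (measurable_tr x)).
have me3 (x : bV') : measurable_fun [set: bV'] (fun z : bV' => (eta e z * \1_S x)%:E).
  by apply/measurable_EFinP; apply: measurable_funM => //; exact: measurable_eta.
have QE := conv_trE.
have cSE (x : bV') : (c * \1_S x)%:E = (\int[leb']_z (eta e z * \1_S x)%:E)%E.
  under eq_integral do rewrite EFinM.
  by rewrite ge0_integralZr//; [rewrite cE|move=> z _; rewrite lee_fin eta_ge0].
have pw (x : bV') : ((`|convS S (eta e) x - c * \1_S x|)%:E <= \int[leb']_z F (x, z))%E.
  set D := (\int[_]_z F (x, z))%E.
  have D0 : (0 <= D)%E by exact: integral_ge0.
  have H1 : ((convS S (eta e) x)%:E <= (c * \1_S x)%:E + D)%E.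
    rewrite QE cSE -ge0_integralD//; last by move=> z _; rewrite lee_fin mulr_ge0 ?eta_ge0.
    apply: ge0_le_integral => //; first by move=> z _; rewrite lee_fin mulr_ge0 ?eta_ge0.
      exact: emeasurable_funD.
    move=> z _; rewrite -EFinD lee_fin -mulrDr ler_wpM2l ?eta_ge0//=.
    by rewrite -lerBlDl ler_norm.
  have H2 : ((c * \1_S x)%:E <= (convS S (eta e) x)%:E + D)%E.
    rewrite QE cSE -ge0_integralD//; last by move=> z _; rewrite lee_fin mulr_ge0 ?eta_ge0.
    apply: ge0_le_integral => //; first by move=> z _; rewrite lee_fin mulr_ge0 ?eta_ge0.
      exact: emeasurable_funD.
    move=> z _; rewrite -EFinD lee_fin -mulrDr ler_wpM2l ?eta_ge0//=.
    by rewrite -lerBlDl distrC ler_norm.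
  move: H1 H2 D0; clearbody D; case: D => [D||]//; last by move=> *; rewrite leey.
  by rewrite -!EFinD !lee_fin ler_norml => H1 H2 _; apply/andP; split; lra.
apply: (@le_trans _ _ (\int[leb']_x \int[leb']_z F (x, z))%E).
  apply: ge0_le_integral => //.
  - apply/measurable_EFinP; apply: measurableT_comp => //; apply: measurable_funB => //.
    exact: measurable_funM.
  - exact: (measurable_fun_fubini_tonelli_F (m2 := leb')).
rewrite (@fubini_tonelli _ _ _ _ R leb' leb' F mF F0).
have -> : (c * (e * P / kap n.+1))%:E = (\int[leb']_z ((eta e z)%:E * (e * P / kap n.+1)%:E))%E.
  rewrite ge0_integralZr//; [by rewrite cE|by move=> z _; rewrite lee_fin eta_ge0|].
  by rewrite lee_fin divr_ge0 ?mulr_ge0// ltW.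
apply: ge0_le_integral => //.
- by move=> z _; exact: integral_ge0.
- exact: (measurable_fun_fubini_tonelli_G (m1 := leb')).
- exact: emeasurable_funM.
move=> z _.
have mC : measurable (crossing S z).
  by apply: measurableU; apply: measurableD => //; rewrite -[X in measurable X]setTI; exact: (measurable_tr z).
have -> : (\int[leb']_x F (x, z) = (eta e z)%:E * lebB (crossing S z))%E.
  have -> : lebB (crossing S z) = (\int[leb']_x (\1_(crossing S z) x)%:E)%E by rewrite integral_indic// setIT.
  rewrite -ge0_integralZl//; last 2 first.
  + by apply/measurable_EFinP; exact: measurable_indic.
  + by rewrite lee_fin eta_ge0.
  apply: eq_integral => x _; rewrite /F /= EFinM; congr (_ * _)%E; congr EFin.
  rewrite !indicE (addrC z x) /crossing.
  have [h1|h1] := boolP (x + z \in S); have [h2|h2] := boolP (x \in S).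
  + by rewrite subrr normr0 memNset//= => -[[_]|[_]]; apply; [exact: set_mem h2|exact: set_mem h1].
  + by rewrite subr0 normr1 mem_set//; left; split; [exact: set_mem h1|move=> /mem_set; apply/negP].
  + by rewrite sub0r normrN normr1 mem_set//; right; split; [exact: set_mem h2|move=> /mem_set; apply/negP].
  + rewrite subrr normr0 memNset//= => -[[h _]|[h _]]; first by move: h1; rewrite mem_set.
    by move: h2; rewrite mem_set.
have [ze|/ltW ze] := leP e (enorm z); first by rewrite /eta etam_out// expr0n /= !mul0e.
apply: lee_wpmul2l; first by rewrite lee_fin eta_ge0.
have := @kap_crossing R n S z (_ : (hausB n.+1 bd < +oo)%E); rewrite -/bd SP ltry => /(_ isT).
have : (0 <= lebB (crossing S z))%E by [].
case: (lebB _) => [q||]//; last by rewrite gt0_muley ?lte_fin.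
rewrite -!EFinM !lee_fin => q0 h; rewrite ler_pdivlMr// mulrC; apply: (le_trans h).
by apply: ler_wpM2r.
Qed.

End mollification.

Lemma decreasing_small d (T : measurableType d) (R : realType) (mu : {measure set T -> \bar R})
  (F : (set T)^nat) (e : R) : (mu (F 0%N) < +oo)%E -> (forall k, measurable (F k)) ->
  \bigcap_k F k = set0 -> {homo F : a b / (a <= b)%N >-> (b <= a)%O} -> 0 < e ->
  exists k, (mu (F k) <= e%:E)%E.
Proof.
move=> F0 mF cF hF e0.
have := nonincreasing_cvg_mu F0 mF (bigcapT_measurable mF) hF.
rewrite cF measure0 => c0; apply: contrapT => /forallNP H.
have : (e%:E <= limn (mu \o F))%E.
  apply: lime_ge; first by apply/cvg_ex; exists 0%E.
  by apply: nearW => k; have /negP := H k; rewrite -ltNge => /ltW.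
by rewrite (cvg_lim _ c0)// lee_fin leNgt e0.
Qed.

(** * Perimeter of a stretched set of finite area *)

Section bvper_smooth.
Context {R : realType} (n : nat).
Local Notation bV' := (@bV R n.+2).
Local Notation leb' := (@lebB R n.+2).
Local Notation haus' := (@hausB R n.+2 n.+1).
Variables (S : set bV') (s P : R).
Hypothesis mS : measurable S.
Hypothesis Ss : lebB S = s%:E.
Hypothesis SP : hausB n.+1 (boundary S : set bV') = P%:E.

(** The mollifier at scale [K], normalised to 1 at the origin. Sets of finite volume may be
    unbounded, whereas [c11] asks for compact support. *)
Definition cutoff (K : R) (x : 'rV[R]_n.+2) : R := (K ^+ 4)^-1 * eta K x.

Definition cutoff_grad (K : R) (x : 'rV[R]_n.+2) : 'rV[R]_n.+2 := (K ^+ 4)^-1 *: deta K x.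

Lemma cutoff_c11b K : 0 < K -> exists L, c11b L (cutoff K) (cutoff_grad K).
Proof. by move=> K0; have [L cL] := @eta_c11b R n.+2 K K0; eexists; exact: c11b_scale cL. Qed.

Lemma cutoff_itv K x : 0 < K -> 0 <= cutoff K x <= 1.
Proof.
move=> K0; have /andP[a b] := eta_itv K x; have K4 : 0 < K ^+ 4 by rewrite exprn_gt0.
by rewrite /cutoff mulr_ge0 ?invr_ge0 ?(ltW K4)//= ler_pdivrMl// mulr1.
Qed.

Lemma cutoff_grad_le K x : 0 < K -> enorm (cutoff_grad K x) <= 4 / K.
Proof.
move=> K0; have K4 : 0 < K ^+ 4 by rewrite exprn_gt0.
rewrite /cutoff_grad /deta !enormZ ger0_norm ?invr_ge0 ?(ltW K4)// ler_pdivrMl//.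
rewrite (_ : K ^+ 4 * (4 / K) = 4 * (K ^+ 2 * K)); last by field; rewrite gt_eqF.
rewrite mulNr normrN normrM (ger0_norm (ler0n _ 4)) -mulrA ler_pM2l//.
have [h|/ltW h] := leP K (enorm x); first by rewrite etam_out// normr0 mul0r mulr_ge0 ?exprn_ge0 ?(ltW K0).
have /andP[a b] := etam_itv K x.
by apply: ler_pM; rewrite ?enorm_ge0// ger0_norm.
Qed.

Lemma cutoff_ge K r x : 0 < K -> enorm x < r -> 1 - cutoff K x <= 2 * r ^+ 2 / K ^+ 2.
Proof.
move=> K0 xr; have K2 : 0 < K ^+ 2 by rewrite exprn_gt0.
have xx : dotv x x <= r ^+ 2.
  by rewrite -sqr_enorm lerXn2r ?nnegrE ?enorm_ge0 ?(ltW xr)// (le_trans (enorm_ge0 x))// ltW.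
have d0 := dotv_ge0 x.
rewrite ler_pdivlMr//.
have h : (K ^+ 2 - dotv x x) * K ^+ 2 - dotv x x * K ^+ 2 <= cutoff K x * K ^+ 2 * K ^+ 2.
  have -> : cutoff K x * K ^+ 2 * K ^+ 2 = eta K x by rewrite /cutoff; field; rewrite gt_eqF.
  rewrite /eta /etam; case: (leP 0 (K ^+ 2 - dotv x x)) => h.
    by rewrite -subr_ge0 (_ : _ - _ = dotv x x ^+ 2) ?sqr_ge0//; ring.
  rewrite expr0n /=; apply: (@le_trans _ _ ((K ^+ 2 - dotv x x) * K ^+ 2)).
    by rewrite gerBl mulr_ge0// ltW.
  by rewrite nmulr_rle0// ltW.
rewrite -(ler_pM2r K2); have : dotv x x * K ^+ 2 <= r ^+ 2 * K ^+ 2 by apply: ler_wpM2r; rewrite ?(ltW K2).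
move: h; rewrite mulrBl (_ : (1 - cutoff K x) * K ^+ 2 * K ^+ 2 = K ^+ 2 * K ^+ 2 - cutoff K x * K ^+ 2 * K ^+ 2); last by ring.
rewrite (_ : 2 * r ^+ 2 * K ^+ 2 = 2 * (r ^+ 2 * K ^+ 2)); last by ring.
by set a := dotv x x * _; set b := _ * K ^+ 2 * _; set c' := r ^+ 2 * _; set d' := K ^+ 2 * _ => h1 h2; lra.
Qed.

Lemma cutoff_cvg d : 0 < d -> exists2 K0, 0 < K0 & forall K, K0 <= K ->
  (\int[leb']_x (\1_S x * (1 - cutoff K x))%:E <= d%:E)%E.
Proof.
move=> d0; have s0 : 0 <= s by rewrite -lee_fin -Ss.
pose F k : set bV' := S `\` eball 0 k%:R.
have mF k : measurable (F k) by apply: measurableD => //; exact: measurable_eball.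
have FS k : (lebB (F k) <= s%:E)%E by rewrite -Ss; apply: le_outer_measure => x [].
have F0 : \bigcap_k F k = set0.
  apply/seteqP; split => // x Fx; have [_] := Fx (Num.truncn (enorm x)).+1 I; apply.
  by rewrite /eball /= subr0 truncnS_gt// ?num_real.
have Fm : {homo F : a b / (a <= b)%N >-> (b <= a)%O}.
  move=> a b ab; apply/subsetPset => x [Sx xb]; split => // xa; apply: xb.
  by apply: lt_le_trans xa _; rewrite ler_nat.
have d2 : 0 < d / 2 by rewrite divr_gt0.
have [k Fk] := @decreasing_small _ _ R leb' F (d / 2) (le_lt_trans (FS 0%N) (ltry _)) mF F0 Fm d2.
pose K0 := 1 + 4 * s * k%:R ^+ 2 / d.
have A0 : 0 <= 4 * s * k%:R ^+ 2 / d by rewrite divr_ge0 ?(ltW d0)// mulr_ge0 ?exprn_ge0// mulr_ge0.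
exists K0; first by rewrite /K0; lra.
move=> K KK; have K1 : 1 <= K by apply: le_trans KK; rewrite lerDl.
have Kp : 0 < K by lra.
have K2 : 0 < K ^+ 2 by rewrite exprn_gt0.
have sK : s * (2 * k%:R ^+ 2 / K ^+ 2) <= d / 2.
  rewrite mulrA ler_pdivrMr//.
  have : 4 * s * k%:R ^+ 2 / d <= K ^+ 2.
    by apply: (le_trans (_ : _ <= K)); [rewrite /K0 in KK; lra|rewrite expr2 ler_peMl// ltW].
  by rewrite ler_pdivrMr//; lra.
have c0 : 0 <= 2 * k%:R ^+ 2 / K ^+ 2 :> R by rewrite divr_ge0 ?(ltW K2)// mulr_ge0// exprn_ge0.
have [L cL] := cutoff_c11b Kp.
apply: (@le_trans _ _ (\int[leb']_x ((\1_(F k) x)%:E + (2 * k%:R ^+ 2 / K ^+ 2)%:E * (\1_S x)%:E))%E).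
  have mI (A : set bV') : measurable A -> measurable_fun [set: bV'] (\1_A : bV' -> R).
    by move=> mA; exact: measurable_indic.
  apply: ge0_le_integral => //.
  - by move=> x _; rewrite lee_fin mulr_ge0// subr_ge0; have /andP[] := cutoff_itv x Kp.
  - apply/measurable_EFinP; apply: measurable_funM; first exact: mI.
    apply: measurable_funB => //; exact: continuous_measurableV (lip_continuous (cb_lip cL)).
  - by apply: emeasurable_funD; [|apply: measurable_funeM]; apply/measurable_EFinP; exact: mI.
  move=> x _; rewrite -EFinM -EFinD lee_fin !indicE.
  have /andP[p0 p1] := cutoff_itv x Kp.
  case: (boolP (x \in S)) => xS; last by rewrite mul0r mulr0 addr0.
  rewrite mul1r mulr1; case: (boolP (x \in F k)) => xF; first by rewrite /=; lra.
  rewrite add0r; apply: cutoff_ge => //.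
  apply/negPn/negP; rewrite -leNgt => h; move/negP: xF; apply; apply/mem_set; split; first exact: set_mem.
  by rewrite /eball /= subr0; apply/negP; rewrite -leNgt.
rewrite ge0_integralD//; last 2 first.
- by move=> x _; rewrite mule_ge0// lee_fin.
- by apply: measurable_funeM; apply/measurable_EFinP; exact: measurable_indic.
rewrite ge0_integralZl//; last by apply/measurable_EFinP; exact: measurable_indic.
rewrite !integral_indic// !setIT.
  apply: (@le_trans _ _ ((d / 2)%:E + (2 * k%:R ^+ 2 / K ^+ 2)%:E * s%:E)%E).
    apply: leeD => //; apply: lee_wpmul2l; first by rewrite lee_fin.
    by rewrite -Ss.
  by rewrite -EFinM -EFinD lee_fin; lra.
by apply/measurable_EFinP; exact: measurable_indic.
Qed.

(** The approximating function is the mollified indicator times a wide cutoff, composed with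
    [stretchV]; its total variation is bounded through [conv_grad_int]. The Lipschitz constant [l]
    enters only through an error that vanishes with the mollification radius. *)
Lemma bvper_smooth (g : R -> R) (M l W : R) (i : 'I_n.+2) : measurable_fun setT g ->
  (forall t, 1 <= g t) -> (forall t, g t <= M) -> (forall s t, `|g s - g t| <= l * `|s - t|) ->
  (\int[haus']_(x in boundary S) (g (x ord0 i))%:E = W%:E)%E ->
  bvper (stretchV g i @^-1` S : set bV') (W / kap n.+1).
Proof.
move=> mg g1 gM gl gW eps eps0; have k0 := @kap_gt0 R n.
have s0 : 0 <= s by rewrite -lee_fin -Ss.
have P0 : 0 <= P by rewrite -lee_fin -SP.
have l0 : 0 <= l by have := gl 1 0; rewrite subr0 normr1 mulr1; apply: le_trans.
have M1 : 1 <= M by apply: le_trans (g1 0) (gM 0).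
have M0 : 0 < M by apply: lt_le_trans M1.
have [b bE] : exists b, b = P / kap n.+1 by eexists.
have b0 : 0 <= b by rewrite bE divr_ge0// ltW.
(* [B = e b] bounds the L^1 error of the normalised mollification. It reappears as [M B] and as
   [4 l B], and this choice keeps each of them within [eps / 2]. *)
have [A AE] : exists A, A = (M + 4 * l) * b + 1 by eexists.
have A0 : 0 < A by rewrite AE ltr_wpDl// mulr_ge0// addr_ge0 ?mulr_ge0// ltW.
have [e eE] : exists e, e = eps / (2 * A) by eexists.
have e0 : 0 < e by rewrite eE divr_gt0// mulr_gt0.
have eA : e * A = eps / 2 by rewrite eE; field; rewrite gt_eqF.
have [B BE] : exists B, B = e * b by eexists.
have B0 : 0 <= B by rewrite BE mulr_ge0// ltW.
have lB0 : 0 <= l * B by rewrite mulr_ge0.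
have MB0 : 0 <= M * B by rewrite mulr_ge0// ltW.
have [hMB hlB] : M * B <= eps / 2 /\ 4 * (l * B) <= eps / 2.
  have : e * A = M * B + 4 * (l * B) + e by rewrite AE BE; ring.
  by split; lra.
have [c c0 cE] := @eta_int R n e e0.
have [L1 cQ] := conv_c11b mS Ss e0.
have eM0 : 0 < eps / (2 * M) by rewrite divr_gt0// mulr_gt0.
have [K0 K0p HK] := cutoff_cvg eM0.
(* The second summand makes the gradient of the cutoff, at most [4 / K], cost no more than [eps / 2]
   against the mass [M (s + B)] of the stretched function. *)
have [K KE] : exists K, K = K0 + 8 * (M * (s + B)) / eps by eexists.
have MsB : 0 <= M * (s + B) by rewrite mulr_ge0 ?addr_ge0// ltW.
have KK : K0 <= K by rewrite KE lerDl divr_ge0 ?(ltW eps0)// mulr_ge0.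
have Kp : 0 < K by apply: lt_le_trans KK.
have hK : 4 / K * (M * (s + B)) <= eps / 2.
  rewrite mulrAC ler_pdivrMr//; have : 8 * (M * (s + B)) / eps <= K by rewrite KE lerDr ltW.
  by rewrite ler_pdivrMr//; lra.
have [L2 cc] := cutoff_c11b Kp.
have cu := c11b_mul (c11b_scale c^-1 cQ) cc.
have cT := c11b_stretch i mg g1 gM gl cu.
set Q := convS S (eta e) in cQ cu cT; set u := (fun x => _ * cutoff K x) in cu cT.
set G := (fun x => _ + _) in cu cT.
have mQ : measurable_fun [set: bV'] (Q : bV' -> R).
  exact: continuous_measurableV (lip_continuous (cb_lip cQ)).
have mu : measurable_fun [set: bV'] (u : bV' -> R).
  exact: continuous_measurableV (lip_continuous (cb_lip cu)).
have mI : measurable_fun [set: bV'] (\1_S : bV' -> R) by exact: measurable_indic.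
have mc : measurable_fun [set: bV'] (cutoff K : bV' -> R).
  exact: continuous_measurableV (lip_continuous (cb_lip cc)).
have mT := @measurable_stretchV R g M mg g1 gM n.+1 i.
have Qc x : 0 <= c^-1 * Q x <= 1.
  have /andP[a1 a2] := conv_itv mS Ss e0 x cE.
  by rewrite mulr_ge0 ?invr_ge0 ?(ltW c0)//= ler_pdivrMl// mulr1.
have u01 x : 0 <= u x <= 1.
  have /andP[a1 a2] := Qc x; have /andP[d1 d2] := cutoff_itv x Kp.
  by rewrite /u mulr_ge0//= mulr_ile1.
have L1Q := conv_L1 mS Ss SP e0 cE; rewrite -/Q -mulrA -bE -BE in L1Q.
have L1u : (\int[leb']_x (`|u x - \1_S x|)%:E <= (B + eps / (2 * M))%:E)%E.
  apply: (@le_trans _ _ (\int[leb']_x ((c^-1)%:E * (`|Q x - c * \1_S x|)%:E + (\1_S x * (1 - cutoff K x))%:E))%E).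
    apply: ge0_le_integral => //.
    - by apply/measurable_EFinP; apply: measurableT_comp => //; exact: measurable_funB.
    - apply: emeasurable_funD; [apply: measurable_funeM|]; apply/measurable_EFinP.
        by apply: measurableT_comp => //; apply: measurable_funB => //; exact: measurable_funM.
      by apply: measurable_funM => //; exact: measurable_funB.
    move=> x _; rewrite -EFinM -EFinD lee_fin.
    have -> : u x - \1_S x = cutoff K x * (c^-1 * (Q x - c * \1_S x)) - \1_S x * (1 - cutoff K x).
      by rewrite /u; field; rewrite gt_eqF.
    have /andP[d1 d2] := cutoff_itv x Kp.
    apply: (le_trans (ler_normB _ _)); apply: lerD.
      by rewrite normrM ger0_norm// normrM (ger0_norm (_ : 0 <= c^-1)) ?invr_ge0 ?(ltW c0)// ler_piMl// mulr_ge0// invr_ge0 ltW.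
    by rewrite ger0_norm// mulr_ge0// subr_ge0.
  rewrite ge0_integralD//; last 4 first.
  - by move=> x _; rewrite mule_ge0// lee_fin invr_ge0 ltW.
  - apply: measurable_funeM; apply/measurable_EFinP.
    by apply: measurableT_comp => //; apply: measurable_funB => //; exact: measurable_funM.
  - by move=> x _; rewrite lee_fin mulr_ge0// subr_ge0; have /andP[] := cutoff_itv x Kp.
  - by apply/measurable_EFinP; apply: measurable_funM => //; exact: measurable_funB.
  rewrite ge0_integralZl//; last 2 first.
  - by apply/measurable_EFinP; apply: measurableT_comp => //; apply: measurable_funB => //; exact: measurable_funM.
  - by rewrite lee_fin invr_ge0 ltW.
  rewrite EFinD; apply: leeD; last exact: HK.
  apply: (@le_trans _ _ ((c^-1)%:E * (c * B)%:E)%E); first by apply: lee_wpmul2l; rewrite ?lee_fin ?invr_ge0 ?(ltW c0).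
  by rewrite -EFinM lee_fin mulKf// gt_eqF.
(* Stretching multiplies lengths by at most [M], so the support grows from [K] to at most [M K]. *)
have far y : M * K <= `|y| -> K <= enorm (stretchV g i y).
  move=> h; apply: le_trans (norm_le_enorm _); rewrite -(ler_pM2l M0); apply: (le_trans h).
  apply: norm_le_coord => [|j]; first by rewrite mulr_ge0// ltW.
  apply: (@le_trans _ _ (M * `|stretchV g i y 0 j|)); last by rewrite ler_wpM2l ?(ltW M0)// norm_coord.
  rewrite updE; case: eqP => [->|_]; last by rewrite ler_peMl.
  have /andP[_] := Lam_norm mg g1 gM (LamV g (y 0 i)) (LamV g 0).
  have V0 : LamV g 0 = 0 by rewrite -{1}(Lam0 g) (LamK mg g1 gM).
  by rewrite !(LamVK mg g1 gM) V0 !subr0.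
have ET : forall y, \1_(stretchV g i @^-1` S) y = \1_S (stretchV g i y) :> R.
  by move=> y; rewrite !indicE; congr (nat_of_bool _)%:R; apply/idP/idP; rewrite !inE.
have c11T : c11 (4 * (`|c^-1| * L1 * L2) * (1 + l)) (M * K) (fun y => u (stretchV g i y)) (stretch_grad g i G).
  apply: (c11b_c11 cT) => [x|y /far h|y /far h]; first exact: u01.
    by rewrite /u /cutoff /eta etam_out// expr0n /= !mulr0.
  have G0 : G (stretchV g i y) = 0.
    by rewrite /G /cutoff_grad /cutoff /deta /eta etam_out// expr0n /= !mulr0 !scale0r scaler0 scaler0 addr0.
  by apply/rowP => j; rewrite stretch_gradE G0 !mxE mulr0 if_same.
exists (4 * (`|c^-1| * L1 * L2) * (1 + l)), (M * K), (fun y => u (stretchV g i y)), (stretch_grad g i G); split => //.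
  under eq_integral do rewrite ET.
  apply: (@le_trans _ _ (M%:E * \int[leb']_x (`|u x - \1_S x|)%:E)%E).
    apply: (@stretched_integral_le R g M mg g1 gM _ i M (fun x => `|u x - \1_S x|)) => //; first exact: ltW.
    by apply: measurableT_comp => //; exact: measurable_funB.
  apply: (@le_trans _ _ (M%:E * (B + eps / (2 * M))%:E)%E); first by apply: lee_wpmul2l; rewrite ?lee_fin ?(ltW M0).
  rewrite -EFinM lee_fin mulrDr (_ : M * (eps / (2 * M)) = eps / 2); last by field; rewrite gt_eqF.
  by lra.
rewrite -lee_fin /gradJ (JE (lipc_enorm (lipc_ge0 (c11_lip c11T)) (c11_grad c11T))).
have Ggrad y : enorm (stretch_grad g i G y) <=
    (c * kap n.+1)^-1 * (kap n.+1 * enorm (conv_grad S e (stretchV g i y))) + c^-1 * (4 / K) * Q (stretchV g i y).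
  apply: (@le_trans _ _ (enorm (G (stretchV g i y)))); first exact: stretch_grad_le.
  set x := stretchV g i y; have /andP[a1 a2] := Qc x; have /andP[d1 d2] := cutoff_itv x Kp.
  apply: (le_trans (enormD _ _)); rewrite addrC; apply: lerD.
    rewrite !enormZ ger0_norm// (ger0_norm (_ : 0 <= c^-1)) ?invr_ge0 ?(ltW c0)//.
    rewrite (_ : (c * kap n.+1)^-1 * _ = c^-1 * enorm (conv_grad S e x)); last by field; rewrite !gt_eqF.
    by rewrite ler_piMl// mulr_ge0 ?enorm_ge0// invr_ge0 ltW.
  rewrite enormZ ger0_norm// [leRHS]mulrAC; apply: ler_wpM2l => //; exact: cutoff_grad_le.
have cgm : measurable_fun [set: bV'] (fun x : bV' => enorm (conv_grad S e x)).
  have mG : measurable_fun [set: bV'] (conv_grad S e : bV' -> bV').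
    apply: measurable_to_bV => j; apply: continuous_measurableV.
    by apply: (@lip_continuous _ _ _ L1) => x y; exact: (cb_glip cQ).
  exact: (measurableT_comp (@measurable_enorm R n.+2) mG).
have mg1 : measurable_fun [set: bV'] (fun y : bV' => (kap n.+1 * enorm (conv_grad S e (stretchV g i y)))%:E).
  by apply/measurable_EFinP; apply: measurable_funM; [exact: measurable_cst|exact: (measurableT_comp cgm mT)].
have mQT : measurable_fun [set: bV'] (fun y : bV' => (Q (stretchV g i y))%:E).
  by apply/measurable_EFinP; exact: (measurableT_comp mQ mT).
apply: (@le_trans _ _ (\int[leb']_y (((c * kap n.+1)^-1)%:E * (kap n.+1 * enorm (conv_grad S e (stretchV g i y)))%:E +
   (c^-1 * (4 / K))%:E * (Q (stretchV g i y))%:E))%E).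
  apply: ge0_le_integral => //.
  - by move=> x _; rewrite lee_fin enorm_ge0.
  - apply/measurable_EFinP; exact: measurable_lipc (lipc_enorm (lipc_ge0 (c11_lip c11T)) (c11_grad c11T)).
  - by apply: emeasurable_funD; apply: measurable_funeM.
  - by move=> y _; rewrite -!EFinM -EFinD lee_fin.
have ck : 0 <= (c * kap n.+1)^-1 by rewrite invr_ge0 ltW// mulr_gt0.
have cK : 0 <= c^-1 * (4 / K) by rewrite mulr_ge0 ?invr_ge0 ?(ltW c0)// divr_ge0// ltW.
have Q0 x : 0 <= Q x by have /andP[+ _] := Qc x; rewrite pmulr_rge0 ?invr_gt0.
have kg0 (y : bV') : (0 <= (kap n.+1 * enorm (conv_grad S e (stretchV g i y)))%:E)%E.
  by rewrite lee_fin mulr_ge0 ?enorm_ge0// ltW.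
have QT0 (y : bV') : (0 <= (Q (stretchV g i y))%:E)%E by rewrite lee_fin.
rewrite ge0_integralD//; last 4 first.
- by move=> y _; rewrite mule_ge0.
- exact: measurable_funeM.
- by move=> y _; rewrite mule_ge0.
- exact: measurable_funeM.
rewrite !ge0_integralZl//.
have IQ : (\int[leb']_x (Q x)%:E <= (c * (s + B))%:E)%E.
  apply: (@le_trans _ _ (\int[leb']_x ((`|Q x - c * \1_S x|)%:E + c%:E * (\1_S x)%:E))%E).
    apply: ge0_le_integral => //.
    - by move=> x _; rewrite lee_fin.
    - exact/measurable_EFinP.
    - apply: emeasurable_funD; [|apply: measurable_funeM]; apply/measurable_EFinP => //.
      by apply: measurableT_comp => //; apply: measurable_funB => //; exact: measurable_funM.
    - by move=> x _; rewrite -EFinM -EFinD lee_fin -lerBlDr ler_norm.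
  rewrite ge0_integralD//; last 3 first.
  - apply/measurable_EFinP; apply: measurableT_comp => //; apply: measurable_funB => //; exact: measurable_funM.
  - by move=> x _; rewrite mule_ge0// lee_fin ltW.
  - by apply: measurable_funeM; exact/measurable_EFinP.
  rewrite ge0_integralZl//; last 2 first.
  - exact/measurable_EFinP.
  - by rewrite lee_fin ltW.
  rewrite integral_indic// setIT mulrDr addrC EFinD; apply: leeD => //.
  apply: (@le_trans _ _ (c%:E * lebB S)%E) => //; by rewrite Ss.
have IQT : (\int[leb']_y (Q (stretchV g i y))%:E <= (M * (c * (s + B)))%:E)%E.
  apply: (@le_trans _ _ (M%:E * \int[leb']_x (Q x)%:E)%E).
    by apply: (@stretched_integral_le R g M mg g1 gM _ i M Q) => //; exact: ltW.
  by rewrite EFinM; apply: lee_wpmul2l; rewrite ?lee_fin ?(ltW M0).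
have IG := conv_grad_int mS Ss SP e0 mg g1 gM gl gW cE.
apply: (@le_trans _ _ (((c * kap n.+1)^-1)%:E * (c * (W + 4 * l * e * P))%:E + (c^-1 * (4 / K))%:E * (M * (c * (s + B)))%:E)%E).
  by apply: leeD; apply: lee_wpmul2l; rewrite ?lee_fin.
rewrite -!EFinM -EFinD lee_fin.
have -> : (c * kap n.+1)^-1 * (c * (W + 4 * l * e * P)) = W / kap n.+1 + 4 * (l * B).
  by rewrite BE bE; field; rewrite !gt_eqF.
have -> : c^-1 * (4 / K) * (M * (c * (s + B))) = 4 / K * (M * (s + B)).
  by field; rewrite !gt_eqF.
by lra.
Qed.

End bvper_smooth.

(** * Negligible layers *)

Section null_sets.
Context {R : realType}.

Lemma null_coord n (i : 'I_n.+1) (N : set R) : measurable N -> lebesgue_measure N = 0%E ->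
  lebB ([set x : 'rV[R]_n.+1 | N (x 0 i)] : set (@bV R n.+1)) = 0%E.
Proof.
move=> mN N0; rewrite -(@lebB_sw R n i).
have -> : sw i @^-1` [set x : 'rV[R]_n.+1 | N (x 0 i)] = [set x : 'rV[R]_n.+1 | N (x 0 ord0)].
  by apply/seteqP; split => x /=; rewrite swEi.
set A := [set x | _]; have mA : measurable (A : set (@bV R n.+1)).
  by rewrite -[X in measurable X]setTI; exact: (measurable_coord ord0).
have -> : lebB (A : set (@bV R n.+1)) = (\int[@lebB R n.+1]_x (\1_A x)%:E)%E by rewrite integral_indic// setIT.
rewrite fubiniV//; last by apply/measurable_EFinP; exact: measurable_indic.
under eq_integral => s _.
  have -> : (\int[@lebB R n]_y (\1_A (consv s y))%:E = (\1_N s)%:E * lebB (setT : set (@bV R n)))%E.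
    rewrite -(integral_cst (@lebB R n) measurableT); apply: eq_integral => y _.
    by congr ((nat_of_bool _)%:R)%:E; apply/idP/idP; rewrite !inE /A /= consv0.
  over.
rewrite ge0_integralZr//; last by apply/measurable_EFinP; exact: measurable_indic.
rewrite integral_indic// setIT.
by transitivity (lebesgue_measure N * lebB (setT : set (@bV R n)))%E => //; rewrite N0 mul0e.
Qed.

Definition strip n (j : 'I_n) (t d : R) : set (@bV R n) := [set x : 'rV[R]_n | `|x 0 j - t| <= d].

Lemma measurable_strip n (j : 'I_n) t d : measurable (strip j t d).
Proof.
rewrite (_ : strip j t d = (fun x : @bV R n => (x : 'rV[R]_n) 0 j) @^-1` `[t - d, t + d]%classic).
  by rewrite -[X in measurable X]setTI; apply: (measurable_coord j).
by apply/seteqP; split => x /=; rewrite /strip /= in_itv /= ler_distl.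
Qed.

(** The hyperplane itself is null, and the strips shrink to it; finite volume permits continuity
    from above. *)
Lemma strip_small n (A : set (@bV R n.+1)) (j : 'I_n.+1) t e : measurable A -> (lebB A < +oo)%E -> 0 < e ->
  exists2 d, 0 < d & (lebB (A `&` strip j t d) <= e%:E)%E.
Proof.
move=> mA Af e0; pose P0 : set (@bV R n.+1) := [set x : 'rV[R]_n.+1 | [set t] (x 0 j)].
have mP : measurable P0 by rewrite -[X in measurable X]setTI; apply: (measurable_coord j).
have P00 : lebB P0 = 0%E by apply: null_coord => //; exact: lebesgue_measure_set1.
pose F k := (A `&` strip j t k.+1%:R^-1) `\` P0.
have mF k : measurable (F k) by apply: measurableD => //; apply: measurableI => //; exact: measurable_strip.
have cF : \bigcap_k F k = set0.
  apply/seteqP; split => // x Fx; have [_ xP] := Fx 0%N I; apply: xP => /=.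
  apply/eqP; rewrite -subr_eq0 -normr_le0 leNgt; apply/negP => xt.
  have [k xk] : exists k, k.+1%:R^-1 < `|x 0 j - t|.
    by exists (Num.truncn `|x 0 j - t|^-1); rewrite invf_plt ?posrE// truncnS_gt// num_real.
  have [[_ xs] _] := Fx k I.
  by move: xs; rewrite /strip /= leNgt xk.
have hF : {homo F : a b / (a <= b)%N >-> (b <= a)%O}.
  move=> a b ab; apply/subsetPset => x [[Ax xb] nx]; split => //; split => //.
  by apply: le_trans xb _; rewrite lef_pV2 ?posrE// ler_nat.
have F0 : (@lebB R n.+1 (F 0%N) < +oo)%E by apply: le_lt_trans Af; apply: le_outer_measure => x [[]].
have [k Fk] := decreasing_small F0 mF cF hF e0.
exists k.+1%:R^-1; first by rewrite invr_gt0.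
apply: (@le_trans _ _ (lebB (F k `|` P0))).
  by apply: le_outer_measure => x As; have [xP|xP] := pselect (P0 x); [right|left].
apply: (le_trans (outer_measureU2 _ _ _)).
rewrite -[X in (_ + X)%E]/(lebB P0) P00 adde0; exact: Fk.
Qed.

End null_sets.

(** * Lipschitz approximation of a profile *)

Lemma min_lip {R : realDomainType} (c a b : R) : `|Num.min c a - Num.min c b| <= `|a - b|.
Proof.
have h1 := ler_norm (a - b); have h2 := ler_norm (b - a); rewrite distrC in h2.
by case: (leP c a) => ?; case: (leP c b) => ?; rewrite ler_norml; apply/andP; split; lra.
Qed.

Lemma max_lip {R : realDomainType} (c a b : R) : `|Num.max c a - Num.max c b| <= `|a - b|.
Proof.
have h1 := ler_norm (a - b); have h2 := ler_norm (b - a); rewrite distrC in h2.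
by case: (leP c a) => ?; case: (leP c b) => ?; rewrite ler_norml; apply/andP; split; lra.
Qed.

Section lipschitz_density.
Context {R : realType} (mu : {measure set (measurableTypeR R) -> \bar R}).
Hypothesis muT : (mu setT < +oo)%E.

Let mlip (h : R -> R) l : (forall s t, `|h s - h t| <= l * `|s - t|) -> measurable_fun [set: measurableTypeR R] h.
Proof.
move=> hl; apply: continuous_measurable_fun => x; apply/cvgrPdist_lt => e e0.
have l1 : 0 < 1 + `|l| by rewrite ltr_pwDl.
apply/nbhs_ballP; exists (e / (1 + `|l|)) => [|y]; first exact: divr_gt0.
move=> xy; have {xy} : `|x - y| < e / (1 + `|l|) := xy.
rewrite ltr_pdivlMr// mulrC; apply: le_lt_trans; apply: (le_trans (hl _ _)).
by apply: ler_wpM2r => //; apply: (le_trans (ler_norm l)); rewrite lerDr.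
Qed.

Definition lip_approx (A : set R) := forall d, 0 < d -> exists h l,
  [/\ forall t, 0 <= h t <= 1, forall s t, `|h s - h t| <= l * `|s - t| &
      (\int[mu]_t (`|h t - \1_A t|)%:E <= d%:E)%E].

Lemma lip_approx_ray (a : R) : lip_approx `]a, +oo[%classic.
Proof.
move=> d d0; pose F k : set (measurableTypeR R) := `]a, a + k.+1%:R^-1]%classic.
have cF : \bigcap_k F k = set0.
  apply/seteqP; split => // x Fx.
  have : a < x by have := Fx 0%N I; rewrite /F /= in_itv => /andP[].
  rewrite -subr_gt0 => xa; have := Fx (Num.truncn (x - a)^-1) I; rewrite /F /= in_itv/= => /andP[_].
  apply/negP; rewrite -ltNge -ltrBrDl invf_plt ?posrE// truncnS_gt// num_real.
have hF : {homo F : a b / (a <= b)%N >-> (b <= a)%O}.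
  move=> b c bc; apply/subsetPset => x; rewrite /F /= !in_itv/= => /andP[-> h].
  by apply: le_trans h _; rewrite lerD2l lef_pV2 ?posrE// ler_nat.
have F0 : (mu (F 0%N) < +oo)%E by apply: le_lt_trans muT; apply: le_measure; rewrite ?inE//; exact: measurable_itv.
have [k Fk] := decreasing_small F0 (fun k => measurable_itv _) cF hF d0.
pose h t := Num.min 1 (Num.max 0 ((t - a) * k.+1%:R)).
have h01 t : 0 <= h t <= 1 by rewrite /h le_min ler01 le_max lexx ge_min lexx.
have hl s t : `|h s - h t| <= k.+1%:R * `|s - t|.
  apply: (le_trans (min_lip _ _ _)); apply: (le_trans (max0_lip _ _)).
  by rewrite -mulrBl opprB addrA subrK normrM mulrC ger0_norm.
exists h, k.+1%:R; split => //.
have mA : @measurable _ (measurableTypeR R) `]a, +oo[%classic by exact: measurable_itv.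
have IF : (\int[mu]_x (\1_(F k) x)%:E = mu (F k))%E by rewrite integral_indic ?setIT//; exact: measurable_itv.
apply: le_trans Fk; rewrite -IF.
apply: ge0_le_integral => //.
- apply/measurable_EFinP; apply: measurableT_comp => //; apply: measurable_funB; first exact: mlip hl.
  exact: measurable_indic.
- by apply/measurable_EFinP; apply: measurable_indic; exact: measurable_itv.
move=> t _; rewrite lee_fin !indicE /F; have [ta|ta] := leP t a.
  rewrite (_ : h t = 0) ?memNset ?subrr ?normr0//=; first by rewrite in_itv /= ltNge ta.
    by rewrite in_itv /= ltNge ta.
  by rewrite /h [Num.max 0 _]max_l ?min_r// mulr_le0_ge0// subr_le0.
rewrite [_ \in `]a, +oo[%classic]mem_set /= ?in_itv/= ?ta//.
have [tk|tk] := leP t (a + k.+1%:R^-1).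
  rewrite mem_set /= ?in_itv/= ?ta//; have /andP[h0 h1] := h01 t.
  by rewrite ler_norml; apply/andP; split; lra.
rewrite (_ : h t = 1) ?subrr ?normr0//= /h min_l// le_max; apply/orP; right.
by rewrite -ler_pdivrMr// div1r lerBrDl ltW.
Qed.

Lemma lip_approxC A : measurable A -> lip_approx A -> lip_approx (~` A).
Proof.
move=> mA HA d /HA[h [l [h01 hl hd]]]; exists (fun t => 1 - h t), l; split => [t|s t|].
- by have /andP[a b] := h01 t; rewrite subr_ge0 b gerBl a.
- by rewrite opprB addrC addrA subrK distrC; apply: hl.
- apply: le_trans hd; rewrite le_eqVlt; apply/orP; left; apply/eqP; apply: eq_integral => t _.
  by rewrite !indicE in_setC -normrN; congr (`| _ |%:E); case: (t \in A) => /=; ring.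
Qed.

Lemma lip_approxU A B : measurable A -> measurable B -> lip_approx A -> lip_approx B -> lip_approx (A `|` B).
Proof.
move=> mA mB HA HB d d0; have d2 : 0 < d / 2 by rewrite divr_gt0.
have [h [l [h01 hl hd]]] := HA _ d2; have [h' [l' [h01' hl' hd']]] := HB _ d2.
have mh := mlip hl; have mh' := mlip hl'.
have mI (C : set (measurableTypeR R)) : measurable C -> measurable_fun [set: measurableTypeR R] (\1_C : measurableTypeR R -> R).
  by move=> mC; exact: measurable_indic.
exists (fun t => Num.max (h t) (h' t)), (`|l| + `|l'|).
have mx (a b c e : R) : `|Num.max a b - Num.max c e| <= `|a - c| + `|b - e|.
  have h1 := ler_norm (a - c); have h2 := ler_norm (b - e).
  have h3 := ler_norm (c - a); have h4 := ler_norm (e - b); rewrite distrC in h3; rewrite distrC in h4.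
  have n1 := normr_ge0 (a - c); have n2 := normr_ge0 (b - e).
  by case: (leP a b) => ?; case: (leP c e) => ?; rewrite ler_norml; apply/andP; split; lra.
split => [t|s t|].
- by have /andP[a b] := h01 t; have /andP[a' b'] := h01' t; rewrite le_max a/= ge_max b.
- apply: (le_trans (mx _ _ _ _)); rewrite mulrDl; apply: lerD.
    by apply: (le_trans (hl _ _)); apply: ler_wpM2r => //; exact: ler_norm.
  by apply: (le_trans (hl' _ _)); apply: ler_wpM2r => //; exact: ler_norm.
- apply: (@le_trans _ _ (\int[mu]_t ((`|h t - \1_A t|)%:E + (`|h' t - \1_B t|)%:E))%E).
    apply: ge0_le_integral => //.
    + apply/measurable_EFinP; apply: measurableT_comp => //; apply: measurable_funB.
        exact: measurable_maxr.
      by apply: mI; exact: measurableU.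
    + apply: emeasurable_funD; apply/measurable_EFinP; apply: measurableT_comp => //;
      apply: measurable_funB => //; exact: mI.
    move=> t _; rewrite -EFinD lee_fin; have -> : \1_(A `|` B) t = Num.max (\1_A t) (\1_B t) :> R.
      rewrite !indicE in_setU; apply/eqP; rewrite eq_le ge_max !le_max.
      by rewrite !ler_nat; case: (t \in A); case: (t \in B).
    exact: mx.
  rewrite ge0_integralD//; last 2 first.
  + by apply/measurable_EFinP; apply: measurableT_comp => //; apply: measurable_funB => //; exact: mI.
  + by apply/measurable_EFinP; apply: measurableT_comp => //; apply: measurable_funB => //; exact: mI.
  by rewrite (splitr d) EFinD; apply: leeD.
Qed.

(** The sets whose indicator is an L^1 limit of Lipschitz functions form a sigma-algebra containing
    the rays. Finiteness of [mu] reduces a countable union to a finite one. *)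
Lemma lip_approx_all (A : set (measurableTypeR R)) : measurable A -> lip_approx A.
Proof.
move=> mA; suff [] : measurable A /\ lip_approx A by [].
have sub : (@RGenOInfty.G R).-sigma.-measurable `<=` [set A : set (measurableTypeR R) | measurable A /\ lip_approx A].
  apply: smallest_sub; last first.
    by move=> _ [x ->]; split; [exact: measurable_itv|exact: lip_approx_ray].
  split.
  - split; first exact: measurable0.
    move=> d d0; exists (cst 0), 0; split => [t|s t|]; first by rewrite lexx ler01.
      by rewrite subrr normr0 mul0r.
    by rewrite integral0_eq ?lee_fin ?ltW// => t _; rewrite indic0 subrr normr0.
  - by move=> B [mB HB]; rewrite setTD; split; [exact: measurableC|exact: lip_approxC].
  - move=> B HB; have mB k : measurable (B k : set (measurableTypeR R)) by have [] := HB k.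
    have mU : measurable (\bigcup_k B k : set (measurableTypeR R)) by exact: bigcupT_measurable.
    split => // d d0; have d2 : 0 < d / 2 by rewrite divr_gt0.
    pose U k : set (measurableTypeR R) := \big[setU/set0]_(j < k) B j.
    have mUk k : measurable (U k) by apply: bigsetU_measurable => j _.
    have HU k : lip_approx (U k).
      rewrite /U; elim: k => [|k IH].
        rewrite big_ord0 => e e0; exists (cst 0), 0; split => [t|s t|]; first by rewrite lexx ler01.
          by rewrite subrr normr0 mul0r.
        by rewrite integral0_eq ?lee_fin ?ltW// => t _; rewrite indic0 subrr normr0.
      have [_ Hk] := HB k; rewrite big_ord_recr /=; exact: (lip_approxU (mUk k) (mB k) IH Hk).
    pose F k : set (measurableTypeR R) := (\bigcup_k B k) `\` U k.
    have mF k : measurable (F k) by exact: measurableD.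
    have cF : \bigcap_k F k = set0.
      apply/seteqP; split => // x Fx; have [[j _ Bj] _] := Fx 0%N I.
      by have [_] := Fx j.+1 I; apply; rewrite /U -bigcup_mkord; exists j => /=.
    have hF : {homo F : a b / (a <= b)%N >-> (b <= a)%O}.
      move=> a b ab; apply/subsetPset => x [Ux nx]; split => // xa; apply: nx.
      move: xa; rewrite /U -!bigcup_mkord => -[j /= ja Bj]; exists j => //=; exact: leq_trans ja ab.
    have F0 : (mu (F 0%N) < +oo)%E by apply: le_lt_trans muT; apply: le_measure; rewrite ?inE.
    have [k Fk] := decreasing_small F0 mF cF hF d2.
    have [h [l [h01 hl hd]]] := HU k _ d2; exists h, l; split => //.
    have mI (C : set (measurableTypeR R)) : measurable C -> measurable_fun [set: measurableTypeR R] (\1_C : measurableTypeR R -> R).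
      by move=> mC; exact: measurable_indic.
    apply: (@le_trans _ _ (\int[mu]_t ((`|h t - \1_(U k) t|)%:E + (\1_(F k) t)%:E))%E).
      apply: ge0_le_integral => //.
      + apply/measurable_EFinP; apply: measurableT_comp => //; apply: measurable_funB; first exact: mlip hl.
        exact: mI.
      + apply: emeasurable_funD; apply/measurable_EFinP; last exact: mI.
        by apply: measurableT_comp => //; apply: measurable_funB; [exact: mlip hl|exact: mI].
      move=> t _; rewrite -EFinD lee_fin !indicE.
      have [tU|tU] := boolP (t \in U k).
        rewrite [t \in \bigcup_k _]mem_set ?lerDl//.
        by move: tU; rewrite inE /U -bigcup_mkord => -[j _ Bj]; exists j.
      have [tB|tB] := boolP (t \in \bigcup_k B k); last by rewrite lerDl.
      rewrite mem_set; last by split; [exact: set_mem|move=> /mem_set; apply/negP].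
      by rewrite subr0; apply: (le_trans (ler_normB _ _)); rewrite normr1.
    rewrite ge0_integralD//; last 2 first.
    + apply/measurable_EFinP; apply: measurableT_comp => //; apply: measurable_funB; [exact: mlip hl|exact: mI].
    + by apply/measurable_EFinP; exact: mI.
    rewrite (splitr d) EFinD; apply: leeD => //.
    by rewrite integral_indic// setIT.
apply: sub; rewrite -RGenOInfty.measurableE; exact: mA.
Qed.

(** Layer-cake decomposition: each step removes the top layer [g > 1 + K ep] and adds back [ep]
    times a Lipschitz approximation of its indicator. *)
Lemma step_approx (ep : R) (K : nat) : 0 < ep -> forall g : measurableTypeR R -> R, measurable_fun setT g ->
  (forall t, 1 <= g t <= 1 + K%:R * ep) -> forall d, 0 < d -> exists h l s,
  [/\ forall x y, `|h x - h y| <= l * `|x - y|, measurable_fun [set: measurableTypeR R] s,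
      forall t, g t <= s t <= g t + ep, forall t, s t <= 1 + K%:R * ep &
      (\int[mu]_t (`|h t - s t|)%:E <= d%:E)%E].
Proof.
move=> ep0; elim: K => [|K IH] g mg g1 d d0.
  exists (cst 1), 0, (cst 1); split => //.
  - by move=> x y; rewrite subrr normr0 mul0r.
  - by move=> t; have /andP[a b] := g1 t; rewrite mul0r in b; apply/andP; split => /=; lra.
  - by move=> t; rewrite mul0r addr0.
  - by rewrite integral0_eq ?lee_fin ?(ltW d0)// => t _; rewrite subrr normr0.
pose a := 1 + K%:R * ep; have KS : 1 + K.+1%:R * ep = a + ep by rewrite /a -natr1; ring.
have a1 : 1 <= a by rewrite lerDl mulr_ge0// ltW.
have mg' : measurable_fun setT (fun t : measurableTypeR R => Num.min (g t) a) by exact: measurable_minr.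
have d2 : 0 < d / 2 by rewrite divr_gt0.
have [|h [l [s [hl ms sb sK hd]]]] := IH _ mg' _ _ d2.
  by move=> t; have /andP[b _] := g1 t; rewrite le_min b a1 ge_min lexx orbT.
pose A : set (measurableTypeR R) := [set t | a < g t].
have mA : measurable A.
  rewrite (_ : A = g @^-1` `]a, +oo[%classic); last by apply/seteqP; split => t /=; rewrite in_itv/= andbT.
  by rewrite -[X in measurable X]setTI; apply: mg => //; exact: measurable_itv.
have mI : measurable_fun [set: measurableTypeR R] (\1_A : measurableTypeR R -> R) by exact: measurable_indic.
have de : 0 < d / 2 / ep by rewrite divr_gt0.
have [h' [l' [h01 hl' hd']]] := lip_approx_all mA de.
exists (fun t => h t + ep * h' t), (l + ep * l'), (fun t => s t + ep * \1_A t); split.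
- move=> x y; rewrite (_ : _ - _ = (h x - h y) + ep * (h' x - h' y)); last by ring.
  apply: (le_trans (ler_normD _ _)); rewrite mulrDl; apply: lerD => //.
  by rewrite normrM gtr0_norm// -mulrA ler_pM2l.
- by apply: measurable_funD => //; exact: measurable_funM.
- move=> t; have /andP[g1t g2t] := g1 t; rewrite KS in g2t.
  have /andP[s1 s2] := sb t; have sa := sK t; rewrite -/a in sa.
  have [gt|gt] := leP (g t) a.
    rewrite min_l// in s1 s2; rewrite indicE memNset ?mulr0 ?addr0 ?s1//.
    by rewrite /A /= ltNge gt.
  rewrite min_r ?(ltW gt)// in s1 s2; rewrite indicE mem_set// mulr1; apply/andP; split; lra.
- move=> t; rewrite KS; apply: lerD; first exact: sK.
  by rewrite ler_piMr ?(ltW ep0)// indicE; case: (_ \in _).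
- have mh := mlip hl; have mh' := mlip hl'.
  have m1 : measurable_fun [set: measurableTypeR R] (fun t => (`|h t - s t|)%:E).
    by apply/measurable_EFinP; apply: measurableT_comp => //; exact: measurable_funB.
  have m2 : measurable_fun [set: measurableTypeR R] (fun t => (`|h' t - \1_A t|)%:E).
    by apply/measurable_EFinP; apply: measurableT_comp => //; exact: measurable_funB.
  apply: (@le_trans _ _ (\int[mu]_t ((`|h t - s t|)%:E + ep%:E * (`|h' t - \1_A t|)%:E))%E).
    apply: ge0_le_integral => //.
    + apply/measurable_EFinP; apply: measurableT_comp => //; apply: measurable_funB;
      by apply: measurable_funD => //; apply: measurable_funM => //; exact: measurable_cst.
    + by apply: emeasurable_funD => //; exact: measurable_funeM.
    move=> t _; rewrite -EFinM -EFinD lee_fin.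
    rewrite (_ : _ - _ = (h t - s t) + ep * (h' t - \1_A t)); last by ring.
    by apply: (le_trans (ler_normD _ _)); rewrite lerD2l normrM gtr0_norm.
  rewrite ge0_integralD//; last 2 first.
  + by move=> t _; rewrite mule_ge0// lee_fin ltW.
  + exact: measurable_funeM.
  rewrite (splitr d) EFinD; apply: leeD => //; rewrite ge0_integralZl//; last by rewrite lee_fin ltW.
  apply: (@le_trans _ _ (ep%:E * (d / 2 / ep)%:E)%E); first by apply: lee_wpmul2l; rewrite ?lee_fin ?(ltW ep0).
  by rewrite -EFinM lee_fin mulrCA divff ?mulr1// gt_eqF.
Qed.

Lemma lip_dense (g : measurableTypeR R -> R) (M d : R) : measurable_fun setT g -> (forall t, 1 <= g t) ->
  (forall t, g t <= M) -> 0 < d -> exists h l, [/\ forall t, 1 <= h t, forall t, h t <= M,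
    forall x y, `|h x - h y| <= l * `|x - y|, measurable_fun [set: measurableTypeR R] h &
    (\int[mu]_t (`|h t - g t|)%:E <= d%:E)%E].
Proof.
move=> mg g1 gM d0; have [m muE] : exists m, mu setT = m%:E.
  by exists (fine (mu setT)); rewrite fineK// ge0_fin_numE.
have m0 : 0 <= m by rewrite -lee_fin -muE.
have M1 : 1 <= M := le_trans (g1 0) (gM 0).
pose ep := d / 2 / (m + 1); have ep0 : 0 < ep by rewrite !divr_gt0// ltr_wpDl.
have epm : ep * m <= d / 2.
  rewrite /ep mulrAC ler_pdivrMr ?ltr_wpDl//; have : 0 <= d / 2 by lra.
  by move=> ?; rewrite ler_wpM2l//; lra.
have d2 : 0 < d / 2 by rewrite divr_gt0.
have [|h [l [s [hl ms sb sK hd]]]] := @step_approx ep (Num.truncn ((M - 1) / ep)).+1 ep0 g mg _ (d / 2) d2.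
  move=> t; rewrite g1 /= -lerBlDl; apply: (le_trans (_ : _ <= M - 1)); first by rewrite lerD2r.
  by rewrite -ler_pdivrMr// ltW// truncnS_gt// num_real.
(* Clamping to [[1, M]] is 1-Lipschitz and fixes [g], so it restores the bounds on the density
   without spoiling the approximation. *)
pose h' t := Num.max 1 (Num.min M (h t)).
have cl (x y : R) : `|Num.max 1 (Num.min M x) - Num.max 1 (Num.min M y)| <= `|x - y|.
  exact: le_trans (max_lip _ _ _) (min_lip _ _ _).
have hl' x y : `|h' x - h' y| <= l * `|x - y| by apply: le_trans (hl x y); exact: cl.
exists h', l; split => //.
- by move=> t; rewrite /h' le_max lexx.
- by move=> t; rewrite /h' ge_max M1 ge_min lexx.
- exact: mlip hl'.
have mh := mlip hl; have mh' := mlip hl'.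
have m1 : measurable_fun [set: measurableTypeR R] (fun t => (`|h t - s t|)%:E).
  by apply/measurable_EFinP; apply: measurableT_comp => //; exact: measurable_funB.
apply: (@le_trans _ _ (\int[mu]_t ((`|h t - s t|)%:E + ep%:E))%E).
  apply: ge0_le_integral => //.
  - by apply/measurable_EFinP; apply: measurableT_comp => //; exact: measurable_funB.
  - exact: emeasurable_funD.
  move=> t _; rewrite -EFinD lee_fin; have gE : g t = Num.max 1 (Num.min M (g t)) by rewrite min_r// max_r.
  rewrite [X in `|_ - X|]gE; apply: (le_trans (cl _ _)).
  rewrite (_ : h t - g t = (h t - s t) + (s t - g t)); last by ring.
  apply: (le_trans (ler_normD _ _)); apply: lerD => //; have /andP[a b] := sb t.
  by rewrite ger0_norm ?subr_ge0// lerBlDl.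
rewrite ge0_integralD//; last by move=> t _; rewrite lee_fin ltW.
rewrite (splitr d) EFinD; apply: leeD => //.
by rewrite integral_cst// muE -EFinM lee_fin.
Qed.

End lipschitz_density.

(** * Borel minorant of a measurable density *)

Section borel_version.
Context {R : realType}.

(** The Borel version has to lie below [lam] everywhere and not only almost everywhere: the area of
    a boundary may charge the layers over the null set [N], and replacing [lam] by [g] must not
    increase it. *)
Lemma borel_below (lam : R -> R) (M : R) : lebesgue_measurable_fun lam -> (forall t, 1 <= lam t) ->
  (forall t, lam t <= M) -> exists (g : measurableTypeR R -> R) (N : set (measurableTypeR R)),
  [/\ measurable_fun setT g, forall t, 1 <= g t <= lam t, measurable N, lebesgue_measure N = 0%E &
      forall t, ~ N t -> g t = lam t].
Proof.
move=> ml l1 lM.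
pose q (m : nat) : R := ratr (odflt 0 (unpickle m)).
have /choice[X HX] m : exists XZ : set (measurableTypeR R) * set (measurableTypeR R),
    [/\ measurable XZ.1, measurable XZ.2, lebesgue_measure XZ.2 = 0%E, XZ.1 `<=` [set t | q m < lam t] &
        [set t | q m < lam t] `<=` XZ.1 `|` XZ.2].
  have : ((wlength idfun)^*)%mu.-cara.-measurable [set t | q m < lam t].
    rewrite (_ : [set t | _] = lam @^-1` `]q m, +oo[%classic); last by apply/seteqP; split => t /=; rewrite in_itv/= andbT.
    by rewrite -[X in _ X]setTI; apply: ml => //; exact: measurable_itv.
  rewrite -completed_caratheodory_measurable g_sigma_completed_algebra_genE.
  move=> [A mA [N [Z [mZ Z0 NZ]] AN]]; exists (A, Z); split => //=.
    by rewrite -AN; exact: subsetUl.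
  by rewrite -AN => t [|/NZ]; [left|right].
pose N : set (measurableTypeR R) := \bigcup_m (X m).2.
have mN : measurable N by apply: bigcupT_measurable => m; have [] := HX m.
have N0 : lebesgue_measure N = 0%E.
  apply/eqP; rewrite eq_le measure_ge0 andbT.
  apply: (le_trans (@measure_sigma_subadditive _ _ _ lebesgue_measure N (fun m => (X m).2) _ mN _)) => //.
    by move=> m; have [] := HX m.
  by rewrite eseries0// => m _ _; have [] := HX m.
(* On the exceptional set [g] takes the value 1, the smallest that the density may have. *)
pose g t := 1 + (lam t - 1) * \1_(~` N) t.
have gN t : ~ N t -> g t = lam t by move=> nt; rewrite /g indicE mem_set// mulr1 addrC subrK.
have gN1 t : N t -> g t = 1 by move=> nt; rewrite /g indicE memNset ?mulr0 ?addr0// => /(_ nt).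
exists g, N; split => //; last first.
  move=> t; have [nt|nt] := pselect (N t); first by rewrite gN1// lexx l1.
  by rewrite gN// lexx l1.
apply: (measurability _ (RGenOInfty.measurableE R)) => _ [_ [a ->] <-]; rewrite setTI.
have [a1|a1] := ltP a 1.
  rewrite (_ : _ @^-1` _ = setT); first exact: measurableT.
  apply/seteqP; split => // t _; rewrite /= in_itv/= andbT; apply: (lt_le_trans a1).
  by have [nt|nt] := pselect (N t); [rewrite gN1|rewrite gN].
have -> : g @^-1` `]a, +oo[%classic = (\bigcup_(m in [set m | a < q m]) (X m).1) `\` N.
  apply/seteqP; split => [t|t [[m /= am Xt] nt]]; rewrite /= in_itv/= andbT.
    have [nt|nt] := pselect (N t); first by rewrite gN1// ltNge a1.
    rewrite gN// => at_; split => //.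
    have [r] := rat_in_itvoo at_; rewrite in_itv/= => /andP[ar rl].
    have qr : q (pickle r) = ratr r by rewrite /q pickleK.
    exists (pickle r); first by rewrite /= qr.
    have [_ _ _ _ /(_ t)] := HX (pickle r); rewrite /= qr => /(_ rl)[//|Zt].
    by exfalso; apply: nt; exists (pickle r).
  by rewrite gN//; apply: (lt_trans am); have [_ _ _ /(_ _ Xt)] := HX m.
apply: measurableD => //; apply: bigcup_measurable => m _; by have [] := HX m.
Qed.

End borel_version.

(** The integral of a nonnegative function is a supremum over simple functions below it, hence
    monotone for arbitrary functions. It is applied to the density under the area measure, for which
    measurability is not known. *)
Lemma nonneg_le_integral d (T : measurableType d) (R : realType) (mu : {measure set T -> \bar R})
  (D : set T) (f g : T -> \bar R) : (forall x, D x -> 0 <= f x)%E -> (forall x, D x -> f x <= g x)%E ->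
  (\int[mu]_(x in D) f x <= \int[mu]_(x in D) g x)%E.
Proof.
move=> f0 fg; rewrite !ge0_integralE//; last by move=> x Dx; exact: le_trans (f0 x Dx) (fg x Dx).
apply: ge_ereal_sup => _ [h hf <-]; apply: ereal_sup_ubound; exists h => //= x.
apply: (le_trans (hf x)); rewrite !patchE; case: ifP => // /set_mem; exact: fg.
Qed.

Section change_of_sigma_algebra.
Context {R : realType} (n : nat).

Lemma cara_integral (mu : {outer_measure set 'rV[R]_n -> \bar R}) (m : {measure set (@bV R n) -> \bar R})
  (D : set (@bV R n)) (h : @bV R n -> \bar R) :
  (forall A, measurable (A : set (@bV R n)) -> mu.-caratheodory A) ->
  (forall A, measurable A -> m A = mu A) -> measurable D -> measurable_fun setT h -> (forall x, 0 <= h x)%E ->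
  (\int[cara_measure mu]_(x in D) h x = \int[m]_(x in D) h x)%E.
Proof.
move=> mc mm mD mh h0.
have mid : measurable_fun [set: caratheodory_type mu] (id : caratheodory_type mu -> @bV R n).
  by move=> _ A mA; rewrite setTI; exact: mc.
pose p : {measure set (@bV R n) -> \bar R} :=
  @measure_function_pushforward__canonical__measure_function_Measure _ _ _ _ _
    (cara_measure mu) (id : caratheodory_type mu -> @bV R n) mid.
transitivity (\int[p]_(x in D) h x)%E; last by apply: eq_measure_integral => A mA _; rewrite mm.
by rewrite ge0_integral_pushforward//; exact: measurable_funS mh.
Qed.

End change_of_sigma_algebra.

(** * Weighted isoperimetric inequality *)

Section profile_integrals.
Context {R : realType} (n : nat) (i : 'I_n.+1).
Implicit Types (g h : R -> R) (m : {measure set (@bV R n.+1) -> \bar R}) (A B D : set (@bV R n.+1)).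

Definition pint m g D : \bar R := (\int[m]_(x in D) (g ((x : 'rV[R]_n.+1) ord0 i))%:E)%E.

Let mgi g : measurable_fun setT g -> measurable_fun [set: @bV R n.+1] (fun x : @bV R n.+1 => (g ((x : 'rV[R]_n.+1) ord0 i))%:E).
Proof. by move=> mg; apply/measurable_EFinP; apply: (measurableT_comp mg); exact: measurable_coord. Qed.

Lemma pint_ge0 m g D : (forall t, 0 <= g t) -> (0 <= pint m g D)%E.
Proof. by move=> g0; apply: integral_ge0 => x _; rewrite lee_fin. Qed.

Lemma pint_le m g D M : measurable D -> measurable_fun setT g -> (forall t, 0 <= g t) ->
  (forall t, g t <= M) -> (pint m g D <= M%:E * m D)%E.
Proof.
move=> mD mg g0 gM; rewrite /pint -integral_cst//; apply: ge0_le_integral => //.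
- by move=> x _; rewrite lee_fin.
- exact: measurable_funS (mgi mg).
- by move=> x _; rewrite lee_fin.
Qed.

Lemma pint_ge m g D : measurable D -> measurable_fun setT g -> (forall t, 1 <= g t) -> (m D <= pint m g D)%E.
Proof.
move=> mD mg g1; rewrite -[leLHS]mul1e -integral_cst//; apply: ge0_le_integral => //.
- exact: measurable_funS (mgi mg).
- by move=> x _; rewrite lee_fin.
Qed.

Lemma pint_diff m g h D : measurable D -> measurable_fun setT g -> measurable_fun setT h ->
  (forall t, 0 <= g t) -> (forall t, 0 <= h t) ->
  (pint m g D <= pint m h D + pint m (fun t => `|g t - h t|)%R D)%E.
Proof.
move=> mD mg mh g0 h0.
have mgh : measurable_fun setT (fun t => `|g t - h t|) by apply: measurableT_comp => //; exact: measurable_funB.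
rewrite /pint -ge0_integralD//; last 3 first.
- by move=> x _; rewrite lee_fin.
- exact: measurable_funS (mgi mh).
- exact: measurable_funS (mgi mgh).
apply: ge0_le_integral => //.
- by move=> x _; rewrite lee_fin.
- exact: measurable_funS (mgi mg).
- by apply: emeasurable_funD; [exact: measurable_funS (mgi mh)|exact: measurable_funS (mgi mgh)].
- by move=> x _; rewrite -EFinD lee_fin -lerBlDl ler_norm.
Qed.

Lemma pint_sub m g A B M : measurable A -> measurable B -> measurable_fun setT g ->
  (forall t, 0 <= g t) -> (forall t, g t <= M) -> (pint m g A <= pint m g B + M%:E * m (A `\` B))%E.
Proof.
move=> mA mB mg g0 gM; rewrite /pint -[in leLHS](setUIDK A B) ge0_integral_setU//; last 5 first.
- exact: measurableI.
- exact: measurableD.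
- by apply: measurable_funS (mgi mg).
- by move=> x _; rewrite lee_fin.
- by apply/disj_setPS => x [[_ ?] []].
apply: leeD; last by apply: pint_le => //; exact: measurableD.
apply: ge0_subset_integral => //; [exact: measurableI|exact: measurable_funS (mgi mg)|].
by move=> x _; rewrite lee_fin.
Qed.

Let mcoord : measurable_fun [set: @bV R n.+1]
  (fun x : @bV R n.+1 => ((x : 'rV[R]_n.+1) ord0 i : measurableTypeR R)).
Proof. exact: measurable_coord. Qed.

(** Distribution of the height under [m] restricted to [D]: integrals of a profile become integrals
    on the line. *)
Definition coord_measure m D (mD : measurable D) : {measure set (measurableTypeR R) -> \bar R} :=
  @measure_function_pushforward__canonical__measure_function_Measure _ _ _ _ _
    (mrestr m mD) _ mcoord.

Lemma coord_measureT m D (mD : measurable D) : coord_measure m mD setT = m D.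
Proof. by rewrite /= /pushforward /mrestr preimage_setT setTI. Qed.

Lemma mrestr_integral d (T : measurableType d) (m : {measure set T -> \bar R}) (D : set T) (mD : measurable D)
  (f : T -> \bar R) : measurable_fun setT f -> (forall x, 0 <= f x)%E ->
  (\int[mrestr m mD]_x f x = \int[m]_(x in D) f x)%E.
Proof.
move=> mf f0; have mDC : measurable (~` D) by exact: measurableC.
rewrite (@ge0_negligible_integral _ _ _ (mrestr m mD) setT (~` D))//; last first.
  by rewrite /= /mrestr setICl measure0.
by rewrite setTD setCK; apply: eq_measure_integral => A mA AD; change (m (A `&` D) = m A); rewrite setIidl.
Qed.

Lemma coord_integral m D (mD : measurable D) g : measurable_fun setT g -> (forall t, 0 <= g t) ->
  (\int[coord_measure m mD]_t (g t)%:E = pint m g D)%E.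
Proof.
move=> mg g0; rewrite ge0_integral_pushforward//=; last 2 first.
- by apply/measurable_EFinP.
- by move=> x _; rewrite lee_fin.
by rewrite preimage_setT mrestr_integral//; [exact: mgi|move=> x; rewrite lee_fin].
Qed.

(** One Lipschitz profile must be close to [g] for the area, for the volume and for the heights in
    [[-T, T]] at once; density in L^1 of the sum of the three finite measures provides it. *)
Lemma profile_approx (m1 m2 : {measure set (@bV R n.+1) -> \bar R}) A B g M T d : measurable A -> measurable B ->
  (m1 A < +oo)%E -> (m2 B < +oo)%E -> measurable_fun setT g -> (forall t, 1 <= g t) ->
  (forall t, g t <= M) -> 0 < d -> exists h l, [/\
    [/\ measurable_fun setT h, forall t, 1 <= h t, forall t, h t <= M & forall x y, `|h x - h y| <= l * `|x - y|],
    (pint m1 (fun t => `|h t - g t|)%R A <= d%:E)%E, (pint m2 (fun t => `|h t - g t|)%R B <= d%:E)%E &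
    (\int[lebesgue_measure]_(t in `[(- T)%R, T]%classic) (`|h t - g t|)%:E <= d%:E)%E].
Proof.
move=> mA mB Af Bf mg g1 gM d0.
have mI : @measurable _ (measurableTypeR R) `[- T, T]%classic by exact: measurable_itv.
pose m3 : {measure set (measurableTypeR R) -> \bar R} := mrestr (@lebesgue_measure R) mI.
pose m23 : {measure set (measurableTypeR R) -> \bar R} := measure_add (coord_measure m2 mB) m3.
pose m : {measure set (measurableTypeR R) -> \bar R} := measure_add (coord_measure m1 mA) m23.
have mE X : m X = (coord_measure m1 mA X + m23 X)%E by exact: measure_addE.
have mE' X : m23 X = (coord_measure m2 mB X + m3 X)%E by exact: measure_addE.
have mT : (m setT < +oo)%E.
  have cA : (coord_measure m1 mA setT < +oo)%E by rewrite coord_measureT.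
  have cB : (coord_measure m2 mB setT < +oo)%E by rewrite coord_measureT.
  have c3 : (m3 setT < +oo)%E.
    change (lebesgue_measure ([set: measurableTypeR R] `&` `[(- T)%R, T]%classic) < +oo)%E.
    by rewrite setTI lebesgue_measure_itv /=; case: ifP => _; rewrite -?EFinD ltry.
  by rewrite mE lte_add_pinfty// mE' lte_add_pinfty.
have [h [l [h1 hM hl mh hd]]] := lip_dense mT mg g1 gM d0.
have mgh : measurable_fun [set: measurableTypeR R] (fun t => `|h t - g t|).
  by apply: measurableT_comp => //; exact: measurable_funB.
have mghE : measurable_fun [set: measurableTypeR R] (fun t => (`|h t - g t|)%:E) by exact/measurable_EFinP.
rewrite ge0_integral_measure_add// ge0_integral_measure_add// !coord_integral// mrestr_integral// in hd.
set a := pint m1 _ _ in hd; set b := pint m2 _ _ in hd; set c := (\int[_]_(_ in _) _)%E in hd.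
have a0 : (0 <= a)%E by exact: pint_ge0.
have b0 : (0 <= b)%E by exact: pint_ge0.
have c0 : (0 <= c)%E by apply: integral_ge0.
exists h, l; split => //; apply: le_trans hd.
- by rewrite leeDl// adde_ge0.
- by apply: (@le_trans _ _ (b + c)%E); rewrite ?leeDl// leeDr.
- by apply: (@le_trans _ _ (b + c)%E); rewrite ?leeDr.
Qed.

(** The difference of the two primitives is an integral over an interval between 0 and [s], so L^1
    closeness of the profiles makes the stretchings uniformly close on [[-T, T]]. *)
Lemma Lam_diff g h M M' T d s : measurable_fun setT g -> (forall t, 1 <= g t) -> (forall t, g t <= M) ->
  measurable_fun setT h -> (forall t, 1 <= h t) -> (forall t, h t <= M') -> `|s| <= T ->
  (\int[lebesgue_measure]_(t in `[(- T)%R, T]%classic) (`|h t - g t|)%:E <= d%:E)%E ->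
  `|Lam h s - Lam g s| <= d.
Proof.
move=> mg g1 gM mh h1 hM; rewrite ler_norml => /andP[s1 s2] hd.
have mgh : measurable_fun [set: R] (fun t => `|h t - g t|) by apply: measurableT_comp => //; exact: measurable_funB.
have key a b : a <= b -> `]a, b] `<=` `[- T, T]%classic -> `|Ig h a b - Ig g a b| <= d.
  move=> ab abT; have ih := Ig_integrable mh h1 hM a b; have ig := Ig_integrable mg g1 gM a b.
  rewrite /Ig -RintegralB//; apply: (le_trans (le_normr_Rintegral _ _)) => //.
    rewrite (_ : _ \o _ = ((EFin \o h) \- (EFin \o g))%E); first exact: integrableB.
    by apply/funext => x /=; rewrite EFinB.
  have f0 : (0 <= \int[lebesgue_measure]_(t in `]a, b]) (`|h t - g t|)%:E)%E by apply: integral_ge0.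
  have fd : (\int[lebesgue_measure]_(t in `]a, b]) (`|h t - g t|)%:E <= d%:E)%E.
    apply: le_trans hd; apply: ge0_subset_integral => //.
    by apply/measurable_EFinP; exact: measurable_funS mgh.
  by rewrite /Rintegral -lee_fin fineK// ge0_fin_numE// (le_lt_trans fd)// ltry.
rewrite /Lam; have [s0|/ltW s0] := leP 0 s.
  rewrite [Ig h s 0]Ig_out// [Ig g s 0]Ig_out// !subr0; apply: key => // t; rewrite /= !in_itv/= => /andP[a b].
  by apply/andP; split; lra.
rewrite [Ig h 0 s]Ig_out// [Ig g 0 s]Ig_out// !sub0r -opprD normrN; apply: key => // t; rewrite /= !in_itv/= => /andP[a b].
by apply/andP; split; lra.
Qed.

End profile_integrals.

Lemma ge0_fin_real {R : realType} (x : \bar R) (c : R) : (0 <= x)%E -> (x <= c%:E)%E -> exists y, x = y%:E.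
Proof. by case: x => [y _ _|_|//]; [exists y|rewrite leye_eq]. Qed.

Lemma powD_ge {R : realDomainType} (r t : R) m : 0 <= r -> 0 <= t -> r ^+ m.+1 + t ^+ m.+1 <= (r + t) ^+ m.+1.
Proof.
move=> r0 t0; elim: m => [|m IH]; first by rewrite !expr1.
rewrite [leRHS]exprS; apply: le_trans (ler_wpM2l (addr_ge0 r0 t0) IH).
rewrite mulrDl !mulrDr -!exprS; have : 0 <= r * t ^+ m.+1 by rewrite mulr_ge0// exprn_ge0.
have : 0 <= t * r ^+ m.+1 by rewrite mulr_ge0// exprn_ge0.
set a := r * t ^+ _; set b := t * r ^+ _; set c := r ^+ _; set d := t ^+ _ => ? ?; lra.
Qed.

Lemma le_perturb {R : realFieldType} (a b C : R) : 0 < C ->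
  (forall t, 0 < t -> t <= 1 -> a <= b + t * C) -> a <= b.
Proof.
move=> C0 key; rewrite leNgt; apply/negP => lt.
have ab : 0 < a - b by rewrite subr_gt0.
pose t := Num.min 1 ((a - b) / (2 * C)).
have t0 : 0 < t by rewrite lt_min ltr01 divr_gt0// mulr_gt0.
have := key t t0; rewrite ge_min lexx => /(_ isT).
have : t * (2 * C) <= a - b by rewrite -ler_pdivlMr ?mulr_gt0// ge_min lexx orbT.
by move=> h1 h2; lra.
Qed.

Lemma distr_le_add {R : realDomainType} (a b c e : R) : a <= b + c -> b <= a + c -> c <= e -> `|a - b| <= e.
Proof.
by move=> ? ? ?; rewrite ler_norml; apply/andP; split; lra.
Qed.

Section weighted_isoperimetric_inequality.
Context {R : realType} (n : nat) (i : 'I_n.+2).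
Local Notation bV' := (@bV R n.+2).
Local Notation leb' := (@lebB R n.+2).
Local Notation haus' := (@hausB R n.+2 n.+1).

Lemma stretched_pint (g : R -> R) M (X : set bV') : measurable_fun setT g -> (forall t, 1 <= g t) ->
  (forall t, g t <= M) -> measurable X -> lebB (stretchV g i @^-1` X : set bV') = pint i leb' g X.
Proof. by move=> mg g1 gM mX; exact: (@stretchedE R g M mg g1 gM n.+1 i X mX). Qed.

(** The profile is replaced by a Lipschitz one, the set is stretched by it, and [bvper_iso] applies.
    The radius [r + t] makes room for the error in the volume, and then [t] tends to 0. *)
Lemma weighted_iso (S : set bV') s P (g : R -> R) M w W r :
  measurable S -> lebB S = s%:E -> hausB n.+1 (boundary S : set bV') = P%:E ->
  measurable_fun setT g -> (forall t, 1 <= g t) -> (forall t, g t <= M) ->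
  pint i leb' g S = w%:E -> pint i haus' g (boundary S) = W%:E ->
  0 <= r -> w <= omega n.+2 * r ^+ n.+2 -> n.+2%:R * (kap n.+1 * w) <= r * W.
Proof.
move=> mS Ss SP mg g1 gM wE WE r0 wr; have k0 := @kap_gt0 R n.
have g0 t : 0 <= g t := le_trans ler01 (g1 t).
have mB := @measurable_boundary R n.+2 S.
have w0 : 0 <= w by rewrite -lee_fin -wE; exact: pint_ge0.
have W0 : 0 <= W by rewrite -lee_fin -WE; exact: pint_ge0.
have [C CE] : exists C, C = n.+2%:R * kap n.+1 + r + W + 1 by eexists.
have Nk : 0 <= n.+2%:R * kap n.+1 :> R by rewrite mulr_ge0// ltW.
have key t : 0 < t -> t <= 1 -> n.+2%:R * (kap n.+1 * w) <= r * W + t * C.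
  (* By [powD_ge] the ball of radius [r + t] exceeds that of radius [r] by at least [omega t^N],
     which absorbs the volume error [d]. *)
  move=> t0 t1; have [d dE] : exists d, d = Num.min t (omega n.+2 * t ^+ n.+2) by eexists.
  have d0 : 0 < d by rewrite dE lt_min t0 mulr_gt0 ?omega_pos// exprn_gt0.
  have dt : d <= t by rewrite dE ge_min lexx.
  have dom : d <= omega n.+2 * t ^+ n.+2 by rewrite dE ge_min lexx orbT.
  have SPf : (haus' (boundary S) < +oo)%E by rewrite [haus' _]SP ltry.
  have Sf : (leb' S < +oo)%E by rewrite [leb' _]Ss ltry.
  have [h [l [[mh h1 hM hl] hB hS _]]] := profile_approx i 0 mB mS SPf Sf mg g1 gM d0.
  have h0 u : 0 <= h u := le_trans ler01 (h1 u).
  have hS' : (pint i leb' (fun t => `|g t - h t|)%R S <= d%:E)%E.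
    by apply: le_trans hS; rewrite /pint; under eq_integral do rewrite distrC.
  have hW : (pint i haus' h (boundary S) <= (W + d)%:E)%E.
    by apply: (le_trans (pint_diff i haus' mB mh mg h0 g0)); rewrite EFinD -WE leeD2l.
  have hw : (pint i leb' h S <= (w + d)%:E)%E.
    by apply: (le_trans (pint_diff i leb' mS mh mg h0 g0)); rewrite EFinD -wE leeD2l.
  have hw' : (w%:E <= pint i leb' h S + d%:E)%E.
    by rewrite -wE; apply: (le_trans (pint_diff i leb' mS mg mh g0 h0)); rewrite leeD2l.
  have [W' W'E] := ge0_fin_real (pint_ge0 i haus' (boundary S) h0) hW.
  have [w' w'E] := ge0_fin_real (pint_ge0 i leb' S h0) hw.
  rewrite W'E lee_fin in hW; rewrite w'E lee_fin in hw; rewrite w'E -EFinD lee_fin in hw'.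
  have bv := bvper_smooth mS Ss SP mh h1 hM hl W'E.
  have mA : measurable (stretchV h i @^-1` S : set bV').
    by rewrite -[X in measurable X]setTI; apply: (measurable_stretchV mh h1 hM).
  have rt0 : 0 <= r + t by rewrite addr_ge0// ltW.
  have w'r : w' <= omega n.+2 * (r + t) ^+ n.+2.
    apply: (le_trans hw); apply: (le_trans (lerD wr dom)); rewrite -mulrDr.
    by apply: ler_wpM2l; [exact/ltW/omega_pos|exact: powD_ge r0 (ltW t0)].
  have := bvper_iso mA (etrans (stretched_pint mh h1 hM mS) w'E) bv rt0 w'r.
  move=> h2; have {}h2 : n.+2%:R * w' * kap n.+1 <= (r + t) * W' by rewrite -ler_pdivlMr// -mulrA.
  have h3 : (r + t) * W' <= (r + t) * (W + t) by apply: ler_wpM2l => //; lra.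
  have h4 : n.+2%:R * kap n.+1 * w <= n.+2%:R * kap n.+1 * (w' + t) by apply: ler_wpM2l => //; lra.
  have tt : t * t <= t by rewrite ler_piMl// ltW.
  rewrite CE mulrA; apply: (le_trans h4).
  rewrite mulrDr; move: h2; rewrite -mulrA (mulrC w') mulrA => h2.
  set a := n.+2%:R * kap n.+1 in h2 h4 Nk *; set b := a * w' in h2 *; clearbody b.
  move: h3; rewrite mulrDl mulrDl !mulrDr; set x := r * W'; set y := t * W' => h3.
  move: h2; rewrite mulrDl -/x -/y => h2.
  by rewrite (mulrC a t) (mulrC t r) in h3 *; lra.
by apply: (@le_perturb _ _ _ C) => //; rewrite CE ltr_wpDl// !addr_ge0.
Qed.

(** The two primitives have slope at least 1, so a height that they place on different sides of [t]
    is within [d] of the level that [g] sends to [t]. *)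
Lemma stretch_strip (g h : R -> R) M d (j : 'I_n.+2) t :
  measurable_fun setT g -> (forall t, 1 <= g t) -> (forall t, g t <= M) ->
  measurable_fun setT h -> (forall t, 1 <= h t) -> (forall t, h t <= M) ->
  `|Lam h (LamV g t) - Lam g (LamV g t)| <= d ->
  stretch h i @^-1` hsp j t `+` stretch g i @^-1` hsp j t `<=` strip i (LamV g t) d.
Proof.
move=> mg g1 gM mh h1 hM; set s := LamV g t; rewrite ler_norml => /andP[d1 d2].
have ts : Lam g s = t := LamVK mg g1 gM t.
move=> x; rewrite /hsp /strip /= !updE; case: eqP => [_|_]; last by move=> -[[]|[]].
rewrite -ts (Lam_le mg g1 gM) => -[[hx gx]|[gx hx]].
  move/negP: gx; rewrite -ltNge => sx; have /andP[h2 _] := Lam_lip mh h1 hM (ltW sx).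
  by rewrite ger0_norm ?subr_ge0 ?(ltW sx)//; lra.
move/negP: hx; rewrite -ltNge => hx; have /andP[h2 _] := Lam_lip mh h1 hM gx.
by rewrite ler0_norm ?subr_le0//; lra.
Qed.

(** Optimality is recorded through sets of finite boundary area that approach [E] in volume; the
    bound is the perimeter of a ball of radius [r] on which the density is 1. *)
Definition near_optimal (F : R -> R) (r : R) (E : set bV') := forall d, 0 < d -> exists S s P,
  [/\ measurable (S : set bV'), lebB S = s%:E,
  hausB n.+1 (boundary S : set bV') = P%:E, (lebB (S `+` E) <= d%:E)%E &
  (pint i haus' F (boundary S) <= (kap n.+1 * (n.+2%:R * (omega n.+2 * r ^+ n.+2 / r)) + d)%:E)%E].

Section near_optimal_marginals.
Variables (F : R -> R) (M : R) (E : set bV') (r : R).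
Hypothesis mF : measurable_fun setT F.
Hypothesis F1 : forall t, 1 <= F t.
Hypothesis FM : forall t, F t <= M.
Hypothesis mE : measurable E.
Hypothesis Ef : (lebB E < +oo)%E.
Hypothesis r0 : 0 < r.
Hypothesis Ev : pint i leb' F E = (omega n.+2 * r ^+ n.+2)%:E.
Let v := omega n.+2 * r ^+ n.+2.
Hypothesis nearE : near_optimal F r E.

Definition marginal (j : 'I_n.+2) (t : R) : R := fine (lebB (stretchV F i @^-1` E `&` hsp j t)).

Let F0 t : 0 <= F t. Proof. exact: le_trans ler01 (F1 t). Qed.
Let mE' : measurable (stretchV F i @^-1` E : set bV').
Proof. by rewrite -[X in measurable X]setTI; apply: (measurable_stretchV mF F1 FM). Qed.

Lemma marginalE j t : lebB (stretchV F i @^-1` E `&` hsp j t) = (marginal j t)%:E.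
Proof.
rewrite /marginal fineK// ge0_fin_numE//; apply: (@le_lt_trans _ _ (lebB (stretchV F i @^-1` E))).
  by apply: le_outer_measure => x [].
by rewrite (stretched_pint mF F1 FM mE) Ev ltry.
Qed.

(** Two replacements are made together, [E] by an approximant [S] and [F] by a Lipschitz profile
    [h]. Stretching [S] by [h] then has nearly the volume and marginals of [E] stretched by [F]; for
    the marginal along the stretched axis the discrepancy sits in a thin strip. *)
Lemma near_optimal_sets j t1 t2 e : 0 < e -> exists A P a1 a2 w,
  [/\ [/\ measurable A, @bvper R n.+2 A P, lebB A = w%:E,
        lebB (A `&` hsp j t1) = a1%:E & lebB (A `&` hsp j t2) = a2%:E],
      `|w - v| <= e, `|a1 - marginal j t1| <= e, `|a2 - marginal j t2| <= e & r * P <= n.+2%:R * v + e].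
Proof.
move=> e0; have k0 := @kap_gt0 R n.
have e34 : 3 / 4 * e <= e by lra.
have M1 : 1 <= M := le_trans (F1 0) (FM 0).
have M0 : 0 < M by apply: lt_le_trans M1.
(* Exchanging the sets costs [M (d + ep) <= e / 2] of weighted volume and exchanging the profiles
   [d <= e / 4], which makes [3/4 e] in all. *)
have [ep epE] : exists ep, ep = e / (4 * M) by eexists.
have ep0 : 0 < ep by rewrite epE divr_gt0// mulr_gt0.
have Mep : M * ep = e / 4 by rewrite epE; field; rewrite gt_eqF.
have [d1 d10 Hd1] := strip_small i (LamV F t1) mE Ef ep0.
have [d2 d20 Hd2] := strip_small i (LamV F t2) mE Ef ep0.
(* The last bound serves the perimeter: the excess [2 d] of area becomes at most [e] after
   multiplication by [r / kap]. *)
have [d dE] : exists d, d = Num.min (Num.min d1 d2) (Num.min ep (e * kap n.+1 / (2 * r))) by eexists.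
have d0 : 0 < d by rewrite dE !lt_min d10 d20 ep0 divr_gt0 ?mulr_gt0.
have dd1 : d <= d1 by rewrite dE !ge_min lexx.
have dd2 : d <= d2 by rewrite dE !ge_min lexx !orbT.
have dep : d <= ep by rewrite dE !ge_min lexx !orbT.
have dr : d <= e * kap n.+1 / (2 * r) by rewrite dE !ge_min lexx !orbT.
have [S [s [P [mS Ss SP SE SW]]]] := nearE d0.
have mB := @measurable_boundary R n.+2 S.
have SPf : (haus' (boundary S) < +oo)%E by rewrite [haus' _]SP ltry.
have Sf : (leb' S < +oo)%E by rewrite [leb' _]Ss ltry.
have [h [l [[mh h1 hM hl] hB hS hT]]] :=
  profile_approx i (`|LamV F t1| + `|LamV F t2|) mB mS SPf Sf mF F1 FM d0.
have h0 u : 0 <= h u := le_trans ler01 (h1 u).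
have mFh : measurable_fun setT (fun t => `|F t - h t|) by apply: measurableT_comp => //; exact: measurable_funB.
have mhF : measurable_fun setT (fun t => `|h t - F t|) by apply: measurableT_comp => //; exact: measurable_funB.
have hW : (pint i haus' h (boundary S) <= (kap n.+1 * (n.+2%:R * (v / r)) + d + d)%:E)%E.
  by apply: (le_trans (pint_diff i haus' mB mh mF h0 F0)); rewrite EFinD leeD.
have [W WE] := ge0_fin_real (pint_ge0 i haus' (boundary S) h0) hW.
rewrite WE lee_fin in hW.
have cmp (X X' : set bV') : measurable X -> measurable X' -> (lebB (E `&` (X `+` X')) <= ep%:E)%E ->
    (pint i leb' h (S `&` X) <= pint i leb' F (E `&` X') + (3 / 4 * e)%:E)%E /\
    (pint i leb' F (E `&` X') <= pint i leb' h (S `&` X) + (3 / 4 * e)%:E)%E.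
  move=> mX mX' XX.
  have mSX : measurable (S `&` X) by exact: measurableI.
  have mEX : measurable (E `&` X') by exact: measurableI.
  have D (A B : set bV') : A `<=` (S `+` E) `|` E `&` (X `+` X') -> (M%:E * lebB A <= (e / 2)%:E)%E.
    move=> AS; apply: (@le_trans _ _ (M%:E * (d%:E + ep%:E))%E).
      apply: lee_wpmul2l; first by rewrite lee_fin ltW.
      apply: (@le_trans _ _ (lebB ((S `+` E) `|` E `&` (X `+` X')))); first exact: le_outer_measure.
      apply: (le_trans (outer_measureU2 _ _ _)).
      exact: leeD.
    rewrite -EFinD -EFinM lee_fin; apply: (@le_trans _ _ (M * (ep + ep))).
      by rewrite ler_pM2l// lerD2r.
    by rewrite mulrDr Mep (_ : e / 4 + e / 4 = e / 2)//; field.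
  have ed : d <= e / 4 by apply: (le_trans dep); rewrite -Mep ler_peMl// ltW.
  have sub1 (f : R -> R) : measurable_fun setT f -> (forall t, 0 <= f t) ->
      (pint i leb' f S <= d%:E)%E -> (pint i leb' f (S `&` X) <= d%:E)%E.
    move=> mf f0; apply: le_trans; apply: ge0_subset_integral => //; last first.
      by move=> x _; rewrite lee_fin.
    by apply/measurable_EFinP; apply: (measurableT_comp mf); exact: measurable_funS (measurable_coord i).
  split.
    apply: (le_trans (pint_diff i leb' mSX mh mF h0 F0)).
    rewrite (_ : 3 / 4 * e = e / 2 + e / 4); last by field.
    rewrite EFinD [leRHS]addeA; apply: leeD; last first.
      by apply: (@le_trans _ _ d%:E); [exact: sub1|rewrite lee_fin].
    apply: (le_trans (pint_sub i leb' mSX mEX mF F0 FM)); rewrite leeD2l//.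
    apply: (D _ setT) => x [[Sx Xx] nEX]; have [Ex|nE] := pselect (E x); last by left; left.
    by right; split => //; left; split => // X'x; apply: nEX.
  rewrite (_ : 3 / 4 * e = e / 4 + e / 2); last by field.
  rewrite EFinD [leRHS]addeA; apply: (le_trans (pint_sub i leb' mEX mSX mF F0 FM)); apply: leeD.
    apply: (le_trans (pint_diff i leb' mSX mF mh F0 h0)); rewrite leeD2l//.
    apply: (@le_trans _ _ d%:E); last by rewrite lee_fin.
    by apply: sub1 => //; apply: le_trans hS; rewrite /pint; under eq_integral do rewrite distrC.
  apply: (D _ setT) => x [[Ex X'x] nSX]; have [Sx|nS] := pselect (S x); last by left; right.
  by right; split => //; right; split => // Xx; apply: nSX.
have mH t : measurable (stretch h i @^-1` hsp j t : set bV').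
  by rewrite -[X in measurable X]setTI; apply: (measurable_stretch mh h1 hM) => //; exact: measurable_halfspace.
have mHF t : measurable (stretch F i @^-1` hsp j t : set bV').
  by rewrite -[X in measurable X]setTI; apply: (measurable_stretch mF F1 FM) => //; exact: measurable_halfspace.
have EA t : stretchV h i @^-1` (S `&` stretch h i @^-1` hsp j t) = stretchV h i @^-1` S `&` hsp j t.
  by apply/seteqP; split => y /=; rewrite (stretchVK mh h1 hM).
have EF t : stretchV F i @^-1` (E `&` stretch F i @^-1` hsp j t) = stretchV F i @^-1` E `&` hsp j t.
  by apply/seteqP; split => y /=; rewrite (stretchVK mF F1 FM).
have half t : `|LamV F t| <= `|LamV F t1| + `|LamV F t2| -> (exists2 d', d <= d' & (lebB (E `&` strip i (LamV F t) d') <= ep%:E)%E) ->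
    exists a, lebB (stretchV h i @^-1` S `&` hsp j t) = a%:E /\ `|a - marginal j t| <= e.
  move=> tT [d' dd' Hd']; rewrite -EA (stretched_pint mh h1 hM (measurableI _ _ mS (mH t))).
  have [|c1 c2] := cmp _ _ (mH t) (mHF t).
    apply: le_trans Hd'; apply: le_outer_measure => x [Ex xx]; split => //.
    have := stretch_strip mF F1 FM mh h1 hM (le_trans (Lam_diff mF F1 FM mh h1 hM tT hT) dd').
    by apply; exact: xx.
  have mgE := marginalE j t; rewrite -EF (stretched_pint mF F1 FM (measurableI _ _ mE (mHF t))) in mgE.
  rewrite mgE -EFinD in c1; have [a aE] := ge0_fin_real (pint_ge0 i leb' _ h0) c1.
  exists a; split => //; move: c1 c2; rewrite mgE aE -EFinD !lee_fin => c1 c2.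
  exact: distr_le_add c1 c2 e34.
have [a1 [a1E a1e]] : exists a, lebB (stretchV h i @^-1` S `&` hsp j t1) = a%:E /\ `|a - marginal j t1| <= e.
  by apply: half; [rewrite lerDl|exists d1].
have [a2 [a2E a2e]] : exists a, lebB (stretchV h i @^-1` S `&` hsp j t2) = a%:E /\ `|a - marginal j t2| <= e.
  by apply: half; [rewrite lerDr|exists d2].
have [|c1 c2] := cmp _ _ measurableT measurableT.
  by rewrite (_ : _ `&` _ = set0) ?measure0 ?lee_fin ?ltW// /setY setDv setU0 setI0.
rewrite !setIT Ev -EFinD in c1 c2; have [w wE] := ge0_fin_real (pint_ge0 i leb' _ h0) c1.
have bv := bvper_smooth mS Ss SP mh h1 hM hl WE.
exists (stretchV h i @^-1` S), (W / kap n.+1), a1, a2, w; split => //.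
- split => //; first by rewrite -[X in measurable X]setTI; apply: (measurable_stretchV mh h1 hM).
  by rewrite (stretched_pint mh h1 hM mS).
- by move: c1 c2; rewrite wE -EFinD !lee_fin => c1 c2; exact: distr_le_add c1 c2 e34.
- rewrite mulrA ler_pdivrMr//.
  apply: (@le_trans _ _ (r * (kap n.+1 * (n.+2%:R * (v / r)) + d + d))); first by apply: ler_wpM2l => //; exact: ltW.
  rewrite -addrA mulrDr (_ : r * (kap n.+1 * _) = n.+2%:R * v * kap n.+1); last by field; rewrite gt_eqF.
  rewrite [leRHS]mulrDl lerD2l; move: dr; rewrite ler_pdivlMr ?mulr_gt0// => dr.
  by rewrite (_ : r * (d + d) = d * (2 * r))//; ring.
Qed.

(** [bvper_rigid] concerns the first axis; exchanging it with axis [j] keeps volume and perimeter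
    and carries one marginal to the other. *)
Lemma marginal_rigid j t1 t2 : 0 < marginal j t1 -> marginal j t1 <= marginal j t2 -> marginal j t2 < v -> t1 <= t2 ->
  r * beta n (marginal j t2 / r ^+ n.+2) - r * beta n (marginal j t1 / r ^+ n.+2) = t2 - t1.
Proof.
move=> m1 m12 m2 t12; apply: bvper_rigid => // e e0.
have [A [P [a1 [a2 [w [[mA bA Aw A1 A2] h1 h2 h3 h4]]]]]] := near_optimal_sets j t1 t2 e0.
have S t : sw j @^-1` A `&` hsp ord0 t = sw j @^-1` (A `&` hsp j t).
  by apply/seteqP; split => x; rewrite /hsp /= swEi.
exists (sw j @^-1` A), P, a1, a2, w; split => //; split.
- exact: measurable_preimage_sw.
- exact: bvper_sw.
- by rewrite lebB_sw.
- by rewrite S lebB_sw.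
- by rewrite S lebB_sw.
Qed.

End near_optimal_marginals.

End weighted_isoperimetric_inequality.

(** * Rigidity *)

Section ball_marginals.
Context {R : realType} (n : nat).
Local Notation bV' := (@bV R n.+2).
Local Notation leb' := (@lebB R n.+2).
Implicit Types (r t : R) (p : 'rV[R]_n.+2).

Lemma ball_halfspace0 p r t : 0 < r ->
  lebB (eball p r `&` hsp ord0 t : set bV') = (r ^+ n.+2 * Bf n ((t - p 0 ord0) / r))%:E.
Proof.
move=> r0; pose X : set 'rV[R]_n.+2 := [set x | eball 0 1 x /\ x 0 ord0 <= (t - p 0 ord0) / r].
pose f (x : 'rV[R]_n.+2) := r *: x + p; pose g (y : 'rV[R]_n.+2) := r^-1 *: (y - p).
have rV : 0 < r^-1 by rewrite invr_gt0.
have gf x : g (f x) = x by rewrite /g /f addrK scalerA mulVf ?gt_eqF// scale1r.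
have fg y : f (g y) = y by rewrite /g /f scalerA divff ?gt_eqF// scale1r subrK.
have fX : f @` X = eball p r `&` hsp ord0 t.
  apply/seteqP; split => [_ [x [xb xt] <-]|y [yb yt]].
    split; rewrite /eball /hsp /f /=.
      by rewrite addrK enormZ gtr0_norm// -[ltRHS]mulr1 ltr_pM2l//; rewrite /eball /= subr0 in xb.
    by rewrite !mxE; move: xt; rewrite ler_pdivlMr//; lra.
  exists (g y); rewrite ?fg//; split; rewrite /eball /hsp /g /=.
    by rewrite subr0 enormZ gtr0_norm// ltr_pdivrMl// mulr1.
  by rewrite !mxE ler_pdivlMr// mulrC mulrA divff ?gt_eqF// mul1r lerD2r.
have Xb : (lebesgue_outer X <= (omega n.+2)%:E)%E.
  by apply: (@le_trans _ _ (lebesgue_outer (@eball R n.+2 0 1))); [apply: le_outer_measure => x []|rewrite lebesgue_eball// expr1n mulr1].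
have BE : lebesgue_outer X = (Bf n ((t - p 0 ord0) / r))%:E.
  by rewrite /Bf fineK// ge0_fin_numE ?outer_measure_ge0// (le_lt_trans Xb)// ltry.
have rN : 0 < r ^+ n.+2 by rewrite exprn_gt0.
rewrite /lebB -fX EFinM -BE; apply/eqP; rewrite eq_le; apply/andP; split.
  by apply: lebesgue_lip => // x y _ _; rewrite /f opprD addrACA subrr addr0 -scalerBr enormZ gtr0_norm.
have := @lebesgue_lip R _ g (f @` X) r^-1 rV.
have -> : g @` (f @` X) = X by rewrite image_comp (_ : g \o f = id) ?image_id//; apply/funext.
move=> H; have {H} := H (fun x y _ _ => _); rewrite exprVn => H.
have H' : (lebesgue_outer X <= (r ^+ n.+2)^-1%:E * lebesgue_outer (f @` X))%E.
  by apply: H => x y; rewrite /g -scalerBr enormZ gtr0_norm// opprB addrA subrK.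
apply: (@le_trans _ _ ((r ^+ n.+2)%:E * ((r ^+ n.+2)^-1%:E * lebesgue_outer (f @` X)))%E).
  by apply: lee_wpmul2l => //; rewrite lee_fin ltW.
by rewrite muleA -EFinM divff ?gt_eqF// mul1e.
Qed.

Lemma ball_halfspace j p r t : 0 < r ->
  lebB (eball p r `&` hsp j t : set bV') = (r ^+ n.+2 * Bf n ((t - p 0 j) / r))%:E.
Proof.
move=> r0; rewrite -(lebB_sw j) -[p 0 j]swE0 -ball_halfspace0//; congr lebB.
apply/seteqP; split => x; rewrite /eball /hsp /= swEi.
  by rewrite -(enorm_sw j (sw j x - p)) swB swK.
by rewrite -(enorm_sw j (x - sw j p)) swB swK.
Qed.

Lemma ray_measure_unique (m1 m2 : {measure set (measurableTypeR R) -> \bar R}) :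
  (m1 setT < +oo)%E -> m1 setT = m2 setT ->
  (forall t, m1 `]-oo, t]%classic = m2 `]-oo, t]%classic) ->
  forall A, measurable A -> m1 A = m2 A.
Proof.
move=> f1 mT mr.
have m2T : (m2 setT < +oo)%E by rewrite -mT.
move=> A mA; apply: (@measure_unique _ R (measurableTypeR R) (@RGenOInfty.G R) (fun k => `](- k%:R)%R, +oo[%classic) _ _ _ _ m1 m2) => //.
- exact: RGenOInfty.measurableE.
- by move=> _ _ [x ->] [y ->]; exists (Num.max x y); apply/seteqP; split => t /=; rewrite !in_itv/= !andbT gt_max;
   [move=> [-> ->]|move=> /andP[]].
- by move=> k; eexists.
- apply/seteqP; split => // t _; exists (Num.truncn (- t)).+1 => //=.
  by rewrite in_itv/= andbT ltrNl truncnS_gt// num_real.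
- move=> _ [x ->]; have mC : `]x, +oo[%classic = setT `\` `]-oo, x]%classic.
    by apply/seteqP; split => t /=; rewrite !in_itv/= andbT ltNge; [move=> /negP|move=> [_ /negP]].
  have mD (m : {measure set (measurableTypeR R) -> \bar R}) : (m setT < +oo)%E ->
      m `]x, +oo[%classic = (m setT - m `]-oo, x]%classic)%E.
    by move=> mf; rewrite mC measureD ?setTI//; exact: measurable_itv.
  by rewrite !mD// mr mT.
- by move=> k; apply: le_lt_trans f1; apply: le_measure; rewrite ?inE//; exact: measurable_itv.
Qed.

Section same_marginals.
Variables (E : set bV') (r : R).
Hypothesis mE : measurable E.
Hypothesis r0 : 0 < r.
Let v := omega n.+2 * r ^+ n.+2.
Hypothesis Ev : lebB E = v%:E.

Let sqdist p (x : bV') : R := dotv (x - p) (x - p).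

Let sqdist_ge0 p x : 0 <= sqdist p x. Proof. exact: dotv_ge0. Qed.

Lemma measurable_sqdist p : measurable_fun [set: bV'] (fun x : bV' => (sqdist p x)%:E).
Proof.
apply/measurable_EFinP; rewrite /sqdist; under eq_fun do rewrite -sqr_enorm.
apply: measurable_funX; exact: (measurableT_comp (@measurable_enorm R n.+2) (measurable_tr (- p))).
Qed.

(* The ball is the only set with its coordinate marginals: both sets have the same moment of inertia about [p]. *)
Lemma marginals_ball p : (forall j t, lebB (E `&` hsp j t) = lebB (eball p r `&` hsp j t)) ->
  lebB (E `+` eball p r) = 0%E.
Proof.
move=> marg; set B : set bV' := eball p r; have mB : measurable B by exact: measurable_eball.
have Bv : lebB B = v%:E by rewrite /lebB lebesgue_eball// ltW.
have v0 : 0 <= v by rewrite -lee_fin -Ev.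
have Ef : (lebB E < +oo)%E by rewrite Ev ltry.
have coordE j : (\int[leb']_(x in E) (((x : 'rV[R]_n.+2) ord0 j - p ord0 j) ^+ 2)%:E =
     \int[leb']_(x in B) (((x : 'rV[R]_n.+2) ord0 j - p ord0 j) ^+ 2)%:E)%E.
  have mq : measurable_fun [set: R] (fun s => (s - p ord0 j) ^+ 2).
    by apply: measurable_funX; exact: measurable_funB.
  have q0 s : 0 <= (s - p ord0 j) ^+ 2 by exact: sqr_ge0.
  have := coord_integral j leb' mE mq q0; rewrite /pint => <-.
  have := coord_integral j leb' mB mq q0; rewrite /pint => <-.
  apply: eq_measure_integral => A mA _; apply: ray_measure_unique => //.
  - by rewrite coord_measureT.
  - by rewrite !coord_measureT; change (lebB E = lebB B); rewrite Ev Bv.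
  - move=> t; have H (D : set bV') (mD : measurable D) :
        coord_measure j leb' mD `]-oo, t]%classic = lebB (D `&` hsp j t).
      by rewrite /= /pushforward /mrestr setIC; congr lebB; apply/seteqP; split => x [? h]; split; rewrite /hsp /= ?in_itv//= in h *.
    by rewrite !H; exact: marg.
(* The squared distance to [p] is a sum of functions of one coordinate each, so its integral depends
   only on the marginals. *)
have moment : (\int[leb']_(x in E) (sqdist p x)%:E = \int[leb']_(x in B) (sqdist p x)%:E)%E.
  have S (D : set bV') : measurable D -> (\int[leb']_(x in D) (sqdist p x)%:E =
      \sum_(j < n.+2) \int[leb']_(x in D) (((x : 'rV[R]_n.+2) ord0 j - p ord0 j) ^+ 2)%:E)%E.
    move=> mD; rewrite -ge0_integral_sum//.
    - by apply: eq_integral => x _; rewrite sumEFin /sqdist /dotv; congr EFin; apply: eq_bigr => j _; rewrite !mxE expr2.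
    - move=> j; apply/measurable_EFinP; apply: measurable_funX; apply: measurable_funB => //.
      exact: measurable_funS (measurable_coord j).
    - by move=> j x _; rewrite lee_fin sqr_ge0.
  by rewrite !S//; apply: eq_bigr => j _; exact: coordE.
pose D1 := E `\` B; pose D2 := B `\` E.
have mD1 : measurable D1 by exact: measurableD.
have mD2 : measurable D2 by exact: measurableD.
have mEB : measurable (E `&` B) by exact: measurableI.
have r2 : 0 <= r ^+ 2 by exact: sqr_ge0.
have BS (D : set bV') : measurable D -> D `<=` B -> exists y, [/\ 0 <= y,
    (\int[leb']_(x in D) (sqdist p x)%:E)%E = y%:E & (y%:E <= (r ^+ 2)%:E * lebB D)%E].
  move=> mD DB; have c1 : (\int[leb']_(x in D) (sqdist p x)%:E <= (r ^+ 2)%:E * lebB D)%E.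
    rewrite -[leRHS](integral_cst leb' mD); apply: ge0_le_integral => //.
    - by move=> x _; rewrite lee_fin.
    - exact: measurable_funS (measurable_sqdist p).
    - move=> x /DB; rewrite /B /eball /= => xb; rewrite lee_fin /sqdist -sqr_enorm.
      by rewrite lerXn2r ?nnegrE ?enorm_ge0 ?(ltW r0)// ltW.
  have c2 : ((r ^+ 2)%:E * lebB D <= (r ^+ 2 * v)%:E)%E.
    by rewrite [leRHS]EFinM; apply: lee_wpmul2l; rewrite ?lee_fin// -Bv; exact: le_outer_measure.
  have I0 : (0 <= \int[leb']_(x in D) (sqdist p x)%:E)%E by apply: integral_ge0 => x _; rewrite lee_fin.
  have [y yE] := ge0_fin_real I0 (le_trans c1 c2).
  by exists y; split => //; [rewrite -lee_fin -yE|rewrite -yE].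
have split1 (D C : set bV') (h : bV' -> \bar R) : measurable D -> measurable C ->
    measurable_fun setT h -> (forall x, 0 <= h x)%E ->
    (\int[leb']_(x in D) h x = \int[leb']_(x in D `&` C) h x + \int[leb']_(x in D `\` C) h x)%E.
  move=> mD mC mh h0; rewrite -[in LHS](setUIDK D C) ge0_integral_setU//; [exact: measurableI|exact: measurableD| |].
    exact: measurable_funS mh.
  by apply/disj_setPS => x [[_ ?] []].
have lebf (D : set bV') : measurable D -> D `<=` E `|` B -> exists2 y, 0 <= y & lebB D = y%:E.
  move=> mD DE; have h : (lebB D <= (v + v)%:E)%E.
    apply: (@le_trans _ _ (lebB (E `|` B))); first exact: le_outer_measure.
    by apply: (le_trans (outer_measureU2 _ _ _)); rewrite EFinD; apply: leeD; [rewrite -Ev|rewrite -Bv].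
  have [y yE] := ge0_fin_real (measure_ge0 leb' D) h.
  by exists y; rewrite // -lee_fin -yE.
have [m1 m10 D1m] := lebf D1 mD1 (fun x h => or_introl h.1).
have [m2 m20 D2m] := lebf D2 mD2 (fun x h => or_intror h.1).
have [m3 m30 EBm] := lebf (E `&` B) mEB (fun x h => or_introl h.1).
have m12 : m1 = m2.
  have h1 : lebB E = (lebB (E `&` B) + lebB D1)%E by rewrite -[in LHS](setUIDK E B) measureU//; apply/seteqP; split => // x [[_ ?] []].
  have h2 : lebB B = (lebB (E `&` B) + lebB D2)%E by rewrite setIC -[in LHS](setUIDK B E) measureU//; [exact: measurableI|apply/seteqP; split => // x [[_ ?] []]].
  move: h1 h2; rewrite Ev Bv EBm D1m D2m -!EFinD => -[h1] [h2]; lra.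
have [y3 [y30 y3E _]] := BS (E `&` B) mEB (fun x h => h.2).
have [y2 [y20 y2E y2r]] := BS D2 mD2 (fun x h => h.1).
have sq0 (x : bV') : (0 <= (sqdist p x)%:E)%E by rewrite lee_fin.
have I1 : (\int[leb']_(x in D1) (sqdist p x)%:E)%E = y2%:E.
  move: moment; rewrite (split1 E B) ?(split1 B E)//; try exact: measurable_sqdist.
  rewrite setIC [B `&` E]setIC y3E -/D1 -/D2 y2E; case: (\int[_]_(_ in D1) _)%E => [z| |] //.
  by rewrite -!EFinD => -[] h; congr EFin; lra.
have y2m : r ^+ 2 * m2 <= y2.
  rewrite -lee_fin -I1 -m12 EFinM -D1m -[leLHS](integral_cst leb' mD1); apply: ge0_le_integral => //.
  - exact: measurable_funS (measurable_sqdist p).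
  move=> x [_]; rewrite /B /eball /= => /negP; rewrite -leNgt => xb; rewrite lee_fin /sqdist -sqr_enorm.
  by rewrite lerXn2r ?nnegrE ?enorm_ge0 ?(ltW r0).
(* [E \ B] and [B \ E] have equal volume and equal moment, yet the squared distance is at least
   [r^2] on the former and strictly below [r^2] on the latter, which must therefore be null. *)
have D20 : lebB D2 = 0%E.
  pose h (x : bV') : \bar R := (r ^+ 2 - sqdist p x)%:E.
  have mh : measurable_fun D2 h.
    apply/measurable_EFinP; apply: measurable_funB => //.
    by apply/measurable_EFinP; exact: measurable_funS (measurable_sqdist p).
  have hp x : D2 x -> 0 < r ^+ 2 - sqdist p x.
    move=> [xb _]; rewrite subr_gt0 /sqdist -sqr_enorm ltrXn2r// ?nnegrE ?enorm_ge0 ?(ltW r0)//.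
  have h0 : (\int[leb']_(x in D2) `|h x| = 0)%E.
    have hI : (\int[leb']_(x in D2) `|h x| + y2%:E = (r ^+ 2 * m2)%:E)%E.
      rewrite -y2E -ge0_integralD//; last 2 first.
      - exact: measurableT_comp mh.
      - exact: measurable_funS (measurable_sqdist p).
      rewrite EFinM -D2m -[RHS](integral_cst leb' mD2); apply: eq_integral => x /set_mem /hp h1.
      by rewrite /h /= gtr0_norm// -EFinD subrK.
    have I0 : (0 <= \int[leb']_(x in D2) `|h x|)%E by apply: integral_ge0.
    move: hI I0; case: (\int[_]_(_ in D2) _)%E => [z| |] //; rewrite -EFinD => -[] hz; rewrite lee_fin => z0.
    by congr EFin; lra.
  have [N [mN N0 DN]] := (ae_eq_integral_abs leb' mD2 mh).1 h0.
  apply/eqP; rewrite -measure_le0 -N0; apply: le_outer_measure => x Dx; apply: DN => /= /(_ Dx) /eqP.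
  by rewrite /h eqe gt_eqF// hp.
apply/eqP; rewrite -measure_le0; apply: (le_trans (outer_measureU2 _ _ _)).
change (lebB D1 + lebB D2 <= 0)%E; rewrite D20 adde0 D1m lee_fin m12.
by move: D20; rewrite D2m => -[->].
Qed.

Definition cdf (j : 'I_n.+2) (t : R) : R := fine (lebB (E `&` hsp j t)).

Let v0 : 0 < v. Proof. by rewrite mulr_gt0 ?omega_pos// exprn_gt0. Qed.

Let mEh j t : measurable (E `&` hsp j t). Proof. by apply: measurableI => //; exact: measurable_halfspace. Qed.

Lemma cdfE j t : lebB (E `&` hsp j t) = (cdf j t)%:E.
Proof.
rewrite /cdf fineK// ge0_fin_numE// (@le_lt_trans _ _ (lebB E))//; first by apply: le_outer_measure => x [].
by rewrite Ev ltry.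
Qed.

Lemma cdf_itv j t : 0 <= cdf j t <= v.
Proof. by rewrite -!lee_fin -cdfE measure_ge0/= -Ev; apply: le_outer_measure => x []. Qed.

Lemma cdf_le j s t : s <= t -> cdf j s <= cdf j t.
Proof.
move=> st; rewrite -lee_fin -!cdfE; apply: le_outer_measure => x [Ex xs]; split => //.
exact: le_trans xs st.
Qed.

Lemma cdf_cont j t e : 0 < e -> exists2 d, 0 < d &
  forall s u, `|s - t| <= d -> `|u - t| <= d -> cdf j u <= cdf j s + e.
Proof.
move=> e0; have Ef : (lebB E < +oo)%E by rewrite Ev ltry.
have [d d0 Hd] := strip_small j t mE Ef e0.
exists d => // s u sd ud; rewrite -lee_fin EFinD -!cdfE; apply: le_trans (leeD2l _ Hd).
apply: le_trans (outer_measureU2 _ _ _); apply: le_outer_measure => x [Ex xu].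
have [xs|xs] := leP (x 0 j) s; [by left|right; split => //].
move: sd ud xu; rewrite /strip /hsp /= !ler_norml => /andP[? ?] /andP[? ?] ?.
by apply/andP; split; lra.
Qed.

Lemma cdf_small j e : 0 < e -> (exists t, cdf j t <= e) /\ (exists t, v - e <= cdf j t).
Proof.
move=> e0; have Ef : (lebB E < +oo)%E by rewrite Ev ltry.
split.
  pose F k : set bV' := E `&` hsp j (- k%:R).
  have F0 : (lebB (F 0%N) < +oo)%E by apply: le_lt_trans Ef; apply: le_outer_measure => x [].
  have mF k : measurable (F k) by exact: mEh.
  have F1 : \bigcap_k F k = set0.
    apply/seteqP; split => // x Fx; have [_] := Fx (Num.truncn (- x 0 j)).+1 I.
    by rewrite /hsp /= lerNr leNgt truncnS_gt// num_real.
  have F2 : {homo F : a b / (a <= b)%N >-> (b <= a)%O}.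
    move=> a b ab; apply/subsetPset => x [Ex xb]; split => //.
    by apply: le_trans xb _; rewrite lerN2 ler_nat.
  have [k] := decreasing_small F0 mF F1 F2 e0.
  by move=> Fk; exists (- k%:R); rewrite -lee_fin -cdfE.
pose F k : set bV' := E `\` hsp j k%:R.
have F0 : (lebB (F 0%N) < +oo)%E by apply: le_lt_trans Ef; apply: le_outer_measure => x [].
have mF k : measurable (F k) by apply: measurableD => //; exact: measurable_halfspace.
have F1 : \bigcap_k F k = set0.
  apply/seteqP; split => // x Fx; have [_] := Fx (Num.truncn (x 0 j)).+1 I; apply.
  by rewrite /hsp /= ltW// truncnS_gt// num_real.
have F2 : {homo F : a b / (a <= b)%N >-> (b <= a)%O}.
  move=> a b ab; apply/subsetPset => x [Ex xb]; split => // xa; apply: xb.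
  by apply: le_trans xa _; rewrite ler_nat.
have [k Fk] := decreasing_small F0 mF F1 F2 e0.
exists k%:R; rewrite lerBlDr -lee_fin EFinD -cdfE -Ev.
apply: (@le_trans _ _ (lebB (E `&` hsp j k%:R) + lebB (F k))%E); last exact: leeD2l.
apply: le_trans (outer_measureU2 _ _ _).
by apply: le_outer_measure => x Ex; have [xk|xk] := pselect (hsp j k%:R x); [left|right].
Qed.

Lemma cdf_continuous j : continuous (cdf j).
Proof.
move=> t; apply/cvgrPdist_le => e e0; have [d d0 Hd] := cdf_cont j t e0.
apply/nbhs_ballP; exists d => // s ts'; have ts : `|t - s| < d := ts'.
have st : `|s - t| <= d by rewrite distrC ltW.
have tt : `|t - t| <= d by rewrite subrr normr0 ltW.
by have := Hd s t st tt; have := Hd t s tt st; rewrite ler_norml => ? ?; apply/andP; split; lra.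
Qed.

Lemma cdf_value j a b y : a <= b -> cdf j a <= y -> y <= cdf j b -> exists2 t, a <= t <= b & cdf j t = y.
Proof.
move=> ab ay yb; have ivt := @IVT R (cdf j) a b y ab (continuous_subspaceT (@cdf_continuous j)).
by have [|t] := ivt; rewrite ?ge_min ?le_max ?ay ?yb ?orbT// in_itv; exists t.
Qed.

Lemma cdf_mid j : exists2 t, 0 < cdf j t & cdf j t < v.
Proof.
have v4 : 0 < v / 4 by rewrite divr_gt0.
have [[a Ha] [b Hb]] := cdf_small j v4.
have ab : a <= b by rewrite leNgt; apply/negP => /ltW/(cdf_le j); lra.
by have [||t _ tv] := @cdf_value j a b (v / 2) ab; [lra|lra|exists t; rewrite tv; lra].
Qed.

(** The identity between two heights determines the centre from a single one with [0 < cdf < v].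
    Where [cdf] is 0 or [v] the identity is silent; there a discrepancy would, by continuity,
    already appear at an intermediate value. *)
Lemma cdf_ball j : (forall t1 t2, 0 < cdf j t1 -> cdf j t1 <= cdf j t2 -> cdf j t2 < v -> t1 <= t2 ->
    r * beta n (cdf j t2 / r ^+ n.+2) - r * beta n (cdf j t1 / r ^+ n.+2) = t2 - t1) ->
  exists p : R, forall t, cdf j t = r ^+ n.+2 * Bf n ((t - p) / r).
Proof.
move=> rig; have [t0 V0 V1] := cdf_mid j.
have rN : 0 < r ^+ n.+2 by rewrite exprn_gt0.
pose b t := beta n (cdf j t / r ^+ n.+2); pose p : R := t0 - r * b t0; exists p.
pose W t := r ^+ n.+2 * Bf n ((t - p) / r).
have Wle s t : s <= t -> W s <= W t.
  move=> st; rewrite /W ler_pM2l//; apply: Bf_nondec; rewrite ler_pM2r ?invr_gt0//.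
  by rewrite lerD2r.
have W0 t : 0 <= W t.
  have B0 : 0 <= Bf n ((t - p) / r).
    have [h|/ltW h] := leP (- 1) ((t - p) / r); first by rewrite -(Bf_le0 n (lexx (-1))); exact: Bf_nondec.
    by rewrite Bf_le0.
  by rewrite /W mulr_ge0// ltW.
have Wv t : W t <= v.
  rewrite /W /v mulrC ler_pM2r//.
  have [h|/ltW h] := leP ((t - p) / r) 1; first by rewrite -(Bf_ge1 n (lexx 1)); exact: Bf_nondec.
  by rewrite Bf_ge1.
have mid t : 0 < cdf j t -> cdf j t < v -> cdf j t = W t.
  move=> c0 c1; have bt : b t = (t - p) / r.
    have : r * b t - r * b t0 = t - t0.
      have [h|/ltW h] := leP t0 t; first by apply: rig => //; exact: cdf_le.
      by have := rig t t0 c0 (cdf_le j h) V1 h; rewrite -/(b t) -/(b t0); lra.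
    by move=> h; rewrite /p (_ : t - _ = r * b t); [rewrite mulrC mulKf// gt_eqF|lra].
  have cN : 0 <= cdf j t / r ^+ n.+2 <= omega n.+2.
    by rewrite divr_ge0 ?(ltW c0) ?(ltW rN)//= ler_pdivrMr// ltW.
  by rewrite /W -bt /b betaK// mulrC divfK// gt_eqF.
move=> t; rewrite -/(W t); have /andP[c0 c1] := cdf_itv j t.
have [cv|cv] := eqVneq (cdf j t) v.
  apply/eqP; rewrite cv eq_le Wv andbT leNgt; apply/negP => Wt.
  have tt0 : t0 < t by rewrite ltNge; apply/negP => /(cdf_le j); rewrite cv leNgt V1.
  have mv : Num.max (cdf j t0) (W t) < v by rewrite gt_max V1.
  have m1 : cdf j t0 <= Num.max (cdf j t0) (W t) by rewrite le_max lexx.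
  have m2 : W t <= Num.max (cdf j t0) (W t) by rewrite le_max lexx orbT.
  move: mv m1 m2; set m := Num.max _ _ => mv m1 m2.
  (* The intermediate value is taken strictly between [m] and [v]: at [s] the identity holds, but
     [W s <= W t <= m] contradicts it. *)
  have [||s /andP[_ st] sy] := @cdf_value j t0 t ((m + v) / 2) (ltW tt0); [lra|rewrite cv; lra|].
  by have := mid s; have := Wle s t st; rewrite sy; lra.
have [cz|cz] := eqVneq (cdf j t) 0; last first.
  by apply: mid; rewrite lt_neqAle ?cv ?c1// eq_sym cz c0.
apply/eqP; rewrite cz eq_le W0/= leNgt; apply/negP => Wt.
have tt0 : t < t0 by rewrite ltNge; apply/negP => /(cdf_le j); rewrite cz leNgt V0.
have mv : 0 < Num.min (cdf j t0) (W t) by rewrite lt_min V0.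
have m1 : Num.min (cdf j t0) (W t) <= cdf j t0 by rewrite ge_min lexx.
have m2 : Num.min (cdf j t0) (W t) <= W t by rewrite ge_min lexx orbT.
move: mv m1 m2; set m := Num.min _ _ => mv m1 m2.
have [||s /andP[ts _] sy] := @cdf_value j t t0 (m / 2) (ltW tt0); [rewrite cz; lra|lra|].
by have := mid s; have := Wle t s ts; rewrite sy; lra.
Qed.

Lemma rigid_ball : (forall j t1 t2, 0 < cdf j t1 -> cdf j t1 <= cdf j t2 -> cdf j t2 < v -> t1 <= t2 ->
    r * beta n (cdf j t2 / r ^+ n.+2) - r * beta n (cdf j t1 / r ^+ n.+2) = t2 - t1) ->
  exists p, lebB (E `+` eball p r) = 0%E.
Proof.
move=> rig; have /choice[p Hp] j := cdf_ball (rig j).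
exists (\row_j p j); apply: marginals_ball => j t.
by rewrite ball_halfspace// cdfE Hp mxE.
Qed.

End same_marginals.

End ball_marginals.

(** * Exclusion of the region of larger density *)

Section strictness.
Context {R : realType} (n : nat) (i : 'I_n.+2).
Local Notation bV' := (@bV R n.+2).
Local Notation leb' := (@lebB R n.+2).
Local Notation haus' := (@hausB R n.+2 n.+1).

Definition layer (G : set R) : set bV' := [set x | G ((x : 'rV[R]_n.+2) ord0 i)].

Lemma measurable_layer G : measurable G -> measurable (layer G).
Proof. by move=> mG; rewrite -[X in measurable X]setTI; exact: (measurable_coord i measurableT mG). Qed.

Lemma pint_bump (m : {measure set bV' -> \bar R}) (g : R -> R) (G : set R) e D : measurable D -> measurable G ->
  measurable_fun setT g -> (forall t, 0 <= g t) -> 0 <= e ->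
  pint i m (fun t => g t + e * \1_G t) D = (pint i m g D + e%:E * m (D `&` layer G))%E.
Proof.
move=> mD mG mg g0 e0; have mL := measurable_layer mG.
have mq (q : R -> R) : measurable_fun setT q -> measurable_fun D (fun x : bV' => (q ((x : 'rV[R]_n.+2) ord0 i))%:E).
  move=> mq; apply: (@measurable_funS _ _ _ _ setT) => //.
  by apply/measurable_EFinP; apply: (measurableT_comp mq); exact: measurable_coord.
rewrite /pint (_ : (e%:E * _)%E = (\int[m]_(x in D) (e * \1_G ((x : 'rV[R]_n.+2) ord0 i))%:E)%E); last first.
  under [RHS]eq_integral do rewrite EFinM.
  rewrite ge0_integralZl//; last by exact: mq.
  congr (_ * _)%E; rewrite setIC -(integral_indic m mD mL).
  by apply: eq_integral => x _; congr (_%:R%:E); apply/idP/idP => /set_mem h; apply/mem_set.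
rewrite -ge0_integralD//.
- by move=> x _; rewrite lee_fin.
- exact: mq.
- by move=> x _; rewrite lee_fin mulr_ge0.
- by apply: (mq (fun t => e * \1_G t)); apply: measurable_funM.
Qed.

Section profile.
Variables (F : R -> R) (M : R) (r : R).
Hypothesis mF : measurable_fun setT F.
Hypothesis F1 : forall t, 1 <= F t.
Hypothesis FM : forall t, F t <= M.
Hypothesis r0 : 0 < r.
Let v := omega n.+2 * r ^+ n.+2.

(* Sweeping the part of the boundary in the layer horizontally shows that it has area at least [2 kap m / D];
   lowering the density by [e] there would save more perimeter than the isoperimetric inequality allows. *)
Lemma thin_layer E (G : set R) e j D : measurable E -> pint i leb' F E = v%:E -> near_optimal i F r E ->
  measurable G -> 0 < e -> (forall t, G t -> 1 + e <= F t) ->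
  j != i -> 0 < D -> n.+2%:R * D <= r ->
  (forall x y : 'rV[R]_n.+2, E x -> E y -> G (x ord0 i) -> x ord0 i = y ord0 i -> `|x ord0 j - y ord0 j| < D) ->
  lebB (E `&` layer G) = 0%E.
Proof.
move=> mE Ev nearE mG e0 GF ji D0 Dr thin; have k0 := @kap_gt0 R n.
have M1 : 1 <= M := le_trans (F1 0) (FM 0).
have F0 t : 0 <= F t := le_trans ler01 (F1 t).
have mL := measurable_layer mG; set L := layer G in mL *.
have mA : measurable (E `&` L) by exact: measurableI.
have Afin : (lebB (E `&` L) <= v%:E)%E.
  by rewrite -Ev; apply: (le_trans _ (pint_ge i leb' mE mF F1)); apply: le_outer_measure => x [].
have [m mA'] := ge0_fin_real (measure_ge0 leb' (E `&` L)) Afin.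
change (lebB (E `&` L) = m%:E) in mA'; rewrite mA'.
have m0 : 0 <= m by rewrite -lee_fin -mA'; exact: (measure_ge0 leb').
congr EFin; apply/eqP; rewrite eq_le m0 andbT leNgt; apply/negP => mp.
(* The lowered density is still at least 1, so [weighted_iso] applies to it. *)
pose g t := F t - e * \1_G t.
have mI : measurable_fun setT (fun t : R => e * \1_G t) by apply: measurable_funM.
have mg : measurable_fun setT g by exact: measurable_funB.
have g1 t : 1 <= g t.
  by rewrite /g indicE; have := F1 t; case: (boolP (t \in G)) => [/set_mem/GF|_] /=; lra.
have gM t : g t <= M.
  by apply: le_trans (FM t); rewrite /g lerBlDr lerDl mulr_ge0// ltW.
have g0 t : 0 <= g t := le_trans ler01 (g1 t).
have split m' X : measurable X -> pint i m' F X = (pint i m' g X + e%:E * m' (X `&` L))%E.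
  by move=> mX; rewrite -pint_bump ?(ltW e0)//; rewrite /pint; under [RHS]eq_integral do rewrite subrK.
pose tau : 'rV[R]_n.+2 := D *: delta_mx 0 j.
have tauE x l : (x + l *: tau) ord0 i = x ord0 i :> R.
  by rewrite !mxE eqxx/= eq_sym (negbTE ji) !mulr0 addr0.
have tauE1 x : (x + tau) ord0 i = x ord0 i :> R by rewrite -(tauE x 1) scale1r.
have tauD : enorm tau = D by rewrite enormZ enorm_delta mulr1 gtr0_norm.
pose C := r + n.+2%:R * kap n.+1 * (M + e).
suff : r * e * kap n.+1 * m <= 0.
  by rewrite leNgt !mulr_gt0.
have Cp : 0 < C by rewrite addr_gt0// !mulr_gt0//; lra.
(* For [d <= q] the volume saved by lowering the density, at least [e (m - d)], outweighs the error
   [M d] of the approximant. *)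
pose q := e * m / (M + e).
have qp : 0 < q by rewrite divr_gt0// ?mulr_gt0//; lra.
have qE : (M + e) * q = e * m by rewrite /q; field; rewrite gt_eqF//; lra.
apply: (@le_perturb _ _ _ (q * (2 * (r * e * kap n.+1) + D * C))).
  by rewrite mulr_gt0// addr_gt0// ?mulr_gt0.
move=> t t0 t1; rewrite add0r [leRHS]mulrA; have [d dE] : exists d, d = t * q by eexists.
have d0 : 0 < d by rewrite dE mulr_gt0.
have dq : (M + e) * d <= e * m.
  by rewrite dE mulrCA qE; rewrite ger_pMl// mulr_gt0.
rewrite -dE; have [S [s [P [mS Ss SP SE SW]]]] := nearE _ d0.
have mB := @measurable_boundary R n.+2 S.
have [h hE] : exists h, lebB (S `&` L) = h%:E.
  apply: (@ge0_fin_real _ _ s) => //; rewrite -Ss.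
  by apply: le_outer_measure => x [].
have [H HE] : exists H, hausB n.+1 (boundary S `&` L : set bV') = H%:E.
  apply: (@ge0_fin_real _ _ P) => //; rewrite -SP.
  by apply: le_outer_measure => x [].
have bnd X Y : X `\` Y `<=` S `+` E -> (lebB (X `\` Y : set bV') <= d%:E)%E.
  by move=> XY; apply: le_trans SE; exact: le_outer_measure.
have h1 : h <= m + d.
  rewrite -lee_fin EFinD -hE -mA'; apply: (le_trans (outer_leD lebesgue_outer _ (E `&` L))).
  by apply: leeD2l; apply: bnd => x [[Sx Lx] nE]; left; split => // Ex; exact: nE.
have h2 : m <= h + d.
  rewrite -lee_fin EFinD -hE -mA'; apply: (le_trans (outer_leD lebesgue_outer _ (S `&` L))).
  by apply: leeD2l; apply: bnd => x [[Ex Lx] nS]; right; split => // Sx; exact: nS.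
have dM X Y : X `\` Y `<=` S `+` E -> (M%:E * lebB (X `\` Y : set bV') <= (M * d)%:E)%E.
  by move=> XY; rewrite EFinM; apply: lee_wpmul2l; [rewrite lee_fin; lra|exact: bnd].
have v1 : (pint i leb' F S <= (v + M * d)%:E)%E.
  by apply: (le_trans (pint_sub i leb' mS mE mF F0 FM)); rewrite Ev EFinD leeD2l//; apply: dM => x; left.
have v2 : (v%:E <= pint i leb' F S + (M * d)%:E)%E.
  by rewrite -Ev; apply: (le_trans (pint_sub i leb' mE mS mF F0 FM)); rewrite leeD2l//; apply: dM => x; right.
have [w wE] : exists w, pint i leb' g S = w%:E.
  apply: (@ge0_fin_real _ _ (v + M * d)); first exact: pint_ge0.
  by apply: le_trans v1; rewrite (split _ _ mS) leeDl// mule_ge0// lee_fin ltW.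
have [W WE] : exists W, pint i haus' g (boundary S) = W%:E.
  apply: ge0_fin_real (pint_ge0 _ _ _ g0) (le_trans _ SW).
  by rewrite (split _ _ mB) leeDl// mule_ge0// lee_fin ltW.
rewrite (split _ _ mS) wE in v1 v2.
have hE' : (leb' : {measure set bV' -> \bar R}) (S `&` L) = h%:E := hE.
rewrite hE' -EFinM -!EFinD !lee_fin in v1 v2.
rewrite (split _ _ mB) WE in SW.
have HE' : (haus' : {measure set bV' -> \bar R}) (boundary S `&` L) = H%:E := HE.
rewrite HE' -EFinM -EFinD lee_fin in SW.
have eh1 : e * h <= e * (m + d) by rewrite ler_pM2l.
have eh2 : e * m <= e * (h + d) by rewrite ler_pM2l.
(* With the lowered density the approximant has volume at most [v], so the isoperimetric inequality
   may be used with the same radius [r]. *)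
have wv : w <= v by rewrite mulrDl in dq; rewrite mulrDr in eh2; lra.
have iso := weighted_iso mS Ss SP mg g1 gM wE WE (ltW r0) wv.
have rW : r * W <= n.+2%:R * kap n.+1 * v + r * d - r * (e * H).
  have : r * (W + e * H) <= r * (kap n.+1 * (n.+2%:R * (v / r)) + d) by rewrite ler_pM2l.
  rewrite [X in _ <= X]mulrDr (_ : r * (kap n.+1 * _) = n.+2%:R * kap n.+1 * v); last by field; rewrite gt_eqF.
  by rewrite mulrDr; lra.
have Nk : 0 < n.+2%:R * kap n.+1 :> R by rewrite mulr_gt0.
have wl : n.+2%:R * kap n.+1 * (v - (M + e) * d - e * m) <= n.+2%:R * kap n.+1 * w.
  by rewrite ler_pM2l//; rewrite mulrDr in eh1; rewrite mulrDl; lra.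
(* [tau] is horizontal and as long as the layer is wide, so [E] in the layer and its translate are
   disjoint. Up to [2 d] both consist of points crossing the boundary of [S] within the layer,
   whence [2 m]; this factor 2 is decisive below. *)
have sweepH : kap n.+1 * (2 * m - 2 * d) <= D * H.
  pose A : set bV' := E `&` L; pose A' : set bV' := tr tau @^-1` A.
  have mA1 : measurable A' by rewrite -[X in measurable X]setTI; exact: (measurable_tr _ measurableT mA).
  have A'm : lebB A' = m%:E by rewrite lebB_tr.
  have dis : A `&` A' = set0.
    apply/seteqP; split => // x [[Ex Lx] [Ex' _]]; have := thin (tr tau x) x Ex' Ex.
    rewrite /tr tauE1 => /(_ Lx erefl); rewrite !mxE !eqxx addrAC subrr add0r mulr1.
    by rewrite gtr0_norm// ltxx.
  pose X := crossing S tau `&` L.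
  have kX : ((kap n.+1)%:E * lebB X <= D%:E * H%:E)%E.
    rewrite -HE -tauD -[enorm tau]enormN; apply: (@le_trans _ _ ((kap n.+1)%:E * lebesgue_outer (sweep (boundary S `&` L) (- tau)))%E).
      rewrite lee_wpmul2l//; first by rewrite lee_fin ltW.
      apply: le_outer_measure => y [/crossing_sweep[a [l [ba l01 ya]]] Ly]; exists a, l; split => //; split => //.
      by rewrite /L /layer /= in Ly *; rewrite ya scalerN -scaleNr tauE in Ly.
    by apply: kap_sweep; change (hausB n.+1 (boundary S `&` L : set bV') < +oo)%E; rewrite HE ltry.
  have cov : (lebB (A `|` A') <= lebB X + (d + d)%:E)%E.
    apply: (@le_trans _ _ (lebB X + (lebB (S `+` E) + lebB (tr tau @^-1` (S `+` E) : set bV')))%E).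
      apply: (@le_trans _ _ (lebB X + lebB ((S `+` E) `|` tr tau @^-1` (S `+` E)))%E); last first.
        by apply: leeD2l; exact: outer_measureU2.
      apply: le_trans (outer_measureU2 _ _ _); apply: le_outer_measure => x Ax.
      have Lx : L x by case: Ax => -[_] //; rewrite /L /layer /= /tr tauE1.
      have Lx' : L (tr tau x) by rewrite /L /layer /= /tr tauE1.
      have nAA : ~ (E x /\ E (tr tau x)).
        by move=> [Ex Ex']; have : (A `&` A') x by []; rewrite dis.
      have [d1|d1] := pselect ((S `+` E) x); first by right; left.
      have [d2|d2] := pselect ((S `+` E) (tr tau x)); first by right; right.
      left; split => //; case: Ax => -[Ex _].
        have Sx : S x by apply: contrapT => ?; apply: d1; right.
        by right; split => // Sx'; apply: nAA; split => //; apply: contrapT => ?; apply: d2; left.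
      have Sx : S (tr tau x) by apply: contrapT => ?; apply: d2; right.
      by left; split => // Sx'; apply: nAA; split => //; apply: contrapT => ?; apply: d1; left.
    by apply: leeD2l; rewrite lebB_tr EFinD; apply: leeD.
  have UA : lebB (A `|` A') = (m + m)%:E.
    by apply: (etrans (measureU leb' mA mA1 dis)); exact: (f_equal2 adde mA' A'm).
  rewrite UA in cov; move: kX cov; case: (lebB X) => [x| |].
  - rewrite -EFinD -!EFinM !lee_fin => kx cx; apply: le_trans kx; rewrite ler_pM2l//; lra.
  - by rewrite gt0_muley ?lte_fin// leye_eq.
  - by rewrite leeNy_eq.
(* The saving in area is at least [2 r e kap m / D], while the loss of volume justifies only
   [N kap e m <= r e kap m / D], because [N D <= r]. What remains is [r e kap m] bounded by a
   multiple of [d]. *)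
have s1 : r * e * (kap n.+1 * (2 * m - 2 * d)) <= r * e * (D * H) by rewrite ler_pM2l// mulr_gt0.
have s2 : D * (r * (e * H)) <= D * (n.+2%:R * kap n.+1 * (e * m) + C * d).
  rewrite ler_pM2l// /C; move: iso wl rW; rewrite mulrA.
  set a := n.+2%:R * kap n.+1; set b := a * w; rewrite !mulrBr mulrDl -mulrA => ? ? ?; lra.
have s3 : D * (n.+2%:R * kap n.+1 * (e * m)) <= r * (kap n.+1 * (e * m)).
  rewrite (_ : D * _ = n.+2%:R * D * (kap n.+1 * (e * m))); last by ring.
  by rewrite ler_wpM2r// !mulr_ge0// ltW.
have e1 : r * e * (D * H) = D * (r * (e * H)) by ring.
have e2 : r * (kap n.+1 * (e * m)) = r * e * kap n.+1 * m by ring.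
have e3 : r * e * (kap n.+1 * (2 * m - 2 * d)) = 2 * (r * e * kap n.+1 * m) - d * (2 * (r * e * kap n.+1)) by ring.
have e4 : d * (2 * (r * e * kap n.+1) + D * C) = d * (2 * (r * e * kap n.+1)) + D * (C * d) by ring.
move: s2; rewrite mulrDr => s2; rewrite e1 e3 in s1; rewrite e2 in s3; rewrite e4; lra.
Qed.

Variable Z : set R.
Hypothesis mZ : measurable Z.
Hypothesis Z0 : (lebesgue_measure (Z : set (measurableTypeR R)) = 0)%E.
Hypothesis F_le0 : forall t, t <= 0 -> F t = 1.
Hypothesis F_gt0 : forall t, 0 < t -> ~ Z t -> 1 < F t.

Let stretch_ball p : set bV' := stretch F i @^-1` eball p r.

Let m_ball p : measurable (stretch_ball p).
Proof.
rewrite -[X in measurable X]setTI; apply: (measurable_stretch mF F1 FM) => //.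
exact: measurable_eball.
Qed.

Let stretchV_ball p : stretchV F i @^-1` stretch_ball p = eball p r.
Proof. by apply/seteqP; split => y; rewrite /stretch_ball /= (stretchVK mF F1 FM). Qed.

Lemma ball_below p : near_optimal i F r (stretch_ball p) -> p ord0 i + r <= 0.
Proof.
move=> nearE; rewrite leNgt; apply/negP => pr.
pose D := r / n.+2%:R; have D0 : 0 < D by rewrite divr_gt0.
have Dr : n.+2%:R * D <= r by rewrite /D mulrC divfK.
have Dr' : D <= r by rewrite /D ler_pdivrMr// ler_peMr ?(ltW r0)// ler1n.
(* A cap of height [eta] of the ball has half-width at most [sqrt(2 r eta) = D / 2]. *)
have [eta etaE] : exists eta, eta = D * D / (8 * r) by eexists.
have eta2 : 8 * (r * eta) = D * D by rewrite etaE; field; rewrite gt_eqF.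
have eta0 : 0 < eta by rewrite etaE divr_gt0// mulr_gt0.
have etar : eta <= r.
  have : 8 * (r * eta) <= r * r by rewrite eta2 ler_pM// ltW.
  by rewrite mulrCA ler_pM2l//; lra.
have [T [T0 Tp Tr]] : exists T, [/\ 0 <= T, p ord0 i + r - eta <= T & T < p ord0 i + r].
  exists (Num.max 0 (p ord0 i + r - eta)); split; rewrite ?le_max ?lexx ?orbT//.
  by rewrite gt_max pr /=; lra.
have [t0 tT] := Lam_surj mF F1 FM T.
have t00 : 0 <= t0 by rewrite -(Lam_le mF F1 FM) Lam0 tT.
have Ev : pint i leb' F (stretch_ball p) = v%:E.
  by rewrite -(stretched_pint i mF F1 FM (m_ball p)) stretchV_ball /lebB lebesgue_eball// ltW.
have [j ji] : exists j : 'I_n.+2, j != i.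
  by have [->|i0] := eqVneq i ord0; [exists ord_max|exists ord0; rewrite eq_sym].
have close x : stretch_ball p x -> t0 < (x : 'rV[R]_n.+2) ord0 i -> `|x ord0 j - p ord0 j| < D / 2.
  move=> xb tx; have Tx : T < Lam F (x ord0 i) by rewrite -tT (Lam_lt mF F1 FM).
  have : enorm (stretch F i x - p) ^+ 2 < r ^+ 2 by rewrite ltrXn2r ?nnegrE ?enorm_ge0 ?(ltW r0).
  rewrite sqr_enorm /dotv (bigD1 i)//= (bigD1 j)//= !mxE.
  set rest := \sum_(_ | _) _; have : 0 <= rest by apply: sumr_ge0 => l _; rewrite -expr2 sqr_ge0.
  rewrite eqxx (negbTE ji).
  set a := x ord0 j - p ord0 j; set b := Lam F _ - p ord0 i.
  have bp : r - eta <= b by rewrite /b; lra.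
  have bb : (r - eta) * (r - eta) <= b * b by apply: ler_pM => //; lra.
  move=> h1 h2; have aa : a ^+ 2 < (D / 2) ^+ 2 by rewrite !expr2 -/a in h2 *; nra.
  have D2 : 0 <= D / 2 by rewrite divr_ge0// ltW.
  rewrite ltNge; apply/negP => h; move: aa; rewrite ltNge -(real_normK (num_real a)) => /negP; apply.
  by rewrite lerXn2r ?nnegrE.
(* [thin_layer] asks for a uniform excess of the density; the layers [G k] exhaust the heights above
   [t0] up to the null set [Z]. *)
pose G k := [set t | t0 < t /\ 1 + k.+1%:R^-1 <= F t].
have mG k : measurable (G k).
  rewrite (_ : G k = `]t0, +oo[%classic `&` (setT `&` F @^-1` `[1 + k.+1%:R^-1, +oo[%classic)).
    apply: measurableI; first exact: measurable_itv.
    by apply: mF => //; exact: measurable_itv.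
  by apply/seteqP; split => t; rewrite /G /= !in_itv/= !andbT; [move=> []|move=> [? []]].
have null k : lebB (stretch_ball p `&` layer (G k)) = 0%E.
  apply: (@thin_layer _ (G k) k.+1%:R^-1 j D (m_ball p) Ev nearE) => //.
  - by move=> t [].
  move=> x y xb yb [tx _] xy; have := close x xb tx; rewrite xy in tx; have := close y yb tx.
  rewrite !ltr_norml => /andP[? ?] /andP[? ?]; apply/andP; split; lra.
pose Q : set bV' := stretch_ball p `&` layer [set t | t0 < t].
have mQ : measurable Q.
  apply: measurableI => //; apply: measurable_layer.
  rewrite (_ : [set t | _] = `]t0, +oo[%classic); first exact: measurable_itv.
  by apply/seteqP; split => t /=; rewrite in_itv/= andbT.
have Q0 : lebB Q = 0%E.
  apply/eqP; rewrite -measure_le0.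
  have QU : Q `<=` layer Z `|` \bigcup_k (stretch_ball p `&` layer (G k)).
    move=> x [xb tx]; have [xZ|xZ] := pselect (Z ((x : 'rV[R]_n.+2) ord0 i)); first by left.
    right; have := F_gt0 (le_lt_trans t00 tx) xZ; rewrite -subr_gt0 => F0.
    exists (Num.truncn (F (x ord0 i) - 1)^-1) => //; split => //; split => //.
    rewrite -lerBrDl -[leRHS]invrK lef_pV2 ?posrE ?invr_gt0//.
    by apply: ltW; rewrite truncnS_gt// num_real.
  apply: (@le_trans _ _ (lebB (layer Z) + lebB (\bigcup_k (stretch_ball p `&` layer (G k))))%E).
    by apply: le_trans (outer_measureU2 _ _ _); exact: le_outer_measure.
  rewrite [lebB (layer Z)](null_coord i mZ Z0) add0e.
  apply: (le_trans (outer_measure_sigma_subadditive _ _)).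
  by rewrite eseries0// => k _ _; exact: null.
have VQ : stretchV F i @^-1` Q = eball p r `\` hsp i T.
  apply/seteqP; split => y; rewrite /Q /stretch_ball /layer /= (stretchVK mF F1 FM) /hsp /= updE eqxx.
    by rewrite -(Lam_lt mF F1 FM) tT (LamVK mF F1 FM) => -[yb yT]; split => //; apply/negP; rewrite -ltNge.
  move=> [yb /negP]; rewrite -ltNge => yT; split => //.
  by rewrite -(Lam_lt mF F1 FM) tT (LamVK mF F1 FM).
have VQ0 : lebB (eball p r `\` hsp i T : set bV') = 0%E.
  rewrite -VQ (stretched_pint i mF F1 FM mQ); apply/eqP; rewrite eq_le.
  apply/andP; split; last by apply: pint_ge0 => t; exact: le_trans ler01 (F1 t).
  apply: (le_trans (pint_le i leb' mQ mF _ FM)); first by move=> t; exact: le_trans ler01 (F1 t).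
  have Q0' : (leb' : {measure set bV' -> \bar R}) Q = 0%E := Q0.
  by rewrite Q0' mule0.
(* A null cap would leave the whole volume of the ball below [T], whereas [Bf] is strictly
   increasing up to 1. *)
have : (v%:E <= (r ^+ n.+2 * Bf n ((T - p ord0 i) / r))%:E)%E.
  rewrite -(ball_halfspace i p T r0) -[leRHS]adde0 -VQ0.
  rewrite -(@lebesgue_eball R n.+1 p r (ltW r0)).
  by have := outer_leD lebesgue_outer (eball p r) (eball p r `&` hsp i T); rewrite setDIr setDv set0U.
rewrite lee_fin /v mulrC ler_pM2l ?exprn_gt0// leNgt => /negP; apply.
rewrite -(Bf_ge1 n (lexx 1)); apply: Bf_lt => //.
  by rewrite ler_pdivlMr//; lra.
by rewrite ltr_pdivrMr//; lra.
Qed.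

Lemma near_optimal_ball (E : set bV') : measurable E -> pint i leb' F E = v%:E -> near_optimal i F r E ->
  exists2 p : 'rV[R]_n.+2, p ord0 i + r <= 0 & lebB (E `+` eball p r) = 0%E.
Proof.
move=> mE Ev nearE.
have Ef : (lebB E < +oo)%E by apply: (le_lt_trans (pint_ge i leb' mE mF F1)); rewrite Ev ltry.
have mE' : measurable (stretchV F i @^-1` E : set bV').
  by rewrite -[X in measurable X]setTI; apply: (measurable_stretchV mF F1 FM).
have E'v : lebB (stretchV F i @^-1` E : set bV') = v%:E by rewrite (stretched_pint i mF F1 FM mE).
have [p Hp] := rigid_ball mE' r0 E'v (marginal_rigid mF F1 FM mE Ef r0 Ev nearE).
have mEp : measurable (E `+` stretch_ball p) by apply: measurableU; exact: measurableD.
have Ep : lebB (E `+` stretch_ball p) = 0%E.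
  apply/eqP; rewrite -measure_le0; apply: (le_trans (pint_ge i leb' mEp mF F1)).
  by rewrite -(stretched_pint i mF F1 FM mEp) -Hp -(stretchV_ball p).
have pr : p ord0 i + r <= 0.
  apply: ball_below => d d0; have [S [s [P [mS Ss SP SE SW]]]] := nearE d d0.
  exists S, s, P; split => //; apply: le_trans SE; rewrite -[leRHS]adde0 -Ep.
  exact: (outer_setY lebesgue_outer).
(* Below height 0 the stretching is the identity, so a stretched ball lying there is the ball
   itself. *)
have LamE t : t <= 0 -> Lam F t = t.
  move=> t0; have := @Lam_bounds _ F M mF F1 FM t 0 1 1 t0; rewrite Lam0 !mul1r !sub0r.
  move=> H; have {H} : - t <= - Lam F t <= - t.
    by apply: H => u /andP[_ u0]; rewrite F_le0// lexx.
  by move=> /andP[? ?]; lra.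
exists p => //; rewrite -Ep; congr (lebB (_ `+` _)); apply/seteqP; split => x xb.
  suff xE : stretch F i x = x by rewrite /stretch_ball /= xE.
  rewrite /stretch LamE ?upd_id//.
  by have := abs_le_enorm (x - p) i; rewrite !mxE ler_norml => /andP[_ h]; rewrite /eball /= in xb; lra.
suff xE : stretch F i x = x by rewrite -xE.
rewrite /stretch LamE ?upd_id//; rewrite -(Lam_le mF F1 FM) Lam0.
have := abs_le_enorm (stretch F i x - p) i; rewrite !mxE eqxx ler_norml => /andP[_ h].
by rewrite /stretch_ball /eball /= in xb; lra.
Qed.

End profile.
End strictness.

(** * Area of the sphere *)

Lemma enorm_sub_le {R : realType} n (x y : 'rV[R]_n) : `|enorm x - enorm y| <= enorm (x - y).
Proof.
rewrite ler_norml; apply/andP; split.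
  by have := enormD (y - x) x; rewrite subrK enormB; lra.
by have := enormD (x - y) y; rewrite subrK; lra.
Qed.

Section sphere.
Context {R : realType} (n : nat).
Local Notation bV' := (@bV R n.+2).
Local Notation leb' := (@lebB R n.+2).
Implicit Types (x y z : 'rV[R]_n.+2) (Q : set bV') (h e : R).

Definition sphere : set 'rV[R]_n.+2 := [set x | enorm x = 1].

Definition unit_of x : 'rV[R]_n.+2 := (enorm x `^ (-1)) *: x.

Definition sector Q h : set bV' := [set x | Q (unit_of x) /\ 1 < enorm x <= 1 + h].

Lemma measurable_sector Q h : measurable Q -> measurable (sector Q h).
Proof.
move=> mQ; have mu : measurable_fun [set: bV'] (unit_of : bV' -> bV').
  apply: measurable_to_bV => i; under eq_fun do rewrite mxE.
  apply: measurable_funM; last exact: measurable_coord.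
  by apply: (measurableT_comp (measurable_powR _)); exact: measurable_enorm.
rewrite (_ : sector Q h = (setT `&` unit_of @^-1` Q) `&` (setT `&` enorm @^-1` `]1, 1 + h]%classic)).
  by apply: measurableI; [exact: mu|apply: measurable_enorm => //; exact: measurable_itv].
by apply/seteqP; split => x; rewrite /sector /= in_itv/=; [move=> []|move=> [[_ ?] [_ ?]]].
Qed.

Let cap z (y : 'rV[R]_n.+1) : 'rV[R]_n.+2 := refl z (consv (Num.sqrt (1 - enorm y ^+ 2)) y).

Let measurable_cap z : measurable_fun [set: @bV R n.+1] (cap z : @bV R n.+1 -> bV').
Proof.
have m1 : measurable_fun [set: @bV R n.+1] (fun y : 'rV[R]_n.+1 => consv (Num.sqrt (1 - enorm y ^+ 2)) y : bV').
  apply: measurable_to_bV => i; case: (unliftP ord0 i) => [j ->|->].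
    by under eq_fun do rewrite consvS; exact: measurable_coord.
  under eq_fun do rewrite consv0.
  apply: (measurableT_comp (continuous_measurable_fun (@sqrt_continuous R))).
  by apply: measurable_funB => //; apply: measurable_funX; exact: measurable_enorm.
have m2 : measurable_fun [set: bV'] (refl z : bV' -> bV').
  apply: measurable_to_bV => i; apply: continuous_measurableV.
  apply: (@lip_continuous _ _ _ n.+2%:R) => x y.
  rewrite (_ : _ - _ = (refl z (x - y)) 0 i); last by rewrite reflB !mxE.
  by apply: (le_trans (abs_le_enorm _ _)); rewrite enorm_refl; exact: enorm_le_norm.
exact: (measurableT_comp m2 m1).
Qed.

(* Polar coordinates do not increase distances outside the unit ball. *)
Lemma polar_dist x y : 1 <= enorm x -> 1 <= enorm y ->
  (enorm x - enorm y) ^+ 2 + enorm (unit_of x - unit_of y) ^+ 2 <= enorm (x - y) ^+ 2.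
Proof.
move=> x1 y1; have x0 : 0 < enorm x by lra.
have y0 : 0 < enorm y by lra.
have [d dE] : exists d, d = dotv (unit_of x) (unit_of y) by eexists.
have ux : dotv (unit_of x) (unit_of x) = 1.
  by rewrite dotvZl dotvZr -sqr_enorm powR_inv1 ?enorm_ge0//; field; rewrite gt_eqF.
have uy : dotv (unit_of y) (unit_of y) = 1.
  by rewrite dotvZl dotvZr -sqr_enorm powR_inv1 ?enorm_ge0//; field; rewrite gt_eqF.
have xy : dotv x y = enorm x * enorm y * d.
  by rewrite dE dotvZl dotvZr !powR_inv1 ?enorm_ge0//; field; rewrite !gt_eqF.
have d1 : d <= 1.
  by rewrite dE (le_trans (dotv_le _ _))// !enormE ux uy sqrtr1 mulr1.
rewrite !sqr_enorm !dotvBl !dotvBr ux uy [dotv y x]dotvC [dotv (unit_of y) _]dotvC -dE xy -!sqr_enorm.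
have : 0 <= (enorm x * enorm y - 1) * (1 - d).
  by rewrite mulr_ge0 ?subr_ge0//; rewrite -[leLHS]mulr1 ler_pM.
rewrite mulrBl mulrBr !mulr1 !mul1r; lra.
Qed.

(** A small patch is a graph over its tangent hyperplane, Lipschitz with a constant close to 1, so
    its area is nearly at most [kap] times the volume of its projection [D]. By [polar_dist] the
    cylinder over [D] lies in a 1-Lipschitz image of the sector. *)
Lemma sector_patch Q (a : 'rV[R]_n.+2) e h : measurable Q -> Q `<=` sphere -> Q a -> 0 < e -> e <= 1 / 2 -> 0 < h ->
  (forall x, Q x -> enorm (x - a) <= e) ->
  (h%:E * hausdorff_outer n.+1 Q <= ((1 + 2 * e) ^+ n.+1 * kap n.+1)%:E * lebB (sector Q h))%E.
Proof.
move=> mQ Qs Qa e0 e1 h0 Qe.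
pose z : 'rV[R]_n.+2 := a - unitv n.+1.
have za : refl z a = unitv n.+1 by apply: refl_swap; rewrite (Qs _ Qa) enorm_delta.
have near x : Q x -> 1 - e <= refl z x 0 ord0 /\ enorm (tlv (refl z x)) <= e.
  move=> Qx; have ex : enorm (refl z x - unitv n.+1) <= e by rewrite -za -reflB enorm_refl; exact: Qe.
  split.
    have := abs_le_enorm (refl z x - unitv n.+1) ord0; rewrite [X in `|X|](_ : _ = refl z x 0 ord0 - 1); last by rewrite !mxE !eqxx.
    by rewrite ler_norml => /andP[h1 _]; lra.
  have -> : tlv (refl z x) = tlv (refl z x - unitv n.+1).
    by apply/rowP => j; rewrite !mxE (_ : lift ord0 j == ord0 = false) ?andbF ?subr0.
  exact: le_trans (enorm_tlv _) ex.
have capK x : Q x -> cap z (tlv (refl z x)) = x.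
  move=> Qx; have [h1 _] := near x Qx; rewrite /cap.
  have -> : 1 - enorm (tlv (refl z x)) ^+ 2 = refl z x 0 ord0 ^+ 2.
    have := sqr_enorm_tlv (refl z x); rewrite enorm_refl (Qs _ Qx) expr1n => ->; ring.
  by rewrite sqrtr_sqr ger0_norm ?consvK ?reflK//; lra.
pose D : set (@bV R n.+1) := cap z @^-1` Q `&` [set y | enorm y <= 1].
have mD : measurable D.
  apply: measurableI; first by rewrite -[X in measurable X]setTI; exact: measurable_cap.
  rewrite (_ : [set y | _] = setT `&` enorm @^-1` `]-oo, 1%R]%classic); first by apply: measurable_enorm => //; exact: measurable_itv.
  by apply/seteqP; split => y; rewrite /= in_itv/= => // -[].
have tcap (y : 'rV[R]_n.+1) : tlv (refl z (cap z y)) = y by rewrite /cap reflK tlvK.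
have QD : Q = cap z @` D.
  apply/seteqP; split => [x Qx|_ [y [Qy _] <-]//]; exists (tlv (refl z x)); last exact: capK.
  split; first by rewrite /= capK.
  by have [_ h1] := near x Qx; rewrite /=; lra.
have lipQ x y (x' y' : 'rV[R]_n.+1) : Q x -> Q y -> tlv (refl z x) = x' -> tlv (refl z y) = y' ->
      enorm (x - y) <= (1 + 2 * e) * enorm (x' - y').
  move=> Qx Qy <- <-; have [x1 x2] := near x Qx; have [y1 y2] := near y Qy.
  have nx := sqr_enorm_tlv (refl z x); have ny := sqr_enorm_tlv (refl z y).
  rewrite enorm_refl (Qs _ Qx) expr1n in nx; rewrite enorm_refl (Qs _ Qy) expr1n in ny.
  have nxy := sqr_enorm_tlv (refl z (x - y)); rewrite enorm_refl in nxy; rewrite reflB tlvB in nxy.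
  set p := tlv (refl z x) in x2 nx nxy *; set q := tlv (refl z y) in y2 ny nxy *.
  move: nxy; rewrite (_ : (refl z x - refl z y) 0 ord0 = refl z x 0 ord0 - refl z y 0 ord0); last by rewrite !mxE.
  set s := refl z x 0 ord0 in x1 nx *; set t := refl z y 0 ord0 in y1 ny * => nxy.
  (* Both points are on the unit sphere, so [s^2 - t^2 = |q|^2 - |p|^2]; here [s + t >= 1] and
     [|p| + |q| <= 2 e]. *)
  have st : `|s - t| <= 2 * e * enorm (p - q).
    have h1 : (s - t) * (s + t) = - ((enorm p - enorm q) * (enorm p + enorm q)).
      by rewrite -!subr_sqr; lra.
    have st0 : 0 < s + t by lra.
    have : `|s - t| * (s + t) <= enorm (p - q) * (2 * e).
      rewrite -[s + t]ger0_norm ?(ltW st0)// -normrM h1 normrN normrM.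
      apply: ler_pM => //; first exact: enorm_sub_le.
      by rewrite ger0_norm ?addr_ge0 ?enorm_ge0//; lra.
    have : `|s - t| <= `|s - t| * (s + t) by rewrite ler_peMr//; lra.
    by rewrite [2 * e * _]mulrC; lra.
  have E0 : 0 <= enorm (p - q) by exact: enorm_ge0.
  have K0 : 0 <= (1 + 2 * e) * enorm (p - q) by rewrite mulr_ge0//; lra.
  rewrite -(@ler_pXn2r _ 2) ?nnegrE ?enorm_ge0// nxy exprMn -(real_normK (num_real (s - t))).
  have : `|s - t| ^+ 2 <= (2 * e * enorm (p - q)) ^+ 2.
    by rewrite lerXn2r// nnegrE ?mulr_ge0//; lra.
  rewrite exprMn; have : 0 <= e * enorm (p - q) ^+ 2 by rewrite mulr_ge0 ?sqr_ge0// ltW.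
  by set w := enorm (p - q) ^+ 2; rewrite !expr2 !mulrDl !mulrDr; lra.
have e2 : 0 < 1 + 2 * e by lra.
have HQ : (hausdorff_outer n.+1 Q <= ((1 + 2 * e) ^+ n.+1)%:E * ((kap n.+1)%:E * lebB D))%E.
  rewrite {1}QD -hausdorff_lebesgue; apply: hausdorff_lip => // x y [Qx _] [Qy _].
  exact: (lipQ _ _ _ _ Qx Qy (tcap x) (tcap y)).
pose C : set 'rV[R]_n.+2 := [set x | D (tlv x) /\ 0 < x 0 ord0 <= h].
have CE : lebesgue_outer C = (h%:E * lebB D)%E.
  rewrite /C (@lebesgue_cylinder _ _ _ (const_mx (-2)) 3 0 h) ?subr0 ?(ltW h0)// => y [_ y1] i.
  have := abs_le_enorm y i; rewrite /= in y1; rewrite !mxE /= ler_norml => /andP[? ?].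
  by apply/andP; split; lra.
pose f x := consv (enorm x - 1) (tlv (refl z (unit_of x))).
have CS : C `<=` f @` sector Q h.
  move=> x [Dx /andP[x0 xh]]; have [Qx _] := Dx; have Sx := Qs _ Qx.
  pose y := (1 + x 0 ord0) *: cap z (tlv x); rewrite /sphere /= in Sx.
  have yE : enorm y = 1 + x 0 ord0 by rewrite enormZ Sx mulr1 ger0_norm//; lra.
  have uy : unit_of y = cap z (tlv x).
    by rewrite /unit_of yE powR_inv1 ?scalerA ?mulVf ?scale1r//; [rewrite gt_eqF//; lra|lra].
  exists y; first by rewrite /sector /= uy yE; split => //; apply/andP; split; lra.
  by rewrite /f uy yE tcap addrAC subrr add0r consvK.
have Cs : (lebesgue_outer C <= lebB (sector Q h))%E.
  apply: (@le_trans _ _ (lebesgue_outer (f @` sector Q h))); first exact: le_outer_measure.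
  rewrite -[leRHS]mul1e -(expr1n R n.+2); apply: lebesgue_lip => // x y [_ /andP[x1 _]] [_ /andP[y1 _]].
  rewrite mul1r -(@ler_pXn2r _ 2) ?nnegrE ?enorm_ge0// sqr_enorm_tlv tlvB !tlvK.
  have -> : (f x - f y) 0 ord0 = enorm x - enorm y by rewrite mxE !consv0 mxE consv0; ring.
  apply: le_trans (polar_dist (ltW x1) (ltW y1)); rewrite lerD2l -tlvB -reflB.
  by rewrite lerXn2r ?nnegrE ?enorm_ge0// -(enorm_refl z) enorm_tlv.
apply: (@le_trans _ _ (h%:E * (((1 + 2 * e) ^+ n.+1)%:E * ((kap n.+1)%:E * lebB D)))%E).
  by apply: lee_wpmul2l => //; rewrite lee_fin ltW.
rewrite muleCA EFinM -muleA; apply: lee_wpmul2l; first by rewrite lee_fin exprn_ge0// ltW.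
by rewrite muleCA -CE; apply: lee_wpmul2l => //; rewrite lee_fin ltW// kap_gt0.
Qed.

Lemma expr_le1 (t : R) m : 0 <= t -> t <= 1 -> (1 + t) ^+ m <= 1 + t * 3 ^+ m.
Proof.
move=> t0 t1; elim: m => [|m IH]; first by rewrite !expr0 mulr1 lerDl.
have c0 : 0 <= t * 3 ^+ m by rewrite mulr_ge0// exprn_ge0.
have m1 : t <= t * 3 ^+ m by rewrite ler_peMr// exprn_ege1// ler1n.
have h0 : 0 <= 1 + t by lra.
rewrite exprS; apply: (le_trans (ler_wpM2l h0 IH)).
have : t * (t * 3 ^+ m) <= t * 3 ^+ m by rewrite ler_piMl.
rewrite [3 ^+ m.+1]exprS mulrDl !mulrDr !mulr1 mul1r (mulrCA t 3); lra.
Qed.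

Lemma expr_sub1_le (h : R) m : 0 <= h -> (1 + h) ^+ m - 1 <= m%:R * h * (1 + h) ^+ m.
Proof.
move=> h0; elim: m => [|m IH]; first by rewrite expr0 subrr !mul0r.
have c0 : 0 <= (1 + h) ^+ m by rewrite exprn_ge0//; lra.
have m0 : 0 <= m%:R * h * (1 + h) ^+ m by rewrite !mulr_ge0.
have : 0 <= h * (m%:R * h * (1 + h) ^+ m) by rewrite mulr_ge0.
have : 0 <= h * (h * (1 + h) ^+ m) by rewrite !mulr_ge0.
have -> : m.+1%:R = m%:R + 1 :> R by rewrite -natr1.
rewrite exprS; set c := (1 + h) ^+ m in IH c0 m0 *.
have -> : (m%:R + 1) * h * ((1 + h) * c) = m%:R * h * c + h * c + h * (m%:R * h * c) + h * (h * c) by ring.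
by move=> ? ?; rewrite mulrDl mul1r; lra.
Qed.

(** The area is bounded by the volume of a thin outer shell divided by its thickness [t]: the
    sectors over the patches are disjoint and fill at most the shell. *)
Lemma sphere_area1 : (hausdorff_outer n.+1 sphere <= (kap n.+1 * (n.+2%:R * omega n.+2))%:E)%E.
Proof.
have k0 := @kap_gt0 R n; have o0 := @omega_pos R n.+2.
have key t : 0 < t -> t <= 1 -> (hausdorff_outer n.+1 sphere <=
    ((1 + t) ^+ (n.+1 + (2 * n.+2).+1) * (kap n.+1 * (n.+2%:R * omega n.+2)))%:E)%E.
  move=> t0 t1; pose e := t / 2 / n.+2%:R; have e0 : 0 < e by rewrite !divr_gt0.
  have eN : n.+2%:R * e = t / 2 by rewrite /e mulrC divfK.
  pose Q k : set bV' := sphere `&` cell e k.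
  have ms : measurable (sphere : set bV').
    rewrite (_ : sphere = setT `&` enorm @^-1` [set 1]); first by apply: measurable_enorm.
    by apply/seteqP; split => y // -[].
  have mQ k : measurable (Q k) by apply: measurableI => //; exact: measurable_cell.
  have mS k : measurable (sector (Q k) t) by exact: measurable_sector.
  have SQ : sphere `<=` \bigcup_k Q k.
    by move=> x sx; have [k _ kx] : (\bigcup_k cell e k) x by [rewrite bigcup_cell]; exists k.
  have h1 k : (hausdorff_outer n.+1 (Q k) <= ((1 + t) ^+ n.+1 * kap n.+1 / t)%:E * lebB (sector (Q k) t))%E.
    have [[a Qa]|Q0] := pselect (exists a, Q k a); last first.
      rewrite (_ : Q k = set0) ?outer_measure0; last by apply/seteqP; split => // x Qx; case: Q0; exists x.
      by rewrite mule_ge0// ?lee_fin ?divr_ge0 ?mulr_ge0 ?exprn_ge0 ?addr_ge0// ?(ltW k0) ?(ltW t0).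
    have t20 : 0 < t / 2 by rewrite divr_gt0.
    have t21 : t / 2 <= 1 / 2 by rewrite ler_pM2r.
    have Qe x : Q k x -> enorm (x - a) <= t / 2.
      move=> [_ xk]; apply: (le_trans (enorm_le_norm _)); rewrite -eN ler_pM2l//.
      exact: cell_norm xk Qa.2.
    have := sector_patch (mQ k) (fun x q => q.1) Qa t20 t21 t0 Qe.
    rewrite (_ : 2 * (t / 2) = t); last by field.
    move=> H; have {}H := lee_wpmul2l (_ : (0 <= t^-1%:E)%E) H.
    have ti : (0 <= t^-1%:E)%E by rewrite lee_fin invr_ge0 ltW.
    move: (H ti); rewrite !muleA -!EFinM mulVf ?gt_eqF// mul1e.
    by rewrite mulrC.
  have h2 : (\sum_(k <oo) lebB (sector (Q k) t) <= (n.+2%:R * omega n.+2 * t * (1 + t) ^+ (2 * n.+2).+1)%:E)%E.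
    rewrite -measure_semi_bigcup//; last 2 first.
    - apply/trivIsetP => k l _ _ kl; apply/seteqP; split => // x [[[_ xk] _] [[_ xl] _]].
      have /trivIsetP/(_ k l I I kl) := @trivIset_cell R n.+2 e e0.
      by move=> /seteqP[/(_ (unit_of x)) + _]; apply.
    - exact: bigcup_measurable.
    have t1' : 0 <= 1 + t by lra.
    (* The sectors contain the outer radius [1 + t] but balls are open, so the shell is taken
       slightly thicker. *)
    have [s sE] : exists s, s = t * (1 + t) by eexists.
    have st : t < s by rewrite sE ltr_pMr//; lra.
    have s0 : 0 <= s by lra.
    have s1 : 1 + s <= (1 + t) ^+ 2 by rewrite sE expr2; nra.
    apply: (@le_trans _ _ (lebB (eball 0 (1 + s) `\` eball 0 1 : set bV'))).
      apply: le_outer_measure => x [k _ [_ /andP[x1 xt]]]; rewrite /eball /= subr0.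
      by split; [lra|apply/negP; rewrite -leNgt ltW].
    rewrite [lebB _](_ : _ = (lebB (eball 0 (1 + s) : set bV') - lebB (eball 0 1 : set bV'))%E); last first.
      rewrite [LHS](@measureD _ _ _ leb') ?setIidr//; try exact: measurable_eball.
      - by move=> x; rewrite /eball /= => ?; lra.
      - by change (lebB (eball 0 (1 + s) : set bV') < +oo)%E; rewrite /lebB lebesgue_eball ?ltry//; lra.
    rewrite /lebB !lebesgue_eball//; last by lra.
    rewrite -EFinB lee_fin expr1n -mulrBr.
    rewrite (_ : n.+2%:R * _ * _ * _ = omega n.+2 * (n.+2%:R * s * (1 + t) ^+ (2 * n.+2))); last by rewrite sE exprS; ring.
    rewrite ler_pM2l//; apply: (le_trans (expr_sub1_le _ s0)); apply: ler_wpM2l; first by rewrite mulr_ge0.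
    by rewrite exprM lerXn2r// nnegrE ?exprn_ge0//; lra.
  apply: (@le_trans _ _ (\sum_(k <oo) hausdorff_outer n.+1 (Q k))%E).
    apply: (@le_trans _ _ (hausdorff_outer n.+1 (\bigcup_k Q k))); first exact: le_outer_measure.
    exact: outer_measure_sigma_subadditive.
  apply: (@le_trans _ _ (\sum_(k <oo) (((1 + t) ^+ n.+1 * kap n.+1 / t)%:E * lebB (sector (Q k) t)))%E).
    by apply: lee_nneseries => [k _ _|k _]; [exact: outer_measure_ge0|exact: h1].
  rewrite nneseriesZl; last by move=> k _; exact: outer_measure_ge0.
  have C0 : (0 <= ((1 + t) ^+ n.+1 * kap n.+1 / t)%:E)%E.
    by rewrite lee_fin divr_ge0 ?mulr_ge0 ?exprn_ge0 ?addr_ge0// ?(ltW k0) ?(ltW t0).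
  apply: (le_trans (lee_wpmul2l C0 h2)); rewrite -EFinM lee_fin exprD le_eqVlt; apply/orP; left; apply/eqP.
  by field; rewrite gt_eqF.
have [H HE] := ge0_fin_real (outer_measure_ge0 _ sphere) (key 1 ltr01 (lexx 1)).
rewrite HE lee_fin; set K := kap n.+1 * _ in key *.
have K0 : 0 < K by rewrite /K !mulr_gt0.
apply: (@le_perturb _ _ _ (3 ^+ (n.+1 + (2 * n.+2).+1) * K)); first by rewrite mulr_gt0// exprn_gt0.
move=> t t0 t1; have := key t t0 t1; rewrite HE lee_fin => /le_trans; apply.
apply: (le_trans (ler_wpM2r (ltW K0) (expr_le1 _ (ltW t0) t1))).
by rewrite mulrDl mul1r -mulrA.
Qed.

Lemma ball_boundary (c : 'rV[R]_n.+2) r : 0 < r -> boundary (eball c r) `<=` [set x | enorm (x - c) = r].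
Proof.
move=> r0 x [cx nx]; have ce y z' : enorm (y - c) <= enorm (z' - c) + n.+2%:R * `|y - z'|.
  have := enorm_sub_le (y - c) (z' - c); rewrite opprB addrA subrK => h.
  by have := enorm_le_norm (y - z'); have := ler_norm (enorm (y - c) - enorm (z' - c)); lra.
apply/eqP; rewrite eq_le; apply/andP; split.
  rewrite leNgt; apply/negP => h; pose d := (enorm (x - c) - r) / n.+2%:R.
  have d0 : 0 < d by rewrite divr_gt0// subr_gt0.
  have [y [yb yx]] := cx _ (nbhsx_ballx x d d0).
  have := ce x y; rewrite /eball /= in yb; have : n.+2%:R * `|x - y| < enorm (x - c) - r.
    by rewrite mulrC -ltr_pdivlMr//; move: yx; rewrite -ball_normE.
  by lra.
rewrite leNgt; apply/negP => h; apply: nx; pose d := (r - enorm (x - c)) / n.+2%:R.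
have d0 : 0 < d by rewrite divr_gt0// subr_gt0.
apply: (filterS _ (nbhsx_ballx x d d0)) => y yx; rewrite /eball /=.
have := ce y x; have : n.+2%:R * `|y - x| < r - enorm (x - c).
  by rewrite mulrC -ltr_pdivlMr// distrC; move: yx; rewrite -ball_normE.
by lra.
Qed.

Lemma sphere_area (c : 'rV[R]_n.+2) r : 0 < r ->
  (hausdorff_outer n.+1 (boundary (eball c r)) <= (kap n.+1 * (n.+2%:R * omega n.+2) * r ^+ n.+1)%:E)%E.
Proof.
move=> r0; pose f x := r *: x + c.
apply: (@le_trans _ _ (hausdorff_outer n.+1 (f @` sphere))).
  apply: le_outer_measure => x /(ball_boundary r0) /= xr; exists (r^-1 *: (x - c)).
    by rewrite /sphere /= enormZ xr gtr0_norm ?invr_gt0// mulVf// gt_eqF.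
  by rewrite /f scalerA divff ?gt_eqF// scale1r subrK.
rewrite mulrC EFinM; apply: le_trans (lee_wpmul2l _ sphere_area1); last by rewrite lee_fin exprn_ge0// ltW.
apply: hausdorff_lip => // x y _ _; rewrite /f opprD addrACA subrr addr0 -scalerBr enormZ gtr0_norm//.
Qed.

End sphere.

(** * Smoothness of balls *)

Section smooth_ball.
Context {R : realType} (n : nat).
Implicit Types (f : 'rV[R]_n.+1 -> R) (x v c : 'rV[R]_n.+1) (U : set 'rV[R]_n.+1).

(** The defining function of a ball and all its iterated partial derivatives are quadratic, affine
    or constant, so one computation of a difference quotient covers every order. *)
Lemma derive_quadratic f x v (a b : R) : (forall h, f (h *: v + x) = f x + h * a + h ^+ 2 * b) ->
  derivable f x v /\ 'D_v f x = a.
Proof.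
move=> fE; have L : (fun h => h^-1 *: (f (h *: v + x) - f x)) @ 0^' --> a.
  have L1 : (fun h : R => a + h * b) @ 0^' --> a.
    rewrite -[X in _ --> X]addr0 -[X in _ --> _ + X](mul0r b).
    apply: cvgD; first exact: cvg_cst.
    by apply: cvgM; [exact: (@cvg_within _ (nbhs (0 : R)))|exact: cvg_cst].
  apply: cvg_trans L1; apply: near_eq_cvg; near=> h.
  have h0 : h != 0 by near: h; exact: nbhs_dnbhs_neq.
  by rewrite fE /GRing.scale /=; field.
by split; [apply/cvg_ex; exists a|exact: cvg_lim L].
Unshelve. all: by end_near. Qed.

Lemma class_C_cst k U (a : R) : class_C k U (fun=> a).
Proof.
elim: k a => [|k IH] a; first by split => // x _; exact: cst_continuous.
split; first by move=> x _; exact: cst_continuous.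
move=> i; have D x := @derive_quadratic (fun=> a) x (delta_mx 0 i) 0 0.
split=> [x _|]; first by apply: (D x _).1 => h; rewrite !mulr0 !addr0.
rewrite (_ : partial i _ = fun=> 0)//; apply/funext => x.
by apply: (D x _).2 => h; rewrite !mulr0 !addr0.
Qed.

Lemma class_C_affine k U i (a b : R) : class_C k U (fun x => a * (x 0 i - b)).
Proof.
have ct : continuous (fun x : 'rV[R]_n.+1 => a * (x 0 i - b)).
  apply: (@lip_continuous _ _ _ `|a|) => x y.
  rewrite -mulrBr normrM ler_wpM2l// (_ : _ - _ = (x - y) 0 i); first exact: norm_coord.
  by rewrite !mxE; ring.
case: k => [|k]; split => //; try by move=> x _; exact: ct.
move=> j; have D x : derivable (fun x => a * (x 0 i - b)) x (delta_mx 0 j) /\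
    'D_(delta_mx 0 j) (fun x => a * (x 0 i - b)) x = a * (delta_mx 0 j : 'rV[R]_n.+1) 0 i.
  by apply: (@derive_quadratic _ _ _ _ 0) => h; rewrite !mxE; ring.
split=> [x _|]; first exact: (D x).1.
rewrite (_ : partial j _ = fun=> a * (delta_mx 0 j : 'rV[R]_n.+1) 0 i); first exact: class_C_cst.
by apply/funext => x; exact: (D x).2.
Qed.

Lemma partial_sqdist c r x j : derivable (fun x => dotv (x - c) (x - c) - r) x (delta_mx 0 j) /\
  partial j (fun x => dotv (x - c) (x - c) - r) x = 2 * (x 0 j - c 0 j).
Proof.
have -> : 2 * (x 0 j - c 0 j) = 2 * dotv (delta_mx 0 j) (x - c).
  rewrite /dotv (bigD1 j)//= big1 ?addr0 => [|l lj]; last by rewrite !mxE (negbTE lj) mul0r.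
  by rewrite !mxE !eqxx mul1r.
apply: (@derive_quadratic _ _ _ _ (dotv (delta_mx 0 j) (delta_mx 0 j))) => h.
have -> : h *: delta_mx 0 j + x - c = h *: delta_mx 0 j + (x - c) by rewrite addrA.
move: (x - c) => w; set u := delta_mx 0 j; rewrite dotvDl !dotvDr !dotvZl !dotvZr (dotvC w u).
by ring.
Qed.

Lemma class_C_sqdist k U c r : class_C k U (fun x => dotv (x - c) (x - c) - r).
Proof.
have ct : continuous (fun x : 'rV[R]_n.+1 => dotv (x - c) (x - c) - r).
  have ce : continuous (fun x : 'rV[R]_n.+1 => enorm (x - c)).
    apply: (@lip_continuous _ _ _ n.+1%:R) => x y.
    by apply: (le_trans (enorm_sub_le _ _)); rewrite opprB addrA subrK; exact: enorm_le_norm.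
  have -> : (fun x : 'rV[R]_n.+1 => dotv (x - c) (x - c) - r) =
      ((fun x => enorm (x - c)) * (fun x => enorm (x - c)) - cst r)%R.
    by apply/funext => x; rewrite -sqr_enorm expr2.
  by move=> x; apply: continuousB; [exact: (continuousM (ce x) (ce x))|exact: cst_continuous].
case: k => [|k]; split => //; try by move=> x _; exact: ct.
move=> j; split=> [x _|]; first exact: (partial_sqdist c r x j).1.
rewrite (_ : partial j _ = fun x => 2 * (x 0 j - c 0 j)); first exact: class_C_affine.
by apply/funext => x; exact: (partial_sqdist c r x j).2.
Qed.

End smooth_ball.

Lemma smooth_ball {R : realType} n (c : 'rV[R]_n.+2) r : 0 < r -> smooth_set (eball c r).
Proof.
move=> r0 x /(ball_boundary r0) /= xr; exists setT, (fun x => dotv (x - c) (x - c) - r ^+ 2); split => //.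
- exact: openT.
- by move=> k; exact: class_C_sqdist.
have [i xi] : exists i, (x - c) 0 i != 0.
  apply: contrapT => /forallNP H; have x0 : x - c = 0.
    by apply/rowP => i; have /negP := H i; rewrite negbK => /eqP ->; rewrite mxE.
  by move: r0; rewrite -xr x0 enorm0 ltxx.
exists i; first by rewrite (partial_sqdist c _ x i).2 mulf_neq0//; move: xi; rewrite !mxE.
congr (_ `&` _); apply/seteqP; split => y; rewrite /eball /= -sqr_enorm subr_lt0.
  by move=> h; rewrite ltrXn2r ?nnegrE ?enorm_ge0 ?(ltW r0).
by rewrite ltr_pXn2r// nnegrE ?enorm_ge0// ltW.
Qed.

(** * Weighted perimeter *)

(** At a boundary point that belonged to [E], the set would coincide nearby with the open set
    [g < 0]. *)
Lemma smooth_open {R : realType} n (E : set 'rV[R]_n.+1) : smooth_set E -> open E.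
Proof.
move=> sE; rewrite openE => x Ex; rewrite /interior.
have [bx|nb] := pselect (boundary E x); last first.
  by apply: contrapT => nx; apply: nb; split => //; exact: subset_closure.
have [U [g [oU Ux cg [j _ UE]]]] := sE x bx.
have [_ gx] : (U `&` [set y | g y < 0]) x by rewrite -UE.
have [cx _] := cg 0%N.
have nU : nbhs x U by exact: open_nbhs_nbhs.
have ng : nbhs x [set y | g y < 0] by exact: (cx x Ux _ (lt_nbhsl gx)).
apply: (filterS _ (filterI nU ng)) => y [Uy gy].
by have [] : (U `&` E) y by rewrite UE.
Qed.

(** * Perimeter for a density equal to a profile almost everywhere *)

Section density.
Context {R : realType} (n : nat) (i : 'I_n.+2).
Local Notation bV' := (@bV R n.+2).
Local Notation leb' := (@lebB R n.+2).
Local Notation haus' := (@hausB R n.+2 n.+1).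
Variables (f : 'rV[R]_n.+2 -> R) (F : R -> R) (M : R) (Z : set R).
Hypothesis mF : measurable_fun setT F.
Hypothesis F1 : forall t, 1 <= F t.
Hypothesis FM : forall t, F t <= M.
Hypothesis mZ : measurable Z.
Hypothesis Z0 : (lebesgue_measure (Z : set (measurableTypeR R)) = 0)%E.
Hypothesis Ff : forall x : 'rV[R]_n.+2, F (x 0 i) <= f x <= M.
Hypothesis fF : forall x : 'rV[R]_n.+2, ~ Z (x 0 i) -> f x = F (x 0 i).

Local Notation lbg := (@lebesgue_outer R n.+2).
Local Notation cT := (caratheodory_type lbg).

Let F' (x : bV') : \bar R := (F ((x : 'rV[R]_n.+2) ord0 i))%:E.

Let mF' : measurable_fun setT F'.
Proof. by apply/measurable_EFinP; apply: (measurableT_comp mF); exact: measurable_coord. Qed.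

Let F'0 x : (0 <= F' x)%E. Proof. by rewrite lee_fin (le_trans ler01). Qed.

Let mF'c : measurable_fun [set: cT] (F' : cT -> \bar R).
Proof.
by move=> _ A mA; rewrite setTI; apply: borel_lebesgue_measurable; rewrite -[X in measurable X]setTI; exact: mF'.
Qed.

Let M0 : 0 < M.
Proof. exact: lt_le_trans ltr01 (le_trans (F1 0) (FM 0)). Qed.

Lemma volume_ge (E : set cT) : measurable E -> (lbg E <= weighted_volume f E)%E.
Proof.
move=> mE; rewrite -[leLHS]mul1e -[X in (X <= _)%E](@integral_cst _ _ _ (@leb R n.+2) E mE 1%E).
apply: nonneg_le_integral => x _; rewrite lee_fin ?ler01//.
by have /andP[h _] := Ff x; exact: le_trans (F1 _) h.
Qed.

(** The density is squeezed between its Borel minorant and the minorant plus [M] on the null layer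
    over [Z]; only the outer terms need be measurable for this comparison. *)
Lemma volumeE (E Y : set cT) : measurable E -> measurable (Y : set bV') -> lbg (E `+` Y) = 0%E ->
  weighted_volume f E = pint i leb' F Y.
Proof.
move=> mE mY EY; have mYc : measurable (Y : set cT) by exact: borel_lebesgue_measurable.
have mL : measurable (layer i Z : set cT) by apply: borel_lebesgue_measurable; exact: measurable_layer.
have mFE (D : set cT) : measurable_fun D (F' : cT -> \bar R) by exact: measurable_funS mF'c.
transitivity (\int[@leb R n.+2]_(x in E) F' x)%E.
  apply/eqP; rewrite eq_le; apply/andP; split; last first.
    by apply: nonneg_le_integral => x _ //; rewrite lee_fin; have /andP[] := Ff x.
  apply: (@le_trans _ _ (\int[@leb R n.+2]_(x in E) (F' x + M%:E * (\1_(layer i Z) x)%:E))%E).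
    apply: nonneg_le_integral => x _.
      by rewrite lee_fin; have /andP[h _] := Ff x; apply: le_trans h; exact: le_trans (F1 _).
    rewrite -EFinM -EFinD lee_fin indicE; case: (boolP (x \in _)) => [_|/negP xZ].
      have /andP[_ h] := Ff x; apply: (le_trans h); rewrite mulr1 lerDr; exact: le_trans (F1 _).
    by rewrite mulr0 addr0 fF// => Zx; apply: xZ; exact/mem_set.
  have mI : measurable_fun E (fun x : cT => (\1_(layer i Z) x)%:E : \bar R).
    by apply/measurable_EFinP.
  have mMI : measurable_fun E (fun x : cT => (M%:E * (\1_(layer i Z) x)%:E)%E) by apply: measurable_funeM.
  have MI0 (x : cT) : E x -> (0 <= M%:E * (\1_(layer i Z) x)%:E)%E by rewrite -EFinM lee_fin mulr_ge0// ltW.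
  rewrite (ge0_integralD _ mE (fun x _ => F'0 x) (mFE E) MI0 mMI).
  rewrite ge0_integralZl//; last by rewrite lee_fin ltW.
  rewrite integral_indic// (_ : leb _ = 0%E) ?mule0 ?adde0//.
  apply/eqP; rewrite -measure_le0 -(null_coord i mZ Z0).
  by change (lbg (layer i Z `&` E) <= lbg (layer i Z))%E; apply: le_outer_measure => x [].
transitivity (\int[@leb R n.+2]_(x in Y) F' x)%E; last first.
  exact: (@cara_integral R n.+2 lbg leb' Y F' (fun A => @borel_lebesgue_measurable R _ A) (fun A _ => erefl) mY mF' F'0).
rewrite integral_mkcond [RHS]integral_mkcond; apply: ge0_ae_eq_integral => //.
- by apply/(measurable_restrictT _ mE).
- by apply/(measurable_restrictT _ mYc).
- by move=> x _; rewrite patchE; case: ifP.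
- by move=> x _; rewrite patchE; case: ifP.
exists (E `+` Y); split => //; first by apply: measurableU; exact: measurableD.
move=> x /= H; apply: contrapT => nx; apply: H => _; rewrite !patchE.
have [Ex|Ex] := pselect (E x); have [Yx|Yx] := pselect (Y x).
- by rewrite !mem_set.
- by case: nx; left.
- by case: nx; right.
- by rewrite !memNset.
Qed.

Lemma borel_version (E : set cT) (v : R) : measurable E -> weighted_volume f E = v%:E ->
  exists Y : set bV', [/\ measurable Y, lbg (E `+` Y) = 0%E & pint i leb' F Y = v%:E].
Proof.
move=> mE Ev; have [Y [mY EY YE]] := @lebesgue_hull R n.+1 E.
have Ef : (lbg E < +oo)%E by apply: (le_lt_trans (volume_ge mE)); rewrite Ev ltry.
have EY0 : lbg (E `+` Y) = 0%E.
  rewrite (_ : E `+` Y = Y `\` E); last by apply/seteqP; split => [x [[/EY]|]//|x]; right.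
  have mYc : measurable (Y : set cT) by exact: borel_lebesgue_measurable.
  have Yf : (@leb R n.+2 Y < +oo)%E by change (leb' Y < +oo)%E; rewrite [leb' Y]YE.
  rewrite [LHS](@measureD _ _ _ (@leb R n.+2) _ _ mYc mE Yf) setIidr//.
  change (leb' Y - lbg E = 0)%E; rewrite [leb' Y]YE subee// ge0_fin_numE//.
  exact: outer_measure_ge0.
by exists Y; split => //; rewrite -Ev; apply/esym; exact: volumeE.
Qed.

(** Only an inequality holds, since the boundary may have positive area over [Z]; it has the
    direction needed for lower bounds. *)
Lemma area_ge (S : set 'rV[R]_n.+2) : (pint i haus' F (boundary S) <= weighted_area f S)%E.
Proof.
have mB := @measurable_boundary R n.+2 S.
rewrite /pint -(@cara_integral R n.+2 (hausdorff_outer n.+1) haus' _ F'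
  (fun A => @borel_hausdorff_measurable R _ _ A) (fun A _ => erefl) mB mF' F'0).
by apply: nonneg_le_integral => x _ //; rewrite lee_fin; have /andP[] := Ff x.
Qed.

Lemma cvg_L1_small (Eh : (set 'rV[R]_n.+2)^nat) (E : set cT) d : measurable E -> (forall h, smooth_set (Eh h)) ->
  cvg_L1 Eh E -> 0 < d -> \forall h \near \oo, (lbg (Eh h `+` E) <= d%:E)%E.
Proof.
move=> mE sE /fine_cvgP[fn /cvgrPdist_lt cv] d0; have := cv d d0; move: fn.
have I h : (\int[@leb R n.+2]_x `|\1_(Eh h) x - \1_E x|%:E = lbg (Eh h `+` E))%E.
  have mS : measurable (Eh h : set cT).
    by apply: borel_lebesgue_measurable; apply: open_measurableV; exact: smooth_open.
  rewrite -[RHS](_ : (leb ((Eh h `+` E) `&` setT) = _)%E); last by rewrite setIT.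
  rewrite -integral_indic//; last by apply: measurableU; exact: measurableD.
  apply: eq_integral => x _; congr EFin; rewrite !indicE /=.
  have [Sx|Sx] := pselect (Eh h x); have [Ex|Ex] := pselect (E x).
  - by rewrite (mem_set Sx) (mem_set Ex) subrr normr0 memNset// => -[] [].
  - by rewrite (mem_set Sx) (memNset Ex) mem_set ?subr0 ?normr1//; left.
  - by rewrite (memNset Sx) (mem_set Ex) mem_set ?sub0r ?normrN1//; right.
  - by rewrite (memNset Sx) (memNset Ex) subrr normr0 memNset// => -[] [].
apply: filterS2 => h; rewrite I => hf /=; rewrite I sub0r normrN => hd.
rewrite -(fineK hf) lee_fin ltW//; apply: le_lt_trans hd; exact: ler_norm.
Qed.

(** A value strictly above the perimeter exceeds some lower limit along smooth sets, hence is
    undercut by areas arbitrarily far in that sequence, where L^1 convergence has set in. *)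
Lemma perimeter_approx (E : set cT) p d : measurable E -> (perimeter f E < p%:E)%E -> 0 < d ->
  exists S, [/\ smooth_set S, (weighted_area f S <= p%:E)%E & (lbg (S `+` E) <= d%:E)%E].
Proof.
move=> mE /ereal_inf_lt[_ [Eh [sE cE] <-] lp] d0.
have [k _ Hk] := cvg_L1_small mE sE cE d0.
have : (einfs (fun h => weighted_area f (Eh h)) k < p%:E)%E.
  apply: le_lt_trans lp; rewrite limn_einf_lim (cvg_lim _ (@cvg_einfs_sup _ _))//.
  by apply: ereal_sup_ubound; exists k.
move=> /ereal_inf_lt[_ [h /= kh <-] hp]; exists (Eh h); split => //; first exact: ltW.
exact: Hk.
Qed.

Lemma near_sets (E : set cT) (Y : set bV') v p d : measurable E -> measurable Y ->
  lbg (E `+` Y) = 0%E -> pint i leb' F Y = v%:E -> (perimeter f E < p%:E)%E -> 0 < d ->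
  exists S s P, [/\ measurable (S : set bV'), lebB S = s%:E,
    hausB n.+1 (boundary S : set bV') = P%:E, (lebB (S `+` Y) <= d%:E)%E &
    (pint i haus' F (boundary S) <= p%:E)%E].
Proof.
move=> mE mY EY Yv Ep d0; have [S [sS Sp SE]] := perimeter_approx mE Ep d0.
have mS : measurable (S : set bV') by apply: open_measurableV; exact: smooth_open.
have SY : (lebB (S `+` Y) <= d%:E)%E.
  by apply: le_trans SE; rewrite -[leRHS]adde0 -EY; exact: (outer_setY lbg).
have Sf : (lebB S <= (d + v)%:E)%E.
  apply: (le_trans (outer_leD lbg S Y)); rewrite addeC EFinD; apply: leeD.
    by apply: le_trans SY; apply: le_outer_measure => x; left.
  by rewrite -Yv; exact: (pint_ge i leb' mY mF F1).
have aS : (pint i haus' F (boundary S) <= p%:E)%E := le_trans (area_ge S) Sp.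
have hS := pint_ge i haus' (@measurable_boundary R n.+2 S) mF F1.
have [s Ss] := ge0_fin_real (measure_ge0 leb' S) Sf.
have [P SP] := ge0_fin_real (measure_ge0 haus' (boundary S)) (le_trans hS aS).
by exists S, s, P.
Qed.

(** A perimeter below the bound would give smooth sets with areas below some [p < b] and nearly the
    volume of the ball; [weighted_iso] at a radius slightly above [r] excludes them. *)
Lemma perimeter_lower (E : set cT) r : 0 < r -> measurable E ->
  weighted_volume f E = (omega n.+2 * r ^+ n.+2)%:E ->
  ((kap n.+1 * (n.+2%:R * (omega n.+2 * r ^+ n.+2 / r)))%:E <= perimeter f E)%E.
Proof.
move=> r0 mE; set v := omega n.+2 * _; set b := kap n.+1 * _ => Ev.
have [Y [mY EY Yv]] := borel_version mE Ev.
rewrite leNgt; apply/negP => Eb.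
have [p pb Ep] : exists2 p, p < b & (perimeter f E < p%:E)%E.
  case: (perimeter f E) Eb => [q| |] //; last by move=> _; exists (b - 1); [rewrite ltrBlDr ltrDl|exact: ltNyr].
  by rewrite lte_fin => qb; exists ((q + b) / 2); rewrite ?lte_fin; lra.
have k0 := @kap_gt0 R n.
have F0 t : 0 <= F t := le_trans ler01 (F1 t).
have p0 : 0 <= p.
  have [S [s [P [_ _ _ _ h]]]] := near_sets mE mY EY Yv Ep ltr01.
  by rewrite -lee_fin; apply: le_trans h; exact: pint_ge0.
have bE : r * b = n.+2%:R * kap n.+1 * v by rewrite /b; field; rewrite gt_eqF.
have Nk : 0 < n.+2%:R * kap n.+1 :> R by rewrite mulr_gt0.
suff : r * b <= r * p by rewrite ler_pM2l// leNgt pb.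
rewrite bE; apply: (@le_perturb _ _ _ (p + n.+2%:R * kap n.+1 * M)).
  by rewrite ltr_wpDl// mulr_gt0.
(* The weighted volume of the approximant errs by at most [M d], which fits between the balls of
   radii [r] and [r + t] by [powD_ge]. *)
move=> t t0 t1; have [d [d0 dt dM]] : exists d, [/\ 0 < d, d <= t & M * d <= omega n.+2 * t ^+ n.+2].
  exists (Num.min t (omega n.+2 * t ^+ n.+2 / M)); split.
  - by rewrite lt_min t0 divr_gt0// mulr_gt0 ?omega_pos// exprn_gt0.
  - by rewrite ge_min lexx.
  - by rewrite mulrC -ler_pdivlMr// ge_min lexx orbT.
have [S [s [P [mS Ss SP SY SW]]]] := near_sets mE mY EY Yv Ep d0.
have [W WE] := ge0_fin_real (pint_ge0 i haus' (boundary S) F0) SW.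
have MS X X' : X `\` X' `<=` S `+` Y -> (M%:E * lebB (X `\` X' : set bV') <= (M * d)%:E)%E.
  move=> XS; rewrite EFinM; apply: lee_wpmul2l; first by rewrite lee_fin ltW.
  by apply: le_trans SY; exact: le_outer_measure.
have v1 : (pint i leb' F S <= (v + M * d)%:E)%E.
  by apply: (le_trans (pint_sub i leb' mS mY mF F0 FM)); rewrite Yv EFinD leeD2l//; apply: MS => x; left.
have v2 : (v%:E <= pint i leb' F S + (M * d)%:E)%E.
  by rewrite -Yv; apply: (le_trans (pint_sub i leb' mY mS mF F0 FM)); rewrite leeD2l//; apply: MS => x; right.
have [w wE] := ge0_fin_real (pint_ge0 i leb' S F0) v1.
rewrite WE lee_fin in SW; rewrite wE lee_fin in v1; rewrite wE -EFinD lee_fin in v2.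
have rt : 0 <= r + t by lra.
have wr : w <= omega n.+2 * (r + t) ^+ n.+2.
  apply: (le_trans v1); apply: (le_trans (lerD (lexx v) dM)); rewrite -mulrDr.
  by apply: ler_wpM2l; [exact/ltW/omega_pos|exact: powD_ge (ltW r0) (ltW t0)].
have iso := weighted_iso mS Ss SP mF F1 FM wE WE rt wr.
have h1 : (r + t) * W <= (r + t) * p by rewrite ler_wpM2l.
have h2 : n.+2%:R * kap n.+1 * v <= n.+2%:R * kap n.+1 * (w + M * t).
  rewrite ler_pM2l//; apply: (le_trans v2); rewrite lerD2l ler_pM2l//.
rewrite mulrA in iso; move: h2 iso h1; set K := n.+2%:R * kap n.+1; clearbody K.
by rewrite !mulrDr !mulrDl (mulrCA K) (mulrCA t) (mulrC t M) (mulrCA K); lra.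
Qed.

Lemma isoperimetric_ball (E : set cT) r : 0 < r -> measurable E ->
  (forall t, t <= 0 -> F t = 1) -> (forall t, 0 < t -> ~ Z t -> 1 < F t) ->
  weighted_volume f E = (omega n.+2 * r ^+ n.+2)%:E ->
  (perimeter f E <= (kap n.+1 * (n.+2%:R * (omega n.+2 * r ^+ n.+2 / r)))%:E)%E ->
  exists2 c : 'rV[R]_n.+2, c ord0 i + r <= 0 & lbg (E `+` eball c r) = 0%E.
Proof.
move=> r0 mE Fle Fgt Ev EP; have [Y [mY EY Yv]] := borel_version mE Ev.
have nY : near_optimal i F r Y.
  move=> d d0; apply: (near_sets mE mY EY Yv _ d0); apply: (le_lt_trans EP).
  by rewrite lte_fin ltrDl.
have [c cr Yc] := near_optimal_ball mF F1 FM r0 mZ Z0 Fle Fgt mY Yv nY.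
exists c => //; apply/eqP; rewrite eq_le outer_measure_ge0 andbT.
apply: (@le_trans _ _ (lbg (E `+` Y) + lbg (Y `+` eball c r))%E); last by rewrite EY add0e -Yc.
exact: outer_setY.
Qed.

Lemma ball_perimeter (c : 'rV[R]_n.+2) r : 0 < r -> (forall x, boundary (eball c r) x -> f x = 1) ->
  (perimeter f (eball c r) <= (kap n.+1 * (n.+2%:R * (omega n.+2 * r ^+ n.+2 / r)))%:E)%E.
Proof.
move=> r0 f1; apply: (@le_trans _ _ (weighted_area f (eball c r))).
  (* The ball is smooth, so the constant sequence is admissible and the perimeter is at most the
     area of its boundary. *)
  apply: ereal_inf_lbound; exists (fun=> eball c r).
    split => [_|]; first exact: smooth_ball.
    rewrite /cvg_L1 (_ : (fun h => _) = fun=> 0%E); first exact: cvg_cst.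
    by apply/funext => h; under eq_integral do rewrite subrr normr0; rewrite integral0.
  by rewrite (cvg_limn_einf_sup (@cvg_cst _ (weighted_area f (eball c r)) _ _ _)).1.
rewrite /weighted_area.
have mB : measurable (boundary (eball c r) : set (caratheodory_type (@hausdorff_outer R n.+2 n.+1))).
  by apply: borel_hausdorff_measurable; exact: measurable_boundary.
rewrite (_ : (\int[_]_(x in _) _)%E = (\int[@hausdorff R n.+2 n.+1]_(x in boundary (eball c r)) 1%:E)%E); last first.
  by apply: eq_integral => x /set_mem /f1 ->.
rewrite integral_cst// mul1e.
apply: (le_trans (sphere_area c r0)); rewrite lee_fin le_eqVlt; apply/orP; left; apply/eqP.
by rewrite [r ^+ n.+2]exprS; field; rewrite gt_eqF.
Qed.

End density.

(** * Existence and shape of isoperimetric sets *)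

Theorem theorem3p2 (R : realType) (n : nat) (hn : (2 <= n.+1)%N)
    (lam : R -> R)
    (lam_meas : lebesgue_measurable_fun lam)
    (lam_ge1 : forall t, 1 <= lam t)
    (lam_bdd : exists M, forall t, lam t <= M)
    (lam_gt1 : forall t, 0 < t -> 1 < lam t)
    (v : R) (v_gt0 : 0 < v) :
  let f := @halfspace_density R n lam in
  (exists E : set 'rV[R]_n.+1, isoperimetric f v E) /\
  (forall E : set 'rV[R]_n.+1, isoperimetric f v E ->
     exists (c : 'rV[R]_n.+1) (r : R),
       [/\ 0 < r, eball c r `<=` [set x | last_coord x <= 0] &
           ae_eq_set E (eball c r)]).
Proof.
case: n hn => [//|n] _ f; have [M lamM] := lam_bdd.
have [g [Z [mg glam mZ Z0 gZ]]] := borel_below lam_meas lam_ge1 lamM.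
pose i : 'I_n.+2 := ord_max.
have fE x : f x = if 0 < x ord0 i then lam (x ord0 i) else 1.
  rewrite /f /halfspace_density indicE /last_coord; case: ifPn => h.
    by rewrite mem_set// mulr1 addrC subrK.
  by rewrite memNset ?mulr0 ?addr0//; exact/negP.
(* At heights [t <= 0] the density is 1 whatever [lam] is, so the Borel minorant is used only above
   0. *)
pose F t : R := if 0 < t then g t else 1.
have mF : measurable_fun setT F.
  apply: measurable_fun_ifT => //; exact: measurable_fun_ltr.
have M1 : 1 <= M := le_trans (lam_ge1 0) (lamM 0).
have F1 t : 1 <= F t by rewrite /F; case: ifP => // _; have /andP[] := glam t.
have FM t : F t <= M.
  by rewrite /F; case: ifP => // _; have /andP[_ h] := glam t; exact: le_trans h (lamM t).
have Ff (x : 'rV[R]_n.+2) : F (x ord0 i) <= f x <= M.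
  rewrite fE /F; case: ifP => _; last by rewrite lexx.
  by have /andP[_ ->] := glam (x ord0 i); rewrite lamM.
have fF (x : 'rV[R]_n.+2) : ~ Z (x ord0 i) -> f x = F (x ord0 i).
  by rewrite fE /F => /gZ ->.
have Fle t : t <= 0 -> F t = 1 by rewrite /F leNgt => /negbTE ->.
have Fgt t : 0 < t -> ~ Z t -> 1 < F t by rewrite /F => t0 /gZ ->; rewrite t0 lam_gt1.
have o0 := @omega_pos R n.+2.
(* The radius of the Euclidean ball of volume [v]. *)
pose r := nroot n.+2 (v / omega n.+2).
have vo : 0 < v / omega n.+2 by rewrite divr_gt0.
have rN : r ^+ n.+2 = v / omega n.+2 by apply: nrootK; exact: ltW.
have vE : v = omega n.+2 * r ^+ n.+2 by rewrite rN mulrC divfK// gt_eqF.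
have r0 : 0 < r.
  rewrite lt_neqAle nroot_ge0 andbT eq_sym; apply/eqP => r0.
  by move: vo; rewrite -rN r0 expr0n/= ltxx.
(* The ball tangent from below to the hyperplane at height 0: the density is 1 on its closure, so
   its weighted volume and area are Euclidean. *)
pose c0 : 'rV[R]_n.+2 := - r *: delta_mx ord0 i.
have c0i : c0 ord0 i = - r by rewrite !mxE !eqxx mulr1.
have ball_le (c x : 'rV[R]_n.+2) : c ord0 i + r <= 0 -> enorm (x - c) <= r -> x ord0 i <= 0.
  move=> ci xc; have := abs_le_enorm (x - c) i; rewrite !mxE ler_norml => /andP[_ h]; lra.
have c0r : c0 ord0 i + r <= 0 by rewrite c0i addNr.
have mb : measurable (eball c0 r : set (@bV R n.+2)) by exact: measurable_eball.
have mbc : lebesgue_measurable (eball c0 r) by exact: borel_lebesgue_measurable mb.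
have f1 (x : 'rV[R]_n.+2) : x ord0 i <= 0 -> f x = 1 by rewrite fE ltNge => ->.
have bv : weighted_volume f (eball c0 r) = v%:E.
  rewrite /weighted_volume (_ : (\int[_]_(x in _) _)%E = (\int[@leb R n.+2]_(x in eball c0 r) 1%:E)%E); last first.
    by apply: eq_integral => x /set_mem xb; rewrite f1//; apply: (ball_le c0) => //; exact: ltW.
  by rewrite integral_cst// mul1e; rewrite vE; apply: lebesgue_eball; exact: ltW.
have bP : (perimeter f (eball c0 r) <= (kap n.+1 * (n.+2%:R * (omega n.+2 * r ^+ n.+2 / r)))%:E)%E.
  apply: ball_perimeter => // x /(ball_boundary r0) xr; apply: f1; apply: (ball_le c0) => //.
  by rewrite /= in xr; rewrite xr.
split.
  exists (eball c0 r); split; [exact: mbc|exact: bv|move=> E mE Ev; apply: (le_trans bP)].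
  by rewrite vE in Ev; exact: (perimeter_lower mF F1 FM mZ Z0 Ff fF r0 mE Ev).
(* Minimality compares [E] with that ball, which supplies the upper bound on the perimeter for the
   rigidity argument. *)
move=> E [mE Ev Emin]; have EP := le_trans (Emin _ mbc bv) bP; rewrite vE in Ev.
have [c cr Ec] := isoperimetric_ball mF F1 FM mZ Z0 Ff fF r0 mE Fle Fgt Ev EP.
by exists c, r; split => // x xc; apply: (ball_le c) => //; exact: ltW.
Qed.
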